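(* Let $\varphi$ be a growth function with $I(\varphi)\in(0,1)$, and let $(\varphi,q,s)$ be an admissible triplet. Suppose $T$ is a linear or positive sublinear operator which is bounded on $L^2(\mathbb{R}^n)$. If there exists $C>0$ such that for every $\lambda\in(0,\infty)$ and every multiple $b$ of a $(\varphi,q,s)$-atom associated with a ball $B\subset\mathbb{R}^n$, $$\sup_{\tau\in(0,\infty)}\varphi\Big(\{|T(b)|>\tau\},\frac{\tau}{\lambda}\Big)\le C\,\varphi\Big(B,\frac{\|b\|_{L^q_\varphi(B)}}{\lambda}\Big),$$ then $T$ extends uniquely to a bounded operator from $H^\varphi(\mathbb{R}^n)$ to $WL^\varphi(\mathbb{R}^n)$.
   Context: Musielak–Orlicz function: $\varphi:\mathbb{R}^n\times[0,\infty)\to[0,\infty)$ with $\varphi(x,\cdot)$ an Orlicz function (nondecreasing, vanishing only at $0$, tending to $\infty$) for each $x$ and $\varphi(\cdot,t)$ measurable for each $t$. Uniformly lower/upper type $p$: $\varphi(x,st)\le Cs^p\varphi(x,t)$ for all $x,t$ and $s\in(0,1]$ / $s\in[1,\infty)$. $I(\varphi)$ is the infimum of $p$ such that $\varphi$ is of uniformly upper type $p$, $i(\varphi)$ the supremum of $p$ such that it is of uniformly lower type $p$. $\varphi\in\mathbb{A}_q$ ($q>1$): $\sup_{B,\,t>0}\frac{1}{|B|}\int_B\varphi(x,t)dx\,(\frac1{|B|}\int_B\varphi(x,t)^{-1/(q-1)}dx)^{q-1}<\infty$ over balls $B$; $\varphi\in\mathbb{A}_1$: $\sup_{B,t}\frac{1}{|B|}\int_B\varphi(x,t)dx\cdot\operatorname{ess\,sup}_B\varphi(\cdot,t)^{-1}<\infty$;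 $\mathbb{A}_\infty=\bigcup_{q\ge1}\mathbb{A}_q$. A growth function is a Musielak–Orlicz function in $\mathbb{A}_\infty$, of uniformly lower type $p$ for some $p\in(0,1]$ and uniformly upper type $1$. $\varphi(E,t):=\int_E\varphi(x,t)dx$, $\{|f|>\tau\}:=\{x:|f(x)|>\tau\}$. $L^\varphi$: measurable $f$ with finite $\|f\|_{L^\varphi}:=\inf\{\lambda>0:\int\varphi(x,|f(x)|/\lambda)dx\le1\}$. $WL^\varphi$: measurable $f$ with finite $\|f\|_{WL^\varphi}:=\inf\{\lambda>0:\sup_{\tau>0}\varphi(\{|f|>\tau\},\tau/\lambda)\le1\}$. Let $q(\varphi):=\inf\{q\ge1:\varphi\in\mathbb{A}_q\}$, $m(\varphi):=\lfloor n(q(\varphi)/i(\varphi)-1)\rfloor$. For $m\in\mathbb{N}$ let $\mathcal{S}_m$ be the set of Schwartz functions $\psi$ with $\sup_{|\alpha|\le m+1}\sup_x(1+|x|)^{(m+2)(n+1)}|\partial^\alpha\psi(x)|\le1$; for $f\in\mathcal{S}'$, $f^*(x):=\sup_{\psi\in\mathcal{S}_{m(\varphi)}}\sup_{|y-x|<t,\,t>0}|f*\psi_t(y)|$, $\psi_t=t^{-n}\psi(\cdot/t)$. $H^\varphi:=\{f\in\mathcal{S}':f^*\in L^\varphi\}$, $\|f\|_{H^\varphi}:=\|f^*\|_{L^\varphi}$. A triplet $(\varphi,q,s)$ is admissible if $q\in(q(\varphi),\infty]$, $s\in[m(\varphi),\infty)\cap\mathbb{N}$. A $(\varphi,q,s)$-atom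 is a measurable $a$ supported in a ball $B$ with $\|a\|_{L^q_\varphi(B)}\le\|\chi_B\|_{L^\varphi}^{-1}$ and $\int a(x)x^\gamma dx=0$ for $|\gamma|\le s$, where $\|a\|_{L^q_\varphi(B)}:=\sup_{t>0}[\varphi(B,t)^{-1}\int_B|a|^q\varphi(x,t)dx]^{1/q}$ ($q<\infty$), $\|a\|_{L^\infty(B)}$ ($q=\infty$); a multiple of an atom is $ca$, $c$ constant. A positive sublinear operator satisfies $T(f)\ge0$, $T(af)\le|a|T(f)$, $T(f+g)\le T(f)+T(g)$ pointwise. *)

(* Defs.v *)
From HB Require Import structures.
From mathcomp Require Import all_boot all_order all_algebra.
From mathcomp Require Import all_classical all_reals all_analysis.
From mathcomp Require Import measurable_realfun.
Set Implicit Arguments. Unset Strict Implicit. Unset Printing Implicit Defensive.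
Import Order.TTheory GRing.Theory Num.Theory.
Import numFieldNormedType.Exports.
Local Open Scope classical_set_scope.
Local Open Scope ring_scope.

Section MO.
Context {R : realType} {n : nat}.
Local Notation Rn := 'rV[R]_n.

Definition enorm (x : Rn) : R := Num.sqrt (\sum_(i < n) x ord0 i ^+ 2).
Definition eball (c : Rn) (r : R) : set Rn := [set x | enorm (x - c) < r].
Definition rowseq (s : seq R) : Rn := \row_(i < n) nth 0 s i.

Fixpoint iint (k : nat) (g : seq R -> \bar R) : \bar R :=
  match k with
  | 0 => g [::]
  | k'.+1 => (\int[@lebesgue_measure R]_x iint k' (fun s => g (x :: s)))%E
  end.
Definition nnint (f : Rn -> \bar R) : \bar R := iint n (fun s => f (rowseq s)).
Definition leb (A : set Rn) : \bar R := nnint (fun x => (\1_A x)%:E).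
Definition borelRn (A : set Rn) : Prop :=
  measurable [set t : n.-tuple R | A (\row_(i < n) tnth t i)].
Definition ae (P : Rn -> Prop) : Prop :=
  exists N, borelRn N /\ leb N = 0%E /\ forall x, ~ N x -> P x.
Definition lebRn (A : set Rn) : Prop :=
  exists B N, borelRn B /\ borelRn N /\ leb N = 0%E /\
    ((A `\` B) `|` (B `\` A)) `<=` N.
Definition measR (f : Rn -> R) : Prop :=
  forall Y : set R, measurable Y -> lebRn (f @^-1` Y).
Definition measE (f : Rn -> \bar R) : Prop :=
  forall Y : set (\bar R), measurable Y -> lebRn (f @^-1` Y).
Definition rint (f : Rn -> R) : \bar R :=
  (nnint (fun x => (Num.max (f x) 0)%:E) - nnint (fun x => (Num.max (- f x) 0)%:E))%E.

Definition test := Rn -> R.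
Definition e_ (i : 'I_n) : Rn := delta_mx ord0 i.
Definition partial (i : 'I_n) (f : Rn -> R) : Rn -> R := fun x => derive f x (e_ i).

Fixpoint dpart (al : seq 'I_n) (f : Rn -> R) : Rn -> R :=
  match al with [::] => f | i :: al' => partial i (dpart al' f) end.
Definition smooth (f : Rn -> R) : Prop :=
  forall (al : seq 'I_n) (i : 'I_n) (x : Rn), derivable (dpart al f) x (e_ i).

Definition MO_function (phi : Rn -> R -> R) : Prop :=
  [/\ (forall x, phi x 0 = 0),
      (forall x t, 0 < t -> 0 < phi x t),
      (forall x s t, 0 <= s -> s <= t -> phi x s <= phi x t),
      (forall x, phi x t @[t --> +oo] --> +oo) &
      (forall t, 0 <= t -> measR (fun x => phi x t))].
Definition upper_type (phi : Rn -> R -> R) (p : R) : Prop :=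
  exists C : R, forall x t s, 0 <= t -> 1 <= s -> phi x (s * t) <= C * s `^ p * phi x t.
Definition lower_type (phi : Rn -> R -> R) (p : R) : Prop :=
  exists C : R, forall x t s, 0 <= t -> 0 < s -> s <= 1 -> phi x (s * t) <= C * s `^ p * phi x t.
Definition Iphi (phi : Rn -> R -> R) : R := inf [set p | upper_type phi p].
Definition iphi (phi : Rn -> R -> R) : R := sup [set p | lower_type phi p].

Definition avg (B : set Rn) (g : Rn -> R) : \bar R :=
  (nnint (fun x => (\1_B x * g x)%:E) * ((fine (leb B))^-1)%:E)%E.
Definition esssup (B : set Rn) (g : Rn -> R) : \bar R :=
  ereal_inf [set M : \bar R | ae (fun x => B x -> ((g x)%:E <= M)%E)].
Definition in_Aq (phi : Rn -> R -> R) (q : R) : Prop :=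
  exists C : R, forall (c : Rn) (r t : R), 0 < r -> 0 < t ->
    (avg (eball c r) (fun x => phi x t) *
     (avg (eball c r) (fun x => (phi x t `^ (- (q - 1)^-1))%R)) `^ (q - 1) <= C%:E)%E.
Definition in_A1 (phi : Rn -> R -> R) : Prop :=
  exists C : R, forall (c : Rn) (r t : R), 0 < r -> 0 < t ->
    (avg (eball c r) (fun x => phi x t) *
     esssup (eball c r) (fun x => ((phi x t)^-1)%R) <= C%:E)%E.
Definition in_A (phi : Rn -> R -> R) (q : R) : Prop :=
  (q = 1 /\ in_A1 phi) \/ (1 < q /\ in_Aq phi q).
Definition in_Ainf (phi : Rn -> R -> R) : Prop := exists q, 1 <= q /\ in_A phi q.
Definition qphi (phi : Rn -> R -> R) : R := inf [set q | 1 <= q /\ in_A phi q].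

Definition growth (phi : Rn -> R -> R) : Prop :=
  [/\ MO_function phi, in_Ainf phi,
      (exists p, 0 < p <= 1 /\ lower_type phi p) & upper_type phi 1].

(* m(phi) = floor (n (q(phi)/i(phi) - 1)), a nonnegative integer *)
Definition mphi (phi : Rn -> R -> R) : nat :=
  Num.truncn (n%:R * (qphi phi / iphi phi - 1)).

Definition schwartz (psi : Rn -> R) : Prop :=
  smooth psi /\ forall (al : seq 'I_n) (N : nat), exists C : R,
    forall x, (1 + enorm x) ^+ N * `|dpart al psi x| <= C.
Definition Sm (m : nat) (psi : Rn -> R) : Prop :=
  schwartz psi /\ forall (al : seq 'I_n), (size al <= m.+1)%N -> forall x,
    (1 + enorm x) ^+ ((m + 2) * (n + 1)) * `|dpart al psi x| <= 1.
Definition seminorm (k : nat) (psi : Rn -> R) : R :=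
  sup [set v | exists x (al : seq 'I_n), (size al <= k)%N /\
               v = (1 + enorm x) ^+ k * `|dpart al psi x|].

(* tempered distributions: functionals on test functions, only their values
   on Schwartz functions matter *)
Definition distr := (Rn -> R) -> R.
Definition tempered (f : distr) : Prop :=
  (forall (a : R) psi1 psi2, schwartz psi1 -> schwartz psi2 ->
     f (fun x => a * psi1 x + psi2 x) = a * f psi1 + f psi2) /\
  exists (C : R) (k : nat), forall psi, schwartz psi -> `|f psi| <= C * seminorm k psi.
Definition fdist (f : Rn -> R) : distr := fun psi => fine (rint (fun x => f x * psi x)).
Definition dcomb (a : R) (f : distr) (b : R) (g : distr) : distr :=
  fun psi => a * f psi + b * g psi.
Definition dil (psi : Rn -> R) (t : R) (y : Rn) : Rn -> R :=
  fun x => t ^- n * psi (t^-1 *: (y - x)).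
Definition gmax (m : nat) (f : distr) (x : Rn) : \bar R :=
  ereal_sup [set v | exists psi t y, [/\ Sm m psi, 0 < t, enorm (y - x) < t &
                                         v = (`|f (dil psi t y)|)%:E]].

Definition phiE (phi : Rn -> R -> R) (x : Rn) (e : \bar R) : \bar R :=
  match e with EFin r => (phi x r)%:E | +oo%E => +oo%E | -oo%E => 0%E end.
Definition modular (phi : Rn -> R -> R) (g : Rn -> \bar R) (lam : R) : \bar R :=
  nnint (fun x => phiE phi x (g x * (lam^-1)%:E)%E).
Definition inLphi (phi : Rn -> R -> R) (g : Rn -> \bar R) : Prop :=
  measE g /\ exists lam, 0 < lam /\ (modular phi g lam <= 1)%E.
Definition Lphi_norm (phi : Rn -> R -> R) (g : Rn -> \bar R) : R :=
  inf [set lam | 0 < lam /\ (modular phi g lam <= 1)%E].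
Definition absE (f : Rn -> R) : Rn -> \bar R := fun x => (`|f x|)%:E.

Definition inH (phi : Rn -> R -> R) (f : distr) : Prop :=
  tempered f /\ inLphi phi (gmax (mphi phi) f).
Definition Hnorm (phi : Rn -> R -> R) (f : distr) : R :=
  Lphi_norm phi (gmax (mphi phi) f).

Definition phiset (phi : Rn -> R -> R) (E : set Rn) (t : R) : \bar R :=
  nnint (fun x => (\1_E x * phi x t)%:E).
Definition inWL (phi : Rn -> R -> R) (h : Rn -> R) : Prop :=
  measR h /\ exists lam : R, 0 < lam /\ forall tau : R, 0 < tau ->
    (phiset phi [set x | (tau < `|h x|)%R] (tau / lam)%R <= 1)%E.
Definition WLnorm (phi : Rn -> R -> R) (h : Rn -> R) : R :=
  inf [set lam : R | 0 < lam /\ forall tau : R, 0 < tau ->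
    (phiset phi [set x | (tau < `|h x|)%R] (tau / lam)%R <= 1)%E].

Definition Lqphi (phi : Rn -> R -> R) (q : \bar R) (B : set Rn) (a : Rn -> R) : \bar R :=
  match q with
  | EFin r => ereal_sup [set ((nnint (fun x => ((\1_B x * `|a x| `^ r * phi x t)%R)%:E) *
                  ((fine (phiset phi B t))^-1)%:E) `^ (r^-1))%E | t in [set t : R | 0 < t]]
  | +oo%E => esssup B (fun x => `|a x|)
  | -oo%E => 0%E
  end.
Definition atom (phi : Rn -> R -> R) (q : \bar R) (s : nat) (c : Rn) (r : R)
    (a : Rn -> R) : Prop :=
  [/\ 0 < r, measR a, (forall x, ~ eball c r x -> a x = 0),
      (Lqphi phi q (eball c r) a <= ((Lphi_norm phi (absE \1_(eball c r)))^-1)%:E)%E &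
      forall gam : 'I_n -> nat, (\sum_(i < n) gam i <= s)%N ->
        rint (fun x => a x * \prod_(i < n) x ord0 i ^+ gam i) = 0%E].
Definition admissible (phi : Rn -> R -> R) (q : \bar R) (s : nat) : Prop :=
  ((qphi phi)%:E < q)%E /\ (mphi phi <= s)%N.

Definition inL2 (f : Rn -> R) : Prop :=
  measR f /\ (nnint (fun x => (`|f x| ^+ 2)%:E) < +oo)%E.
Definition L2norm (f : Rn -> R) : R := Num.sqrt (fine (nnint (fun x => (`|f x| ^+ 2)%:E))).
Definition bounded_L2 (T : (Rn -> R) -> Rn -> R) : Prop :=
  exists C : R, forall f, inL2 f -> inL2 (T f) /\ L2norm (T f) <= C * L2norm f.

End MO.

Inductive opkind := Linear | PosSublinear.

Section Ops.
Context {R : realType} {n : nat}.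
Local Notation Rn := 'rV[R]_n.

Definition kind_L2 (k : opkind) (T : (Rn -> R) -> Rn -> R) : Prop :=
  match k with
  | Linear => forall f g (a b : R), inL2 f -> inL2 g ->
      ae (fun x => T (fun y => a * f y + b * g y) x = a * T f x + b * T g x)
  | PosSublinear => forall f g (a : R), inL2 f -> inL2 g -> forall x,
      [/\ 0 <= T f x, T (fun y => a * f y) x <= `|a| * T f x &
          T (fun y => f y + g y) x <= T f x + T g x]
  end.

Definition kind_H (k : opkind) (phi : Rn -> R -> R) (Tt : distr -> Rn -> R) : Prop :=
  match k with
  | Linear => forall f g (a b : R), inH phi f -> inH phi g ->
      ae (fun x => Tt (dcomb a f b g) x = a * Tt f x + b * Tt g x)
  | PosSublinear => forall f g (a : R), inH phi f -> inH phi g ->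
      ae (fun x => [/\ 0 <= Tt f x, Tt (dcomb a f 0 f) x <= `|a| * Tt f x &
                      Tt (dcomb 1 f 1 g) x <= Tt f x + Tt g x])
  end.

Definition extension_of (k : opkind) (phi : Rn -> R -> R)
    (T : (Rn -> R) -> Rn -> R) (Tt : distr -> Rn -> R) : Prop :=
  [/\ kind_H k phi Tt,
      (exists C : R, forall f, inH phi f ->
          inWL phi (Tt f) /\ WLnorm phi (Tt f) <= C * Hnorm phi f) &
      (forall f, inL2 f -> inH phi (fdist f) -> ae (fun x => Tt (fdist f) x = T f x))].
End Ops.

(* Main.v *)
(** Whitney balls of the level sets [{f* > 2^k}] carry pieces [b_J] of a distribution [f], built from a compactly
supported refinable kernel whose dyadic increments are finite differences of high order. These annihilate polynomials,
so the [b_J] are multiples of atoms, bounded by [C 2^k], with [sum_J phi(B_J, 2^k/lam) <= C int phi(x, f*/lam)].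
Truncations of [sum_J b_J] converge only weakly, but midpoint combinations of them (Mazur) converge in L2. As the upper
type of [phi] is less than 1, level set bounds [a_J] add up under sums, which bounds [T f] in weak [L^phi] for [f] in
[L2] and [H^phi]; such [f] are dense in [H^phi], and [T] extends by limits in the measure [phi(x, 1) dx]. *)
Require Import Defs.
From HB Require Import structures.
From mathcomp Require Import all_boot all_order all_algebra.
From mathcomp Require Import all_classical all_reals all_analysis.
From mathcomp Require Import measurable_realfun ring lra zify.
Set Implicit Arguments. Unset Strict Implicit. Unset Printing Implicit Defensive.
Import Order.TTheory GRing.Theory Num.Theory.
Import numFieldNormedType.Exports.
Local Open Scope classical_set_scope.
Local Open Scope ring_scope.

(** Moments could be forced by subtracting polynomial projections; here the order of two operations
    yields them. A halving of the scale changes [f * Phi_l] by differences of auxiliary functions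
    [f * A_l]; these are cut off first and differenced afterwards, so each piece keeps the
    cancellation by itself. The level [k] attached to a point depends on the scale: a ball of radius
    comparable to [l] still meets the complement of the next level set, so [f * A_l] has size [2^k]
    there. For a fixed level the admissible scales at a point form an interval, so the main part
    telescopes; what the cutoffs disturb is a geometric sum or concerns boundedly many scales.
    [phi(x, .)] is assumed neither convex nor continuous, so the modular is replaced by a sum over
    dyadic levels, countably subadditive up to a constant. The value of [m(phi)] enters through
    [n q < p (n + m + 1)]: doubling a ball costs [2^(nq)], the decay of the maximal function of an
    atom gains [2^(p(n+m+1))]. Extensions agree only almost everywhere, so approximating sequences
    converge at geometric speed and Borel-Cantelli replaces subsequences. *)

Lemma le_of_eq (d : Order.disp_t) (U : porderType d) (x y : U) : x = y -> (x <= y)%O.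
by move->. Qed.

Lemma le_via (d : Order.disp_t) (U : porderType d) (y x z : U) : (x <= y -> y <= z -> x <= z)%O.
exact: le_trans. Qed.
Arguments le_via {d U} y {x z}.

(** An alias that records a proof of sigma-finiteness, so that the canonical structure required by
    Tonelli can be attached to a measure for which it was only proved. *)
Definition sfmeasure (R : realType) (d : measure_display) (T : measurableType d)
 (m : {measure set T -> \bar R}) of sigma_finite setT m : set T -> \bar R := m.

Section sfmeasure.
Context (R : realType) (d : measure_display) (T : measurableType d).
Context (m : {measure set T -> \bar R}) (sf : sigma_finite setT m).
HB.instance Definition _ := Measure.on (sfmeasure sf).
HB.instance Definition _ := Measure_isSigmaFinite.Build _ _ _ (sfmeasure sf) sf.
End sfmeasure.

(** * Iterated integrals as integrals against a measure on tuples *)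

Section bridge.
Context {R : realType}.
Local Open Scope ereal_scope.

Lemma le_integral_ge0 d (T : measurableType d) (mu : {measure set T -> \bar R})
 (f g : T -> \bar R) :
 (forall x, 0 <= f x) -> (forall x, f x <= g x) ->
 \int[mu]_x f x <= \int[mu]_x g x.
move=> f0 fg; rewrite !ge0_integralTE//; last by move=> x; exact: le_trans (fg x).
by apply: le_ereal_sup => _ [h hf <-]; exists h => // x; exact: le_trans (hf x) (fg x).
Qed.

(* The functions need not be measurable: the integral of a nonnegative function is a lower integral. *)
Import HBNNSimple.
Lemma eq_integral_null d (T : measurableType d) (mu : {measure set T -> \bar R})
 (f g : T -> \bar R) (N : set T) :
 measurable N -> mu N = 0 -> measurable_fun setT g ->
 (forall x, 0 <= f x) -> (forall x, 0 <= g x) ->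
 (forall x, ~ N x -> f x = g x) ->
 \int[mu]_x f x = \int[mu]_x g x.
move=> mN N0 mg f0 g0 fg.
have mNC : measurable (~` N) by exact: measurableC.
have gN : \int[mu]_x g x = \int[mu]_x (g \_ (~` N)) x.
 apply: ae_eq_integral => //.
 - by apply/(measurable_restrictT _ mNC); exact: measurable_funS mg.
 - exists N; split => // x /= /not_implyP[_]; apply: contra_notP => nNx.
 by rewrite patchE mem_set.
apply/eqP; rewrite eq_le; apply/andP; split.
 rewrite [leLHS]ge0_integralTE//; apply: ge_ereal_sup => _ [h hf <-].
 rewrite -integralT_nnsfun.
 have -> : \int[mu]_x (h x)%:E = \int[mu]_x ((EFin \o h) \_ (~` N)) x.
 apply: ae_eq_integral => //.
 - exact/measurable_EFinP.
 - apply/(measurable_restrictT _ mNC); apply: measurable_funS (measurableT) _ _ => //.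
 exact/measurable_EFinP.
 - exists N; split => // x /= /not_implyP[_]; apply: contra_notP => nNx.
 by rewrite patchE mem_set.
 apply: le_integral_ge0 => x; rewrite patchE; case: ifPn => // /set_mem nNx.
 - by rewrite lee_fin.
 - by rewrite /= -fg.
rewrite gN; apply: le_integral_ge0 => x; rewrite patchE; case: ifPn => //.
by move/set_mem => nNx; rewrite fg.
Qed.

(** The measure on [k.+1]-tuples is the image under [cons] of Lebesgue measure times the measure on
    [k]-tuples; Tonelli then performs the first integration of [iint]. Sigma-finiteness is part of
    the statement because the next product needs it. *)
Lemma tuple_measure_exists k :
 exists m : {sigma_finite_measure set (k.-tuple R) -> \bar R},
 forall g : seq R -> \bar R, (forall s, 0 <= g s) ->
 measurable_fun setT (fun t : k.-tuple R => g t) ->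
 iint k g = \int[m]_t g t.
elim: k => [|k [m mE]].
 exists [the {sigma_finite_measure set (0.-tuple R) -> \bar R} of dirac [tuple]].
 by move=> g g0 mg /=; rewrite integral_dirac// diracT mul1e.
pose cns (z : R * k.-tuple R) : k.+1.-tuple R := [tuple of z.1 :: z.2].
have mcns : measurable_fun setT cns by exact: measurable_cons.
pose PM : {measure set (k.+1.-tuple R) -> \bar R} :=
 measure_function_pushforward__canonical__measure_function_Measure (lebesgue_measure \x m) mcns.
have sf : sigma_finite setT PM.
 have /sigma_finiteP[F [TF ndF Foo]] := sigma_finiteT (@lebesgue_measure R).
 have /sigma_finiteP[G [TG ndG Goo]] := sigma_finiteT m.
 (* Both exhaustions are nondecreasing, so products of sets with equal indices already cover the
    space. *)
 exists (fun i => [set t : k.+1.-tuple R | F i (thead t)] `&`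
 [set t : k.+1.-tuple R | G i [tuple of behead t]]).
 apply/seteqP; split => // t _.
 have [i _ Fi] : (\bigcup_i F i) (thead t) by rewrite -TF.
 have [j _ Gj] : (\bigcup_i G i) [tuple of behead t] by rewrite -TG.
 exists (maxn i j) => //; split => /=.
 by move: Fi; apply/subsetPset/ndF/leq_maxl.
 by move: Gj; apply/subsetPset/ndG/leq_maxr.
 move=> i; have [mF Fi] := Foo i; have [mG Gi] := Goo i; split.
 apply: measurableI.
 by rewrite -[X in measurable X]setTI; apply: (@measurable_tnth _ _ _ ord0).
 by rewrite -[X in measurable X]setTI; apply: measurable_behead.
 rewrite /PM /= /pushforward /=.
 rewrite (_ : _ @^-1` _ = F i `*` G i).
 by rewrite product_measure1E// lte_mul_pinfty// ge0_fin_numE.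
 have E (x : R) (t : k.-tuple R) : [tuple of behead [tuple of x :: t]] = t.
 exact/val_inj.
 by apply/seteqP; split => -[x t] /=; rewrite E.
exists (sfmeasure sf) => g g0 mg.
have -> : \int[sfmeasure sf]_t g t = \int[pushforward (lebesgue_measure \x m) cns]_t g t by [].
rewrite ge0_integral_pushforward//= preimage_setT.
rewrite fubini_tonelli1//; last exact: (measurableT_comp mg mcns).
apply: eq_integral => x _; rewrite mE//.
apply: (measurableT_comp mg).
by apply: measurable_cons => //; exact: measurable_id.
Qed.

Definition mutup k := projT1 (cid (tuple_measure_exists k)).

Lemma iintE k (g : seq R -> \bar R) : (forall s, 0 <= g s) ->
 measurable_fun setT (fun t : k.-tuple R => g t) ->
 iint k g = \int[mutup k]_t g t.
exact: (projT2 (cid (tuple_measure_exists k))). Qed.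

Lemma iint_ge0 k (g : seq R -> \bar R) : (forall s, 0 <= g s) -> 0 <= iint k g.
elim: k g => [|k IH] g g0 /=; first exact: g0.
by apply: integral_ge0 => x _; exact: IH.
Qed.

Lemma le_iint k (f g : seq R -> \bar R) : (forall s, 0 <= f s) ->
 (forall s, f s <= g s) -> iint k f <= iint k g.
elim: k f g => [|k IH] f g f0 fg //=.
by apply: le_integral_ge0 => x; [exact: iint_ge0|exact: IH].
Qed.

Lemma meas_tuple_cons k (g : seq R -> \bar R) (x : R) :
 measurable_fun setT (fun t : k.+1.-tuple R => g t) ->
 measurable_fun setT (fun t : k.-tuple R => g (x :: t)).
move=> mg; apply: (measurableT_comp mg (g := fun t : k.-tuple R => [tuple of x :: t])).
by apply: measurable_cons => //; exact: measurable_id.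
Qed.

Lemma measurable_iint k (g : seq R -> \bar R) : (forall s, 0 <= g s) ->
 measurable_fun setT (fun t : k.+1.-tuple R => g t) ->
 measurable_fun setT (fun x : R => iint k (fun s => g (x :: s))).
move=> g0 mg.
pose f (z : R * k.-tuple R) := g (z.1 :: z.2).
have -> : (fun x : R => iint k (fun s => g (x :: s))) = fubini_F (mutup k) f.
 apply/funext => x; rewrite iintE//; exact: meas_tuple_cons.
apply: measurable_fun_fubini_tonelli_F => //; last by move=> z; exact: g0.
apply: (measurableT_comp mg (g := fun z : R * k.-tuple R => [tuple of z.1 :: z.2])).
exact: measurable_cons.
Qed.

(** Only [g] is measurable, so Fubini applies to [g] and to the null set but not to [f]. Almost
    every slice of [N] is null; the induction hypothesis handles these slices, and the remaining
    first coordinates form a null set of the line. *)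
Lemma eq_iint_null k (f g : seq R -> \bar R) (N : set (seq R)) :
 (forall s, 0 <= f s) -> (forall s, 0 <= g s) ->
 measurable_fun setT (fun t : k.-tuple R => g t) ->
 measurable [set t : k.-tuple R | N t] ->
 iint k (fun s => (\1_N s)%:E) = 0 ->
 (forall s, ~ N s -> f s = g s) -> iint k f = iint k g.
elim: k f g N => [|k IH] f g N f0 g0 mg mN N0 fg /=.
 apply: fg => N1; move: N0 => /=; rewrite indicE mem_set// => /eqP.
 by rewrite eqe oner_eq0.
have mI (j : nat) (M : set (seq R)) : measurable [set t : j.-tuple R | M t] ->
 measurable_fun setT (fun t : j.-tuple R => (\1_M t : R)%:E).
 move=> mM; apply/measurable_EFinP.
 have -> : (fun t : j.-tuple R => (\1_M t : R)) = \1_[set t : j.-tuple R | M t].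
 by [].
 exact: measurable_indic.
pose h x := iint k (fun s => (\1_N (x :: s) : R)%:E).
have h0 x : 0 <= h x by apply: iint_ge0 => s; rewrite lee_fin.
have mh : measurable_fun setT h.
 apply: (measurable_iint (g := fun s => (\1_N s : R)%:E)) => //; exact: mI.
have mZ : measurable (h @^-1` (~` [set 0])).
 by rewrite -[X in measurable X]setTI; apply: mh => //; exact: measurableC.
apply: (@eq_integral_null _ (measurableTypeR R) lebesgue_measure _ _ (h @^-1` (~` [set 0]))) => //.
- move: N0 => /= N0.
 have := @ae_eq_integral_abs _ _ _ lebesgue_measure setT measurableT h mh.
 case=> + _.
 have -> : \int[lebesgue_measure]_x `|h x| = \int[lebesgue_measure]_x h x.
 by apply: eq_integral => x _; rewrite gee0_abs.
 move=> /(_ N0)[M [mM M0 sM]]; apply: (@subset_measure0 _ (measurableTypeR R) _ lebesgue_measure _ M) => // x /= hx.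
 by apply: sM => /(_ I).
- exact: measurable_iint.
- by move=> x; exact: iint_ge0.
- by move=> x; exact: iint_ge0.
- move=> x /= /contrapT hx; apply: (IH _ _ [set s | N (x :: s)]) => //.
 + exact: meas_tuple_cons.
 + have mc : measurable_fun setT (fun t : k.-tuple R => [tuple of (x : R) :: t]).
 by apply: measurable_cons => //; exact: measurable_id.
 by have := mc measurableT _ mN; rewrite setTI.
 + by move=> Ns; exact: fg.
Qed.
End bridge.

(** * The Lebesgue sigma-algebra and Lebesgue measure on row vectors *)

Section RL.
Context {R : realType} {n : nat}.
Local Notation Rn := 'rV[R]_n.
Local Open Scope ereal_scope.

Definition tup2row (t : n.-tuple R) : Rn := \row_(i < n) tnth t i.
Definition row2tup (x : Rn) : n.-tuple R := [tuple x ord0 i | i < n].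

Lemma tup2rowK : cancel tup2row row2tup.
by move=> t; apply/eq_from_tnth => i; rewrite tnth_mktuple mxE. Qed.

Lemma row2tupK : cancel row2tup tup2row.
by move=> x; apply/rowP => i; rewrite mxE tnth_mktuple. Qed.

Lemma rowseq_tuple (t : n.-tuple R) : rowseq t = tup2row t.
by apply/rowP => i; rewrite !mxE (tnth_nth 0%R). Qed.

Definition borelfun (g : Rn -> \bar R) := measurable_fun setT (g \o tup2row).

Lemma borelRnE (A : set Rn) : borelRn A = measurable (tup2row @^-1` A).
by []. Qed.

Lemma nnint_ge0 (f : Rn -> \bar R) : (forall x, 0 <= f x) -> 0 <= nnint f.
by move=> f0; exact: iint_ge0. Qed.

Lemma le_nnint (f g : Rn -> \bar R) : (forall x, 0 <= f x) ->
 (forall x, f x <= g x) -> nnint f <= nnint g.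
by move=> f0 fg; apply: le_iint => s. Qed.

Lemma nnint_borelE (g : Rn -> \bar R) : (forall x, 0 <= g x) -> borelfun g ->
 nnint g = \int[mutup n]_t g (tup2row t).
move=> g0 mg; rewrite /nnint iintE//.
 by apply: eq_integral => t _; rewrite rowseq_tuple.
by apply: eq_measurable_fun mg => t /=; rewrite rowseq_tuple.
Qed.

Lemma borelfun_indic (A : set Rn) : borelRn A -> borelfun (fun x => (\1_A x : R)%:E).
move=> mA; apply/measurable_EFinP.
rewrite (_ : (fun _ => _) = \1_(tup2row @^-1` A)); first exact: measurable_indic.
by [].
Qed.

Lemma leb_borelE (A : set Rn) : borelRn A -> leb A = mutup n (tup2row @^-1` A).
move=> mA; rewrite /leb nnint_borelE//; last exact: borelfun_indic.
by rewrite -[X in _ = mutup n X]setIT -integral_indic.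
Qed.

Lemma eq_nnint_null (f g : Rn -> \bar R) (N : set Rn) :
 (forall x, 0 <= f x) -> (forall x, 0 <= g x) -> borelfun g ->
 borelRn N -> leb N = 0 -> (forall x, ~ N x -> f x = g x) -> nnint f = nnint g.
move=> f0 g0 mg mN N0 fg; apply: (@eq_iint_null _ _ _ _ [set s | N (rowseq s)]) => //.
- by apply: eq_measurable_fun mg => t /=; rewrite rowseq_tuple.
- move: mN; congr measurable; apply/seteqP; split => t /=; rewrite rowseq_tuple; exact.
- by move=> Ns; exact: fg.
Qed.

Lemma leb_lebRn (A B N : set Rn) : borelRn B -> borelRn N -> leb N = 0 ->
 (A `\` B) `|` (B `\` A) `<=` N -> leb A = leb B.
move=> mB mN N0 ABN; apply: (@eq_nnint_null _ _ N) => //.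
- exact: borelfun_indic.
- move=> x nNx; rewrite !indicE; congr (_%:R%:E); congr nat_of_bool.
 apply/idP/idP; rewrite !inE => h;
 apply: contrapT => h'; apply: nNx; apply: ABN; [left|right]; by [].
Qed.

Lemma borelRnU_null (F : nat -> set Rn) : (forall i, borelRn (F i)) ->
 (forall i, leb (F i) = 0) -> borelRn (\bigcup_i F i) /\ leb (\bigcup_i F i) = 0.
move=> mF F0; have mU : borelRn (\bigcup_i F i).
 by rewrite borelRnE preimage_bigcup; apply: bigcup_measurable => i _; exact: mF.
split => //; rewrite leb_borelE// preimage_bigcup.
apply/eqP; rewrite -measure_le0.
have mF' i : measurable (tup2row @^-1` F i) by exact: mF.
have := measure_sigma_subadditive (mutup n) mF' (bigcup_measurable (fun i _ => mF' i)).
move=> /(_ setT (@subset_refl _ _)) /le_trans; apply.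
by rewrite eseries0// => i _; have := F0 i; rewrite (leb_borelE (mF i)).
Qed.

Lemma borel_lebRn (A : set Rn) : borelRn A -> lebRn A.
move=> mA; exists A, set0; split => //; split; first by rewrite borelRnE preimage_set0.
split; last by move=> x; rewrite setDv setU0.
by rewrite leb_borelE ?preimage_set0// borelRnE preimage_set0.
Qed.

Lemma lebRn0 : lebRn (set0 : set Rn).
by apply: borel_lebRn; rewrite borelRnE preimage_set0. Qed.

Lemma lebRnC (A : set Rn) : lebRn A -> lebRn (~` A).
move=> [B [N [mB [mN [N0 ABN]]]]]; exists (~` B), N; split.
 by rewrite preimage_setC; exact: measurableC.
split => //; split => // x [[nA /contrapT Bx]|[nB /contrapT Ax]]; apply: ABN; [right|left]; by [].
Qed.

Lemma lebRn_bigcup (F : nat -> set Rn) : (forall i, lebRn (F i)) ->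
 lebRn (\bigcup_i F i).
move=> /choice[B] /choice[N] BN.
have [mN N0] := @borelRnU_null N (fun i => (BN i).2.1) (fun i => (BN i).2.2.1).
exists (\bigcup_i B i), (\bigcup_i N i); split.
 by rewrite borelRnE preimage_bigcup; apply: bigcup_measurable => i _; have [] := BN i.
split => //; split => // x [[[i _ Fi] nB]|[[i _ Bi] nF]]; exists i => //; apply: (BN i).2.2.2.
 by left; split => // Bi; apply: nB; exists i.
by right; split => // Fi; apply: nF; exists i.
Qed.
End RL.

(** A copy of the row vectors that carries the completed sigma-algebra [lebRn]. The arguments of
    [phi] and of the operators keep the plain type; the two are convertible. *)
Definition RL (R : realType) (n : nat) : Type := 'rV[R]_n.
HB.instance Definition _ (R : realType) (n : nat) := Pointed.on (RL R n).
Definition RLdisplay : measure_display. by []. Qed.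
HB.instance Definition _ (R : realType) (n : nat) :=
 @isMeasurable.Build RLdisplay (RL R n) (@lebRn R n) lebRn0 (@lebRnC R n) (@lebRn_bigcup R n).
Definition lebm (R : realType) (n : nat) : set (RL R n) -> \bar R := @leb R n.

Section RLmeasure.
Context {R : realType} {n : nat}.
Local Notation Rn := 'rV[R]_n.
Local Open Scope ereal_scope.

Let lebm0 : lebm (set0 : set (RL R n)) = 0.
by rewrite /lebm leb_borelE ?preimage_set0// borelRnE preimage_set0. Qed.

Let lebm_ge0 (A : set (RL R n)) : 0 <= lebm A.
by apply: nnint_ge0 => x; rewrite lee_fin. Qed.

(** Each [F i] is replaced by a Borel set with the union [M] of all exceptional null sets removed.
    Outside [M] the Borel sets coincide with the [F i], hence inherit their disjointness, and
    additivity of the tuple measure applies. *)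
Let lebm_sigma_additive : semi_sigma_additive (@lebm R n).
move=> F mF tF _.
have /choice[B] := mF => /choice[N] BN.
have [mN N0] := @borelRnU_null _ _ N (fun i => (BN i).2.1) (fun i => (BN i).2.2.1).
set M := \bigcup_i N i in mN N0.
have mBM i : borelRn (B i `\` M).
 by have [mB _] := BN i; exact: (measurableD mB mN).
have FE i : lebm (F i) = mutup n (tup2row @^-1` (B i `\` M)).
 rewrite -leb_borelE//; apply: (@leb_lebRn _ _ _ _ M) => // x.
 case=> [[Fx nBM]|[[Bx nM] nF]]; last by exists i => //; apply: (BN i).2.2.2; right.
 apply: contrapT => nM; apply: nBM; split => //; apply: contrapT => nB.
 by apply: nM; exists i => //; apply: (BN i).2.2.2; left.
have -> : lebm (\bigcup_i F i) = mutup n (\bigcup_i (tup2row @^-1` (B i `\` M))).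
 rewrite -preimage_bigcup -leb_borelE; last first.
 by rewrite borelRnE preimage_bigcup; apply: bigcup_measurable => i _; exact: mBM.
 apply: (@leb_lebRn _ _ _ _ M) => //.
 by rewrite borelRnE preimage_bigcup; apply: bigcup_measurable => i _; exact: mBM.
 move=> x; case=> [[[i _ Fx] nBM]|[[i _ [Bx nM]] nF]]; last first.
 exists i => //; apply: (BN i).2.2.2; right; split => // Fx; apply: nF; by exists i.
 apply: contrapT => nM; apply: nBM; exists i => //; split => //; apply: contrapT => nB.
 by apply: nM; exists i => //; apply: (BN i).2.2.2; left.
rewrite (_ : (fun k => _) = fun k => \sum_(0 <= i < k) mutup n (tup2row @^-1` (B i `\` M))).
 apply: measure_semi_sigma_additive => //; last by apply: bigcup_measurable => i _; exact: mBM.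
 apply/trivIsetP => i j _ _ ij; rewrite -preimage_setI -subset0 => t [[Bi nM] [Bj _]].
 have key l : B l (tup2row t) -> F l (tup2row t).
 move=> Bl; apply: contrapT => nF; apply: nM; exists l => //.
 by apply: (BN l).2.2.2; right; split.
 move/trivIsetP : tF => /(_ i j I I ij) FF.
 by have : (F i `&` F j) (tup2row t); [split; exact: key|rewrite FF].
by apply/funext => k; apply: eq_bigr => i _; rewrite FE.
Qed.

HB.instance Definition _ := isMeasure.Build _ _ _ (@lebm R n)
 lebm0 lebm_ge0 lebm_sigma_additive.

Lemma meas_row2tup : measurable_fun setT (row2tup : RL R n -> n.-tuple R).
move=> _ Y mY; rewrite setTI; apply: borel_lebRn; rewrite borelRnE.
by rewrite (_ : _ _ = Y)//; apply/seteqP; split => t /=; rewrite tup2rowK.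
Qed.

Lemma borelfun_measurable (g : Rn -> \bar R) : borelfun g ->
 measurable_fun setT (g : RL R n -> _).
move=> mg; have := measurableT_comp mg meas_row2tup.
by apply: eq_measurable_fun => x /=; rewrite row2tupK.
Qed.

Lemma int_lebm_borel (g : Rn -> \bar R) : (forall x, 0 <= g x) -> borelfun g ->
 \int[@lebm R n]_x g x = nnint g.
move=> g0 mg; rewrite nnint_borelE//.
transitivity (\int[pushforward (@lebm R n) row2tup]_t g (tup2row t)).
 rewrite ge0_integral_pushforward//=; last exact: meas_row2tup.
 by rewrite preimage_setT; apply: eq_integral => x /=; rewrite row2tupK.
apply: eq_measure_integral => [|? A mA _]; first exact: meas_row2tup.
rewrite /=  /pushforward /lebm.
have h : tup2row @^-1` (row2tup @^-1` A) = A.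
 by apply/seteqP; split => t /=; rewrite tup2rowK.
by rewrite leb_borelE ?borelRnE h.
Qed.

(** [g] is the supremum of the functions [q * 1_B] over nonnegative rationals [q], with [B] a Borel
    version of the set where [f] exceeds [q]; the countably many exceptional sets are collected in
    [N]. *)
Lemma borel_version (f : RL R n -> \bar R) : measurable_fun setT f ->
 (forall x, 0 <= f x) ->
 exists g N, [/\ borelfun g, (forall x, 0 <= g x), borelRn N, leb N = 0 &
 forall x, ~ N x -> f x = g x].
move=> mf f0.
pose q (i : nat) : R := if unpickle i is Some r then `|ratr r|%R else 0%R.
have /choice[B /choice[N BN]] : forall i, exists B N, borelRn B /\ borelRn N /\
 leb N = 0 /\ ((f @^-1` [set y | (q i)%:E < y]) `\` B) `|`
 (B `\` (f @^-1` [set y | (q i)%:E < y])) `<=` N.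
 move=> i; have := mf measurableT [set y | (q i)%:E < y].
 rewrite setTI; apply; rewrite -set_itvoy; exact: emeasurable_itv.
have [mN N0] := @borelRnU_null _ _ N (fun i => (BN i).2.1) (fun i => (BN i).2.2.1).
pose g (x : Rn) : \bar R := esups (fun i => (q i * \1_(B i) x)%:E) 0%N.
exists g, (\bigcup_i N i); split => //.
- apply: measurable_fun_esups => i; apply/measurable_EFinP.
 have := @borelfun_indic _ _ (B i) (BN i).1 => /measurable_EFinP h.
 by apply: measurable_funM => //; exact: measurable_cst.
- move=> x; apply: le_trans (_ : (q 0%N * \1_(B 0%N) x)%:E <= _).
 by rewrite lee_fin mulr_ge0.
 by apply: ereal_sup_ubound; exists 0%N.
- move=> x nN.
 have BP i : B i x <-> (q i)%:E < f x.
 split => h; apply: contrapT => h'; apply: nN; exists i => //; apply: (BN i).2.2.2.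
 by right; split.
 by left; split.
 apply/eqP; rewrite eq_le; apply/andP; split; last first.
 apply: ge_ereal_sup => _ [i _ <-]; rewrite indicE.
 case: (boolP (x \in B i)) => [/set_mem /BP/ltW|_]; first by rewrite mulr1.
 by rewrite mulr0.
 apply/lee_addgt0Pr => e e0.
 have [->|f_n0] := eqVneq (f x) 0.
 apply: adde_ge0; last by rewrite ltW.
 by apply: le_trans (_ : (q 0%N * \1_(B 0%N) x)%:E <= _); [rewrite lee_fin mulr_ge0|
 apply: ereal_sup_ubound; exists 0%N].
 have fgt0 : 0 < f x by rewrite lt0e f_n0 f0.
 have key (r : R) : (0 <= r)%R -> r%:E < f x -> r%:E <= g x.
 move=> r0 rf.
 have [r' rr'] : exists r' : R, (r < r')%R /\ r'%:E < f x.
 case: (f x) rf => [y||]//; last first.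
 by move=> _; exists (r + 1)%R; rewrite ltrDl ltry.
 by rewrite lte_fin => ry; exists ((r + y) / 2)%R; rewrite lte_fin; split; lra.
 have [rr'l r'f] := rr'.
 have [s] := rat_in_itvoo rr'l; rewrite in_itv/= => /andP[rs sr'].
 have qs : q (pickle s) = ratr s.
 by rewrite /q pickleK ger0_norm// (le_trans r0)// ltW.
 have Bs : B (pickle s) x by apply/BP; rewrite qs (lt_trans _ r'f)//.
 apply: (le_via (q (pickle s) * \1_(B (pickle s)) x)%:E).
 by rewrite indicE mem_set// mulr1 qs ltW.
 by apply: ereal_sup_ubound; exists (pickle s).
 case fx : (f x) fgt0 => [y||] // y0.
 case: (leP y e) => ye.
 apply: (le_via (0 + e%:E)); first by rewrite add0e.
 by rewrite leeD2r// key// fx.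
 rewrite -leeBlDr// -EFinB key// ?subr_ge0 ?(ltW ye)//.
 by rewrite fx lte_fin ltrBlDr ltrDl.
 suff -> : g x = +oo by [].
 apply/eqyP => r r0; apply: key; first exact: ltW.
 by rewrite fx ltry.
Qed.

(** This turns the iterated integrals of the definitions into an integral against a measure, with
    its limit theorems. The passage through a Borel version is forced, since slices of Lebesgue
    measurable functions may fail to be measurable. *)
Lemma nnintE (f : Rn -> \bar R) : (forall x, 0 <= f x) ->
 measurable_fun setT (f : RL R n -> _) -> nnint f = \int[@lebm R n]_x f x.
move=> f0 mf; have [g [N [mg g0 mN N0 fg]]] := borel_version mf f0.
rewrite (eq_nnint_null f0 g0 mg mN N0 fg) -int_lebm_borel//.
apply/esym/(@eq_integral_null _ _ (RL R n) (@lebm R n) f g N) => //.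
- exact: borel_lebRn.
- exact: borelfun_measurable.
Qed.

Lemma measRP (f : Rn -> R) : measR f <-> measurable_fun setT (f : RL R n -> R).
split => [mf _ Y mY|mf Y mY]; first by rewrite setTI; exact: mf.
by have := mf measurableT Y mY; rewrite setTI.
Qed.

Lemma measEP (f : Rn -> \bar R) : measE f <-> measurable_fun setT (f : RL R n -> \bar R).
split => [mf _ Y mY|mf Y mY]; first by rewrite setTI; exact: mf.
by have := mf measurableT Y mY; rewrite setTI.
Qed.

Lemma aeP (P : Rn -> Prop) : ae P <-> {ae @lebm R n, forall x, P x}.
split => [[N [mN [N0 NP]]]|[A [[B [N [mB [mN [N0 ABN]]]]] A0 AP]]].
 exists N; split => //; first exact: borel_lebRn.
 by move=> x nP; apply: contrapT => nN; apply: nP; exact: NP.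
have B0 : leb B = 0 by rewrite -(leb_lebRn mB mN N0 ABN).
exists (B `|` N); split; first by rewrite borelRnE preimage_setU; exact: measurableU.
split.
 apply/eqP; rewrite leb_borelE; last by rewrite borelRnE preimage_setU; exact: measurableU.
 rewrite preimage_setU -measure_le0; apply: le_trans (measureU2 _ _ _) _ => //.
 apply: (le_via (leb B + leb N)); last by rewrite B0 N0 adde0.
 by rewrite (leb_borelE mB) (leb_borelE mN).
move=> x nBN; apply: contrapT => nP; apply: nBN.
have Ax := AP x nP; case: (pselect (B x)) => Bx; [by left|right].
by apply: ABN; left.
Qed.
End RLmeasure.

(** * The Euclidean norm *)

Section enorm.
Context {R : realType} {n : nat}.
Local Notation Rn := 'rV[R]_n.
Implicit Types x y : Rn.

Lemma sumsq_ge0 x : 0 <= \sum_(i < n) x ord0 i ^+ 2.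
by apply: sumr_ge0 => i _; exact: sqr_ge0. Qed.

Lemma enorm_ge0 x : 0 <= enorm x.
exact: sqrtr_ge0. Qed.

Lemma sqr_enorm x : enorm x ^+ 2 = \sum_(i < n) x ord0 i ^+ 2.
by rewrite sqr_sqrtr// sumsq_ge0. Qed.

Lemma enorm_coord x i : `|x ord0 i| <= enorm x.
rewrite -(@ler_pXn2r _ 2)// ?nnegrE ?enorm_ge0// sqr_enorm real_normK ?num_real//.
by rewrite (bigD1 i)//= lerDl; apply: sumr_ge0 => j _; exact: sqr_ge0.
Qed.

Lemma enorm_le_sum x : enorm x <= \sum_(i < n) `|x ord0 i|.
have s0 : 0 <= \sum_(i < n) `|x ord0 i| by apply: sumr_ge0.
rewrite -(@ler_pXn2r _ 2)// ?nnegrE ?enorm_ge0// sqr_enorm [leRHS]expr2 mulr_suml.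
apply: ler_sum => i _; rewrite -[leLHS](real_normK (num_real _)) expr2 ler_wpM2l//.
by rewrite (bigD1 i)//= lerDl; apply: sumr_ge0.
Qed.

Lemma enorm0 : enorm (0 : Rn) = 0.
by rewrite /enorm big1 ?sqrtr0// => i _; rewrite mxE expr0n. Qed.

Lemma enormZ a x : enorm (a *: x) = `|a| * enorm x.
rewrite /enorm (eq_bigr (fun i => a ^+ 2 * x ord0 i ^+ 2)) => [|i _]; last first.
 by rewrite mxE exprMn.
by rewrite -mulr_sumr sqrtrM ?sqr_ge0// sqrtr_sqr.
Qed.

Lemma enormN x : enorm (- x) = enorm x.
by rewrite -scaleN1r enormZ normrN normr1 mul1r. Qed.

Lemma enormB x y : enorm (x - y) = enorm (y - x).
by rewrite -enormN opprB. Qed.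

Lemma enorm_cauchy x y : \sum_(i < n) x ord0 i * y ord0 i <= enorm x * enorm y.
have [x0|x0] := eqVneq (enorm x) 0.
 rewrite x0 mul0r big1// => i _; have := enorm_coord x i; rewrite x0 normr_le0 => /eqP->.
 by rewrite mul0r.
have [y0|y0] := eqVneq (enorm y) 0.
 rewrite y0 mulr0 big1// => i _; have := enorm_coord y i; rewrite y0 normr_le0 => /eqP->.
 by rewrite mulr0.
have a0 : 0 < enorm x by rewrite lt0r x0 enorm_ge0.
have b0 : 0 < enorm y by rewrite lt0r y0 enorm_ge0.
set a := enorm x in a0 *; set b := enorm y in b0 *.
have -> : a * b = \sum_(i < n) ((b / a) * x ord0 i ^+ 2 + (a / b) * y ord0 i ^+ 2) / 2.
 rewrite -mulr_suml big_split/= -!mulr_sumr -!sqr_enorm -/a -/b; field.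
 by rewrite !gt_eqF.
apply: ler_sum => i _; set u := x ord0 i; set v := y ord0 i.
have : 0 <= (b * u - a * v) ^+ 2 / (2 * a * b).
 by rewrite divr_ge0 ?sqr_ge0// ltW// !mulr_gt0.
have -> : (b * u - a * v) ^+ 2 / (2 * a * b) =
 (b / a * u ^+ 2 + a / b * v ^+ 2) / 2 - u * v.
 by field; rewrite !gt_eqF.
by rewrite subr_ge0.
Qed.

Lemma enormD x y : enorm (x + y) <= enorm x + enorm y.
rewrite -(@ler_pXn2r _ 2)// ?nnegrE ?addr_ge0 ?enorm_ge0// sqrrD !sqr_enorm.
rewrite (eq_bigr (fun i => x ord0 i ^+ 2 + x ord0 i * y ord0 i *+ 2 + y ord0 i ^+ 2)).
 by rewrite !big_split/= lerD2r lerD2l lerD// enorm_cauchy.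
by move=> i _; rewrite mxE sqrrD.
Qed.

Lemma enorm_dist3 x y z : enorm (x - z) <= enorm (x - y) + enorm (y - z).
by rewrite -[x - z](subrKA y); exact: enormD. Qed.

Lemma enorm_delta (a : R) i : enorm (a *: e_ i : Rn) = `|a|.
rewrite enormZ /enorm (bigD1 i)//= !mxE !eqxx expr1n big1 ?addr0 ?sqrtr1 ?mulr1//.
by move=> j /negPf ji; rewrite mxE ji expr0n.
Qed.

End enorm.

(** * Affine changes of variables, tensor products and cubes *)

Section affine.
Context {R : realType}.
Local Open Scope ereal_scope.

Let mu := @lebesgue_measure R.

Lemma integral_oppr (H : R -> \bar R) : measurable_fun setT H -> (forall x, 0 <= H x) ->
 \int[mu]_x H (- x)%R = \int[mu]_x H x.
move=> mH H0.
transitivity (\int[pushforward mu (-%R : R -> measurableTypeR R)]_x H x).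
 by rewrite ge0_integral_pushforward//=.
apply: eq_measure_integral => A mA _; exact: lebesgue_measureN.
Qed.

(** The image of Lebesgue measure under the affine map, multiplied by [a], agrees with Lebesgue
    measure on half-open intervals, hence everywhere by uniqueness. *)
Lemma integral_affine_pos (H : R -> \bar R) (a v : R) : (0 < a)%R ->
 measurable_fun setT H -> (forall x, 0 <= H x) ->
 \int[mu]_x H (a * x + v)%R = (a^-1)%:E * \int[mu]_x H x.
move=> a0 mH H0.
pose aff : R -> measurableTypeR R := fun x => (a * x + v)%R.
have maff : measurable_fun setT aff.
 by apply: measurable_funD => //; apply: measurable_funM.
pose pf : {measure set (measurableTypeR R) -> \bar R} :=
 measure_function_pushforward__canonical__measure_function_Measure mu maff.
pose m' := mscale (NngNum (ltW a0)) pf.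
have mE A : measurable A -> mu A = m' A.
 move=> mA; apply: lebesgue_measure_unique => // _ [[c d] _ <-] /=.
 rewrite /m' /mscale /= /pushforward.
 have -> : aff @^-1` `]c, d] = [set` `](c - v) / a, (d - v) / a]%R].
 apply/seteqP; split => x /=; rewrite !in_itv/= /aff ltr_pdivrMr// ler_pdivlMr//;
 by move=> /andP[h1 h2]; apply/andP; split; lra.
 rewrite !lebesgue_measure_itv/= !lte_fin.
 have -> : ((c - v) / a < (d - v) / a)%R = (c < d)%R by rewrite ltr_pM2r ?invr_gt0// ltrD2r.
 case: ifPn => _; last by rewrite mule0.
 by rewrite -EFinM; congr (_%:E); field; rewrite gt_eqF.
rewrite [in RHS](@eq_measure_integral _ _ _ setT m' mu) => [|A mA _]; last exact: mE.
rewrite ge0_integral_mscale//= muleA -EFinM mulVf ?gt_eqF// mul1e.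
by rewrite ge0_integral_pushforward//=.
Qed.

Lemma integral_affine (H : R -> \bar R) (a v : R) : a != 0%R ->
 measurable_fun setT H -> (forall x, 0 <= H x) ->
 \int[mu]_x H (a * x + v)%R = (`|a|^-1)%:E * \int[mu]_x H x.
move=> an0 mH H0; have [a0|] := ltP 0%R a.
 by rewrite gtr0_norm// integral_affine_pos.
rewrite le_eqVlt (negPf an0)/= => a0; rewrite ltr0_norm//.
rewrite -(integral_oppr mH)// -(@integral_affine_pos (fun x => H (- x)%R) (- a) (- v))//.
- by apply: eq_integral => x _; congr H; lra.
- by rewrite oppr_gt0.
- by apply: (measurableT_comp mH); exact: oppr_measurable.
Qed.

Lemma eq_iint k (f g : seq R -> \bar R) :
 (forall s, size s = k -> f s = g s) -> iint k f = iint k g.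
elim: k f g => [|k IH] f g fg /=; first exact: fg.
by apply: eq_integral => x _; apply: IH => s sk; apply: fg; rewrite /= sk.
Qed.

Fixpoint affs (a : R) (vs : nat -> R) (s : seq R) : seq R :=
 if s is x :: s' then (a * x + vs 0%N)%R :: affs a (vs \o S) s' else [::].

Lemma nth_affs a vs s i : (i < size s)%N -> nth 0%R (affs a vs s) i = (a * nth 0 s i + vs i)%R.
by elim: s vs i => // x s IH vs [|i] //= si; rewrite IH. Qed.

Lemma iint_affs k (g : seq R -> \bar R) a vs : a != 0%R -> (forall s, 0 <= g s) ->
 measurable_fun setT (fun t : k.-tuple R => g t) ->
 iint k (fun s => g (affs a vs s)) = (`|a| ^- k)%:E * iint k g.
move=> a0; elim: k g vs => [|k IH] g vs g0 mg /=; first by rewrite invr1 mul1e.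
under eq_integral => x _.
 rewrite (IH (fun s => g ((a * x + vs 0%N)%R :: s)))//; last exact: meas_tuple_cons.
 over.
have mH := measurable_iint g0 mg.
rewrite (@integral_affine (fun y => (`|a| ^- k)%:E * iint k (fun s => g (y :: s))))//.
- rewrite ge0_integralZl//; first last.
 by move=> x _; exact: iint_ge0.
 by rewrite muleA -EFinM -invfM exprS.
- by apply: measurable_funeM.
- by move=> x; rewrite mule_ge0 ?iint_ge0//.
Qed.

Lemma iint_tensor k (g : nat -> R -> R) (c : nat -> R) :
 (forall i, measurable_fun setT (g i)) -> (forall i x, (0 <= g i x)%R) ->
 (forall i, \int[mu]_x (g i x)%:E = (c i)%:E) ->
 iint k (fun s => (\prod_(i < k) g i (nth 0 s i))%:E) = (\prod_(i < k) c i)%:E.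
elim: k g c => [|k IH] g c mg g0 gc /=; first by rewrite !big_ord0.
rewrite big_ord_recl/=.
transitivity (\int[mu]_x ((g 0%N x)%:E * (\prod_(i < k) c i.+1)%:E)).
 apply: eq_integral => x _.
 rewrite -(IH (fun i => g i.+1) (fun i => c i.+1))//.
 transitivity (iint k (fun s => (g 0%N x)%:E * (\prod_(i < k) g i.+1 (nth 0 s i))%:E)).
 by congr iint; apply/funext => s; rewrite big_ord_recl/=.
 have mp : measurable_fun setT
 (fun t : k.-tuple R => (\prod_(i < k) g i.+1 (nth 0 t i))%:E).
 apply/measurable_EFinP/measurable_prod => i _.
 apply: (measurableT_comp (mg _)).
 apply: eq_measurable_fun (measurable_tnth i) => t _; exact: tnth_nth.
 rewrite !iintE//.
 - by rewrite ge0_integralZl//; [move=> t _; rewrite lee_fin prodr_ge0|rewrite lee_fin].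
 - by move=> s; rewrite lee_fin prodr_ge0.
 - by move=> s; rewrite mule_ge0// lee_fin// prodr_ge0.
 - exact: measurable_funeM.
rewrite ge0_integralZr//.
- by rewrite gc.
- by apply/measurable_EFinP; exact: mg.
- by move=> x _; rewrite lee_fin.
- rewrite lee_fin; apply: prodr_ge0 => i _.
 by rewrite -lee_fin -gc; apply: integral_ge0 => x _; rewrite lee_fin.
Qed.
End affine.

Section lebm_affine.
Context {R : realType} {n : nat}.
Local Notation Rn := 'rV[R]_n.
Local Notation lam := (@lebm R n).
Local Open Scope ereal_scope.

Lemma rowseq_affs (a : R) (v : Rn) (s : seq R) : size s = n ->
 rowseq (affs a (fun i => nth 0%R (row2tup v) i) s) = (a *: rowseq s + v)%R :> Rn.
move=> sn; apply/rowP => i; rewrite !mxE nth_affs ?sn//.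
by rewrite -tnth_nth tnth_mktuple.
Qed.

Lemma borelfun_coord (h : n.-tuple R -> n.-tuple R) (g : Rn -> \bar R) :
 measurable_fun setT h -> borelfun g -> borelfun (fun x => g (tup2row (h (row2tup x)))).
move=> mh mg; have := measurableT_comp mg mh.
by apply: eq_measurable_fun => t /=; rewrite tup2rowK.
Qed.

Let afft (a : R) (v : Rn) (t : n.-tuple R) : n.-tuple R := row2tup (a *: tup2row t + v).

Let measurable_afft (a : R) (v : Rn) : measurable_fun setT (afft a v).
apply/measurable_fun_tnthP => i /=.
apply: (@eq_measurable_fun _ _ _ _ _ (fun t : n.-tuple R => (a * tnth t i + v ord0 i)%R)).
 by move=> t _; rewrite /= tnth_mktuple !mxE.
apply: measurable_funD => //; apply: measurable_funM => //.
exact: measurable_tnth.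
Qed.

Lemma borelfun_affine (a : R) (v : Rn) (g : Rn -> \bar R) : borelfun g ->
 borelfun (fun x => g (a *: x + v)%R).
move=> mg; have := borelfun_coord (measurable_afft a v) mg.
by apply: eq_measurable_fun => t /=; rewrite row2tupK row2tupK.
Qed.

Lemma borelRn_affine (a : R) (v : Rn) (A : set Rn) : borelRn A ->
 borelRn [set x | A (a *: x + v)%R].
move=> mA; have := measurable_afft a v measurableT mA; rewrite setTI.
congr measurable; apply/seteqP; split => t /=;
 rewrite -[\row_i tnth (afft a v t) i]/(tup2row _) row2tupK; exact.
Qed.

Lemma nnint_affine (a : R) (v : Rn) (g : Rn -> \bar R) : a != 0%R ->
 (forall x, 0 <= g x) -> borelfun g ->
 nnint (fun x => g (a *: x + v)%R) = (`|a| ^- n)%:E * nnint g.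
move=> a0 g0 mg; rewrite /nnint -(@iint_affs _ _ _ a (fun i => nth 0%R (row2tup v) i))//.
- by apply: eq_iint => s sn; rewrite rowseq_affs.
- by apply: eq_measurable_fun mg => t /=; rewrite rowseq_tuple.
Qed.

Lemma leb_affine0 (a : R) (v : Rn) (A : set Rn) : a != 0%R -> borelRn A -> leb A = 0 ->
 leb [set x | A (a *: x + v)%R] = 0.
move=> a0 mA A0.
have := @nnint_affine a v (fun x => (\1_A x)%:E) a0 (fun x => _) (borelfun_indic mA).
by rewrite [in X in _ -> X](_ : leb _ = nnint (fun x => (\1_A (a *: x + v)%R)%:E))// => ->//;
 rewrite -/(leb A) A0 mule0.
Qed.

Lemma lebRn_affine (a : R) (v : Rn) (A : set Rn) : a != 0%R -> lebRn A ->
 lebRn [set x | A (a *: x + v)%R].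
move=> a0 [B [N [mB [mN [N0 ABN]]]]].
exists [set x | B (a *: x + v)%R], [set x | N (a *: x + v)%R].
split; first exact: borelRn_affine.
split; first exact: borelRn_affine.
split; first exact: leb_affine0.
by move=> x h; apply: ABN; case: h => -[? ?]; [left|right].
Qed.

Lemma measurable_affine d (T : measurableType d) (a : R) (v : Rn) (f : RL R n -> T) : a != 0%R ->
 measurable_fun setT f -> measurable_fun setT (fun x : RL R n => f (a *: (x : Rn) + v)%R).
move=> a0 mf _ Y mY; rewrite setTI.
by have := mf measurableT Y mY; rewrite setTI => /(@lebRn_affine a v _ a0).
Qed.

Lemma int_affine_lebm (a : R) (v : Rn) (f : RL R n -> \bar R) : a != 0%R ->
 measurable_fun setT f -> (forall x, 0 <= f x) ->
 \int[lam]_x f (a *: (x : Rn) + v)%R = (`|a| ^- n)%:E * \int[lam]_x f x.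
move=> a0 mf f0; have [g [N [mg g0 mN N0 fg]]] := borel_version mf f0.
rewrite -!nnintE//; last exact: measurable_affine.
rewrite (eq_nnint_null f0 g0 mg mN N0 fg) -(nnint_affine v)//.
apply: (@eq_nnint_null _ _ _ _ [set x | N (a *: x + v)%R]) => //.
- exact: borelfun_affine.
- exact: borelRn_affine.
- exact: leb_affine0.
- by move=> Nx; exact: fg.
Qed.

Lemma integral_affine_lebm (a : R) (v : Rn) (f : RL R n -> R) : a != 0%R ->
 measurable_fun setT f ->
 \int[lam]_x (f (a *: (x : Rn) + v)%R)%:E = (`|a| ^- n)%:E * \int[lam]_x (f x)%:E.
move=> a0 mf; rewrite [LHS]integralE [in RHS]integralE.
have mp : measurable_fun setT (EFin \o f)^\+ by apply/measurable_funepos/measurable_EFinP.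
have mm : measurable_fun setT (EFin \o f)^\- by apply/measurable_funeneg/measurable_EFinP.
pose A := \int[lam]_x (EFin \o f)^\+ x; pose B := \int[lam]_x (EFin \o f)^\- x.
transitivity ((`|a| ^- n)%:E * A - (`|a| ^- n)%:E * B).
 congr (_ - _).
 by rewrite -(int_affine_lebm v a0 mp)//; apply: eq_integral => x _; rewrite ?funeposE.
 by rewrite -(int_affine_lebm v a0 mm)//; apply: eq_integral => x _; rewrite ?funenegE.
rewrite -/A -/B.
have A0 : 0 <= A by exact: integral_ge0.
have B0 : 0 <= B by exact: integral_ge0.
have c0 : (0 < `|a| ^- n)%R by rewrite invr_gt0 exprn_gt0// normr_gt0.
move: A B A0 B0 => [A||] [B||] // A0 B0; rewrite ?gt0_muley ?gt0_muleNy ?lte_fin//=.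
by rewrite -EFinD -[X in _ * X]EFinD -EFinM mulrDr mulrN.
Qed.

Lemma nnint_tensor (g : 'I_n -> R -> R) (c : 'I_n -> R) :
 (forall i, measurable_fun setT (g i)) -> (forall i x, (0 <= g i x)%R) ->
 (forall i, \int[@lebesgue_measure R]_x (g i x)%:E = (c i)%:E) ->
 nnint (fun x : Rn => (\prod_(i < n) g i (x ord0 i))%:E) = (\prod_(i < n) c i)%:E.
move=> mg g0 gc.
pose oi (i : nat) : option 'I_n := insub i.
pose g' i := if oi i is Some j then g j else cst 0%R.
pose c' i := if oi i is Some j then c j else 0%R.
have E (i : 'I_n) : oi i = Some i by rewrite /oi valK.
transitivity (iint n (fun s => (\prod_(i < n) g' i (nth 0%R s i))%:E)).
 congr iint; apply/funext => s; congr (_%:E); apply: eq_bigr => i _.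
 by rewrite /g' E mxE.
rewrite (@iint_tensor _ _ g' c').
- by congr (_%:E); apply: eq_bigr => i _; rewrite /c' E.
- by move=> i; rewrite /g'; case: (oi i) => [j|]; [exact: mg|exact: measurable_cst].
- by move=> i x; rewrite /g'; case: (oi i).
- by move=> i; rewrite /g' /c'; case: (oi i) => [j|]; [exact: gc|rewrite integral0].
Qed.

Lemma borelfun_tensor (g : 'I_n -> R -> R) : (forall i, measurable_fun setT (g i)) ->
 borelfun (fun x => (\prod_(i < n) g i (x ord0 i))%:E).
move=> mg; apply/measurable_EFinP/measurable_prod => i _.
apply: eq_measurable_fun (measurableT_comp (mg i) (measurable_tnth i)) => t _ /=.
by rewrite mxE.
Qed.

Definition cube (c : Rn) (r : R) : set Rn :=
 [set x | forall i, (c ord0 i - r <= x ord0 i <= c ord0 i + r)%R].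

Lemma indic_cube c r : (\1_(cube c r) : Rn -> R) =
 fun x => (\prod_(i < n) \1_(`[c ord0 i - r, c ord0 i + r]%classic : set R) (x ord0 i))%R.
apply/funext => x; rewrite indicE.
case: (boolP (x \in cube c r)) => [/set_mem cx|/negP nx].
 rewrite big1// => i _; rewrite indicE mem_set//= in_itv/=; exact: cx.
have [i /negP nxi] : exists i, ~ (c ord0 i - r <= x ord0 i <= c ord0 i + r)%R.
 by apply/existsNP => h; apply: nx; rewrite inE.
rewrite (bigD1 i)//= indicE memNset ?mul0r//= in_itv/=.
exact/negP.
Qed.

Lemma borel_cube c r : borelRn (cube c r).
have h : borelfun (fun x => (\1_(cube c r) x)%:E).
 by rewrite indic_cube; apply: (borelfun_tensor (g := fun i =>
 \1_(`[c ord0 i - r, c ord0 i + r]%classic : set R))%R) => i; exact: measurable_indic.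
have := h measurableT [set 1%E] (emeasurable_set1 _); rewrite setTI.
congr measurable; apply/seteqP; split => t /=; rewrite indicE.
 by case: (boolP (_ \in _)) => [/set_mem//|_ [] /esym/eqP]; rewrite oner_eq0.
by move=> ct; rewrite mem_set.
Qed.

Lemma leb_cube c r : (0 <= r)%R -> leb (cube c r) = ((2 * r) ^+ n)%:E.
move=> r0; rewrite /leb indic_cube (@nnint_tensor (fun i =>
 \1_(`[c ord0 i - r, c ord0 i + r]%classic : set R))%R (fun=> 2 * r)%R)//.
- by rewrite prodr_const card_ord.
- move=> i.
 transitivity (lebesgue_measure (`[c ord0 i - r, c ord0 i + r]%classic : set R)%R).
 by rewrite integral_indic//= setIT.
 rewrite lebesgue_measure_itv/= lte_fin.
 case: ltP => h; last by congr (_%:E); lra.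
 by rewrite -EFinB; congr (_%:E); lra.
Qed.
End lebm_affine.

Ltac pos := repeat first [ done | exact: enorm_ge0 | exact: normr_ge0 | exact: ler0n | exact: powR_ge0 | exact: sqr_ge0
 | (apply: ltW; done) | rewrite lee_fin | rewrite lte_fin | apply: exprn_ge0 | apply: exprn_gt0
 | apply: exprz_ge0 | apply: exprz_gt0 | apply: divr_ge0 | apply: divr_gt0 | apply: mulr_ge0 | apply: mulr_gt0
 | apply: addr_ge0 | apply: addr_gt0 | rewrite invr_ge0 | rewrite invr_gt0 | apply: powR_gt0 ].
Ltac posq := fail.
Ltac pos0 := repeat first [ assumption | exact: ltr01 | exact: ler01 | exact: enorm_ge0 | exact: normr_ge0 | exact: ler0n
 | exact: powR_ge0 | exact: sqr_ge0 | exact: abse_ge0 | (rewrite ltr0n; reflexivity) | (apply: ltW; assumption)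
 | posq | rewrite lee_fin | rewrite lte_fin | apply: exprn_ge0 | apply: exprn_gt0 | apply: exprz_ge0 | apply: exprz_gt0
 | apply: divr_ge0 | apply: divr_gt0 | apply: mulr_ge0 | apply: mulr_gt0 | apply: addr_ge0 | apply: addr_gt0
 | apply: mule_ge0 | apply: adde_ge0 | rewrite invr_ge0 | rewrite invr_gt0 | apply: powR_gt0 ].
Ltac posh := match goal with |- ?G => tryif has_evar G then fail else solve [pos0] end.
#[local] Hint Extern 0 (is_true (0%R <= _)%R) => posh : core.
#[local] Hint Extern 0 (is_true (0%R < _)%R) => posh : core.
#[local] Hint Extern 0 (is_true (0%E <= _)%E) => posh : core.

Section space.
Context {R : realType} {n : nat}.
Local Notation Rn := 'rV[R]_n.
Local Notation L := (@lebm R n).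
Local Notation mfun f := (measurable_fun setT (f : RL R n -> R)) (only parsing).
Local Notation xpow gam x := (\prod_(i < n) (x : Rn) ord0 i ^+ gam i).
Local Notation mset A := (measurable (A : set (RL R n))) (only parsing).

(** * Open sets and continuity with respect to Euclidean balls *)

Definition eopen (O : set Rn) := forall x, O x -> exists2 e : R, 0 < e & eball x e `<=` O.

Definition econt (h : Rn -> R) := forall x (e : R), 0 < e -> exists2 d : R, 0 < d &
 forall y, enorm (y - x) < d -> `|h y - h x| < e.

(** The cubes with rational centre and half-side [1/(m+1)] contained in the set are countably many
    and cover it; cubes are Borel by their product form. *)
Lemma eopen_borel (O : set Rn) : eopen O -> borelRn O.
move=> oO.
pose C (z : 'rV[rat]_n * nat) : set Rn := cube (map_mx ratr z.1) (z.2.+1%:R^-1).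
pose D (i : nat) : set Rn := if unpickle i is Some z then
 (if `[< C z `<=` O >] then C z else set0) else set0.
have -> : O = \bigcup_i D i.
 apply/seteqP; split => [x Ox|x [i _]]; last first.
 rewrite /D; case: unpickle => // z; case: asboolP => // CO; exact: CO.
 have [e e0 eO] := oO x Ox.
 pose m := Num.truncn ((2 * n.+1%:R) / e).
 have mE : (2 * n.+1%:R) / e < m.+1%:R by exact: truncnS_gt.
 have /choice[q qP] : forall i : 'I_n, exists q : rat, `|x ord0 i - ratr q| < m.+1%:R^-1.
 move=> i.
 have h : x ord0 i - m.+1%:R^-1 < x ord0 i by rewrite ltrBlDr ltrDl.
 have [q] := rat_in_itvoo h; rewrite in_itv/= => /andP[q1 q2]; exists q.
 by rewrite ger0_norm ?subr_ge0 ?(ltW q2)// ltrBlDr addrC -ltrBlDr.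
 pose z : 'rV[rat]_n * nat := (\row_i q i, m).
 have CO : C z `<=` O.
 move=> y Cy; apply: eO; rewrite /eball/=.
 apply: le_lt_trans (enorm_le_sum _) _.
 apply: (@le_lt_trans _ _ (\sum_(i < n) (2 * m.+1%:R^-1))).
 apply: ler_sum => i _; rewrite !mxE; have := Cy i; rewrite !mxE /= => /andP[y1 y2].
 move: y1 y2 (qP i); set d := m.+1%:R^-1 => y1 y2.
 by rewrite ltr_norml ler_norml => /andP[x1 x2]; apply/andP; split; lra.
 rewrite sumr_const card_ord -[X in X < _]mulr_natr.
 have : m.+1%:R^-1 < e / (2 * n.+1%:R).
 by rewrite -[ltRHS]invrK ltf_pV2 ?posrE ?invr_gt0 ?divr_gt0// invf_div.
 move=> me; apply: (@lt_le_trans _ _ (2 * (e / (2 * n.+1%:R)) * n.+1%:R)).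
 apply: (@le_lt_trans _ _ (2 * m.+1%:R^-1 * n.+1%:R)).
 by rewrite ler_wpM2l ?ler_nat//.
 by rewrite ltr_pM2r// ltr_pM2l.
 have E (N : R) : N != 0 -> 2 * (e / (2 * N)) * N = e by move=> N0; field.
 by rewrite E.
 exists (pickle z) => //; rewrite /D pickleK asboolT// => i; rewrite !mxE /=.
 have := qP i; move: (m.+1%:R^-1) => d; rewrite ltr_norml => /andP[x1 x2].
 by apply/andP; split; lra.
rewrite borelRnE preimage_bigcup; apply: bigcup_measurable => i _.
rewrite /D; case: unpickle => [z|]; last by rewrite preimage_set0.
by case: ifPn => _; [exact: borel_cube|rewrite preimage_set0].
Qed.

Lemma eopen_measurable (O : set Rn) : eopen O -> mset O.
by move=> oO; apply: borel_lebRn; exact: eopen_borel. Qed.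

Lemma eball_eopen (c : Rn) (r : R) : eopen (eball c r).
move=> x xr; exists (r - enorm (x - c)); first by rewrite subr_gt0.
by move=> y; rewrite /eball/= => yx; have := enorm_dist3 y x c; lra.
Qed.

Lemma econt_borel (h : Rn -> R) : econt h -> measurable_fun setT (h \o tup2row).
move=> ch; apply: (measurability _ (RGenOInfty.measurableE R)) => _ [_ [a ->] <-].
rewrite setTI.
have -> : (h \o tup2row) @^-1` `]a, +oo[%classic = tup2row @^-1` [set x | a < h x].
 by apply/seteqP; split => x /=; rewrite in_itv/= andbT.
apply: eopen_borel => x /= ax.
have [|d d0 dP] := ch x (h x - a); first by rewrite subr_gt0.
exists d => // y /dP; rewrite ltr_norml => /andP[h1 h2] /=; lra.
Qed.

Lemma econt_meas (h : Rn -> R) : econt h -> mfun h.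
move=> ch; have := measurableT_comp (econt_borel ch) meas_row2tup.
by apply: eq_measurable_fun => x /=; rewrite row2tupK.
Qed.

Lemma lsc_measurable (h : Rn -> \bar R) : (forall a : R, eopen [set x | a%:E < h x]%E) ->
 measurable_fun setT (h : RL R n -> \bar R).
move=> oh; apply: (measurability _ (ErealGenOInfty.measurableE R)) => _ [_ [a ->] <-].
rewrite setTI; apply: eopen_measurable.
have -> : h @^-1` `]a%:E, +oo[%classic = [set x | a%:E < h x]%E.
 by apply/seteqP; split => x /=; rewrite in_itv/= andbT.
exact: oh.
Qed.

Lemma econt_lip (h : Rn -> R) (L : R) : (forall x y, `|h x - h y| <= L * enorm (x - y)) ->
 econt h.
move=> hL x e e0; exists (e / (`|L| + 1)); first by rewrite divr_gt0//.
move=> y; rewrite ltr_pdivlMr ?ltr_pwDr// => yx; apply: le_lt_trans (hL _ _) _.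
apply: le_lt_trans yx; rewrite mulrC ler_wpM2l ?enorm_ge0//.
by rewrite (le_trans (ler_norm _))// lerDl.
Qed.

Lemma econt_enorm : econt (enorm : Rn -> R).
apply: (@econt_lip _ 1) => x y; rewrite mul1r ler_norml.
have := enorm_dist3 x y 0; have := enorm_dist3 y x 0; rewrite !subr0 [enorm (y - x)]enormB.
by move=> *; apply/andP; split; lra.
Qed.

(** * Sums over countable index types *)

Section csum.
Context {J : countType}.
Local Open Scope ereal_scope.
Implicit Types (u v : J -> \bar R) (s : seq J).

(** The sum runs over the codes of a countable type; a natural number that codes nothing contributes
    0. For nonnegative terms it is the supremum of the finite sums, so the enumeration does not
    matter. *)
Definition csum u : \bar R := \sum_(i <oo) oapp u 0 (@pickle_inv J i).

Let oapp_ge0 u : (forall j, 0 <= u j) -> forall i, 0 <= oapp u 0 (@pickle_inv J i).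
by move=> u0 i; case: pickle_inv. Qed.

(** The elements with code below [N]; sums over these lists are the truncations used later for the
    families indexed by Whitney balls. *)
Definition cfirst (N : nat) : seq J := pmap (@pickle_inv J) (iota 0 N).

Lemma csum_partial u N : \sum_(0 <= i < N) oapp u 0 (@pickle_inv J i) = \sum_(j <- cfirst N) u j.
rewrite /cfirst; elim: N => [|N IH]; first by rewrite big_nil big_nil.
rewrite -[in RHS]addn1 iotaD add0n pmap_cat big_cat/= -IH big_nat_recr//=; congr (_ + _).
by case: pickle_inv => [j|]/=; rewrite ?big_seq1 ?big_nil.
Qed.

Lemma cfirst_uniq N : uniq (cfirst N).
apply: (@pmap_uniq _ _ _ pickle); last exact: iota_uniq.
by move=> i; have := @pickle_invK J i; rewrite /ocancel.
Qed.

Lemma mem_cfirst N j : (j \in cfirst N) = (pickle j < N)%N.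
rewrite mem_pmap; apply/mapP/idP => [[i]|jN].
 rewrite mem_iota/= add0n => iN; have := @pickle_invK J i.
 by case: pickle_inv => //= k + [->]; move=> ->.
by exists (pickle j); rewrite ?mem_iota ?pickleK_inv.
Qed.

Lemma cfirst_sub s : exists N, {subset s <= cfirst N}.
exists (\max_(j <- s) (pickle j).+1) => j js; rewrite mem_cfirst.
by rewrite (big_rem j js)/= leq_max leqnn.
Qed.

Lemma csum_ge0 u : (forall j, 0 <= u j) -> 0 <= csum u.
by move=> u0; apply: nneseries_ge0 => i _ _; exact: oapp_ge0. Qed.

Lemma le_sum_sub u s s' : (forall j, 0 <= u j) -> uniq s -> {subset s <= s'} ->
 \sum_(j <- s) u j <= \sum_(j <- s') u j.
move=> u0; elim: s s' => [|j s IH] s' /= us ss'; first by rewrite big_nil sume_ge0.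
have js' : j \in s' by apply: ss'; rewrite inE eqxx.
rewrite big_cons (perm_big _ (perm_to_rem js'))/= big_cons leeD2l// IH.
 by [].
 by case/andP: us.
move=> k ks; have : k \in s' by apply: ss'; rewrite inE ks orbT.
rewrite (perm_mem (perm_to_rem js')) => /orP[/eqP kj|//].
by case/andP: us; rewrite -kj ks.
Qed.

Lemma le_csum_fin u s : (forall j, 0 <= u j) -> uniq s -> \sum_(j <- s) u j <= csum u.
move=> u0 us; have [N sN] := cfirst_sub s.
apply: le_trans (le_sum_sub u0 us sN) _; rewrite -csum_partial.
by apply: nneseries_lim_ge => i _ _; exact: oapp_ge0.
Qed.

Lemma csum_le_fin u (b : \bar R) : (forall j, 0 <= u j) ->
 (forall s, uniq s -> \sum_(j <- s) u j <= b) -> csum u <= b.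
move=> u0 ub; apply: lime_le.
 by apply: is_cvg_nneseries => i _ _; exact: oapp_ge0.
by apply: nearW => N; rewrite csum_partial; apply: ub; exact: cfirst_uniq.
Qed.

Lemma le_csum1 u j : (forall j, 0 <= u j) -> u j <= csum u.
by move=> u0; have := @le_csum_fin u [:: j] u0 isT; rewrite big_seq1. Qed.

Lemma le_csum u v : (forall j, 0 <= u j) -> (forall j, u j <= v j) -> csum u <= csum v.
move=> u0 uv; apply: csum_le_fin => // s us; apply: le_trans (le_csum_fin _ us) => //.
 exact: lee_sum.
by move=> j; exact: le_trans.
Qed.

Lemma csumZl (c : R) u : (0 <= c)%R -> (forall j, 0 <= u j) ->
 csum (fun j => c%:E * u j) = c%:E * csum u.
move=> c0 u0; rewrite /csum -nneseriesZl; last by move=> i _; exact: oapp_ge0.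
by apply: eq_eseriesr => i _; case: pickle_inv => //=; rewrite mule0.
Qed.

Lemma integral_csum d (T : measurableType d) (mu : {measure set T -> \bar R})
 (f : J -> T -> \bar R) : (forall j, measurable_fun setT (f j)) ->
 (forall j x, 0 <= f j x) ->
 \int[mu]_x csum (fun j => f j x) = csum (fun j => \int[mu]_x f j x).
move=> mf f0; rewrite /csum integral_nneseries//.
- by apply: eq_eseriesr => i _; case: pickle_inv => [j|]//=; rewrite integral0.
- by move=> i; case: pickle_inv => [j|]//=.
- by move=> i x _; exact: oapp_ge0.
Qed.

Lemma meas_csum d (T : measurableType d) (f : J -> T -> \bar R) :
 (forall j, measurable_fun setT (f j)) -> (forall j x, 0 <= f j x) ->
 measurable_fun setT (fun x => csum (fun j => f j x)).
move=> mf f0; apply: ge0_emeasurable_sum.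
- by move=> i x _ _; exact: oapp_ge0.
- by move=> i _; case: pickle_inv => [j|]//=.
Qed.

Definition ctail N u : \bar R := csum (fun j => if (pickle j < N)%N then 0 else u j).

Lemma ctailE N u : (forall j, 0 <= u j) ->
 ctail N u = \sum_(N <= i <oo) oapp u 0 (@pickle_inv J i).
move=> u0.
have E i : oapp (fun j => if (pickle j < N)%N then 0 else u j) 0 (@pickle_inv J i) =
 if (i < N)%N then 0 else oapp u 0 (@pickle_inv J i).
 have := @pickle_invK J i; case: pickle_inv => [j /= ->|] //=.
 by rewrite if_same.
rewrite /ctail /csum (nneseries_split 0 N); last first.
 by move=> i _; rewrite E; case: ifP => // _; exact: oapp_ge0.
rewrite add0n big1_seq ?add0e; last first.
 by move=> i; rewrite mem_index_iota E => /= ->.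
congr (limn _); apply/funext => k; apply: eq_big_nat => i /andP[Ni _].
by rewrite E ltnNge Ni.
Qed.

Lemma ctail_small u : (forall j, 0 <= u j) -> csum u < +oo -> forall e : R, (0 < e)%R ->
 exists N, ctail N u < e%:E.
move=> u0 uoo e e0.
have := nneseries_tail_cvg uoo (fun i _ => oapp_ge0 u0 i).
move=> /fine_cvgP[+ /cvgrPdist_lt /(_ e e0)] => -[N1 _ h1] [N2 _ h2].
exists (maxn N1 N2); rewrite ctailE//.
have := h1 (maxn N1 N2) (leq_maxl _ _); have := h2 (maxn N1 N2) (leq_maxr _ _).
rewrite /= sub0r normrN => h3 h4; rewrite -(fineK h4) lte_fin.
by apply: le_lt_trans h3; exact: ler_norm.
Qed.

End csum.

(** Grouping the terms by their image under [g] leaves at most [M] nonzero terms over each [i], each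
    below [v i]. It serves with [g] the level of a Whitney ball and [M] the overlap of the balls. *)
Lemma csum_fiber {J I : countType} (g : J -> I) (u : J -> \bar R)
 (v : I -> \bar R) (M : nat) :
 (forall j, 0 <= u j)%E -> (forall i, 0 <= v i)%E -> (forall j, u j <= v (g j))%E ->
 (forall i s, uniq s -> (forall j, j \in s -> g j = i /\ u j != 0%E) -> (size s <= M)%N) ->
 (csum u <= M%:R%:E * csum v)%E.
move=> u0 v0 uv HM; apply: csum_le_fin => // s us.
pose t := undup (map g s).
have -> : (\sum_(j <- s) u j = \sum_(i <- t) \sum_(j <- s | g j == i) u j)%E.
 rewrite (exchange_big_dep xpredT)//= big_seq_cond [RHS]big_seq_cond.
 apply: eq_bigr => j; rewrite andbT => js.
 rewrite [RHS]big_mkcond/= (bigD1_seq (g j))/= ?undup_uniq ?mem_undup ?map_f//.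
 by rewrite eqxx big1 ?addr0// => i /negPf ij; rewrite eq_sym ij.
have -> : (M%:R%:E * csum v = csum (fun i => M%:R%:E * v i))%E by rewrite csumZl.
apply: le_trans (le_csum_fin (s := t) _ (undup_uniq _)); last first.
 by move=> i; rewrite mule_ge0.
apply: lee_sum => i _.
pose s' := [seq j <- s | (g j == i) && (u j != 0%E)].
have -> : (\sum_(j <- s | g j == i) u j = \sum_(j <- s') u j)%E.
 rewrite big_filter [LHS](bigID (fun j => u j != 0%E))/= [X in (_ + X)%E]big1 ?adde0//.
 by move=> j /andP[_ /negPn/eqP].
apply: (le_via (\sum_(j <- s') v i)%E).
 rewrite big_seq [leRHS]big_seq; apply: lee_sum => j; rewrite mem_filter.
 by move=> /andP[/andP[/eqP <- _] _].
rewrite big_const_seq count_predT.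
have -> k : iter k (+%R (v i)) 0%R = (k%:R%:E * v i)%E.
 elim: k => [|k IH] /=; first by rewrite mul0e.
 by rewrite IH -add1n natrD EFinD ge0_muleDl// mul1e.
apply: lee_wpmul2r => //; rewrite lee_fin ler_nat; apply: (HM i); first exact: filter_uniq.
by move=> j; rewrite mem_filter => /andP[/andP[/eqP -> ->] _].
Qed.

(** The interval is open on the left to match the strict inequality in the level sets. *)
Lemma dyadic_exists (t : R) : 0 < t -> exists k : int, 2 ^ k < t <= 2 ^ (k + 1).
move=> t0.
have pow2 (m : nat) : m%:R <= 2 ^+ m :> R.
 by rewrite -natrX ler_nat ltnW// ltn_expl.
pose N := (Num.truncn t^-1).+1.
have N1 : 1 < t * 2 ^+ N.
 rewrite mulrC -ltr_pdivrMr// mul1r; apply: lt_le_trans (pow2 N); exact: truncnS_gt.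
have exP : exists j, t * 2 ^+ N <= 2 ^+ j.
 exists (Num.truncn (t * 2 ^+ N)).+1; apply: le_trans (pow2 _).
 by rewrite ltW// truncnS_gt.
case: (ex_minnP exP) => [[|j]] jP jmin; first by move: jP; rewrite leNgt N1.
exists (j%:Z - N%:Z)%R; have N0 : 0 < 2 ^+ N :> R by [].
rewrite addrAC !expfzDr// expr1z -exprnP -exprnN.
rewrite ltr_pdivrMr// ler_pdivlMr// -exprSr jP andbT ltNge.
by apply/negP => /jmin; rewrite ltnn.
Qed.

Lemma geom_uniq_nat (r : R) (s : seq nat) : 0 < r < 1 -> uniq s ->
 \sum_(k <- s) r ^+ k <= (1 - r)^-1.
move=> /andP[r0 r1] us; rewrite -lee_fin -sumEFin.
have [N sN] : exists N, {subset s <= iota 0 N}.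
 exists (\max_(j <- s) j.+1)%N => j js; rewrite mem_iota add0n/=.
 by rewrite (big_rem j js)/= leq_max leqnn.
apply: le_trans (le_sum_sub (J := nat) _ us sN) _.
 by move=> j; rewrite lee_fin.
have r1' : 0 < 1 - r by rewrite subr_gt0.
rewrite sumEFin lee_fin -[X in iota _ X]subn0 big_mkord.
have := subrX1 r N; rewrite -opprB -[r - 1]opprB mulNr => /oppr_inj h.
by rewrite -[leRHS]mulr1 ler_pdivlMl// -h gerBl.
Qed.

Lemma geom_uniq_int (r : R) (k0 : int) (s : seq int) : 0 < r < 1 -> uniq s ->
 (forall k, k \in s -> k <= k0) -> \sum_(k <- s) r ^ (k0 - k) <= (1 - r)^-1.
move=> r01 us sk.
apply: le_trans (geom_uniq_nat (s := map (fun k => `|k0 - k|%N) s) r01 _).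
 rewrite big_map big_seq [leRHS]big_seq; apply: ler_sum => k ks.
 by rewrite exprnP gez0_abs// subr_ge0 sk.
rewrite map_inj_in_uniq// => a b /sk ak /sk; lia.
Qed.

Lemma powR_expNn (a p : R) (m : nat) : 0 <= a ->
 a `^ (- p) ^+ m = (a ^ (- m%:Z)) `^ p.
move=> a0; have -> : a ^ (- m%:Z) = a `^ (- m%:R) by rewrite -exprnN powR_invn.
by rewrite -powRrM -powR_mulrn// -powRrM !mulNr mulrC.
Qed.

(** * Growth exponents of phi and its dyadic layer sum *)

Section types.
Variable phi : Rn -> R -> R.

(** The growth hypotheses with fixed exponents and a single constant at least 1. Recording [p1 < 1]
    here is how [I(phi) < 1] reaches the weak type estimates. *)
Record qtype (p0 p1 C : R) : Prop := QType {
 qt_0 : forall x, phi x 0 = 0;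
 qt_gt0 : forall x t, 0 < t -> 0 < phi x t;
 qt_mono : forall x s t, 0 <= s -> s <= t -> phi x s <= phi x t;
 qt_meas : forall t, 0 <= t -> measR (fun x => phi x t);
 qt_p0 : 0 < p0;
 qt_p1 : 0 <= p1 < 1;
 qt_C : 1 <= C;
 qt_up : forall x t s, 0 <= t -> 1 <= s -> phi x (s * t) <= C * s `^ p1 * phi x t;
 qt_low : forall x t s, 0 <= t -> 0 < s -> s <= 1 -> phi x (s * t) <= C * s `^ p0 * phi x t }.

Lemma upper_type_lt1 : upper_type phi 1 -> Iphi phi < 1 -> (exists p, p < 1 /\ upper_type phi p).
move=> u1 I1; apply: contrapT => h; move: I1; apply/negP; rewrite -leNgt.
apply: lb_le_inf; first by exists 1.
by move=> p up; rewrite leNgt; apply/negP => p1; apply: h; exists p.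
Qed.

Lemma phi_ge0 : MO_function phi -> forall x t, 0 <= t -> 0 <= phi x t.
by move=> [h0 hp hm _ _] x t t0; rewrite -(h0 x); apply: hm.
Qed.

(** Comparing [phi 0 1] with [phi 0 s] by upper type 1 and back by lower type [p] gives a factor
    [K s^(p-1)], which is below 1 for small [s] if [p > 1]. The bound makes the supremum that
    defines [iphi] a genuine one. *)
Lemma lower_type_le1 p : MO_function phi -> upper_type phi 1 -> lower_type phi p -> p <= 1.
move=> MO [C1 up] [C2 low]; rewrite leNgt; apply/negP => p1.
have [h0 hp hm _ _] := MO.
pose K := `|C1| * `|C2|; have K0 : 0 <= K by pos.
pose s := (K + 1) `^ (- (p - 1)^-1).
have K1 : 1 <= K + 1 by rewrite lerDr.
have s0 : 0 < s by rewrite powR_gt0// (lt_le_trans ltr01).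
have p10 : 0 < p - 1 by rewrite subr_gt0.
have s1 : s <= 1.
 rewrite /s powRN invf_le1 ?powR_gt0 ?(lt_le_trans ltr01)//.
 by rewrite -[leLHS](powRr0 (K + 1)) ler_powR.
have sp : s `^ (p - 1) = (K + 1)^-1.
 by rewrite -powRrM mulNr mulVf ?gt_eqF// powR_inv1.
have f0 := hp 0 1 ltr01.
have e1 : phi 0 1 <= `|C1| * s^-1 * phi 0 s.
 have := up 0 s s^-1 (ltW s0); rewrite invf_ge1// => /(_ s1).
 rewrite mulVf ?gt_eqF// powRr1// => /le_trans; apply.
 by rewrite ler_wpM2r ?(ltW (hp _ _ s0))// ler_wpM2r// ler_norm.
have e2 : phi 0 s <= `|C2| * s `^ p * phi 0 1.
 have := low 0 1 s ler01 s0 s1; rewrite mulr1 => /le_trans; apply.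
 by rewrite ler_wpM2r// ler_wpM2r// ler_norm.
have : phi 0 1 <= K * (K + 1)^-1 * phi 0 1.
 apply: le_trans e1 _.
 apply: (le_via (`|C1| * s^-1 * (`|C2| * s `^ p * phi 0 1))).
 by rewrite ler_wpM2l.
 rewrite -sp powRB ?gt_eqF// powRr1// /K.
 by apply: le_of_eq; field; rewrite gt_eqF.
rewrite -[leLHS]mul1r ler_pM2r// ler_pdivlMr ?(lt_le_trans ltr01)// mul1r.
by rewrite gerDl ler10.
Qed.

(** As [m(phi)] is an integer part, [n(q(phi)/i(phi) - 1) < m(phi) + 1], that is
    [n q(phi) < i(phi)(n + m(phi) + 1)]. The inequality is strict, so it survives replacing [i(phi)]
    by a slightly smaller lower type and [q(phi)] by a slightly larger exponent. *)
Lemma exponents : growth phi -> exists p q q', [/\ 0 < p, lower_type phi p, in_A phi q, q < q' &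
 n%:R * q' < p * (n%:R + (mphi phi).+1%:R)].
move=> [MO [q1 [q11 Aq1]] [p1 [/andP[p10 _] lp1]] up1].
have hs : has_sup [set p | lower_type phi p].
 by split; [exists p1|exists 1 => p lp; exact: lower_type_le1 lp].
have hi : has_inf [set q | 1 <= q /\ in_A phi q].
 by split; [exists q1|exists 1 => q []].
have i0 : 0 < iphi phi by apply: lt_le_trans p10 _; exact: (ub_le_sup hs.2).
have mP : n%:R * (qphi phi / iphi phi - 1) < (mphi phi).+1%:R by exact: truncnS_gt.
set m1 := (mphi phi).+1%:R in mP *.
set M := n%:R + m1; have m10 : 0 < m1 by [].
have M0 : 0 < M by rewrite ltr_wpDl.
pose D := iphi phi * M - n%:R * qphi phi.
have D0 : 0 < D.
 have : iphi phi * (n%:R * (qphi phi / iphi phi - 1)) < iphi phi * m1 by rewrite ltr_pM2l.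
 have -> : iphi phi * (n%:R * (qphi phi / iphi phi - 1)) = n%:R * qphi phi - iphi phi * n%:R.
 by field; rewrite gt_eqF.
 by rewrite /D mulrDr; lra.
(* Moving both exponents by [e] changes the gap [D] by at most [e (M + n)], which is half of it. *)
pose e := D / (2 * (M + n%:R)).
have MN : 0 < M + n%:R by rewrite ltr_wpDr.
have e0 : 0 < e by pos.
have [p lp pe] := sup_adherent e0 hs.
have [q [q_1 Aq] qe] := inf_adherent e0 hi.
have key : n%:R * (qphi phi + e) < p * M.
 have h2 : (iphi phi - e) * M < p * M by rewrite ltr_pM2r.
 have h3 : e * (M + n%:R) = D / 2 by rewrite /e; field; rewrite gt_eqF.
 have h4 : D = iphi phi * M - n%:R * qphi phi by [].
 nra.
exists p, q, (qphi phi + e); split => //; rewrite -(pmulr_lgt0 _ M0); apply: le_lt_trans key.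
by rewrite mulr_ge0// ltW// (lt_trans _ qe)// (lt_le_trans ltr01).
Qed.

Lemma qtype_exists p0 : growth phi -> Iphi phi < 1 -> 0 < p0 -> lower_type phi p0 ->
 exists p1 C, qtype p0 p1 C.
move=> [MO _ _ up1] I1 p00 [C2 low].
have [p [p1 [C1 up]]] := upper_type_lt1 up1 I1.
have [h0 hp hm _ hme] := MO.
(* The upper type may be enlarged to a nonnegative exponent and still stays below 1. *)
exists (Num.max p 0), (Num.max 1 (Num.max C1 C2)); split => //.
- by rewrite le_max lexx orbT/= gt_max p1 ltr01.
- by rewrite le_max lexx.
- move=> x t s t0 s1; apply: le_trans (up x t s t0 s1) _.
 have sp : s `^ p <= s `^ Num.max p 0 by rewrite ler_powR// le_max lexx.
 rewrite ler_wpM2r ?phi_ge0//.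
 apply: (le_via (Num.max 1 (Num.max C1 C2) * s `^ p)).
 by rewrite ler_wpM2r// !le_max lexx orbT.
 by rewrite ler_wpM2l// le_max ler01.
- move=> x t s t0 s0 s1; apply: le_trans (low x t s t0 s0 s1) _.
 by rewrite ler_wpM2r ?phi_ge0// ler_wpM2r// !le_max lexx !orbT.
Qed.

Variables (p0 p1 C : R).
Hypothesis Q : qtype p0 p1 C.

Lemma qt_ge0 x t : 0 <= t -> 0 <= phi x t.
by move=> t0; rewrite -(qt_0 Q x); apply: (qt_mono Q). Qed.

Lemma qt_C0 : 0 < C. exact: lt_le_trans ltr01 (qt_C Q). Qed.
Let C0 := qt_C0.

Lemma qt_up1 x s t : 0 < s -> s <= t -> phi x t <= C * (t / s) * phi x s.
move=> s0 st; have ts : 1 <= t / s by rewrite ler_pdivlMr// mul1r.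
have := qt_up Q x (ltW s0) ts; rewrite divfK ?gt_eqF// => /le_trans; apply.
rewrite ler_wpM2r ?qt_ge0// ler_wpM2l//.
rewrite -[leRHS]powRr1 ?(le_trans ler01)// ler_powR//.
by have /andP[_ /ltW] := qt_p1 Q.
Qed.

(** With [S] the sum, [phi(S)] is the sum of the shares [(s_i/S) phi(S)], and upper type at most 1
    bounds [phi(S)] by [C (S/s_i) phi(s_i)]. The constant does not depend on the number of terms. *)
Lemma phi_subadd (I : eqType) (r : seq I) (P : pred I) (s : I -> R) x : (forall i, 0 <= s i) ->
 phi x (\sum_(i <- r | P i) s i) <= C * \sum_(i <- r | P i) phi x (s i).
move=> s0; set S := \sum_(i <- r | P i) s i.
have [S0|S0] := eqVneq S 0.
 rewrite S0 (qt_0 Q); apply: mulr_ge0 => //.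
 by apply: sumr_ge0 => i _; exact: qt_ge0.
have Sp : 0 < S by rewrite lt0r S0 sumr_ge0.
have -> : phi x S = \sum_(i <- r | P i) s i / S * phi x S.
 by rewrite -mulr_suml -mulr_suml divff// mul1r.
rewrite mulr_sumr [leLHS]big_seq_cond [leRHS]big_seq_cond.
apply: ler_sum => i /andP[ir Pi].
have iS : s i <= S.
 rewrite /S; elim: r ir {S S0 Sp} => // j r IH; rewrite inE => /predU1P[<-|ir].
 by rewrite big_cons Pi lerDl sumr_ge0.
 rewrite big_cons; case: ifP => _; last exact: IH.
 by rewrite (le_trans (IH ir))// lerDr.
have [si0|si0] := eqVneq (s i) 0.
 by rewrite si0 mul0r mul0r mulr_ge0// qt_ge0.
have sip : 0 < s i by rewrite lt0r si0 s0.
rewrite -ler_pdivlMl// invf_div.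
apply: le_trans (qt_up1 x sip iS) _.
by apply: le_of_eq; field; rewrite !gt_eqF.
Qed.

(** A layer-cake substitute for [phi(x, h/lam)], comparable to it by the two type conditions. Its
    integral is a sum over level sets, the form in which Whitney balls are counted. It makes sense
    at [h = +oo] and depends on [h] only through strict inequalities, which makes up for the missing
    continuity of [phi] in [t]. *)
Definition psi (lam : R) (x : Rn) (h : \bar R) : \bar R :=
 csum (fun k : int => (\1_[set y : \bar R | ((2 ^ k)%:E < y)%E] h * phi x (2 ^ k / lam))%:E).

Let pw (k : int) : 0 < 2 ^ k :> R. by pos. Qed.

Let term_ge0 lam x (h : \bar R) : 0 < lam -> forall k : int,
 (0 <= (\1_[set y : \bar R | ((2 ^ k)%:E < y)%E] h * phi x (2 ^ k / lam))%R%:E)%E.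
by move=> l0 k; rewrite lee_fin mulr_ge0// qt_ge0. Qed.

Lemma psi_ge0 lam x h : 0 < lam -> (0 <= psi lam x h)%E.
by move=> l0; apply: csum_ge0; exact: term_ge0. Qed.

Lemma le_psi lam x h h' : 0 < lam -> (h <= h')%E -> (psi lam x h <= psi lam x h')%E.
move=> l0 hh'; apply: le_csum => k; first exact: term_ge0.
rewrite lee_fin ler_wpM2r ?qt_ge0//.
rewrite ler_nat; case: (boolP (h \in _)) => // /set_mem/= kh.
by rewrite mem_set//=; exact: lt_le_trans hh'.
Qed.

Lemma psi_term lam x (h : \bar R) (k : int) : 0 < lam -> ((2 ^ k)%:E < h)%E ->
 ((phi x (2 ^ k / lam))%:E <= psi lam x h)%E.
move=> l0 kh; apply: le_trans (le_csum1 k (term_ge0 x h l0)).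
by rewrite indicE mem_set// mul1r.
Qed.

Lemma psi_pinfty lam x : 0 < lam -> psi lam x +oo%E = +oo%E.
move=> l0; apply/eqyP => A A0.
have f0 : 0 < phi x (1 / lam) by apply: (qt_gt0 Q); rewrite divr_gt0.
pose N := (Num.truncn (A / phi x (1 / lam))).+1.
apply: (le_via (\sum_(k <- map Posz (iota 0 N))
 (\1_[set y : \bar R | ((2 ^ k)%:E < y)%E] +oo%E * phi x (2 ^ k / lam))%:E)%E); last first.
 apply: le_csum_fin; first exact: term_ge0.
 by rewrite map_inj_uniq ?iota_uniq// => a b [].
rewrite sumEFin lee_fin big_map.
apply: (le_via (\sum_(k <- iota 0 N) phi x (1 / lam))).
 rewrite big_const_seq count_predT size_iota iter_addr_0 -mulr_natl -ler_pdivrMr//.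
 by rewrite ltW// truncnS_gt.
apply: ler_sum => k _; rewrite indicE mem_set/= ?ltry// !mul1r.
apply: (qt_mono Q) => //.
by rewrite -[leLHS]mul1r ler_wpM2r// exprn_ege1// ler1n.
Qed.

(** The single term with [2^k < t <= 2^(k+1)] suffices, by the upper type with factor 2. *)
Lemma phi_le_psi lam x (h : \bar R) : 0 < lam -> (0 <= h)%E ->
 (phiE phi x (h * (lam^-1)%:E) <= (2 * C)%:E * psi lam x h)%E.
move=> l0; case: h => [t||]//; last first.
 move=> _; rewrite psi_pinfty// gt0_mulye ?lte_fin ?invr_gt0//=.
 by rewrite gt0_muley// lte_fin.
rewrite lee_fin le_eqVlt => /predU1P[<-|t0].
 by rewrite mul0e/= (qt_0 Q) mule_ge0 ?psi_ge0// lee_fin.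
have [k /andP[k1 k2]] := dyadic_exists t0.
rewrite /=.
apply: (le_via ((2 * C)%:E * (phi x (2 ^ k / lam))%:E)%E); last first.
 apply: lee_wpmul2l; first by pos.
 by apply: psi_term => //; rewrite lte_fin.
rewrite -EFinM; apply: (le_via (phi x (2 ^ (k + 1) / lam))).
 by apply: (qt_mono Q); [rewrite divr_ge0// ltW|rewrite ler_pM2r ?invr_gt0].
apply: (le_trans (qt_up1 (s := 2 ^ k / lam) x _ _)).
- by pos.
- by rewrite ler_pM2r// ler_weXz2l// lerDl.
- rewrite expfzDr// expr1z; apply: le_of_eq.
 by field; rewrite !gt_eqF.
Qed.

(** By the lower type the terms at levels below [t] decay geometrically with ratio [2^(-p0)]; the
    second factor is the sum of that series. *)
Definition Cpsi := C * (1 - 2 `^ (- p0))^-1.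

Let r01 : 0 < (2 : R) `^ (- p0) < 1.
rewrite powR_gt0//= powRN invf_lt1//.
have h1 : 1 `^ p0 = 1 :> R by rewrite powR1.
by rewrite -[ltLHS]h1 gt0_ltr_powR ?nnegrE ?ltr1n// (qt_p0 Q).
Qed.

Lemma Cpsi_gt0 : 0 < Cpsi.
by rewrite mulr_gt0// invr_gt0 subr_gt0; have /andP[] := r01. Qed.

Lemma psi_le_phi lam x t : 0 < lam -> 0 <= t ->
 (psi lam x t%:E <= (Cpsi * phi x (t / lam))%:E)%E.
move=> l0 t0; apply: csum_le_fin => [|s us]; first exact: term_ge0.
rewrite sumEFin lee_fin.
move: t0; rewrite le_eqVlt => /predU1P[<-|t0].
 rewrite big1; first by rewrite mul0r (qt_0 Q) mulr0.
 by move=> k _; rewrite indicE memNset ?mul0r//= lte_fin; apply/negP; rewrite -leNgt.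
have [k0 /andP[k1 k2]] := dyadic_exists t0.
rewrite (bigID (fun k : int => 2 ^ k < t))/= [X in _ + X]big1 ?addr0; last first.
 by move=> k kt; rewrite indicE memNset ?mul0r//=; exact/negP.
rewrite -big_filter; set s' := [seq _ <- _ | _].
have us' : uniq s' by rewrite filter_uniq.
have s'k k : k \in s' -> k <= k0.
 rewrite mem_filter => /andP[kt _]; rewrite leNgt; apply/negP => k0k.
 have : 2 ^ (k0 + 1) <= 2 ^ k :> R.
 by rewrite ler_weXz2l ?ler1n// lezD1.
 by move=> /(le_trans k2); rewrite leNgt kt.
apply: (le_via (\sum_(k <- s') (C * ((2 `^ (- p0)) ^ (k0 - k))) * phi x (t / lam))).
 rewrite big_seq [leRHS]big_seq; apply: ler_sum => k ks.
 rewrite indicE mem_set/=; last by move: ks; rewrite mem_filter => /andP[].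
 rewrite mul1r.
 have -> : 2 ^ k / lam = (2 ^ k / t) * (t / lam) by field; rewrite !gt_eqF.
 have kt1 : 2 ^ k / t <= 1.
 by rewrite ler_pdivrMr// mul1r ltW; move: ks; rewrite mem_filter => /andP[].
 have kt0 : 0 < 2 ^ k / t by pos.
 apply: (le_trans (qt_low Q x _ kt0 kt1)) => //.
 rewrite ler_wpM2r ?qt_ge0//.
 rewrite ler_wpM2l//.
 have -> : 2 `^ (- p0) ^ (k0 - k) = (2 ^ (k - k0)) `^ p0.
 have := s'k k ks; rewrite -subr_ge0 => /gez0_abs; set m := `|_|%N => mE.
 rewrite -mE -exprnP.
 have -> : (k - k0) = - m%:Z by rewrite mE opprB.
 exact: powR_expNn.
 apply: ge0_ler_powR; rewrite ?nnegrE ?(ltW (qt_p0 Q))//.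
 rewrite expfzDr// ler_wpM2l//.
 by rewrite -invr_expz lef_pV2 ?posrE// ltW.
rewrite -mulr_suml -mulr_sumr ler_wpM2r ?qt_ge0//.
by rewrite ler_wpM2l// geom_uniq_int.
Qed.

Definition Kpsi := Cpsi * C * (2 * C).

Lemma Kpsi_gt0 : 0 < Kpsi.
apply: mulr_gt0 => //.
by apply: mulr_gt0 => //; exact: Cpsi_gt0. Qed.

Lemma psi_csum (J : countType) lam x (h : J -> \bar R) : 0 < lam -> (forall j, 0 <= h j)%E ->
 (psi lam x (csum h) <= Kpsi%:E * csum (fun j => psi lam x (h j)))%E.
move=> l0 h0.
have K0 := Kpsi_gt0.
have [[j hj]|hfin] := pselect (exists j, h j = +oo%E).
 have : (csum (fun j => psi lam x (h j)) = +oo)%E.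
 apply/eqP; rewrite eq_le leey/=.
 apply: le_trans (le_csum1 j _); first by rewrite hj psi_pinfty.
 by move=> i; exact: psi_ge0.
 by move=> ->; rewrite gt0_muley// leey.
pose r j := fine (h j).
have hr j : h j = (r j)%:E.
 rewrite fineK// ge0_fin_numE// ltey; apply/eqP => hj; apply: hfin; by exists j.
have r0 j : 0 <= r j by rewrite fine_ge0.
apply: csum_le_fin => [|s us]; first exact: term_ge0.
(* [phi] may jump, so the infinite sum cannot be reached as a limit. But only the finitely many
   levels in [s] matter, and a strict inequality [2^k < csum h] already holds for a finite partial
   sum. *)
have [N HN] : exists N, forall k, k \in s -> ((2 ^ k)%:E < csum h)%E ->
 ((2 ^ k)%:E < \sum_(j <- cfirst N) h j)%E.
 have H1 (k : int) : exists N, ((2 ^ k)%:E < csum h)%E ->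
 ((2 ^ k)%:E < \sum_(j <- cfirst N) h j)%E.
 apply: contrapT => /forallNP H.
 have kc : ((2 ^ k)%:E < csum h)%E by have /not_implyP[] := H 0%N.
 move: (kc); rewrite ltNge => /negP; apply; apply: csum_le_fin => // s' us'.
 have [N sN] := cfirst_sub s'; apply: le_trans (le_sum_sub h0 us' sN) _.
 by have /not_implyP[_ /negP] := H N; rewrite -leNgt.
 have [f fP] := choice H1; exists (\max_(k <- s) f k)%N => k ks kc.
 apply: lt_le_trans (fP k kc) _; apply: le_sum_sub => //; first exact: cfirst_uniq.
 move=> j; rewrite !mem_cfirst => /leq_trans; apply.
 by rewrite (big_rem k ks)/= leq_maxl.
pose S := \sum_(j <- cfirst N) r j.
have SE : (\sum_(j <- cfirst N) h j = S%:E)%E by rewrite -sumEFin; apply: eq_bigr.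
have S0 : 0 <= S by exact: sumr_ge0.
apply: (le_via (psi lam x S%:E)).
 apply: le_trans (le_csum_fin (term_ge0 x S%:E l0) us).
 rewrite big_seq [leRHS]big_seq; apply: lee_sum => k ks.
 rewrite lee_fin ler_wpM2r ?qt_ge0//.
 rewrite ler_nat; case: (boolP (csum h \in _)) => // /set_mem/= kh.
 by rewrite mem_set//= -SE; exact: HN.
apply: le_trans (psi_le_phi x l0 S0) _.
apply: (le_via (Cpsi * (C * \sum_(j <- cfirst N) phi x (r j / lam)))%:E).
 rewrite lee_fin ler_wpM2l ?(ltW Cpsi_gt0)// mulr_suml.
 by apply: phi_subadd => j; rewrite divr_ge0.
apply: (le_via (Kpsi%:E * \sum_(j <- cfirst N) psi lam x (h j))%E); last first.
 apply: lee_wpmul2l; first by pos.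
 by apply: le_csum_fin => [j|]; [exact: psi_ge0|exact: cfirst_uniq].
rewrite mulrA EFinM [X in (_ <= X * _)%E]EFinM -muleA.
apply: lee_wpmul2l; first by rewrite lee_fin mulr_ge0// ltW// Cpsi_gt0.
rewrite -sumEFin ge0_sume_distrr; last by move=> j _; exact: psi_ge0.
apply: lee_sum => j _; have := phi_le_psi x l0 (h0 j).
by rewrite hr.
Qed.

Lemma psi_indic lam x a (B : set Rn) : 0 < lam -> 0 <= a ->
 (psi lam x (a * \1_B x)%:E <= (Cpsi * (\1_B x * phi x (a / lam)))%:E)%E.
move=> l0 a0; apply: le_trans (psi_le_phi x l0 _) _ => //.
rewrite indicE; case: (x \in B); rewrite ?mulr1 ?mul1r// mulr0 !mul0r (qt_0 Q).
by [].
Qed.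
End types.

(** * The dyadic modular *)

Section Mod.
Variables (phi : Rn -> R -> R) (p0 p1 C : R).
Hypothesis Q : qtype phi p0 p1 C.

Lemma meas_weight (E : set (RL R n)) t : 0 <= t -> measurable E ->
 measurable_fun setT (fun x : RL R n => (\1_E x * phi x t)%:E).
move=> t0 mE; apply/measurable_EFinP; apply: measurable_funM.
 exact: measurable_indic.
by have := qt_meas Q t0 => /measRP.
Qed.

Lemma phisetE (E : set (RL R n)) t : 0 <= t -> measurable E ->
 phiset phi E t = (\int[L]_x (\1_E x * phi x t)%:E)%E.
move=> t0 mE; rewrite /phiset nnintE//; last exact: meas_weight.
by move=> x; rewrite lee_fin mulr_ge0// (qt_ge0 Q).
Qed.

Lemma phiset_ge0 E t : 0 <= t -> (0 <= phiset phi E t)%E.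
by move=> t0; apply: nnint_ge0 => x; rewrite lee_fin mulr_ge0// (qt_ge0 Q). Qed.

Lemma le_phiset (E F : set Rn) s t : 0 <= s -> s <= t -> E `<=` F ->
 (phiset phi E s <= phiset phi F t)%E.
move=> s0 st EF; apply: le_nnint => x; rewrite lee_fin.
 by rewrite mulr_ge0// (qt_ge0 Q).
apply: ler_pM; rewrite ?(qt_ge0 Q)//; last exact: (qt_mono Q).
rewrite ler_nat; case: (boolP (x \in E)) => // /set_mem/EF Fx.
by rewrite mem_set.
Qed.

Lemma meas_gt (g : RL R n -> \bar R) (a : \bar R) : measurable_fun setT g ->
 mset ([set x | a < g x]%E).
by move=> mg; have := emeasurable_fun_o_infty measurableT mg a; rewrite setTI. Qed.

Lemma meas_psi lam (g : RL R n -> \bar R) : 0 < lam -> measurable_fun setT g ->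
 measurable_fun setT (fun x : RL R n => psi phi lam x (g x)).
move=> l0 mg; apply: meas_csum => [k|k x]; last first.
 by rewrite lee_fin mulr_ge0// (qt_ge0 Q).
have mE := meas_gt (2 ^ k)%:E mg.
have := meas_weight (t := 2 ^ k / lam) _ mE; rewrite divr_ge0//.
move=> /(_ isT); apply: eq_measurable_fun => x _; rewrite !indicE.
by [].
Qed.

Definition Mod lam (g : RL R n -> \bar R) : \bar R := (\int[L]_x psi phi lam x (g x))%E.

Lemma Mod_ge0 lam g : 0 < lam -> (0 <= Mod lam g)%E.
by move=> l0; apply: integral_ge0 => x _; exact: (psi_ge0 Q). Qed.

Lemma le_Mod lam g g' : 0 < lam -> measurable_fun setT g -> measurable_fun setT g' ->
 (forall x, (g x <= g' x)%E) -> (Mod lam g <= Mod lam g')%E.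
move=> l0 mg mg' gg'; apply: ge0_le_integral => //.
- by move=> x _; exact: (psi_ge0 Q).
- exact: meas_psi.
- exact: meas_psi.
- by move=> x _; exact: (le_psi Q).
Qed.

Lemma ModE lam g : 0 < lam -> measurable_fun setT g ->
 Mod lam g = csum (fun k : int => phiset phi [set x | (2 ^ k)%:E < g x]%E (2 ^ k / lam)).
move=> l0 mg; rewrite /Mod /psi.
have mE (k : int) := meas_gt (2 ^ k)%:E mg.
have t0 (k : int) : 0 <= 2 ^ k / lam by pos.
have E (k : int) x : (\1_[set y : \bar R | ((2 ^ k)%:E < y)%E] (g x) * phi x (2 ^ k / lam))%:E =
 (\1_[set x : RL R n | (2 ^ k)%:E < g x]%E x * phi x (2 ^ k / lam))%:E.
 by [].
transitivity (\int[L]_x csum (fun k : int =>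
 (\1_[set x : RL R n | (2 ^ k)%:E < g x]%E x * phi x (2 ^ k / lam))%:E))%E.
 by [].
rewrite integral_csum.
- by congr csum; apply/funext => k; rewrite phisetE.
- by move=> k; exact: meas_weight.
- by move=> k x; rewrite lee_fin mulr_ge0// (qt_ge0 Q).
Qed.

Lemma modular_le_Mod lam (g : RL R n -> \bar R) : 0 < lam -> (forall x, 0 <= g x)%E ->
 measurable_fun setT g -> (modular phi g lam <= (2 * C)%:E * Mod lam g)%E.
move=> l0 g0 mg; have C0 : 0 <= 2 * C by rewrite mulr_ge0// (le_trans ler01)// (qt_C Q).
rewrite -ge0_integralZl//; first last.
- by move=> x _; exact: (psi_ge0 Q).
- exact: meas_psi.
rewrite -nnintE.
- apply: le_nnint => x; last exact: (phi_le_psi Q).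
 have := g0 x; case: (g x) => [r||] //.
 by rewrite /= => r0; rewrite lee_fin (qt_ge0 Q).
 by move=> _; rewrite gt0_mulye ?lte_fin ?invr_gt0//=.
- by move=> x; rewrite mule_ge0// (psi_ge0 Q).
- by apply: measurable_funeM; exact: meas_psi.
Qed.

Lemma Mod_le_modular lam (g : RL R n -> \bar R) : 0 < lam -> (forall x, 0 <= g x)%E ->
 measurable_fun setT g -> (Mod lam g <= (Cpsi p0 C)%:E * modular phi g lam)%E.
move=> l0 g0 mg; have K0 := Cpsi_gt0 Q.
rewrite -lee_pdivrMl// -ge0_integralZl//; first last.
- by pos.
- by move=> x _; exact: (psi_ge0 Q).
- exact: meas_psi.
rewrite -nnintE.
- apply: le_nnint => x; first by rewrite mule_ge0 ?(psi_ge0 Q)// lee_fin.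
 have := g0 x; case: (g x) => [r||] //; last first.
 by move=> _; rewrite [X in (_ <= _ X)%E]gt0_mulye ?lte_fin// leey.
 rewrite lee_pdivrMl// => r0; exact: (psi_le_phi Q).
- by move=> x; rewrite mule_ge0 ?(psi_ge0 Q)// lee_fin.
- by apply: measurable_funeM; exact: meas_psi.
Qed.

Lemma Mod_csum (J : countType) lam (h : J -> RL R n -> \bar R) : 0 < lam ->
 (forall j x, 0 <= h j x)%E -> (forall j, measurable_fun setT (h j)) ->
 (Mod lam (fun x => csum (fun j => h j x)) <=
 (Kpsi p0 C)%:E * csum (fun j => Mod lam (h j)))%E.
move=> l0 h0 mh; have K0 := Kpsi_gt0 Q.
rewrite /Mod -integral_csum; last 2 first.
- by move=> j; exact: meas_psi.
- by move=> j x; exact: (psi_ge0 Q).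
have mc : measurable_fun setT (fun x : RL R n => csum (fun j => psi phi lam x (h j x))).
 by apply: meas_csum => [j|j x]; [exact: meas_psi|exact: (psi_ge0 Q)].
rewrite -ge0_integralZl//; first last.
- by pos.
- by move=> x _; apply: csum_ge0 => j; exact: (psi_ge0 Q).
apply: ge0_le_integral => //.
- by move=> x _; exact: (psi_ge0 Q).
- by apply: meas_psi => //; exact: meas_csum.
- exact: measurable_funeM.
- by move=> x _; exact: (psi_csum Q).
Qed.

Lemma Mod_indic lam a (B : set (RL R n)) : 0 < lam -> 0 <= a -> measurable B ->
 (Mod lam (fun x => (a * \1_B x)%:E) <= (Cpsi p0 C)%:E * phiset phi B (a / lam))%E.
move=> l0 a0 mB; have K0 := Cpsi_gt0 Q.
have t0 : 0 <= a / lam by pos.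
rewrite phisetE// -ge0_integralZl//; first last.
- by pos.
- by move=> x _; rewrite lee_fin mulr_ge0// (qt_ge0 Q).
- exact: meas_weight.
apply: ge0_le_integral => //.
- by move=> x _; exact: (psi_ge0 Q).
- apply: meas_psi => //; apply/measurable_EFinP; apply: measurable_funM => //.
- by apply: measurable_funeM; exact: meas_weight.
- by move=> x _; rewrite -EFinM; exact: (psi_indic Q).
Qed.

Lemma phiset_le E s t K : 0 <= s -> 0 <= t -> 0 <= K -> mset E ->
 (forall x, phi x s <= K * phi x t) -> (phiset phi E s <= K%:E * phiset phi E t)%E.
move=> s0 t0 K0 mE h; rewrite !phisetE// -ge0_integralZl//; first last.
- by move=> x _; rewrite lee_fin mulr_ge0// (qt_ge0 Q).
- exact: meas_weight.
apply: ge0_le_integral => //.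
- by move=> x _; rewrite lee_fin mulr_ge0// (qt_ge0 Q).
- exact: meas_weight.
- by apply: measurable_funeM; exact: meas_weight.
- by move=> x _; rewrite lee_fin mulrCA ler_wpM2l.
Qed.

Lemma phiset_low E t a : 0 <= t -> 0 < a -> a <= 1 -> mset E ->
 (phiset phi E (a * t) <= (C * a `^ p0)%:E * phiset phi E t)%E.
move=> t0 a0 a1 mE; have C0 := qt_C0 Q.
by apply: phiset_le; rewrite ?mulr_ge0 ?powR_ge0 ?(ltW a0) ?(ltW C0)// => x; exact: (qt_low Q).
Qed.

Lemma phiset_up E t a : 0 <= t -> 1 <= a -> mset E ->
 (phiset phi E (a * t) <= (C * a `^ p1)%:E * phiset phi E t)%E.
move=> t0 a1 mE; have C0 := qt_C0 Q; have a0 := le_trans ler01 a1.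
by apply: phiset_le; rewrite ?mulr_ge0 ?powR_ge0 ?(ltW C0)// => x; exact: (qt_up Q).
Qed.
End Mod.

Ltac posq ::= match goal with Q : qtype ?f _ _ _ |- _ => first [exact: (Kpsi_gt0 Q) | apply: (qt_ge0 Q) | apply: (qt_gt0 Q)
 | apply: (phiset_ge0 Q) | apply: (psi_ge0 Q) ] end.

Lemma powR_invl (b p : R) : 0 <= b -> b^-1 `^ p = (b `^ p)^-1.
by move=> b0; rewrite -powR_inv1// -powRrM mulN1r powRN. Qed.

Lemma powR_divl (a b p : R) : 0 <= a -> 0 <= b -> (a / b) `^ p = a `^ p / b `^ p.
by move=> a0 b0; rewrite powRM// powR_invl. Qed.

(** * Balls, Muckenhoupt weights and doubling *)

Definition vball : R := fine (leb (eball (0 : Rn) 1)).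

Lemma meas_eball (c : Rn) (r : R) : mset (eball c r).
exact/eopen_measurable/eball_eopen. Qed.

Lemma eball_cube (c : Rn) (r : R) : eball c r `<=` cube c r.
move=> x xr i; have := le_lt_trans (enorm_coord (x - c) i) xr.
rewrite !mxE ltr_norml => /andP[h1 h2]; apply/andP; split; lra.
Qed.

Lemma le_leb (A B : set (RL R n)) : measurable A -> measurable B -> A `<=` B ->
 (leb A <= leb B)%E.
by move=> mB AB; apply: (@le_measure _ _ _ L); rewrite ?inE. Qed.

Lemma vball_gt0 : 0 < vball.
have mc r : mset (cube 0 r)
 by apply: borel_lebRn; exact: borel_cube.
have h1 : (leb (eball (0 : Rn) 1) <= (2 ^+ n)%:E)%E.
 have := le_leb (meas_eball 0 1) (mc 1) (@eball_cube 0 1).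
 by rewrite leb_cube// mulr1.
have h2 : (((2 * n.+1%:R^-1) ^+ n)%:E <= leb (eball (0 : Rn) 1))%E.
 rewrite -(@leb_cube _ _ 0)//; apply: le_leb => //; first exact: meas_eball.
 move=> x xc; rewrite /eball/= subr0; apply: le_lt_trans (enorm_le_sum _) _.
 apply: (@le_lt_trans _ _ (\sum_(i < n) n.+1%:R^-1)).
 apply: ler_sum => i _; have := xc i; rewrite mxE; move: (n.+1%:R^-1) => d.
 by move=> /andP[? ?]; rewrite ler_norml; apply/andP; split; lra.
 rewrite sumr_const card_ord -[X in X < _]mulr_natl ltr_pdivrMr// mul1r ltr_nat; exact: ltnSn.
apply: fine_gt0; apply/andP; split.
 by apply: lt_le_trans h2; rewrite lte_fin.
by apply: le_lt_trans h1 _; rewrite ltry.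
Qed.

Lemma leb_ball1 : leb (eball (0 : Rn) 1) = vball%:E.
rewrite fineK// ge0_fin_numE; last by apply: nnint_ge0 => x; rewrite lee_fin.
have mc r : mset (cube 0 r)
 by apply: borel_lebRn; exact: borel_cube.
have := le_leb (meas_eball 0 1) (mc 1) (@eball_cube 0 1).
by rewrite leb_cube// => /le_lt_trans; apply; rewrite ltry.
Qed.

Lemma leb_eball (c : Rn) r : 0 < r -> leb (eball c r) = (r ^+ n * vball)%:E.
move=> r0; rewrite EFinM -leb_ball1.
have ri0 : r^-1 != 0 by rewrite gt_eqF.
have := @nnint_affine _ _ r^-1 (- (r^-1 *: c)) (fun x => (\1_(eball (0 : Rn) 1) x)%:E) ri0.
move=> h; rewrite /leb.
transitivity (nnint (fun x : Rn => (\1_(eball (0 : Rn) 1) (r^-1 *: x + - (r^-1 *: c)))%:E)).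
 congr nnint; apply/funext => x; congr (_%:E); rewrite !indicE; congr (_%:R); congr nat_of_bool.
 have E : enorm (r^-1 *: x - r^-1 *: c) = r^-1 * enorm (x - c).
 by rewrite -scalerBr enormZ gtr0_norm.
 apply/idP/idP; rewrite !inE /eball/= subr0 E mulrC ltr_pdivrMr// mul1r//.
rewrite h//; last 2 first.
 by rewrite gtr0_norm// exprVn invrK.
 by apply: borelfun_indic; apply: eopen_borel; exact: eball_eopen.
Qed.

Lemma integral_eball (c : Rn) r : 0 < r ->
 (\int[L]_x (\1_(eball c r) x)%:E = (r ^+ n * vball)%:E)%E.
move=> r0; rewrite -(leb_eball c r0) /leb nnintE//.
by apply/measurable_EFinP; apply: measurable_indic; exact: meas_eball.
Qed.

(** The form in which the [A_q] condition is used: balls have finite weight, and the weight of a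
    large ball is controlled by that of any ball inside it, with the same constants for all [t]. *)
Definition doubles (phi : Rn -> R -> R) (q D : R) :=
 forall c r c' r' t, 0 < r -> 0 < r' -> 0 < t -> eball c' r' `<=` eball c r ->
 (phiset phi (eball c r) t < +oo)%E /\
 (phiset phi (eball c r) t <= (D * (r / r') `^ (n%:R * q))%:E * phiset phi (eball c' r') t)%E.

Section Aq.
Local Notation vb := vball.
Variables (phi : Rn -> R -> R) (p0 p1 C : R).
Hypothesis Q : qtype phi p0 p1 C.

Lemma integral_pos (E : set (RL R n)) (g : RL R n -> R) : measurable E -> (0 < leb E)%E ->
 measurable_fun setT g -> (forall x, 0 < g x) -> (0 < \int[L]_x (\1_E x * g x)%:E)%E.
move=> mE E0 mg g0; rewrite lt0e; apply/andP; split; last first.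
 by apply: integral_ge0 => x _; rewrite lee_fin mulr_ge0// ltW.
apply/eqP => I0.
have mh : measurable_fun setT (fun x : RL R n => (\1_E x * g x)%:E).
 by apply/measurable_EFinP; apply: measurable_funM.
have := @ae_eq_integral_abs _ _ _ L setT measurableT _ mh; case=> + _.
have -> : (\int[L]_x `|(\1_E x * g x)%:E| = \int[L]_x (\1_E x * g x)%:E)%E.
 by apply: eq_integral => x _; rewrite gee0_abs// lee_fin mulr_ge0// ltW.
move=> /(_ I0)[N [mN N0 sN]].
move: E0; rewrite lt0e => /andP[/negP + _]; apply; apply/eqP.
apply: (@subset_measure0 _ _ _ L E N) => // x Ex.
apply: sN => /(_ I)/eqP; rewrite eqe indicE mem_set// mul1r => /eqP g0x.
by have := g0 x; rewrite g0x ltxx.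
Qed.

Let mphi' t : 0 < t -> mfun (fun x => phi x t).
by move=> t0; have := qt_meas Q (ltW t0) => /measRP. Qed.

Lemma phiset_ball_gt0 c r t : 0 < r -> 0 < t -> (0 < phiset phi (eball c r) t)%E.
move=> r0 t0; rewrite (phisetE Q)//; last exact: meas_eball.
apply: integral_pos; [exact: meas_eball| |exact: mphi'|by move=> x; exact: (qt_gt0 Q)].
by rewrite leb_eball// lte_fin mulr_gt0// vball_gt0.
Qed.

(** If [1/phi] is at most [M] almost everywhere on the ball, the average of [phi^(-1/(q-1))] raised
    to [q - 1] is at most [M]. This reduces the doubling estimate to exponents above 1. *)
Lemma A1_Aq q : 1 < q -> in_A1 phi -> in_Aq phi q.
move=> q1 [K HK]; exists K => c r t r0 t0; apply: le_trans (HK c r t r0 t0).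
have q10 : 0 < q - 1 by rewrite subr_gt0.
have v0 := vball_gt0; have mB := meas_eball c r.
have B0 : 0 < r ^+ n * vb by rewrite mulr_gt0 ?exprn_gt0.
rewrite /avg leb_eball//=; apply: lee_wpmul2l.
 apply: mule_ge0; last by rewrite lee_fin invr_ge0 ltW.
 by apply: nnint_ge0 => x; rewrite lee_fin mulr_ge0// (qt_ge0 Q)// ltW.
apply: le_ereal_inf_tmp => M [N [mN [N0 HN]]].
(* A ball has positive measure, so it contains a point outside the null set; evaluating there shows
   that [M] is positive and not [-oo]. *)
have [x Bx nN] : exists2 x, eball c r x & ~ N x.
 apply: contrapT => h; have : leb (eball c r) = 0%E.
 apply: (@subset_measure0 _ _ _ L _ N) => //; first exact: borel_lebRn.
 by move=> x Bx; apply: contrapT => nN; apply: h; exists x.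
 by rewrite leb_eball// => /eqP; rewrite eqe gt_eqF.
case: M HN => [M||] HN; [|by rewrite leey|by have := HN x nN Bx].
have f0 y := qt_gt0 Q y t0.
have M0 : 0 < M by have := HN x nN Bx; rewrite lee_fin; apply: lt_le_trans; rewrite invr_gt0.
have mw : measurable_fun setT (fun x : RL R n => (\1_(eball c r) x * phi x t `^ (- (q - 1)^-1))%:E).
 apply/measurable_EFinP; apply: measurable_funM => //.
 apply: (@measurableT_comp _ _ _ _ _ _ (fun y : R => y `^ (- (q - 1)^-1))); last exact: mphi'.
 exact: measurable_powR.
rewrite nnintE//; last by move=> y; rewrite lee_fin mulr_ge0// powR_ge0.
set I := integral _ _ _.
have I0 : (0 <= I)%E by apply: integral_ge0 => y _; rewrite lee_fin mulr_ge0// powR_ge0.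
have IM : (I <= (M `^ (q - 1)^-1)%:E * (r ^+ n * vb)%:E)%E.
 rewrite -(integral_eball c r0) -ge0_integralZl//; first last.
 - by rewrite lee_fin powR_ge0.
 - by apply/measurable_EFinP; exact: measurable_indic.
 apply: ae_ge0_le_integral => //.
 - by move=> y _; rewrite lee_fin mulr_ge0// powR_ge0.
 - by move=> y _; rewrite -EFinM lee_fin mulr_ge0// powR_ge0.
 - by apply: measurable_funeM; apply/measurable_EFinP; exact: measurable_indic.
 exists N; split => //; first exact: borel_lebRn.
 move=> y /=; apply: contra_notP => nNy _; rewrite -EFinM lee_fin indicE mulrC.
 case: (boolP (y \in _)) => [/set_mem By|_]; last by rewrite !mulr0.
 rewrite !mulr1 powRN -powR_invl ?(ltW (f0 y))//; have := HN y nNy By; rewrite lee_fin => h.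
 by apply: ge0_ler_powR; rewrite ?nnegrE ?invr_ge0 ?(ltW q10) ?(ltW M0) ?(ltW (f0 y)).
move: I I0 IM => [I||]//; rewrite -EFinM !lee_fin => I0 IM.
rewrite -ler_pdivrMr// in IM.
apply: (le_via ((M `^ (q - 1)^-1) `^ (q - 1))).
 by apply: ge0_ler_powR; rewrite ?nnegrE ?powR_ge0 ?divr_ge0 ?(ltW q10) ?(ltW B0).
by rewrite -powRrM mulVf ?gt_eqF// powRr1// ltW.
Qed.

(** In place of Hoelder's inequality, the small ball is split by a threshold [th]. Where [phi] is
    below [th], the dual weight [w] is at least [1/th'], so by its integral over the large ball this
    part has at most half of the volume; on the rest [phi] exceeds [th]. *)
Lemma doubling_Aq q : 1 < q -> in_Aq phi q -> exists D : R, 0 < D /\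
 forall c r c' r' t, 0 < r -> 0 < r' -> 0 < t -> eball c' r' `<=` eball c r ->
 (phiset phi (eball c r) t < +oo)%E /\
 (phiset phi (eball c r) t <= (D * (r ^+ n / r' ^+ n) `^ q)%:E * phiset phi (eball c' r') t)%E.
move=> q1 [K HK]; have q10 : 0 < q - 1 by rewrite subr_gt0.
exists ((`|K| + 1) * 2 `^ q); split => //.
move=> c r c' r' t r0 r'0 t0 sub.
have v0 := vball_gt0.
pose w (x : RL R n) := phi x t `^ (- (q - 1)^-1).
have mw : measurable_fun setT w.
 apply: (@measurableT_comp _ _ _ _ _ _ (fun y : R => y `^ (- (q - 1)^-1))); last exact: mphi'.
 exact: measurable_powR.
have w0 x : 0 < w x by [].
have mB := meas_eball c r; have mE := meas_eball c' r'.
have := HK c r t r0 t0; rewrite /avg -/(phiset phi (eball c r) t).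
set a := phiset phi _ t; set b := nnint _.
have a0 : (0 < a)%E by exact: phiset_ball_gt0.
have mwB : measurable_fun setT (fun x : RL R n => (\1_(eball c r) x * w x)%:E).
 by apply/measurable_EFinP; apply: measurable_funM.
have bE : b = (\int[L]_x (\1_(eball c r) x * w x)%:E)%E.
 by rewrite /b nnintE// => x; rewrite lee_fin.
rewrite leb_eball//=; set B := r ^+ n * vb.
have B0 : 0 < B by pos.
have b0 : (0 < b)%E by rewrite bE; apply: integral_pos => //; rewrite leb_eball.
move=> ab.
(* An infinite integral of the dual weight would make the [A_q] product infinite, because the other
   average is positive. *)
have bfin : (b < +oo)%E.
 rewrite ltey; apply/eqP => bY; move: ab.
 rewrite bY gt0_mulye ?lte_fin// poweRyr ?gt_eqF// gt0_muley//.
 by rewrite mule_gt0// lte_fin.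
case Eb : b b0 bfin ab => [be||]//; rewrite lte_fin => be0 _.
rewrite poweR_EFin.
have bB : 0 < (be / B) `^ (q - 1) by pos.
case Ea : a a0 => [al||]//; last first.
 by move=> _; rewrite gt0_mulye ?lte_fin// gt0_mulye.
rewrite lte_fin => al0; rewrite lee_fin => ab.
split; first by rewrite ltry.
set E := phiset phi (eball c' r') t.
pose V := r' ^+ n * vb; have V0 : 0 < V by pos.
(* The threshold is such that [th' * b] is half of the volume [V] of the small ball. *)
pose th := (V / (2 * be)) `^ (q - 1); have th0 : 0 < th by pos.
pose th' := V / (2 * be); have th'0 : 0 < th' by pos.
have mEw : measurable_fun setT (fun x : RL R n => (\1_(eball c' r') x * phi x t)%:E).
 exact: (meas_weight Q (ltW t0)).
have mEi : measurable_fun setT (fun x : RL R n => (\1_(eball c' r') x : R)%:E).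
 by apply/measurable_EFinP.
have E1 : (V%:E <= (V / 2)%:E + (th^-1)%:E * E)%E.
 have -> : V%:E = (\int[L]_x (\1_(eball c' r') x)%:E)%E.
 by rewrite integral_eball.
 have -> : ((V / 2)%:E = th'%:E * b)%E.
 by rewrite Eb; congr (_%:E); rewrite /th'; field; rewrite gt_eqF.
 rewrite bE /E (phisetE Q)// -!ge0_integralZl//; first last.
 - by pos.
 - by move=> x _; rewrite lee_fin.
 - by pos.
 - by move=> x _; rewrite lee_fin.
 rewrite -ge0_integralD//; first last.
 - exact: measurable_funeM.
 - by move=> x _; rewrite lee_fin.
 - exact: measurable_funeM.
 - by move=> x _; rewrite lee_fin.
 apply: ge0_le_integral => //.
 - by apply: emeasurable_funD; exact: measurable_funeM.
 move=> x _; rewrite lee_fin [\1_(eball c' r') x]indicE.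
 case: (boolP (x \in _)) => [/set_mem /sub Bx|_]; last first.
 rewrite mul0r mulr0 addr0; apply: mulr_ge0; first exact: ltW.
 by pos.
 rewrite indicE mem_set// !mul1r; have f0 := qt_gt0 Q x t0.
 have [le_th|lt_th] := leP (phi x t) th.
 suff h : 1 <= th' * w x.
 by apply: (le_trans h); rewrite lerDl.
 rewrite /w powRN -ler_pdivrMr// invrK mul1r.
 have -> : th' = th `^ (q - 1)^-1.
 by rewrite -powRrM mulfV ?gt_eqF// powRr1.
 by apply: ge0_ler_powR; rewrite ?nnegrE.
 have : 1 <= th^-1 * phi x t by rewrite mulrC ler_pdivlMr// mul1r ltW.
 by move=> /le_trans; apply; rewrite lerDr.
have E2 : ((V / 2 * th)%:E <= E)%E.
 have : ((V / 2)%:E <= (th^-1)%:E * E)%E.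
 have -> : V / 2 = V - V / 2 by field.
 by rewrite EFinB leeBlDl.
 rewrite -[X in (X <= _ -> _)%E]mule1 => h.
 have := @lee_wpmul2l R th%:E _ _ _ h; rewrite lee_fin => /(_ (ltW th0)).
 by rewrite mule1 muleA -!EFinM mulfV ?gt_eqF// mul1e mulrC.
apply: (le_via ((`|K| + 1) * 2 `^ q * (r ^+ n / r' ^+ n) `^ q * (V / 2 * th))%:E); last first.
 rewrite [X in (X <= _)%E]EFinM; apply: lee_wpmul2l => //.
 by pos.
rewrite lee_fin.
have rV : r ^+ n / r' ^+ n = B / V.
 by rewrite /B /V; field; rewrite gt_eqF//= gt_eqF.
have BV0 : 0 < B / V by pos.
have -> : (`|K| + 1) * 2 `^ q * (r ^+ n / r' ^+ n) `^ q * (V / 2 * th) =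
 (`|K| + 1) * (B * (B / be) `^ (q - 1)).
 rewrite rV.
 have -> : th = (B / be) `^ (q - 1) / (2 * (B / V)) `^ (q - 1).
 have h1 : 0 <= B / be by pos.
 have h2 : 0 <= 2 * (B / V) by pos.
 rewrite -(powR_divl _ h1 h2).
 by rewrite /th; congr (_ `^ _); field; rewrite !gt_eqF.
 have e1 : 2 `^ q * (B / V) `^ q = (2 * (B / V)) * (2 * (B / V)) `^ (q - 1).
 have h2 : 0 <= 2 * (B / V) by pos.
 rewrite -powRM// mulr_powRB1//; exact: lt_trans q1.
 have h0 : (2 * (B / V)) `^ (q - 1) != 0 by rewrite gt_eqF.
 by rewrite -(mulrA (`|K| + 1)) e1; field; rewrite ?gt_eqF.
have : al <= `|K| * (B * (B / be) `^ (q - 1)).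
 have -> : (B / be) `^ (q - 1) = ((be / B) `^ (q - 1))^-1.
 by rewrite -powR_invl// invf_div.
 move: ab; rewrite -ler_pdivlMr// -ler_pdivlMr// invrK => /le_trans; apply.
 rewrite mulrAC -mulrA ler_wpM2r ?ler_norm//; apply: divr_ge0; exact: ltW.
move=> /le_trans; apply; rewrite ler_wpM2r ?lerDl//.
Qed.

(** The exponent must exceed 1 for the argument above and stay at most [q'], where the inequality
    between the exponents still holds: [q] itself serves if it is above 1, and [q'] in the [A_1]
    case. *)
Lemma doubling q q' : in_A phi q -> q < q' -> exists q2 D, [/\ q2 <= q', 0 < D & doubles phi q2 D].
move=> Aq qq'; have [q2 [q21 q2q' Aq2]] : exists q2, [/\ 1 < q2, q2 <= q' & in_Aq phi q2].
 case: Aq qq' => [[-> A1]|[q1 Aq]] qq'; last by exists q; split => //; exact: ltW.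
 by exists q'; split => //; exact: A1_Aq.
have [D [D0 HD]] := doubling_Aq q21 Aq2; exists q2, D; split => // c r c' r' t r0 r'0 t0 s.
rewrite powRrM powR_mulrn ?divr_ge0 ?(ltW r0) ?(ltW r'0)// expr_div_n; exact: HD.
Qed.
End Aq.

(** * Infinite total weight, and tails of maximal functions of atoms *)

Section Aq2.
Variables (phi : Rn -> R -> R) (p0 p1 C q D : R).
Hypotheses (Q : qtype phi p0 p1 C) (D0 : 0 < D) (HD : doubles phi q D).

(** The ball of radius [3^(j+1)] contains, besides the concentric ball of radius [3^j], a disjoint
    ball of that radius, whose weight is a fixed fraction of the whole by doubling. So the weights
    grow at least linearly in [j]. The second centre lies in a coordinate direction, whence [i0]. *)
Lemma phiset_total (t : R) (i0 : 'I_n) (c : Rn) : 0 < t -> forall A : R, exists2 r : R, 0 < r &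
 (A%:E < phiset phi (eball c r) t)%E.
move=> t0 A.
have r0 j : 0 < 3 ^+ j :> R by [].
pose a j := fine (phiset phi (eball c (3 ^+ j)) t).
have aE j : phiset phi (eball c (3 ^+ j)) t = (a j)%:E.
 rewrite fineK// ge0_fin_numE; last exact/(phiset_ge0 Q)/ltW.
 by have [] := HD (r0 j) (r0 j) t0 (@subset_refl _ (eball c (3 ^+ j))).
have a0 j : 0 < a j by rewrite -lte_fin -aE; exact: (phiset_ball_gt0 Q).
pose K := D * 3 `^ (n%:R * q); have K0 : 0 < K by pos.
have step j : a j + a j / K <= a j.+1.
 pose c' := c + (2 * 3 ^+ j) *: e_ i0.
 have cc' : enorm (c - c') = 2 * 3 ^+ j.
 by rewrite opprD addNKr enormN enorm_delta gtr0_norm.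
 have sub : eball c' (3 ^+ j) `<=` eball c (3 ^+ j.+1).
 move=> x; rewrite /eball/= => xc; have := enorm_dist3 x c' c.
 by rewrite [enorm (c' - c)]enormB exprS; move: xc => u; lra.
 have sub2 : eball c (3 ^+ j) `<=` eball c (3 ^+ j.+1).
 by move=> x; rewrite /eball/= exprS; move: (r0 j) => u; lra.
 have dis x : eball c (3 ^+ j) x -> eball c' (3 ^+ j) x -> False.
 rewrite /eball/= => h1 h2; have := enorm_dist3 c x c'; rewrite cc' [enorm (c - x)]enormB.
 by move: h2 => u; lra.
 have mB d u := @meas_eball d u.
 have add : (phiset phi (eball c (3 ^+ j)) t + phiset phi (eball c' (3 ^+ j)) t <=
 phiset phi (eball c (3 ^+ j.+1)) t)%E.
 rewrite !(phisetE Q)// -ge0_integralD//; first last.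
 - exact: (meas_weight Q (ltW t0)).
 - by move=> x _; rewrite lee_fin.
 - exact: (meas_weight Q (ltW t0)).
 - by move=> x _; rewrite lee_fin.
 apply: ge0_le_integral => //.
 - by move=> x _; rewrite lee_fin addr_ge0.
 - by apply: emeasurable_funD; exact: (meas_weight Q (ltW t0)).
 - exact: (meas_weight Q (ltW t0)).
 move=> x _; rewrite lee_fin -mulrDl ler_wpM2r//.
 rewrite !indicE; case: (boolP (x \in eball c (3 ^+ j))) => [/set_mem h1|_].
 by rewrite [X in _ + (nat_of_bool X)%:R]memNset ?addr0 ?(mem_set (sub2 _ h1))// => /(dis _ h1).
 rewrite add0r ler_nat; case: (boolP (x \in eball c' _)) => // /set_mem/sub h.
 by rewrite mem_set.
 have [_ dd] := HD (r0 j.+1) (r0 j) t0 sub.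
 have r3 : 3 ^+ j.+1 / 3 ^+ j = 3 :> R by rewrite exprS mulfK.
 rewrite r3 -/K in dd.
 set b := phiset phi (eball c' (3 ^+ j)) t in add dd.
 have bfin : (b < +oo)%E by have [] := HD (r0 j) (r0 j) t0 (@subset_refl _ (eball c' (3 ^+ j))).
 have b0 : (0 <= b)%E by exact/(phiset_ge0 Q)/ltW.
 case Eb : b b0 bfin add dd => [be||]// b0 _; rewrite !aE !lee_fin => h1 h2.
 have a1 : a j <= a j.+1 by rewrite -lee_fin -!aE; apply: (le_phiset Q) => //; exact: ltW.
 have : a j / K <= be by rewrite ler_pdivrMr// mulrC (le_trans a1).
 by lra.
have lin j : a 0%N + j%:R * (a 0%N / K) <= a j.
 elim: j => [|j IH]; first by rewrite mul0r addr0.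
 have h : a 0%N / K <= a j / K.
 rewrite ler_pM2r//; apply: le_trans IH; rewrite lerDl mulr_ge0// divr_ge0//.
 exact/ltW/a0.
 by have := step j; rewrite -natr1; lra.
have aK : 0 < a 0%N / K by pos.
pose j := (Num.truncn (A / (a 0%N / K))).+1.
exists (3 ^+ j) => //.
rewrite aE; apply: lt_le_trans (lin j).
have : A / (a 0%N / K) < j%:R by exact: truncnS_gt.
by rewrite ltr_pdivrMr// => h; have := a0 0%N; lra.
Qed.

(* The size of the maximal function of an atom of height [a] on the ball [(c, r)]. *)
Definition htail (l : nat) (c : Rn) (r a : R) (x : Rn) : \bar R :=
 csum (fun j : nat => (a / 2 ^+ (j * l) * \1_(eball c (2 ^+ j.+1 * r)) x)%:E).

Lemma htail_ge0 l c r a x : 0 <= a -> (0 <= htail l c r a x)%E.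
by move=> a0; apply: csum_ge0 => j; rewrite lee_fin.
Qed.

Lemma measurable_htail l c r a : 0 <= a ->
 measurable_fun setT (htail l c r a : RL R n -> \bar R).
move=> a0; apply: meas_csum => [j|j x].
 apply/measurable_EFinP; apply: measurable_funM => //; apply: measurable_indic.
 exact: meas_eball.
by pos.
Qed.

(** Passing to the ball dilated by [2^(j+1)] multiplies the weight by about [2^(jnq)], while
    lowering the height by [2^(jl)] gains [2^(-j l p0)] by the lower type. The hypothesis says that
    the resulting ratio [rho] is below 1. *)
Lemma Mod_htail l : n%:R * q < p0 * l%:R -> exists2 K : R, 0 < K &
 forall c r a lam, 0 < r -> 0 < a -> 0 < lam ->
 (Mod phi lam (htail l c r a) <= K%:E * phiset phi (eball c r) (a / lam))%E.
move=> hl.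
pose rho : R := 2 `^ (n%:R * q - p0 * l%:R).
have rho01 : 0 < rho < 1.
 have -> : rho = (2 `^ (p0 * l%:R - n%:R * q))^-1 by rewrite -powRN opprB.
 rewrite invr_gt0 powR_gt0//= invf_lt1//.
 have h1 : 1 `^ (p0 * l%:R - n%:R * q) = 1 :> R by rewrite powR1.
 by rewrite -[ltLHS]h1 gt0_ltr_powR ?nnegrE ?ltr1n ?subr_gt0.
pose K := Kpsi p0 C * (Cpsi p0 C * (C * (D * 2 `^ (n%:R * q))) * (1 - rho)^-1).
have C0 : 0 < C by rewrite (lt_le_trans ltr01)// (qt_C Q).
have /andP[rho0 rho1] := rho01.
have r10 : 0 < (1 - rho)^-1 by rewrite invr_gt0 subr_gt0.
have K0 : 0 < K.
 apply: mulr_gt0; first exact: (Kpsi_gt0 Q).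
 apply: mulr_gt0 => //; apply: mulr_gt0; first exact: (Cpsi_gt0 Q).
 by pos.
exists K => // c r a lam r0 a0 l0.
have pj j : 0 < 2 ^+ j :> R by [].
have mb j := @meas_eball c (2 ^+ j.+1 * r).
have al0 : 0 < a / lam by pos.
apply: (le_trans (Mod_csum Q l0 _ _)).
- by move=> j x; rewrite lee_fin.
- by move=> j; apply/measurable_EFinP; apply: measurable_funM.
rewrite [X in (_ <= X * _)%E]EFinM -muleA; apply: lee_wpmul2l.
 by rewrite lee_fin ltW.
set P := phiset phi (eball c r) (a / lam).
have P0 : (0 <= P)%E by exact/(phiset_ge0 Q)/ltW.
set K1 := Cpsi p0 C * (C * (D * 2 `^ (n%:R * q))).
have K10 : 0 < K1.
 by apply: mulr_gt0; [exact: (Cpsi_gt0 Q)|rewrite !mulr_gt0// powR_gt0].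
have term j : (Mod phi lam (fun x => (a / 2 ^+ (j * l) * \1_(eball c (2 ^+ j.+1 * r)) x)%:E) <=
 (rho ^+ j)%:E * (K1%:E * P))%E.
 apply: (le_trans (Mod_indic Q l0 _ (mb j))) => //.
 have -> : a / 2 ^+ (j * l) / lam = (2 ^+ (j * l))^-1 * (a / lam).
 by field; rewrite !gt_eqF.
 apply: (le_via ((Cpsi p0 C)%:E * ((C * (2 ^+ (j * l))^-1 `^ p0)%:E *
 ((D * (2 ^+ j.+1) `^ (n%:R * q))%:E * P)))%E).
 apply: lee_wpmul2l; first by rewrite lee_fin ltW// (Cpsi_gt0 Q).
 apply: (le_trans (phiset_low Q (ltW al0) _ _ (mb j))).
 - by [].
 - by rewrite invf_le1// exprn_ege1// ler1n.
 apply: lee_wpmul2l; first by pos.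
 have sub : eball c r `<=` eball c (2 ^+ j.+1 * r).
 move=> x; rewrite /eball/= => /lt_le_trans; apply.
 by rewrite ler_peMl// exprn_ege1// ler1n.
 have rj : 0 < 2 ^+ j.+1 * r by pos.
 by have [_] := HD rj r0 al0 sub; rewrite mulfK ?gt_eqF.
 rewrite !muleA; apply: lee_wpmul2r => //; rewrite lee_fin /K1.
 have -> : (2 ^+ (j * l))^-1 `^ p0 = (2 `^ (- (p0 * l%:R))) ^+ j :> R.
 rewrite powR_invl// -(powR_mulrn _ (ler0n R 2)) -powRrM -powRN.
 by rewrite -powR_mulrn// -powRrM; congr (_ _); ring.
 have -> : (2 ^+ j.+1) `^ (n%:R * q) = 2 `^ (n%:R * q) * (2 `^ (n%:R * q)) ^+ j :> R.
 rewrite -exprS -(powR_mulrn _ (ler0n R 2)) -powRrM -powR_mulrn// -powRrM.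
 by congr (_ _); rewrite mulrC.
 have -> : rho = 2 `^ (n%:R * q) * 2 `^ (- (p0 * l%:R)).
 by rewrite -powRD// pnatr_eq0 implybT.
 by rewrite exprMn; apply: le_of_eq; ring.
apply: (le_via (csum (fun j : nat => (rho ^+ j)%:E * (K1%:E * P))%E)).
 by apply: le_csum => j; [exact: (Mod_ge0 Q)|exact: term].
apply: csum_le_fin => [j|s us].
 by rewrite mule_ge0 ?lee_fin// mule_ge0// ltW.
rewrite -ge0_sume_distrl; last by move=> j _; rewrite lee_fin.
rewrite [X in (_ <= X * _)%E]EFinM [X in (_ <= X * _)%E]muleC -muleA.
apply: lee_wpmul2r; first by rewrite mule_ge0// ltW.
by rewrite sumEFin lee_fin geom_uniq_nat.
Qed.

Lemma htail_lb l c r a x t : 0 < r -> 0 <= a -> 0 <= t ->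
 t <= a -> t * enorm (x - c) ^+ l <= a * r ^+ l -> (t%:E <= htail l c r (2 ^+ l * a) x)%E.
move=> r0 a0 t0 ta h.
have term j : (((2 ^+ l * a) / 2 ^+ (j * l) * \1_(eball c (2 ^+ j.+1 * r)) x)%:E <= htail l c r (2 ^+ l * a) x)%E.
 apply: (@le_csum1 _ (fun j => ((2 ^+ l * a) / 2 ^+ (j * l) * \1_(eball c (2 ^+ j.+1 * r)) x)%:E)).
 by move=> i; rewrite lee_fin.
have [lt2|ge2] := ltP (enorm (x - c)) (2 * r).
 apply: le_trans (term 0%N); rewrite divr1 indicE mem_set//= mulr1.
 by rewrite lee_fin (le_trans ta)// ler_peMl// exprn_ege1// ler1n.
pose u := enorm (x - c) / r.
have u0 : 0 < u by rewrite divr_gt0//; apply: lt_le_trans ge2; rewrite mulr_gt0.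
have [k /andP[k1 k2]] := dyadic_exists u0.
have u2 : 2 <= u by rewrite ler_pdivlMr.
have kge0 : 0 <= k.
 rewrite leNgt; apply/negP => k0.
 have : 2 ^ (k + 1) <= 2 ^ 0 :> R by rewrite ler_weXz2l ?ler1n// lezD1.
 by rewrite expr0z; lra.
case: k kge0 k1 k2 => [j|//] _ k1 k2.
rewrite -exprnP in k1; have jE : (Posz j + 1 = j.+1)%R by rewrite -addn1.
rewrite jE -exprnP in k2.
(* At distance up to [2^(j+1) r], endpoint included, the point lies in the open ball of index
   [j.+1]; the factor [2^l] in the height pays for the loss of one index. *)
apply: le_trans (term j.+1).
have xb : eball c (2 ^+ j.+2 * r) x.
 rewrite /eball/= -ltr_pdivrMr//; apply: (le_lt_trans k2).
 by rewrite ltr_pMl// ltr1n.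
rewrite indicE mem_set// mulr1 lee_fin.
rewrite mulSn exprD mulrC invfM mulrACA mulVf// mul1r -ler_pdivrMl//.
rewrite invrK.
have ul : u ^+ l * r ^+ l = enorm (x - c) ^+ l by rewrite -exprMn divfK// gt_eqF.
rewrite -(@ler_pM2r _ (r ^+ l))//; apply: le_trans h.
rewrite -ul [2 ^+ _ * t]mulrC -!mulrA ler_wpM2l// ler_wpM2r//.
by rewrite exprM lerXn2r ?nnegrE// ltW.
Qed.
End Aq2.

(** * Smooth functions of one variable *)

Lemma inte_indic_fin d (T : measurableType d) (mu : {measure set T -> \bar R})
 (A : set T) : measurable A -> (mu A < +oo)%E -> mu.-integrable setT (EFin \o (\1_A : T -> R)).
move=> mA Aoo; apply/integrableP; split; first by apply/measurable_EFinP; exact: measurable_indic.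
rewrite (eq_integral (EFin \o \1_A)); last by move=> x _ /=; rewrite ger0_norm.
by rewrite integral_indic// setIT.
Qed.

Lemma lebesgue_itv_fin b1 b2 (x y : R) :
 (@lebesgue_measure R [set` Interval (BSide b1 x) (BSide b2 y)] < +oo)%E.
by rewrite lebesgue_measure_itv/=; case: ifP => _; rewrite ltry. Qed.

(** A quadratic error bound is the form in which most derivatives below are found. The case [K = 0]
    covers affine functions, and the bound fits functions that vanish to second order, such as
    [ebump] at 0. *)
Lemma is_derive_quad (f : R -> R) (x d K e : R) : 0 < e ->
 (forall h, `|h| < e -> `|f (x + h) - f x - h * d| <= K * h ^+ 2) -> is_derive x 1 f d.
move=> e0 H.
have lim : h^-1 *: (f (h *: 1 + x) - f x) @[h --> 0^'] --> d.
 apply/cvgrPdist_lt => eps eps0.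
 near=> h.
 have h0 : h != 0 by near: h; exact: nbhs_dnbhs_neq.
 have he : `|h| < e by near: h; apply: dnbhs0_lt.
 have hE : `|h| < eps / (`|K| + 1) by near: h; apply: dnbhs0_lt; rewrite divr_gt0.
 rewrite scaler1 addrC; have := H h he.
 have -> : - (h^-1 *: (f (h + x) - f x)) + d = - (h^-1 * (f (x + h) - f x - h * d)).
 rewrite [h + x]addrC.
 by rewrite /GRing.scale/=; field.
 rewrite normrN normrM normfV => Hh.
 apply: (@le_lt_trans _ _ (`|h|^-1 * (K * h ^+ 2))).
 by rewrite ler_wpM2l.
 rewrite -[h ^+ 2](real_normK (num_real h)) mulrCA [X in _ * X]mulrA mulVf ?normr_eq0// mul1r.
 apply: (@le_lt_trans _ _ ((`|K| + 1) * `|h|)).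
 by rewrite ler_wpM2r// (le_trans (ler_norm K))// lerDl.
 by rewrite mulrC -ltr_pdivlMr.
have dx : derivable f x 1 by apply/cvg_ex; exists d.
by apply: DeriveDef => //; exact: cvg_lim.
Unshelve. all: by end_near. Qed.

Lemma exp_poly_bound (p : {poly R}) : exists K : R, forall u, 0 <= u ->
 `|p.[u]| * expR (- u) <= K.
have mono (k : nat) (u : R) : 0 <= u -> u ^+ k * expR (- u) <= k%:R ^+ k.
 case: k => [|k] u0; first by rewrite mul1r -[leRHS](expR0) ler_expR oppr_le0.
 rewrite expRN ler_pdivrMr ?expR_gt0//.
 have -> : expR u = expR (u / k.+1%:R) ^+ k.+1.
 by rewrite -expRM_natl mulrC divfK.
 rewrite -exprMn lerXn2r ?nnegrE//.
 rewrite -ler_pdivrMl// mulrC; apply: le_trans (expR_ge1Dx _).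
 by rewrite lerDr.
exists (\sum_(i < size p) `|p`_i| * i%:R ^+ i) => u u0.
rewrite horner_coef; apply: (le_via (\sum_(i < size p) `|p`_i * u ^+ i| * expR (- u))).
 by rewrite -mulr_suml ler_wpM2r// ler_norm_sum.
apply: ler_sum => i _; rewrite normrM -mulrA ler_wpM2l// ger0_norm//.
exact: mono.
Qed.

(** The classical bump [exp(-1/x)] with polynomial factors in [1/x]: the family is closed under
    differentiation, which sends [p] to [X^2 (p - p')]. *)
Definition ebump (p : {poly R}) (x : R) : R := if 0 < x then p.[x^-1] * expR (- x^-1) else 0.

Lemma ebump_quad p : exists K : R, forall h, `|ebump p h| <= K * h ^+ 2.
have [K HK] := exp_poly_bound ('X^2 * p).
have K0 : 0 <= K by apply: le_trans (HK 0 (lexx _)); rewrite//.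
exists K => h; rewrite /ebump; case: ifPn => h0; last by rewrite normr0.
rewrite normrM [`|expR _|]ger0_norm//.
have := HK h^-1; rewrite invr_ge0 => /(_ (ltW h0)).
rewrite hornerM hornerXn normrM [`|_ ^+ 2|]ger0_norm//.
by rewrite -mulrA exprVn ler_pdivrMl// [K * _]mulrC.
Qed.

Lemma is_derive_horner (p : {poly R}) (x : R) : is_derive x 1 (horner p) p^`().[x].
elim/poly_ind: p => [|p c IH].
 rewrite deriv0 (_ : horner 0 = cst 0); first exact: is_derive_cst.
 by apply/funext => y; rewrite horner0.
rewrite (_ : horner (p * 'X + c%:P) = (horner p * id + cst c)); last first.
 by apply/funext => y; rewrite !hornerE.
have h := is_deriveD (is_deriveM IH (is_derive_id x 1)) (is_derive_cst c x 1).
apply: (is_derive_eq h).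
change (p.[x] * 1 + x * p^`().[x] + 0 = (p * 'X + c%:P)^`().[x]).
by rewrite derivD derivC derivM derivX !mulr1 !addr0 hornerD hornerM hornerX [x * _]mulrC addrC.
Qed.

Lemma is_derive_ebump (p : {poly R}) (x : R) :
 is_derive x 1 (ebump p) (ebump ('X^2 * (p - p^`())) x).
have [x0|x0|->] := ltgtP x 0.
- rewrite [X in is_derive _ _ _ X]/ebump ltNge (ltW x0)/=.
 apply: (@is_derive_quad _ _ _ 0 (- x)) => [|h hx]; first by rewrite oppr_gt0.
 rewrite /ebump !ifF ?subrr ?sub0r ?mulr0 ?oppr0 ?normr0 ?mul0r//; first by apply/negbTE; rewrite -leNgt ltW.
 by apply/negbTE; rewrite -leNgt; have := ler_norm h; lra.
- rewrite [X in is_derive _ _ _ X]/ebump x0.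
 have d1 : is_derive x 1 (fun y : R => y^-1) (- x ^- 2 *: 1).
 by apply: is_deriveV; rewrite ?gt_eqF.
 have d2 := is_derive1_comp (is_derive_horner p x^-1) d1.
 have d3 := @is_derive1_comp _ (@expR R) (fun y : R => - y^-1) x _ _ (is_derive_expR _) (is_deriveN d1).
 have d4 : is_derive x 1 (fun y => p.[y^-1] * expR (- y^-1)) (('X^2 * (p - p^`())).[x^-1] * expR (- x^-1)).
 apply: (is_derive_eq (is_deriveM d2 d3)).
 by rewrite hornerM hornerXn hornerD hornerN /GRing.scale/= exprVn; ring.
 apply: near_eq_is_derive d4.
 near=> y; rewrite /ebump; have -> : 0 < y by near: y; exact: lt_nbhsr.
 by [].
- have [K HK] := ebump_quad p.
 apply: (@is_derive_quad _ _ _ K 1) => // h _.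
 by rewrite /ebump ltxx add0r subr0 mulr0 subr0; exact: HK.
Unshelve. all: by end_near.
Qed.

Inductive sfun : Type :=
| SBump of {poly R} | SPoly of {poly R} | SAdd of sfun & sfun | SMul of sfun & sfun
| SAff of R & R & sfun | SInv of sfun.

Fixpoint sev (e : sfun) (x : R) : R :=
 match e with
 | SBump p => ebump p x
 | SPoly p => p.[x]
 | SAdd e1 e2 => sev e1 x + sev e2 x
 | SMul e1 e2 => sev e1 x * sev e2 x
 | SAff a b e1 => sev e1 (a * x + b)
 | SInv e1 => (sev e1 x)^-1
 end.

Fixpoint sder (e : sfun) : sfun :=
 match e with
 | SBump p => SBump ('X^2 * (p - p^`()))
 | SPoly p => SPoly p^`()
 | SAdd e1 e2 => SAdd (sder e1) (sder e2)
 | SMul e1 e2 => SAdd (SMul (sder e1) e2) (SMul e1 (sder e2))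
 | SAff a b e1 => SMul (SPoly a%:P) (SAff a b (sder e1))
 | SInv e1 => SMul (SPoly (-1)%:P) (SMul (SMul (SInv e1) (SInv e1)) (sder e1))
 end.

Fixpoint swf (e : sfun) : Prop :=
 match e with
 | SBump _ | SPoly _ => True
 | SAdd e1 e2 | SMul e1 e2 => swf e1 /\ swf e2
 | SAff _ _ e1 => swf e1
 | SInv e1 => swf e1 /\ forall x, sev e1 x != 0
 end.

Lemma swf_der e : swf e -> swf (sder e).
by elim: e => //=; intuition. Qed.

Lemma sev_derive e : swf e -> forall x : R, is_derive x 1 (sev e) (sev (sder e) x).
elim: e => [p|p|e1 IH1 e2 IH2|e1 IH1 e2 IH2|a b e1 IH1|e1 IH1] /= we x.
- exact: is_derive_ebump.
- exact: is_derive_horner.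
- by apply: is_deriveD; [exact: IH1 we.1 x|exact: IH2 we.2 x].
- apply: (is_derive_eq (is_deriveM (IH1 we.1 x) (IH2 we.2 x))).
 by rewrite /GRing.scale/=; ring.
- have d : is_derive x 1 (fun y : R => a * y + b) a.
 apply: (@is_derive_quad _ _ _ 0 1) => // h _.
 by rewrite mul0r normr_le0; apply/eqP; ring.
 have h : is_derive x 1 (sev e1 \o (fun y => a * y + b)) (sev (sder e1) (a * x + b) * a).
 exact: (@is_derive1_comp _ (sev e1) (fun y : R => a * y + b) x _ _ (IH1 we (a * x + b)) d).
 apply: (is_derive_eq h).
 by rewrite hornerC mulrC.
- apply: (is_derive_eq (is_deriveV (we.2 x) (IH1 we.1 x))).
 by rewrite hornerC /GRing.scale/= invfM; ring.
Qed.

Lemma sev_continuous e : swf e -> continuous (sev e).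
move=> we x; have [d _] := sev_derive we x.
by apply: differentiable_continuous; exact/derivable1_diffP.
Qed.

Lemma sev_measurable e : swf e -> measurable_fun setT (sev e).
by move=> we; apply: continuous_measurable_fun; exact: sev_continuous. Qed.

Definition ssupp (a : R) (e : sfun) := forall x, a < `|x| -> sev e x = 0.

Lemma ssupp_der a e : swf e -> ssupp a e -> ssupp a (sder e).
move=> we sa x ax; have [d <-] := sev_derive we x.
rewrite -(@derive_cst _ _ _ (0 : R) x 1); apply: near_eq_derive; rewrite//.
near=> y; apply: sa; near: y.
have cn : {for x, continuous (fun y : R => `|y|)} by exact: norm_continuous.
by apply: (cn [set z | a < z]); exact: lt_nbhsr.
Unshelve. all: by end_near. Qed.

Lemma ssupp_bounded a e : swf e -> ssupp a e -> exists2 M : R, 0 <= M & forall x, `|sev e x| <= M.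
move=> we sa.
have cc : compact (`[- `|a|, `|a|]%classic : set R) by exact: segment_compact.
have cf : {within `[- `|a|, `|a|]%classic, continuous (sev e)}.
 by apply: continuous_subspaceT; exact: sev_continuous.
have /compact_bounded[M [_ HM]] := continuous_compact cf cc.
exists (`|M| + 1) => //.
move=> x; have [xa|xa] := leP `|x| `|a|.
 apply: HM; first by rewrite (le_lt_trans (ler_norm M))// ltrDl.
 by exists x => //=; rewrite in_itv/= -ler_norml.
by rewrite sa ?normr0// (le_lt_trans (ler_norm a)).
Qed.

(** * Finite differences and the refinement equation of binomial polynomials *)

Section mask.
Implicit Types (f g : R -> R) (p : {poly R}).

Definition shop (c h : R) f : R -> R := fun x => f x + c * f (x - h).
Definition dif h := shop (-1) h.
Definition dil2 f : R -> R := fun x => 2 * f (2 * x).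

Lemma shopC c h d k f : shop c h (shop d k f) = shop d k (shop c h f).
apply/funext => x; rewrite /shop [x - h - k]addrAC; ring.
Qed.

Lemma iter_shopC c h d k N f : iter N (shop c h) (shop d k f) = shop d k (iter N (shop c h) f).
by elim: N => //= N ->; rewrite shopC. Qed.

(** With [S] the shift by 1/2 this is [(1 - S)(1 + S) = 1 - S^2]. It converts differences of step 1
    into differences of half that step. *)
Lemma dif_add2 f : dif (1 / 2) (shop 1 (1 / 2) f) = dif 1 f.
apply/funext => x; rewrite /dif /shop.
have -> : x - 1 / 2 - 1 / 2 = x - 1; first by lra.
by ring.
Qed.

Lemma dil2_dif f : dil2 (dif 1 f) = dif (1 / 2) (dil2 f).
apply/funext => x; rewrite /dif /shop /dil2.
have -> : 2 * (x - 1 / 2) = 2 * x - 1; first by lra.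
by ring.
Qed.

Lemma iter_dil2_dif N f : dil2 (iter N (dif 1) f) = iter N (dif (1 / 2)) (dil2 f).
by elim: N => //= N IH; rewrite dil2_dif IH. Qed.

Lemma iter_dif1 N f : iter N (dif 1) f = iter N (dif (1 / 2)) (iter N (shop 1 (1 / 2)) f).
elim: N f => [//|N IH] f.
rewrite iterSr -dif_add2 IH [in RHS]iterSr [iter N.+1 (shop _ _) f]iterS; congr (iter N _ _).
by rewrite [LHS]iter_shopC iter_shopC.
Qed.

Lemma iter_dif_comb h N (a b : R) f g : iter N (dif h) (fun x => a * f x + b * g x) =
 fun x => a * iter N (dif h) f x + b * iter N (dif h) g x.
elim: N => [//|N IH]; rewrite iterS IH; apply/funext => x; rewrite !iterS /dif /shop; ring.
Qed.

Lemma iter_shopE c h N f x :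
 iter N (shop c h) f x = \sum_(t < N.+1) c ^+ t * 'C(N, t)%:R * f (x - t%:R * h).
elim: N f x => [|N IH] f x.
 by rewrite big_ord_recl big_ord0 !mul1r mul0r subr0 addr0.
rewrite iterS /shop IH [in RHS]big_ord_recl/= mul0r subr0 !mul1r.
under [X in _ = _ + X]eq_bigr => t _.
 rewrite /bump/= add1n binS natrD mulrDr mulrDl.
 over.
rewrite big_split/= addrA; congr (_ + _); last first.
 rewrite IH mulr_sumr; apply: eq_bigr => t _.
 rewrite exprS !mulrA; congr (_ * f _); rewrite -natr1; ring.
rewrite big_ord_recl/= bin0 mul0r subr0 !mul1r; congr (_ + _).
rewrite [in RHS]big_ord_recr/= bin_small// mulr0 mul0r addr0; apply: eq_bigr => t _.
by [].
Qed.

Lemma eq_iter_shop c h N f g x : 0 <= h ->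
 (forall y, x - N%:R * h <= y <= x -> f y = g y) ->
 iter N (shop c h) f x = iter N (shop c h) g x.
move=> h0 fg; rewrite !iter_shopE; apply: eq_bigr => t _; rewrite fg//.
rewrite lerD2l lerN2 ler_wpM2r ?ler_nat ?gerBl ?mulr_ge0// -ltnS; exact: ltn_ord.
Qed.

Lemma dif_horner h p : dif h (horner p) = horner (p - (p \Po ('X - h%:P))).
apply/funext => x; rewrite /dif /shop hornerD hornerN horner_comp hornerXsubC; ring.
Qed.

Lemma iter_dif_poly h N p : (size p <= N)%N -> iter N (dif h) (horner p) = fun=> 0.
elim: N p => [|N IH] p.
 by rewrite leqn0 size_poly_eq0 => /eqP ->; apply/funext => x; rewrite /= horner0.
move=> sp; rewrite iterSr dif_horner; apply: IH.
have sc : size (p \Po ('X - h%:P)) = size p by rewrite size_comp_poly2// size_XsubC.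
apply/leq_sizeP => j; rewrite leq_eqVlt => /predU1P[<-|Nj]; last first.
 by rewrite coefB !nth_default ?subr0// ?sc; exact: leq_trans sp _.
rewrite coefB; move: sp; rewrite leq_eqVlt => /predU1P[sp|sp]; last first.
 by rewrite !nth_default ?subr0 ?sc.
have -> : p`_N = lead_coef p by rewrite /lead_coef sp.
have -> : (p \Po ('X - h%:P))`_N = lead_coef (p \Po ('X - h%:P)) by rewrite /lead_coef sc sp.
by rewrite lead_coef_comp ?size_XsubC// lead_coefXsubC expr1n mulr1 subrr.
Qed.

Definition ispoly f := exists p, f = horner p.

Lemma ispoly_shop c h f : ispoly f -> ispoly (shop c h f).
move=> [p ->]; exists (p + c *: (p \Po ('X - h%:P))); apply/funext => x.
by rewrite hornerD hornerZ horner_comp hornerXsubC.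
Qed.

Lemma ispoly_iter_shop c h N f : ispoly f -> ispoly (iter N (shop c h) f).
by move=> pf; elim: N => //= N; exact: ispoly_shop. Qed.

Lemma ispoly_eq f g : ispoly f -> ispoly g -> (forall m : nat, f (m%:R / 2) = g (m%:R / 2)) -> f = g.
move=> [p ->] [q ->] pq; suff -> : p = q by [].
apply/eqP; rewrite -subr_eq0; apply/negPn/negP => pq0.
have := max_poly_roots pq0 (rs := [seq (i%:R / 2 : R) | i <- iota 0 (size (p - q)%R)]).
rewrite size_map size_iota ltnn => h; suff: false by []; apply: h.
 by apply/allP => _ /mapP[m _ ->]; rewrite rootE hornerD hornerN pq subrr.
rewrite map_inj_uniq ?iota_uniq// => i j; move/(congr1 (fun z => z * 2)).
by rewrite !divfK// => /eqP; rewrite eqr_nat => /eqP.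
Qed.

(* the polynomial [x |-> binomial (x + M) M] *)
Definition qp (M : nat) : {poly R} := (M`!%:R)^-1 *: \prod_(j < M) ('X + j.+1%:R%:P).

Lemma qpE M x : (qp M).[x] = (M`!%:R)^-1 * \prod_(j < M) (x + j.+1%:R).
rewrite hornerZ horner_prod; congr (_ * _); apply: eq_bigr => j _.
by rewrite hornerD hornerX hornerC.
Qed.

Lemma size_qp M : (size (qp M) <= M.+1)%N.
apply: leq_trans (size_scale_leq _ _) _.
rewrite (eq_bigr (fun j : 'I_M => 'X - (- j.+1%:R)%:P)) => [|j _].
 by rewrite -big_enum/= size_prod_XsubC -cardE card_ord.
by rewrite polyCN opprK.
Qed.

Lemma qp0 : horner (qp 0) = fun=> 1.
by apply/funext => x; rewrite qpE big_ord0 invr1 mulr1. Qed.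

Lemma dif_qp M : dif 1 (horner (qp M.+1)) = horner (qp M).
apply/funext => x; rewrite /dif /shop !qpE big_ord_recr [in X in _ + X]big_ord_recl/=.
rewrite [\prod_(i < M) (x - 1 + _)](eq_bigr (fun j : 'I_M => x + j.+1%:R)) => [|j _]; last first.
 by rewrite /bump/=; ring.
rewrite factS natrM; have f0 : M`!%:R != 0 :> R by [].
have M0 : M.+1%:R != 0 :> R by [].
by field; rewrite f0 addrC natr1.
Qed.

Lemma iter_dif_qp M : iter M (dif 1) (horner (qp M)) = horner (qp 0).
by elim: M => // k; rewrite iterSr dif_qp. Qed.

Lemma qp_at0 M : (qp M).[0] = 1.
elim: M => [|M IH]; first by rewrite qp0.
have := congr1 (fun f => f 0) (dif_qp M); rewrite IH /dif /shop.
by rewrite [(qp M.+1).[0 - 1]]qpE big_ord_recl/= subrK mul0r mulr0 mulr0 addr0.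
Qed.

Lemma qp_neg M j : (0 < j <= M)%N -> (qp M).[- j%:R] = 0.
case: j => [//|j] /andP[_ jM]; rewrite qpE (bigD1 (Ordinal jM))//= addNr mul0r mulr0 //.
Qed.

(** The difference operator of step 1/2 sends both sides for [M.+1] to both sides for [M], so by
    induction their gap takes the same value at all nonnegative half-integers, and it is zero at 0.
    Polynomials that agree at infinitely many points are equal. *)
Lemma qp_refine M : iter M.+1 (shop 1 (1 / 2)) (horner (qp M)) = dil2 (horner (qp M)).
elim: M => [|M IH]; first by apply/funext => x; rewrite /= qp0 /shop /dil2; ring.
apply: ispoly_eq.
- by apply: ispoly_iter_shop; exists (qp M.+1).
- exists (2 *: (qp M.+1 \Po (2 *: 'X))); apply/funext => x.
 by rewrite hornerZ horner_comp [(2 *: 'X).[x]]hornerZ hornerX.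
have per x : iter M.+2 (shop 1 (1 / 2)) (horner (qp M.+1)) x - dil2 (horner (qp M.+1)) x =
 iter M.+2 (shop 1 (1 / 2)) (horner (qp M.+1)) (x - 1 / 2) - dil2 (horner (qp M.+1)) (x - 1 / 2).
 have h1 : dif (1 / 2) (iter M.+2 (shop 1 (1 / 2)) (horner (qp M.+1))) x =
 dif (1 / 2) (dil2 (horner (qp M.+1))) x.
 rewrite -dil2_dif dif_qp -IH [iter M.+2 _ _]iterSr -[in RHS]dif_qp -[dif 1 _]dif_add2.
 by rewrite [in RHS]iter_shopC.
 by move: h1; rewrite /dif {1}/shop [in RHS]/shop; lra.
elim => [|m IHm]; last first.
 have := per (m.+1%:R / 2); have -> : m.+1%:R / 2 - 1 / 2 = m%:R / 2 :> R; first by pos; lra.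
 by rewrite IHm subrr => /eqP; rewrite subr_eq0 => /eqP.
(* the alternating sum vanishes because the degree is too small, so only even shifts count twice *)
rewrite mul0r /dil2 mulr0 qp_at0.
have z : iter M.+2 (dif (1 / 2)) (horner (qp M.+1)) 0 = 0 by rewrite iter_dif_poly// size_qp.
rewrite -[LHS]addr0 -[X in _ + X = _]z !iter_shopE -big_split/= big_ord_recl/= [X in _ + X]big1 => [|t _].
 by rewrite bin0 mul0r subr0 qp_at0; ring.
rewrite /bump/= add1n expr1n -signr_odd.
have [ot|et] := boolP (odd t.+1); first by pos; ring.
have -> : 0 - t.+1%:R * (1 / 2) = - (t.+1)./2%:R :> R.
 rewrite -{1}(odd_double_half t.+1) (negPf et) add0n -muln2; lra.
rewrite qp_neg ?mulr0 ?addr0//; have := ltn_ord t; have := odd_double_half t.+1.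
rewrite (negPf et); lia.
Qed.
End mask.

(** * A compactly supported refinable kernel on the line *)

Section father.
Implicit Types e : sfun.

Definition sdif (h : R) e := SAdd e (SMul (SPoly (-1)%:P) (SAff 1 (- h) e)).
Definition sadd2 (h : R) e := SAdd e (SAff 1 (- h) e).
Definition sdil2 e := SMul (SPoly 2%:P) (SAff 2 0 e).

Lemma sev_sdif h e : sev (sdif h e) = dif h (sev e).
by apply/funext => x /=; rewrite hornerC mul1r. Qed.

Lemma sev_sadd2 h e : sev (sadd2 h e) = shop 1 h (sev e).
by apply/funext => x; rewrite /shop /= !mul1r. Qed.

Lemma sev_sdil2 e : sev (sdil2 e) = dil2 (sev e).
by apply/funext => x /=; rewrite hornerC addr0. Qed.

Lemma sev_iter_sdif h N e : sev (iter N (sdif h) e) = iter N (dif h) (sev e).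
by elim: N => // N IH; rewrite sev_sdif IH. Qed.

Lemma sev_iter_sadd2 h N e : sev (iter N (sadd2 h) e) = iter N (shop 1 h) (sev e).
by elim: N => // N IH; rewrite sev_sadd2 IH. Qed.

Lemma swf_iter_sdif h N e : swf e -> swf (iter N (sdif h) e).
by move=> we; elim: N => // N. Qed.

Lemma swf_iter_sadd2 h N e : swf e -> swf (iter N (sadd2 h) e).
by move=> we; elim: N => // N. Qed.

(** The quotient [e(x)/(e(x) + e(1-x))] with [e(x) = exp(-1/x)] for positive [x]: a smooth step from
    0 left of 0 to 1 right of 1. *)
Definition sstep : sfun :=
 SMul (SBump 1) (SInv (SAdd (SBump 1) (SAff (-1) 1 (SBump 1)))).

Lemma ebump1_ge0 (x : R) : 0 <= ebump 1 x.
by rewrite /ebump; case: ifP => // _; rewrite hornerC. Qed.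

Lemma ebump1_gt0 (x : R) : 0 < x -> 0 < ebump 1 x.
by move=> x0; rewrite /ebump x0 hornerC mul1r expR_gt0. Qed.

Lemma swf_sstep : swf sstep.
split => //; split => //= x; rewrite gt_eqF//.
have [x0|x0] := ltP 0 x; first by rewrite ltr_pwDl ?ebump1_gt0 ?ebump1_ge0.
by rewrite ltr_wpDl ?ebump1_ge0// ebump1_gt0; lra.
Qed.

Lemma sstep0 x : x <= 0 -> sev sstep x = 0.
by move=> x0; rewrite /= {1}/ebump ltNge x0 mul0r. Qed.

Lemma sstep1 x : 1 <= x -> sev sstep x = 1.
move=> x1 /=; have -> : ebump 1 (-1 * x + 1) = 0 by rewrite /ebump ifF//; apply/negbTE; rewrite -leNgt; lra.
rewrite addr0 divff// gt_eqF// ebump1_gt0; lra.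
Qed.

Variable M : nat.

(** A smoothed truncated power: zero left of 0 and equal to the polynomial [qp M] from 1 on.
    Differences of order [M.+1] kill the polynomial part, so [sPhi] is a smooth analogue of a
    B-spline, with compact support. *)
Definition sX := SMul sstep (SPoly (qp M)).
Definition sPhi := iter M.+1 (sdif 1) sX.
(** The defect of [sX] in the refinement equation. That equation is exact for [qp M], so the defect
    lives near the smoothed part and has compact support. *)
Definition sA := SAdd (sdil2 sX) (SMul (SPoly (-1)%:P) (iter M.+1 (sadd2 (1 / 2)) sX)).

Lemma sX0 x : x <= 0 -> sev sX x = 0.
by move=> x0; rewrite [LHS]/= -[_ * _^-1]/(sev sstep x) sstep0// mul0r. Qed.

Lemma sX1 x : 1 <= x -> sev sX x = (qp M).[x].
by move=> x1; rewrite [LHS]/= -[_ * _^-1]/(sev sstep x) sstep1// mul1r. Qed.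

Lemma swf_sX : swf sX. by split => //; exact: swf_sstep. Qed.

Lemma swf_sPhi : swf sPhi. by apply: swf_iter_sdif; exact: swf_sX. Qed.

Lemma swf_sA : swf sA.
split; first by split => //; exact: swf_sX.
by split => //; apply: swf_iter_sadd2; exact: swf_sX.
Qed.

Lemma sev_sA : sev sA = fun x => dil2 (sev sX) x - iter M.+1 (shop 1 (1 / 2)) (sev sX) x.
apply/funext => x.
change (sev (sdil2 sX) x + (-1)%:P.[x] * sev (iter M.+1 (sadd2 (1 / 2)) sX) x =
 dil2 (sev sX) x - iter M.+1 (shop 1 (1 / 2)) (sev sX) x).
by rewrite sev_sdil2 sev_iter_sadd2 hornerC mulN1r.
Qed.

(** The power [M.+1] of [1 - S^2 = (1 - S)(1 + S)], with [S] the shift by 1/2, turns the increment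
    from [sPhi] to its dilate into differences of order [M.+1] of the defect [sA]. *)
Lemma sA_refine : dil2 (sev sPhi) = fun x => sev sPhi x + iter M.+1 (dif (1 / 2)) (sev sA) x.
have -> : sev sA = fun x => 1 * dil2 (sev sX) x + (-1) * iter M.+1 (shop 1 (1 / 2)) (sev sX) x.
 by rewrite sev_sA; apply/funext => x; rewrite [1 * dil2 _ _]mul1r mulN1r.
rewrite iter_dif_comb sev_iter_sdif iter_dil2_dif; apply/funext => x.
by rewrite iter_dif1; ring.
Qed.

Definition srad : R := M%:R + 3.

Lemma ssupp_sPhi : ssupp srad sPhi.
move=> x; rewrite /srad => ax; rewrite sev_iter_sdif.
have [x0|x0] := leP x 0.
 rewrite (@eq_iter_shop _ _ _ _ (horner 0))// => [|y /andP[_ yx]]; last first.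
 by rewrite sX0 ?horner0// (le_trans yx).
 by have := @iter_dif_poly 1 M.+1 0; rewrite size_poly0 => ->.
move: ax; rewrite gtr0_norm// => ax.
rewrite (@eq_iter_shop _ _ _ _ (horner (qp M)))// => [|y /andP[xy _]]; last first.
 by apply: sX1; move: xy; rewrite -natr1; lra.
by have := @iter_dif_poly 1 M.+1 (qp M) (size_qp M); rewrite /dif => ->.
Qed.

Lemma ssupp_sA : ssupp srad sA.
move=> x; rewrite /srad => ax.
have M0 : 0 <= M%:R :> R by [].
rewrite sev_sA.
have [x0|x0] := leP x 0.
 rewrite (@eq_iter_shop _ _ _ _ (fun=> 0))// => [|y /andP[_ yx]]; last first.
 by rewrite sX0// (le_trans yx).
 rewrite iter_shopE big1 => [|t _]; last by rewrite mulr0.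
 by rewrite /dil2 sX0; lra.
move: ax; rewrite gtr0_norm// => ax.
rewrite (@eq_iter_shop _ _ _ _ (horner (qp M)))// => [|y /andP[xy _]]; last first.
 by apply: sX1; move: xy; rewrite -natr1; lra.
by rewrite qp_refine /dil2 sX1; lra.
Qed.

(** [sPhi] is [Y(x) - Y(x - 1)], where [Y] goes from 0 to the constant 1, because [M] differences of
    [qp M] leave the constant 1. The integral of such a difference is the total rise. *)
Lemma integral_sPhi : (\int[@lebesgue_measure R]_x (sev sPhi x)%:E = 1)%E.
pose Y := sev (iter M (sdif 1) sX).
pose B : R := M%:R + 1.
have Y0 x : x <= 0 -> Y x = 0.
 move=> x0; rewrite /Y sev_iter_sdif (@eq_iter_shop _ _ _ _ (fun=> 0))// => [|y /andP[_ yx]].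
 by rewrite iter_shopE big1 // => t _; rewrite mulr0.
 by rewrite sX0// (le_trans yx).
have Y1 x : B <= x -> Y x = 1.
 move=> xB; rewrite /Y sev_iter_sdif (@eq_iter_shop _ _ _ _ (horner (qp M)))//; last first.
 by move=> y /andP[xy _]; apply: sX1; move: xB; rewrite /B; lra.
 have -> : iter M (shop (-1) 1) (horner (qp M)) = horner (qp 0).
 exact: iter_dif_qp.
 by rewrite qp0.
have PY x : sev sPhi x = Y x - Y (x - 1).
 by rewrite sev_sdif /dif /shop mulN1r.
have wY : swf (iter M (sdif 1) sX) by apply: swf_iter_sdif; exact: swf_sX.
have mY : measurable_fun setT Y by exact: sev_measurable.
(* [Y] itself is not integrable. It is cut at [B + 1], and what the cut removes from the difference
   is the indicator of an interval of length 1. *)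
pose g x := Y x * \1_(`]-oo, B + 1]%classic : set R) x.
have mg : measurable_fun setT g by apply: measurable_funM => //; exact: measurable_indic.
have [K K0 HK] : exists2 K : R, 0 <= K & forall x, `|g x| <= K * \1_(`[0, B + 1]%classic : set R) x.
 have cc : compact (`[0, B + 1]%classic : set R) by exact: segment_compact.
 have cf : {within `[0, B + 1]%classic, continuous Y}.
 by apply: continuous_subspaceT; exact: sev_continuous.
 have /compact_bounded[K [_ HK]] := continuous_compact cf cc.
 exists (`|K| + 1) => //.
 move=> x; rewrite /g !indicE !mem_setE !in_itv/=.
 have [x0|x0] := leP 0 x; last by rewrite Y0 ?(ltW x0)// mul0r normr0.
 case: (leP x (B + 1)) => xB; last by rewrite mulr0 normr0.
 rewrite !mulr1; apply: HK; first by rewrite (le_lt_trans (ler_norm K))// ltrDl.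
 by exists x => //=; rewrite in_itv/= x0.
have ig : (@lebesgue_measure R).-integrable setT (EFin \o g).
 have iI : (@lebesgue_measure R).-integrable setT (EFin \o \1_(`[0, B + 1]%classic : set R)).
 by apply: inte_indic_fin => //; exact: lebesgue_itv_fin.
 have iK := integrableZl measurableT K iI.
 apply: (le_integrable measurableT _ _ iK).
 exact/measurable_EFinP.
 by move=> x _; rewrite lee_fin [leRHS]ger0_norm.
pose S x : R := g (x - 1).
have SE : (\int[@lebesgue_measure R]_x (S x)%:E = \int[@lebesgue_measure R]_x (g x)%:E)%E.
 have aff (H : R -> \bar R) : measurable_fun setT H -> (forall x, 0 <= H x)%E ->
 (\int[@lebesgue_measure R]_x H (x - 1)%R = \int[@lebesgue_measure R]_x H x)%E.
 move=> mH H0; have := @integral_affine R H 1 (-1) (oner_neq0 _) mH H0.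
 rewrite normr1 invr1 mul1e => <-; apply: eq_integral => x _; by rewrite mul1r.
 rewrite integralE [in RHS]integralE; congr (_ - _)%E.
 rewrite -(aff (EFin \o g)^\+)%E//; last by apply/measurable_funepos/measurable_EFinP.
 by apply: eq_integral => x _; rewrite !funeposE.
 rewrite -(aff (EFin \o g)^\-)%E//; last by apply/measurable_funeneg/measurable_EFinP.
 by apply: eq_integral => x _; rewrite !funenegE.
have mS : measurable_fun setT S.
 by apply: (measurableT_comp mg); apply: measurable_funB.
have iS : (@lebesgue_measure R).-integrable setT (EFin \o S).
 apply/integrableP; split; first exact/measurable_EFinP.
 have /integrableP[_] := ig; apply: le_lt_trans.
 have := @integral_affine R (fun x => `|(g x)%:E|)%E 1 (-1) (oner_neq0 _).
 rewrite normr1 invr1 mul1e => <- //.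
 by apply: le_of_eq; apply: eq_integral => x _; rewrite mul1r.
 by apply: measurableT_comp => //; exact/measurable_EFinP.
have iw : (@lebesgue_measure R).-integrable setT (EFin \o \1_(`]B + 1, B + 2]%classic : set R)).
 by apply: inte_indic_fin => //; exact: lebesgue_itv_fin.
have -> : (\int[@lebesgue_measure R]_x (sev sPhi x)%:E = \int[@lebesgue_measure R]_x
 ((g x)%:E - (S x)%:E + (\1_(`]B + 1, B + 2]%classic : set R) x)%:E))%E.
 apply: eq_integral => x _; rewrite PY; congr EFin.
 rewrite /S /g !indicE !mem_setE !in_itv/=.
 have -> : (x - 1 <= B + 1) = (x <= B + 2) by apply/idP/idP; lra.
 case: (leP x (B + 1)) => h1; case: (leP x (B + 2)) => h2 /=.
 - by ring.
 - by exfalso; lra.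
 - by rewrite [Y x]Y1 ?[Y (x - 1)]Y1; [ring|lra|lra].
 - by rewrite [Y x]Y1 ?[Y (x - 1)]Y1; [ring|lra|lra].
rewrite integralD//; last exact: integrableB.
rewrite integralB// SE subee ?add0e; last first.
 by apply: integrable_fin_num.
rewrite integral_indic// setIT.
have := @lebesgue_measure_itv R `]B + 1, B + 2]; rewrite /= => ->.
have -> : ((B + 1)%:E < (B + 2)%:E)%E by rewrite lte_fin; lra.
by rewrite -EFinD; congr (_%:E); ring.
Qed.
End father.

(** * Mean value bounds for iterated differences *)

Lemma mvt1 (g dg : R -> R) (a b K : R) : (forall s : R, is_derive s 1 g (dg s)) ->
 (forall s, Num.min a b <= s <= Num.max a b -> `|dg s| <= K) -> `|g b - g a| <= K * `|b - a|.
move=> dgP.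
have cg : continuous g.
 by move=> x; have [d _] := dgP x; apply: differentiable_continuous; exact/derivable1_diffP.
wlog ab : a b / a <= b.
 move=> H HK; have [ab|/ltW ba] := leP a b; first exact: H.
 by rewrite distrC [`|b - a|]distrC; apply: H => // s; rewrite minC maxC; exact: HK.
move=> HK; have [//|c] := @MVT_segment R g dg a b ab.
 by apply: continuous_subspaceT.
rewrite in_itv/= => cab ->; rewrite normrM ler_wpM2r// HK//.
by rewrite min_l// max_r.
Qed.

Lemma iter_dif_bound (g : nat -> R -> R) D (h K x : R) : 0 <= h ->
 (forall k (s : R), is_derive s 1 (g k) (g k.+1 s)) ->
 (forall s, x - D%:R * h <= s <= x -> `|g D s| <= K) ->
 `|iter D (dif h) (g 0) x| <= K * h ^+ D.
move=> h0; elim: D g K => [|D IH] g K dg HK.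
 by rewrite mulr1; apply: HK; rewrite mul0r subr0 lexx.
rewrite iterSr exprS mulrA; apply: (IH (fun k => dif h (g k))) => [k s|s xs].
 have d : is_derive s 1 (fun y : R => y - h) 1.
 apply: (@is_derive_quad _ _ _ 0 1) => // z _.
 by rewrite mul0r normr_le0; apply/eqP; ring.
 have dh : is_derive s 1 (fun y : R => g k (y - h)) (g k.+1 (s - h) * 1).
 exact: (@is_derive1_comp _ (g k) (fun y : R => y - h) s _ _ (dg k (s - h)) d).
 have H := is_deriveD (dg k s) (is_deriveZ (-1) dh).
 apply: (is_derive_eq H).
 by rewrite /dif /shop /GRing.scale/=; ring.
have := @mvt1 (g D) (g D.+1) (s - h) s K (dg D).
rewrite (_ : s - (s - h) = h); last by ring.
rewrite (ger0_norm h0) /dif /shop mulN1r; apply => z.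
rewrite min_l ?max_r ?lerBlDr ?lerDl// => /andP[z1 z2].
move: xs => /andP[s1 s2]; apply: HK; rewrite -natr1 mulrDl mul1r.
by apply/andP; split; lra.
Qed.

(** The trivial bound, for the differences beyond those that derivatives absorb: functions in [Sm m]
    have [m.+1] controlled derivatives, while the kernel yields [M.+1] differences. *)
Lemma iter_dif_bound2 (f : R -> R) N (h K x : R) : 0 <= h ->
 (forall s, x - N%:R * h <= s <= x -> `|f s| <= K) -> `|iter N (dif h) f x| <= 2 ^+ N * K.
move=> h0; elim: N f K => [|N IH] f K HK.
 by rewrite mul1r; apply: HK; rewrite mul0r subr0 lexx.
rewrite iterSr exprSr -mulrA; apply: IH => s /andP[s1 s2].
rewrite /dif /shop mulN1r mulrDl mul1r (le_trans (ler_normB _ _))// lerD//; apply: HK;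
 rewrite -natr1; apply/andP; split; lra.
Qed.

(** * Partial derivatives and Schwartz functions *)

Section schwartz_calculus.
Implicit Types (f g : Rn -> R) (x y : Rn) (al : seq 'I_n).

Lemma is_derive_line f x i (s d : R) :
 is_derive (x + s *: e_ i) (e_ i) f d <-> is_derive s 1 (fun z : R => f (x + z *: e_ i)) d.
have E : (fun h : R => h^-1 *: ((f \o shift (x + s *: e_ i)) (h *: e_ i) - f (x + s *: e_ i))) =
 (fun h : R => h^-1 *: (((fun z : R => f (x + z *: e_ i)) \o shift s) (h *: 1) - f (x + s *: e_ i))).
 apply/funext => h; congr (_ *: (f _ - _)) => /=.
 by rewrite scalerDl scaler1 addrCA.
split => -[]; rewrite /derivable /derive => h1 h2; split; rewrite /derivable /derive.
- by rewrite -E.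
- by rewrite -E.
- by rewrite E.
- by rewrite E.
Qed.

Lemma is_derive_line0 f x i (d : R) :
 is_derive x (e_ i) f d <-> is_derive (0 : R) 1 (fun z : R => f (x + z *: e_ i)) d.
by rewrite -is_derive_line scale0r addr0. Qed.

Definition isder f i g := forall x, is_derive x (e_ i) f (g x).

Lemma isderE f i g : isder f i g -> partial i f = g /\ forall x, derivable f x (e_ i).
by move=> h; split; [apply/funext => x; have [] := h x|move=> x; have [] := h x]. Qed.

Lemma isder_line f i g x (s : R) : isder f i g ->
 is_derive s 1 (fun z : R => f (x + z *: e_ i)) (g (x + s *: e_ i)).
by move=> h; apply/is_derive_line; exact: h. Qed.

(** A family [D] indexed by lists of directions is guessed and verified one derivative at a time;
    the induction over lists is done here once for all derivative formulas below. *)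
Lemma dparts f (D : seq 'I_n -> Rn -> R) :
 D [::] = f -> (forall al i, isder (D al) i (D (i :: al))) ->
 smooth f /\ forall al, dpart al f = D al.
move=> D0 DS.
have E al : dpart al f = D al.
 by elim: al => [|i al IH] /=; [rewrite D0|rewrite IH; have [-> _] := isderE (DS al i)].
split => // al i x; rewrite E; have [_] := isderE (DS al i); exact.
Qed.

Lemma smooth_isder f al i : smooth f -> isder (dpart al f) i (dpart (i :: al) f).
by []. Qed.

Lemma smooth_comb (a : R) f g : smooth f -> smooth g ->
 smooth (fun x => a * f x + g x) /\
 forall al, dpart al (fun x => a * f x + g x) = fun x => a * dpart al f x + dpart al g x.
move=> sf sg.
apply: (@dparts _ (fun al x => a * dpart al f x + dpart al g x)) => // al i x.
have h := is_deriveD (is_deriveZ a (smooth_isder al i sf x)) (smooth_isder al i sg x).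
exact: (is_derive_eq h).
Qed.

Lemma smooth_affine (a : R) (v : Rn) f : smooth f ->
 smooth (fun x => f (a *: x + v)) /\
 forall al, dpart al (fun x => f (a *: x + v)) = fun x => a ^+ size al * dpart al f (a *: x + v).
move=> sf.
apply: (@dparts _ (fun al x => a ^+ size al * dpart al f (a *: x + v))).
 by apply/funext => x; rewrite mul1r.
move=> al i x; apply/is_derive_line0.
have d : is_derive (0 : R) 1 (fun y : R => a * y) a.
 apply: (@is_derive_quad _ _ _ 0 1) => // z _.
 by rewrite mul0r normr_le0; apply/eqP; ring.
have l := isder_line (a *: x + v) (a * 0) (smooth_isder al i sf).
have h := @is_derive1_comp _ (fun z => dpart al f (a *: x + v + z *: e_ i)) (fun y : R => a * y) 0 _ _ l d.
have h2 := is_deriveZ (a ^+ size al) h.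
rewrite mulr0 scale0r addr0 in h2.
have -> : (fun z : R => a ^+ size al * dpart al f (a *: (x + z *: e_ i) + v)) =
 (a ^+ size al *: ((fun z : R => dpart al f (a *: x + v + z *: e_ i)) \o (fun y : R => a * y))).
 apply/funext => z; congr (_ * dpart al f _).
 by rewrite scalerDr scalerA addrAC.
by apply: (is_derive_eq h2); rewrite /GRing.scale/= exprS; ring.
Qed.

Lemma schwartz_decay f al N : schwartz f -> exists2 C : R, 0 < C &
 forall x, (1 + enorm x) ^+ N * `|dpart al f x| <= C.
move=> [_ /(_ al N)[C HC]]; exists (`|C| + 1) => //.
by move=> x; rewrite (le_trans (HC x))// (le_trans (ler_norm C))// lerDl.
Qed.

Lemma enorm1_gt0 x : 0 < 1 + enorm x.
by rewrite ltr_pwDl. Qed.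

Lemma enorm1_ge1 x : 1 <= 1 + enorm x.
by rewrite lerDl. Qed.

Lemma one_enorm_mul x y : 1 + enorm x <= (1 + enorm y) * (1 + enorm (x - y)).
have := enorm_dist3 x y 0; rewrite !subr0.
by have := enorm_ge0 y; have := enorm_ge0 (x - y); nra.
Qed.

Lemma schwartz_decayn f k N : schwartz f -> exists2 C : R, 0 < C &
 forall al, (size al <= k)%N -> forall x, (1 + enorm x) ^+ N * `|dpart al f x| <= C.
move=> sf.
have /choice[C HC] : forall al, exists C : R, 0 < C /\
 forall x, (1 + enorm x) ^+ N * `|dpart al f x| <= C.
 by move=> al; have [C HC] := schwartz_decay al N sf; exists C.
exists (1 + \sum_(m < k.+1) \sum_(t : m.-tuple 'I_n) C (val t)).
 by rewrite ltr_pwDl// sumr_ge0// => m _; rewrite sumr_ge0// => t _; exact: ltW (HC _).1.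
move=> al sal x; apply: le_trans ((HC al).2 x) _.
have sk : (size al < k.+1)%N by [].
rewrite (bigD1 (Ordinal sk))//= (bigD1 (in_tuple al))//= -!addrA.
have p1 : 0 <= \sum_(i : (size al).-tuple 'I_n | i != in_tuple al) C (val i).
 by rewrite sumr_ge0// => t _; exact: ltW (HC _).1.
have p2 : 0 <= \sum_(i < k.+1 | i != Ordinal sk) \sum_(t : i.-tuple 'I_n) C (val t).
 by rewrite sumr_ge0// => m _; rewrite sumr_ge0// => t _; exact: ltW (HC _).1.
by lra.
Qed.

Lemma schwartz_comb (a : R) f g : schwartz f -> schwartz g -> schwartz (fun x => a * f x + g x).
move=> sf sg; have [s d] := smooth_comb a sf.1 sg.1; split => // al N.
have [C C0 HC] := schwartz_decay al N sf; have [D D0 HD] := schwartz_decay al N sg.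
exists (`|a| * C + D) => x; rewrite d (le_trans (ler_wpM2l _ (ler_normD _ _)))//.
by rewrite mulrDr normrM mulrCA lerD// ler_wpM2l.
Qed.

Lemma smooth0 : smooth (fun _ : Rn => 0 : R) /\ forall al, dpart al (fun _ : Rn => 0 : R) = fun=> 0.
by apply: (@dparts _ (fun => 0)) => // al i x; exact: is_derive_cst. Qed.

Lemma schwartz0 : schwartz (fun _ : Rn => 0 : R).
by split; [exact: smooth0.1|move=> N; exists 0 => x; rewrite smooth0.2 normr0 mulr0]. Qed.

Lemma schwartzZ (a : R) f : schwartz f -> schwartz (fun x => a * f x).
move=> sf; have := schwartz_comb a sf schwartz0.
by rewrite (_ : (fun x => a * f x + 0) = (fun x => a * f x))//; apply/funext => x; rewrite addr0.
Qed.

Lemma dpartZ (a : R) f al : smooth f -> dpart al (fun x => a * f x) = fun x => a * dpart al f x.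
move=> sf; have [_ /(_ al)] := smooth_comb a sf smooth0.1; rewrite smooth0.2.
under [X in dpart al X]eq_fun do rewrite addr0.
by move=> ->; apply/funext => x; rewrite addr0.
Qed.

Lemma schwartz_sum (I : Type) (r : seq I) (c : I -> R) (F : I -> Rn -> R) :
 (forall i, schwartz (F i)) -> schwartz (fun x => \sum_(i <- r) c i * F i x) /\
 forall al, dpart al (fun x => \sum_(i <- r) c i * F i x) =
 fun x => \sum_(i <- r) c i * dpart al (F i) x.
move=> sF; elim: r => [|i r [IH1 IH2]].
 have E G : (fun x : Rn => \sum_(i <- [::]) c i * G i x) = fun=> 0 :> R.
 by apply/funext => x; rewrite big_nil.
 rewrite E; split; first exact: schwartz0.
 by move=> al; rewrite smooth0.2.
have E G : (fun x : Rn => \sum_(j <- i :: r) c j * G j x) =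
 fun x => c i * G i x + \sum_(j <- r) c j * G j x.
 by apply/funext => x; rewrite big_cons.
rewrite E; split; first exact: schwartz_comb.
by move=> al; rewrite (smooth_comb _ (sF i).1 IH1.1).2 IH2.
Qed.

Lemma schwartz_affine (a : R) (v : Rn) f : a != 0 -> schwartz f ->
 schwartz (fun x => f (a *: x + v)).
move=> a0 sf; have [s d] := smooth_affine a v sf.1; split => // al N.
have [C C0 HC] := schwartz_decay al N sf.
pose K := (1 + `|a|^-1) * (1 + enorm v).
exists (K ^+ N * (`|a| ^+ size al * C)) => x; rewrite d normrM normrX.
have Kx : 1 + enorm x <= K * (1 + enorm (a *: x + v)).
 have -> : enorm x = `|a|^-1 * enorm (a *: x).
 by rewrite enormZ mulrA mulVf ?mul1r// normr_eq0.
 have := enorm_dist3 (a *: x) (- v) 0; rewrite !subr0 opprK enormN.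
 have := enorm_ge0 v; have := enorm_ge0 (a *: x + v); have : 0 <= `|a|^-1 by [].
 rewrite /K; move: (enorm v) (enorm (a *: x + v)) (enorm (a *: x)) `|a|^-1 => p q r u u0 q0 p0 rpq.
 have := ler_wpM2l u0 rpq; have := mulr_ge0 u0 (mulr_ge0 p0 q0); have := mulr_ge0 p0 q0.
 by rewrite !mulrDl; lra.
apply: (le_via ((K * (1 + enorm (a *: x + v))) ^+ N * (`|a| ^+ size al * `|dpart al f (a *: x + v)|))).
 have x0 := ltW (enorm1_gt0 x).
 by apply: ler_wpM2r; rewrite//; apply: lerXn2r; rewrite ?nnegrE.
rewrite exprMn -mulrA ler_wpM2l//.
by rewrite mulrCA ler_wpM2l.
Qed.

Lemma dilE (psi : Rn -> R) (t : R) (y : Rn) :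
 dil psi t y = fun x => t ^- n * psi (- t^-1 *: x + t^-1 *: y).
by apply/funext => x; rewrite /dil scalerBr addrC scaleNr. Qed.

Lemma schwartz_dil (psi : Rn -> R) (t : R) (y : Rn) : t != 0 -> schwartz psi -> schwartz (dil psi t y).
move=> t0 sp; rewrite dilE; apply/schwartzZ/schwartz_affine => //.
by rewrite oppr_eq0 invr_eq0.
Qed.

Lemma dpart_dil (psi : Rn -> R) (t : R) (y x : Rn) al : smooth psi ->
 dpart al (dil psi t y) x = t ^- n * (- t^-1) ^+ size al * dpart al psi (t^-1 *: (y - x)).
move=> sp; have [s d] := smooth_affine (- t^-1) (t^-1 *: y) sp.
by rewrite dilE dpartZ// d scalerBr [in RHS]addrC scaleNr mulrA.
Qed.

(** The path from [x] to [y] changes one coordinate at a time, so partial derivatives suffice; its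
    points are at most as far from [x] as [y] is, which keeps the bound local. *)
Lemma mvt_bound g (dg : 'I_n -> Rn -> R) x y (K : R) : (forall i, isder g i (dg i)) ->
 (forall i z, enorm (z - x) <= enorm (y - x) -> `|dg i z| <= K) ->
 `|g y - g x| <= n%:R * K * enorm (y - x).
move=> dgP HK.
pose z (k : nat) : Rn := \row_i (if (i < k)%N then y ord0 i else x ord0 i).
have z0 : z 0%N = x by apply/rowP => i; rewrite mxE.
have zn : z n = y by apply/rowP => i; rewrite mxE ltn_ord.
rewrite -zn -[in X in _ - g X]z0.
have tel (k : nat) : g (z k) - g (z 0%N) = \sum_(0 <= i < k) (g (z i.+1) - g (z i)).
 by rewrite telescope_sumr.
rewrite tel (le_trans (ler_norm_sum _ _ _))// big_mkord.
apply: (le_via (\sum_(i < n) K * enorm (z n - x))).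
 apply: ler_sum => i _; rewrite zn.
 have E s : z i + s *: e_ i = \row_j (if (j == i) then x ord0 i + s else z i ord0 j).
 apply/rowP => j; rewrite !mxE /=; case: eqVneq => [->|ji]; first by rewrite ltnn mulr1.
 by rewrite mulr0 addr0.
 have zi1 : z i.+1 = z i + (y ord0 i - x ord0 i) *: e_ i.
 rewrite E; apply/rowP => j; rewrite !mxE ltnS leq_eqVlt.
 by rewrite [X in X || _]val_eqE; case: (eqVneq i) => [->|_] //=; rewrite addrC subrK.
 have zi0 : z i = z i + 0 *: e_ i by rewrite scale0r addr0.
 rewrite zi1 {2}zi0.
 have := @mvt1 (fun s => g (z i + s *: e_ i)) (fun s => dg i (z i + s *: e_ i)) 0 (y ord0 i - x ord0 i) K.
 move=> /(_ (fun s => isder_line _ _ (dgP i))).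
 rewrite subr0 => H; apply: le_trans (H _) _ => [s sb|].
 apply: HK; rewrite E -(@ler_pXn2r _ 2) ?nnegrE// !sqr_enorm.
 apply: ler_sum => j _; rewrite !mxE; case: eqVneq => [->|ji].
 rewrite addrAC subrr add0r -[leLHS]real_normK ?num_real// -[leRHS]real_normK ?num_real//.
 rewrite lerXn2r//; move: sb; rewrite minEle maxEle.
 move: (y ord0 i - x ord0 i) => w; case: (leP 0 w) => w0 /andP[s1 s2].
 by rewrite ler_norml (ger0_norm w0); lra.
 by rewrite ler_norml (ltr0_norm w0); lra.
 by case: ifP => //; rewrite subrr expr0n sqr_ge0.
 rewrite ler_wpM2l//; first by apply: le_trans (HK i x _) => //; rewrite subrr enorm0.
 by have := enorm_coord (y - x) i; rewrite !mxE.
by rewrite sumr_const card_ord -mulrA mulr_natl.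
Qed.
End schwartz_calculus.

(** * Real-valued integrals and integrability by decay *)

Definition inte (f : Rn -> R) := L.-integrable setT (EFin \o (f : RL R n -> R)).

Lemma inte_meas f : inte f -> mfun f.
by move=> /measurable_int/measurable_EFinP. Qed.

Lemma inte_le f g : mfun f -> (forall x, `|f x| <= g x) ->
 inte g -> inte f.
move=> mf fg ig; apply: (le_integrable measurableT _ _ ig); first exact/measurable_EFinP.
by move=> x _; rewrite lee_fin (le_trans (fg x))// ler_norm.
Qed.

Lemma inte_abs f : inte f -> inte (fun x => `|f x|).
by move=> /integrable_norm. Qed.

Lemma inteZ a f : inte f -> inte (fun x => a * f x).
by move=> /(integrableZl measurableT a). Qed.

Lemma inteD f g : inte f -> inte g -> inte (fun x => f x + g x).
by move=> h1 h2; have := integrableD measurableT h1 h2. Qed.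

Lemma inteB f g : inte f -> inte g -> inte (fun x => f x - g x).
by move=> h1 h2; have := integrableB measurableT h1 h2. Qed.

Lemma inte0 : inte (fun=> 0).
exact: integrable0. Qed.

Lemma inte_sum (I : Type) (r : seq I) (F : I -> Rn -> R) : (forall i, inte (F i)) ->
 inte (fun x => \sum_(i <- r) F i x) /\
 \int[L]_x (\sum_(i <- r) F i x) = \sum_(i <- r) \int[L]_x F i x.
move=> iF; elim: r => [|i r [IH1 IH2]].
 have E : (fun x : Rn => \sum_(i <- [::]) F i x) = fun=> 0 by apply/funext => x; rewrite big_nil.
 rewrite E big_nil; split; first exact: inte0.
 by rewrite Rintegral_cst// mul0r.
have E : (fun x : Rn => \sum_(j <- i :: r) F j x) = fun x => F i x + \sum_(j <- r) F j x.
 by apply/funext => x; rewrite big_cons.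
rewrite E big_cons; split; first exact: inteD.
rewrite (RintegralD measurableT (iF i) IH1); congr (_ + _); exact: IH2.
Qed.

Lemma ler_Rint f g : inte f -> inte g -> (forall x, f x <= g x) ->
 \int[L]_x f x <= \int[L]_x g x.
by move=> h1 h2 fg; apply: le_Rintegral => // _; exact: fg. Qed.

Lemma ler_norm_Rint f g : inte f -> inte g -> (forall x, `|f x| <= g x) ->
 `|\int[L]_x f x| <= \int[L]_x g x.
move=> h1 h2 fg; apply: le_trans (le_normr_Rintegral measurableT h1) _.
by apply: ler_Rint => //; exact: inte_abs.
Qed.

(** The majorant is [htail] with exponent [n.+1] around the origin: its dyadic balls have measure
    [2^(jn)] up to a constant and height [2^(-j(n+1))], so the integral is a geometric series. *)
Lemma inte_decay : exists2 K : R, 0 < K & forall (f : Rn -> R) (C : R),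
 mfun f -> (forall x, (1 + enorm x) ^+ n.+1 * `|f x| <= C) ->
 inte f /\ \int[L]_x `|f x| <= K * C.
pose K := 2 ^+ n.+1 * (2 ^+ n * vball) * 2.
have v0 := vball_gt0.
have K0 : 0 < K by pos.
exists K => // f C mf fC.
have C0 : 0 <= C.
 apply: le_trans (fC 0); apply: mulr_ge0 => //; apply: exprn_ge0; exact: ltW.
pose h := htail n.+1 (0 : Rn) 1 (2 ^+ n.+1 * C).
have fh x : (`|f x|%:E <= h x)%E.
 apply: htail_lb => //; have e1 := enorm1_ge1 x; have e0 := enorm1_gt0 x.
 apply: le_trans (fC x); rewrite ler_peMl//; exact: exprn_ege1.
 rewrite subr0 expr1n mulr1; apply: le_trans (fC x); rewrite mulrC ler_wpM2r//.
 by rewrite lerXn2r ?nnegrE ?(ltW e0)// lerDr.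
have hK : (\int[L]_x h x <= (K * C)%:E)%E.
 rewrite integral_csum => [|j|j x]; last 2 first.
 - apply/measurable_EFinP; apply: measurable_funM => //; apply: measurable_indic.
 exact: meas_eball.
 - by pos.
 have tE j : (\int[L]_x (2 ^+ n.+1 * C / 2 ^+ (j * n.+1) * \1_(eball 0 (2 ^+ j.+1 * 1)) x)%:E =
 (2 ^+ n.+1 * (2 ^+ n * vball) * C)%:E * ((2 ^- j)%:E))%E.
 under eq_integral do rewrite EFinM.
 rewrite ge0_integralZl//; last 2 first.
 - by apply/measurable_EFinP; apply: measurable_indic; exact: meas_eball.
 - by pos.
 rewrite integral_eball ?mulr1 ?exprn_gt0//; congr EFin.
 rewrite mulnS exprD exprM [2 ^+ j.+1]exprS exprMn.
 have a0 : 2 ^+ j != 0 :> R by [].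
 have b0 : (2 ^+ j) ^+ n != 0 :> R by [].
 move: (2 ^+ j) ((2 ^+ j) ^+ n) (2 ^+ n.+1 : R) (2 ^+ n : R) a0 b0 => A B D E a0 b0.
 by field; rewrite a0.
 rewrite (_ : (fun j => _) = (fun j => (2 ^+ n.+1 * (2 ^+ n * vball) * C)%:E * ((2 ^- j)%:E))%E); last first.
 by apply/funext => j; exact: tE.
 rewrite csumZl ?(ltW v0)//.
 rewrite (_ : K * C = 2 ^+ n.+1 * (2 ^+ n * vball) * C * 2); last by rewrite /K; ring.
 rewrite [in leRHS]EFinM lee_wpmul2l ?lee_fin ?(ltW v0)//.
 apply: csum_le_fin => [j|s us]//.
 rewrite sumEFin lee_fin.
 have := @geom_uniq_nat (2^-1) s; rewrite invr_gt0 invf_lt1// ltr0n ltr1n => /(_ isT us).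
 rewrite (_ : (1 - 2^-1)^-1 = 2 :> R); last by field.
 by apply: le_trans; apply: le_of_eq; apply: eq_bigr => j _; rewrite exprVn.
have fK : (\int[L]_x `|f x|%:E <= (K * C)%:E)%E.
 by apply: le_trans hK; apply: le_integral_ge0.
have jf : inte f.
 apply/integrableP; split; first exact/measurable_EFinP.
 by apply: le_lt_trans fK _; rewrite ltry.
split => //; rewrite -lee_fin fineK//.
exact: integrable_fin_num (inte_abs jf).
Qed.

Lemma rintE (f : Rn -> R) : mfun f ->
 rint f = (\int[L]_x (f x)%:E)%E.
move=> mf; have mE : measurable_fun setT (EFin \o (f : RL R n -> R)) by exact/measurable_EFinP.
rewrite [in RHS]integralE; congr (_ - _)%E; rewrite nnintE.
- by apply: eq_integral => x _; rewrite funeposE EFin_max.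
- by move=> x; rewrite lee_fin le_max lexx orbT.
- have := measurable_funepos mE; apply: eq_measurable_fun => x _; by rewrite funeposE EFin_max.
- by apply: eq_integral => x _; rewrite funenegE EFin_max.
- by move=> x; rewrite lee_fin le_max lexx orbT.
- have := measurable_funeneg mE; apply: eq_measurable_fun => x _; by rewrite funenegE EFin_max.
Qed.

Lemma fdistE (f psi : Rn -> R) : mfun f ->
 mfun psi -> fdist f psi = \int[L]_x (f x * psi x).
by move=> mf mp; rewrite /fdist rintE//; exact: measurable_funM. Qed.

Lemma Rint_affine (a : R) (v : Rn) (f : Rn -> R) : a != 0 -> inte f ->
 inte (fun x => f (a *: x + v)) /\
 \int[L]_x f (a *: (x : Rn) + v) = `|a| ^- n * \int[L]_x f x.
move=> a0 jf; have mf := inte_meas jf; split.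
 apply/integrableP; split; first by apply/measurable_EFinP; exact: measurable_affine.
 have /integrableP[_ foo] := jf.
 rewrite (@int_affine_lebm R n a v (fun x => `|(f x)%:E|%E))//; last first.
 by apply: measurableT_comp => //; exact/measurable_EFinP.
 by rewrite lte_mul_pinfty.
by rewrite /Rintegral integral_affine_lebm// fineM//; exact: integrable_fin_num.
Qed.

Lemma econt_isder g (dg : 'I_n -> Rn -> R) (K : R) : (forall i, isder g i (dg i)) ->
 (forall i z, `|dg i z| <= K) -> econt g.
move=> dgP HK; apply: (@econt_lip _ (n%:R * K)) => x y.
by apply: mvt_bound dgP _ => i z _; exact: HK.
Qed.

Lemma schwartz_econt (psi : Rn -> R) al : schwartz psi -> econt (dpart al psi).
move=> sp; have [C C0 HC] := schwartz_decayn (size al).+1 0 sp.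
apply: (@econt_isder _ (fun i => dpart (i :: al) psi) C) => [i|i z]; first exact: smooth_isder sp.1.
by have := HC (i :: al) (leqnn _) z; rewrite mul1r.
Qed.

Lemma schwartz_meas (psi : Rn -> R) al : schwartz psi ->
 mfun (dpart al psi).
by move=> sp; apply: econt_meas; exact: schwartz_econt. Qed.

Lemma schwartz_inte (psi : Rn -> R) al : schwartz psi -> inte (dpart al psi).
move=> sp; have [K K0 HK] := inte_decay; have [C C0 HC] := schwartz_decay al n.+1 sp.
by have [] := HK _ C (schwartz_meas al sp).
Qed.

Lemma econt_comp_affine (a : R) (v : Rn) h : econt h -> econt (fun x => h (a *: x + v)).
move=> ch x e e0; have [d d0 hd] := ch (a *: x + v) e e0.
exists (d / (`|a| + 1)); first by pos.
move=> y yx; apply: hd; rewrite opprD addrACA subrr addr0 -scalerBr enormZ.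
rewrite ltr_pdivlMr ?ltr_wpDl// in yx; apply: le_lt_trans yx.
by rewrite mulrC ler_wpM2l ?enorm_ge0// lerDl.
Qed.

(** * Tensor products of smooth functions *)

Section tensor.
Implicit Types e : 'I_n -> sfun.

Definition tens e (x : Rn) : R := \prod_(i < n) sev (e i) (x ord0 i).

Definition tder (al : seq 'I_n) e : 'I_n -> sfun := fun i => iter (count_mem i al) sder (e i).

Lemma swf_tder e al i : (forall i, swf (e i)) -> swf (tder al e i).
by move=> we; rewrite /tder; elim: (count_mem _) => //= k; exact: swf_der. Qed.

Lemma ssupp_tder e al a i : (forall i, swf (e i)) -> (forall i, ssupp a (e i)) -> ssupp a (tder al e i).
move=> we se; rewrite /tder; elim: (count_mem _ _) => //= k; apply: ssupp_der.
by elim: k => //= k; exact: swf_der.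
Qed.

Lemma tens_smooth e : (forall i, swf (e i)) ->
 smooth (tens e) /\ forall al, dpart al (tens e) = tens (tder al e).
move=> we; apply: (@dparts _ (fun al => tens (tder al e))) => // al i x.
apply/is_derive_line0.
pose P := \prod_(j < n | j != i) sev (tder al e j) (x ord0 j).
have d0 := sev_derive (swf_tder al i we) (x ord0 i + 0).
have ds : is_derive (0 : R) 1 (fun z : R => x ord0 i + z) 1.
 apply: (@is_derive_quad _ _ _ 0 1) => // z _.
 by rewrite mul0r normr_le0; apply/eqP; ring.
have d1 := @is_derive1_comp _ (sev (tder al e i)) (fun z : R => x ord0 i + z) 0 _ _ d0 ds.
have d2 := is_deriveZ P d1.
have -> : (fun z : R => tens (tder al e) (x + z *: e_ i)) =
 P *: (sev (tder al e i) \o (fun z : R => x ord0 i + z)).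
 apply/funext => z; rewrite /tens (bigD1 i)//= !mxE !eqxx mulr1 mulrC; congr (_ * _).
 by apply: eq_bigr => j ji; rewrite !mxE (negPf ji) mulr0 addr0.
apply: (is_derive_eq d2).
rewrite mulr1 addr0 /tens [in RHS](bigD1 i)//= /GRing.scale/= mulrC; congr (_ * _).
 by rewrite /tder/= eqxx.
by apply: eq_bigr => j ji; rewrite /tder/= eq_sym (negPf ji).
Qed.

Lemma tens_supp e (a : R) (x : Rn) : (forall i, ssupp a (e i)) -> n%:R * a < enorm x -> tens e x = 0.
move=> se ax; have [[i ai]|H] := pselect (exists i : 'I_n, a < `|x ord0 i|).
 by rewrite /tens (bigD1 i)//= se// mul0r.
exfalso; move: ax; apply/negP; rewrite -leNgt (le_trans (enorm_le_sum x))//.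
rewrite mulr_natl -[X in _ *+ X](card_ord n) -sumr_const; apply: ler_sum => i _.
by rewrite leNgt; apply/negP => ai; apply: H; exists i.
Qed.

Lemma tens_schwartz e (a : R) : (forall i, swf (e i)) -> (forall i, ssupp a (e i)) ->
 schwartz (tens e).
move=> we se; have [s d] := tens_smooth we; split => // al N.
have /choice[M HM] : forall i, exists M : R, 0 <= M /\ forall x, `|sev (tder al e i) x| <= M.
 move=> i; have [M M0 HM] := ssupp_bounded (swf_tder al i we) (ssupp_tder al i we se).
 by exists M.
exists ((1 + `|n%:R * a|) ^+ N * \prod_i M i) => x; rewrite d.
have [ax|ax] := ltP (n%:R * a) (enorm x).
 rewrite (@tens_supp _ a)// => [|i]; last exact: ssupp_tder.
 by rewrite normr0 mulr0 mulr_ge0 ?addr_ge0//; apply: prodr_ge0 => i _; exact: (HM i).1.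
have e0 := ltW (enorm1_gt0 x).
apply: ler_pM; rewrite ?exprn_ge0//.
 apply: lerXn2r; [exact: e0|by pos|].
 by rewrite lerD2l (le_trans ax)// ler_norm.
by rewrite normr_prod; apply: ler_prod => i _; rewrite normr_ge0; exact: (HM i).2.
Qed.

(** The product formula at hand concerns nonnegative factors, so each factor is split into positive
    and negative part and the product is expanded over all sign patterns. *)
Lemma Rint_tens (e : sfun) (a c : R) : swf e -> ssupp a e ->
 (\int[@lebesgue_measure R]_x (sev e x)%:E = c%:E)%E ->
 \int[L]_x tens (fun=> e) x = c ^+ n.
move=> we se ec.
have [M M0 HM] := ssupp_bounded we se.
pose g (b : bool) (x : R) : R := if b then Num.max (sev e x) 0 else Num.max (- sev e x) 0.
have ms := sev_measurable we.
have mg b : measurable_fun setT (g b).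
 case: b; apply: measurable_maxr => //; exact: measurableT_comp.
have g0 b x : 0 <= g b x by case: b; rewrite le_max lexx orbT.
have ie : (@lebesgue_measure R).-integrable setT (EFin \o sev e).
 have iI : (@lebesgue_measure R).-integrable setT (EFin \o \1_(`[- `|a|, `|a|]%classic : set R)).
 by apply: inte_indic_fin => //; exact: lebesgue_itv_fin.
 apply: (le_integrable measurableT _ _ (integrableZl measurableT M iI)); first exact/measurable_EFinP.
 move=> x _; rewrite lee_fin [leRHS]ger0_norm ?mulr_ge0// indicE mem_setE in_itv/= -ler_norml.
 have [xa|xa] := leP `|x| `|a|; first by rewrite mulr1.
 by rewrite se ?normr0 ?mulr0// (le_lt_trans (ler_norm a)).
have [cb cbE] : exists cb : bool -> R, forall b, (\int[@lebesgue_measure R]_x (g b x)%:E = (cb b)%:E)%E.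
 exists (fun b => fine (\int[@lebesgue_measure R]_x (g b x)%:E)%E) => b; rewrite fineK//.
 have ib : (@lebesgue_measure R).-integrable setT (EFin \o g b).
 apply: (le_integrable measurableT _ _ ie); first by apply/measurable_EFinP; exact: mg.
 move=> x _; rewrite lee_fin ger0_norm//; case: b; rewrite ge_max normr_ge0 andbT ?ler_norm//.
 by rewrite -normrN ler_norm.
 exact: (integrable_fin_num measurableT ib).
have cE : c = cb true - cb false.
 suff : c%:E = ((cb true)%:E - (cb false)%:E)%E by move=> [].
 rewrite -ec -!cbE integralE; congr (_ - _)%E; apply: eq_integral => x _.
 by rewrite funeposE EFin_max.
 by rewrite funenegE EFin_max.
pose sg (b : bool) : R := if b then 1 else -1.
have eE x : sev e x = \sum_(b : bool) sg b * g b x.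
 rewrite big_bool/= mul1r mulN1r; case: (leP (sev e x) 0) => h.
 by rewrite max_l ?oppr_ge0// sub0r opprK.
 by rewrite max_r ?subr0// oppr_le0.
have tE x : tens (fun=> e) x = \sum_(F : {ffun 'I_n -> bool})
 (\prod_i sg (F i)) * \prod_i g (F i) (x ord0 i).
 rewrite /tens (eq_bigr (fun i : 'I_n => \sum_(b : bool) sg b * g b (x ord0 i))); last first.
 by [].
 rewrite bigA_distr_bigA/=; apply: eq_bigr => F _; by rewrite big_split.
have iF (F : {ffun 'I_n -> bool}) : inte (fun x => \prod_i g (F i) (x ord0 i)) /\
 \int[L]_x \prod_i g (F i) ((x : Rn) ord0 i) = \prod_i cb (F i).
 have nE := @nnint_tensor R n (fun i => g (F i)) (fun i => cb (F i)) (fun i => mg _) (fun i => g0 _) (fun i => cbE _).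
 have mt : mfun ((fun x : Rn => \prod_i g (F i) (x ord0 i))).
 by apply/measurable_EFinP; apply: borelfun_measurable; apply: (borelfun_tensor (g := fun i => g (F i))) => i.
 rewrite nnintE in nE; last 2 first.
 - by move=> x; rewrite lee_fin; apply: prodr_ge0 => i.
 - exact/measurable_EFinP.
 split; last by rewrite /Rintegral nE.
 apply/integrableP; split; first exact/measurable_EFinP.
 rewrite (eq_integral (fun x : RL R n => (\prod_i g (F i) ((x : Rn) ord0 i))%:E)); last first.
 by move=> x /=; rewrite ger0_norm//; apply: prodr_ge0 => i.
 by rewrite nE ltry.
rewrite (eq_Rintegral _ (f := fun x : RL R n => tens (fun=> e) x) (g := fun x : RL R n => \sum_(F : {ffun 'I_n -> bool})
 (\prod_i sg (F i)) * \prod_i g (F i) ((x : Rn) ord0 i)))//.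
have [_ ->] := @inte_sum _ (index_enum {ffun 'I_n -> bool}) (fun F x => (\prod_i sg (F i)) * \prod_i g (F i) (x ord0 i))
 (fun F => inteZ _ (iF F).1).
rewrite (eq_bigr (fun F : {ffun 'I_n -> bool} => \prod_i (sg (F i) * cb (F i)))); last first.
 by move=> F _; rewrite RintegralZl ?(iF F).2 ?big_split//; exact: (iF F).1.
rewrite -(@bigA_distr_bigA _ _ _ _ _ _ _ (fun=> fun b => sg b * cb b)).
by rewrite prodr_const card_ord big_bool/= mul1r mulN1r cE.
Qed.
End tensor.

(** * Tempered distributions *)

Section tempered_facts.
Variable f : @distr R n.
Hypothesis tf : tempered f.

Lemma tempered0 : f (fun=> 0) = 0.
have := tf.1 1 _ _ schwartz0 schwartz0; rewrite (_ : (fun _ => _ + _) = fun=> 0).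
 by rewrite mul1r => /esym/eqP; rewrite -subr_eq0 addrK => /eqP.
by apply/funext => x; rewrite mulr0 addr0.
Qed.

Lemma temperedZ (a : R) psi : schwartz psi -> f (fun x => a * psi x) = a * f psi.
move=> sp; have := tf.1 a _ _ sp schwartz0; rewrite tempered0 addr0 => <-.
by congr f; apply/funext => x; rewrite addr0.
Qed.

Lemma tempered_sum (I : Type) (r : seq I) (c : I -> R) (F : I -> Rn -> R) :
 (forall i, schwartz (F i)) -> f (fun x => \sum_(i <- r) c i * F i x) = \sum_(i <- r) c i * f (F i).
move=> sF; elim: r => [|i r IH].
 rewrite big_nil -[RHS]tempered0; congr f; apply/funext => x; exact: big_nil.
rewrite big_cons -IH -tf.1//; last by have [] := schwartz_sum r c sF.
by congr f; apply/funext => x; rewrite big_cons.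
Qed.

Lemma temperedB psi1 psi2 : schwartz psi1 -> schwartz psi2 ->
 schwartz (fun x => psi1 x - psi2 x) /\ f (fun x => psi1 x - psi2 x) = f psi1 - f psi2.
move=> s1 s2.
have E : (fun x => psi1 x - psi2 x) = (fun x => -1 * psi2 x + psi1 x).
 by apply/funext => x; rewrite mulN1r addrC.
rewrite E; split; first exact: schwartz_comb.
by rewrite tf.1// mulN1r addrC.
Qed.

(** The seminorm is a supremum; here any pointwise bound [v] takes its place, the form in which
    estimates of test functions arise. *)
Lemma tempered_bound : exists (C : R) (k : nat), 0 < C /\ forall psi v, schwartz psi ->
 (forall al x, (size al <= k)%N -> (1 + enorm x) ^+ k * `|dpart al psi x| <= v) ->
 `|f psi| <= C * v.
have [_ [C [k H]]] := tf; exists (`|C| + 1), k; split => //.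
move=> psi v sp Hv; apply: le_trans (H _ sp) _.
have v0 : 0 <= v.
 apply: le_trans (Hv [::] 0 (leq0n _)); apply: mulr_ge0 => //; apply: exprn_ge0.
have s0 : 0 <= seminorm k psi.
 apply: (le_via ((1 + enorm (0 : Rn)) ^+ k * `|dpart [::] psi 0|)).
 by pos.
 apply: ub_le_sup; last by exists 0, [::].
 by exists v => _ [x [al [sal ->]]]; exact: Hv.
apply: (le_via ((`|C| + 1) * seminorm k psi)).
 by rewrite ler_wpM2r// (le_trans (ler_norm C))// lerDl.
rewrite ler_wpM2l//; apply: ge_sup.
 by exists ((1 + enorm (0 : Rn)) ^+ k * `|dpart [::] psi 0|), 0, [::].
by move=> _ [x [al [sal ->]]]; exact: Hv.
Qed.
End tempered_facts.

(** * Riemann sums and distributions applied to integrals of test functions *)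

Section cells.

Lemma measurable_coord (i : 'I_n) : mfun (fun x : Rn => x ord0 i).
apply: econt_meas; apply: (@econt_lip _ 1) => x y; rewrite mul1r.
by have := enorm_coord (x - y) i; rewrite !mxE.
Qed.

(** Half-open cubes of side [eps/(n+1)] tile the cube of half-side [A >= 1/eps]; a point is within
    [eps] of the corner of its cell, and a point in no cell is far from the origin. Half-openness
    makes the cell unique. *)
Lemma cells (eps : R) : 0 < eps -> exists (I : finType) (E : I -> set Rn) (p : I -> Rn),
 (forall c, mset (E c) /\ (leb (E c) < +oo)%E) /\
 forall y, (exists c, [/\ E c y, enorm (y - p c) <= eps & forall c', E c' y -> c' = c]) \/
 ((forall c, ~ E c y) /\ eps^-1 <= enorm y).
move=> e0; pose d := eps / n.+1%:R.
have d0 : 0 < d by pos.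
pose Q := (Num.truncn ((eps * d)^-1)).+1; pose A := Q%:R * d.
have A0 : eps^-1 <= A.
 rewrite -ler_pdivrMr// -invfM ltW//; exact: truncnS_gt.
pose I : finType := {ffun 'I_n -> 'I_(Q.*2)}.
pose p (c : I) : Rn := \row_i (- A + (c i)%:R * d).
pose E (c : I) : set Rn := [set y | forall i, p c ord0 i <= y ord0 i < p c ord0 i + d].
exists I, E, p; split => [c|y].
 have mE : mset (E c).
 have -> : E c = \bigcap_(i in [set: 'I_n]) [set y : Rn | p c ord0 i <= y ord0 i < p c ord0 i + d].
 by apply/seteqP; split => y h i *; exact: h.
 apply: fin_bigcap_measurable => //.
 move=> i _; have := measurable_coord i measurableT (measurable_itv `[p c ord0 i, p c ord0 i + d[).
 by rewrite setTI; congr measurable; apply/seteqP; split => /=; rewrite in_itv.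
 split => //; apply: (@le_lt_trans _ _ (leb (cube (p c) d))); last by rewrite leb_cube ?ltry.
 apply: le_leb => //; first by apply: borel_lebRn; exact: borel_cube.
 by move=> y h i; have /andP[h1 h2] := h i; apply/andP; split; lra.
have [H|H] := pselect (forall i, - A <= y ord0 i < A); last first.
 right; have [i Hi] : exists i, ~ (- A <= y ord0 i < A) by apply/existsNP.
 split => [c h|]; last first.
 apply: le_trans A0 _; apply: le_trans (enorm_coord y i).
 rewrite leNgt; apply/negP => yA; apply: Hi.
 by move: yA; rewrite ltr_norml => /andP[h1 h2]; rewrite (ltW h1).
 apply: Hi; have := h i; rewrite !mxE => /andP[h1 h2].
 have c0 : 0 <= (c i)%:R * d by pos.
 have c1 : (c i)%:R * d + d <= 2 * A.
 rewrite -[X in _ + X]mul1r -mulrDl natr1 /A mulrA ler_wpM2r//.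
 by rewrite -natrM ler_nat mul2n.
 by apply/andP; split; lra.
left; pose m i := Num.truncn ((y ord0 i + A) / d).
have yA i : 0 <= (y ord0 i + A) / d.
 by have /andP[h1 h2] := H i; rewrite divr_ge0; lra.
have mP i : (m i)%:R * d <= y ord0 i + A < (m i)%:R * d + d.
 have /andP[h1 h2] := truncn_itv (yA i).
 rewrite -ler_pdivlMr// h1/=; move: h2; rewrite ltr_pdivrMr// -natr1 mulrDl mul1r; exact.
have mQ i : (m i < Q.*2)%N.
 rewrite -(ltr_nat R) -mul2n natrM -(ltr_pM2r d0) -mulrA -/A.
 by have := H i; have := mP i; lra.
pose c : I := [ffun i => Ordinal (mQ i)].
have cE i : p c ord0 i = - A + (m i)%:R * d by rewrite mxE ffunE.
exists c; split.
- by move=> i; rewrite cE; have /andP[h1 h2] := mP i; apply/andP; split; lra.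
- apply: le_trans (enorm_le_sum _) _.
 apply: (le_via (\sum_(i < n) d)).
 apply: ler_sum => i _; rewrite 2!mxE cE ler_norml.
 by have /andP[h1 h2] := mP i; apply/andP; split; lra.
 rewrite sumr_const card_ord -mulr_natr mulrAC ler_pdivrMr// ler_wpM2l//.
 by rewrite ler_nat.
- move=> c' h; apply/ffunP => i; apply: val_inj; rewrite ffunE /=.
 have := h i; rewrite mxE => /andP[h1 h2]; have /andP[h3 h4] := mP i.
 have lt1 : (c' i)%:R < (m i).+1%:R :> R.
 by rewrite -(ltr_pM2r d0); lra.
 have lt2 : (m i)%:R < (c' i).+1%:R :> R.
 by rewrite -(ltr_pM2r d0); lra.
 by move: lt1 lt2; rewrite !ltr_nat !ltnS => l1 l2; apply/eqP; rewrite eqn_leq l1.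
Qed.

(** The decay has one order more than integrability requires: outside the tiled cube the surplus
    factor is at most [eps], like the error inside. The local Lipschitz condition carries the same
    weight. *)
Definition slip (K : R) (g : Rn -> R) :=
 (forall y, (1 + enorm y) ^+ n.+2 * `|g y| <= K) /\
 (forall y y', enorm (y' - y) <= 1 -> (1 + enorm y) ^+ n.+2 * `|g y' - g y| <= K * enorm (y' - y)).

Lemma slip_econt K g : slip K g -> econt g.
move=> [_ H] x e e0; exists (Num.min 1 (e / (`|K| + 1))).
 by rewrite lt_min ltr01 divr_gt0.
move=> y; rewrite lt_min => /andP[y1]; rewrite ltr_pdivlMr// => y2.
apply: le_lt_trans y2; apply: le_trans (_ : (1 + enorm x) ^+ n.+2 * `|g y - g x| <= _).
 by rewrite ler_peMl// exprn_ege1// enorm1_ge1.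
apply: le_trans (H _ _ (ltW y1)) _; rewrite mulrC ler_wpM2l//.
by rewrite (le_trans (ler_norm K))// lerDl.
Qed.

Lemma slip_meas K g : slip K g -> mfun g.
by move=> /slip_econt; exact: econt_meas. Qed.

Lemma slip_inte K g : slip K g -> inte g.
move=> sg; have [B B0 HB] := @inte_decay.
have [] // := HB g K (slip_meas sg) _ => x; apply: le_trans (sg.1 x).
rewrite ler_wpM2r//; apply: ler_weXn2l => //; exact: enorm1_ge1.
Qed.

(** Nodes and masses are chosen before [g], and the error depends on [g] through [K] alone. Applied
    to all derivatives of a family of test functions at all points, one Riemann sum therefore
    approximates in a Schwartz seminorm. *)
Lemma cells_sum : exists2 B : R, 0 < B & forall eps : R, 0 < eps <= 1 ->
 exists (I : finType) (m : I -> R) (p : I -> Rn), forall K g, slip K g ->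
 `|\int[L]_y g y - \sum_c m c * g (p c)| <= B * (K * eps).
have [B B0 HB] := @inte_decay; exists (2 ^+ n.+2 * B) => //.
move=> eps /andP[e0 e1]; have [I [E [p [mE cE]]]] := cells e0.
exists I, (fun c => fine (leb (E c))), p => K g sg.
have K0 : 0 <= K.
 apply: le_trans (sg.1 0); apply: mulr_ge0 => //; apply: exprn_ge0; exact: ltW.
have iE c : inte (\1_(E c)).
 by apply: inte_indic_fin; [exact: (mE c).1|exact: (mE c).2].
have [iS SE] := inte_sum (index_enum I) (fun c => inteZ (g (p c)) (iE c)).
have -> : \sum_c fine (leb (E c)) * g (p c) = \int[L]_y (\sum_c g (p c) * \1_(E c) y).
 rewrite SE; apply: eq_bigr => c _; rewrite RintegralZl//; last exact: iE.
 rewrite mulrC; congr (_ * _); rewrite /Rintegral integral_indic ?setIT//; exact: (mE c).1.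
have ig := slip_inte sg; rewrite -RintegralB//.
suff [j1 j2] : inte (fun y => g y - \sum_c g (p c) * \1_(E c) y) /\
 \int[L]_y `|g y - \sum_c g (p c) * \1_(E c) y| <= B * (2 ^+ n.+2 * (K * eps)).
 apply: le_trans (le_normr_Rintegral measurableT (inteB ig iS)) _.
 by apply: le_trans j2 _; rewrite mulrCA mulrA.
apply: (HB _ _ (inte_meas (inteB ig iS))) => y; have y0 := enorm1_gt0 y; have y1 := enorm1_ge1 y.
have ke : 0 <= K * eps by pos.
have [[c [Ec yp uc]]|[nE ye]] := cE y.
 have -> : \sum_c0 g (p c0) * \1_(E c0) y = g (p c).
 rewrite (bigD1 c)//= indicE mem_set// mulr1 big1 ?addr0// => c' cc'.
 by rewrite indicE memNset ?mulr0// => /uc c'c; rewrite c'c eqxx in cc'.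
 have yp1 : enorm (y - p c) <= 1 by exact: le_trans e1.
 have h := sg.2 _ _ yp1.
 have : (1 + enorm y) ^+ n.+2 <= 2 ^+ n.+2 * (1 + enorm (p c)) ^+ n.+2.
 rewrite -exprMn; apply: lerXn2r; first exact: ltW.
 by pos.
 have := enorm_dist3 y (p c) 0; rewrite !subr0; have := enorm_ge0 (p c); lra.
 move=> h2; apply: (le_via ((1 + enorm y) ^+ n.+2 * `|g y - g (p c)|)).
 by rewrite ler_wpM2r//; apply: ler_weXn2l.
 apply: le_trans (ler_wpM2r (normr_ge0 _) h2) _; rewrite -mulrA ler_wpM2l//.
 by apply: le_trans h _; rewrite ler_wpM2l.
have -> : \sum_c0 g (p c0) * \1_(E c0) y = 0.
 by rewrite big1// => c _; rewrite indicE memNset ?mulr0//; exact: nE.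
rewrite subr0; apply: (le_via (K * eps)); last first.
 by rewrite ler_peMl// exprn_ege1// ler1n.
have := sg.1 y; rewrite exprS -mulrA => h.
rewrite -ler_pdivrMr//; apply: le_trans h; rewrite mulrC ler_wpM2r//.
by apply: le_trans ye _; rewrite lerDr.
Qed.

Variable f : @distr R n.
Hypothesis tf : tempered f.

(** A distribution commutes with finite Riemann sums by linearity. They converge to [W] in the
    seminorm that controls [f], and the same nodes give the integral of [f (w y)], which is again a
    decaying Lipschitz function of [y]. *)
Lemma tempered_Rint (w : Rn -> Rn -> R) (W : Rn -> R) :
 (forall y, schwartz (w y)) -> schwartz W ->
 (forall al x, dpart al W x = \int[L]_y dpart al (w y) x) ->
 (forall k, exists K : R, forall al x, (size al <= k)%N ->
 slip K (fun y => (1 + enorm x) ^+ k * dpart al (w y) x)) ->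
 inte (fun y => f (w y)) /\ f W = \int[L]_y f (w y).
move=> sw sW dW H; have [C [k [C0 HC]]] := tempered_bound tf.
have [K HK] := H k.
have e0 (x : Rn) N : 0 <= (1 + enorm x) ^+ N by pos.
have sf : slip (C * K) (fun y => f (w y)).
 split => [y|y y' yy].
 rewrite -ler_pdivlMl; last by rewrite exprn_gt0// enorm1_gt0.
 rewrite mulrC -mulrA; apply: HC => // al x sal.
 rewrite ler_pdivlMr; last by rewrite exprn_gt0// enorm1_gt0.
 by have := (HK al x sal).1 y; rewrite normrM ger0_norm// mulrC.
 have [s1 <-] := temperedB tf (sw y') (sw y).
 rewrite -ler_pdivlMl; last by rewrite exprn_gt0// enorm1_gt0.
 rewrite mulrC -!mulrA; apply: HC => // al x sal.
 have [_ d] := smooth_comb (-1) (sw y).1 (sw y').1.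
 have -> : (fun x0 => w y' x0 - w y x0) = (fun x0 => -1 * w y x0 + w y' x0).
 by apply/funext => z; rewrite mulN1r addrC.
 rewrite d mulN1r [- _ + _]addrC mulrA ler_pdivlMr; last by rewrite exprn_gt0// enorm1_gt0.
 have := (HK al x sal).2 y y' yy.
 by rewrite -mulrBr normrM [`|(1 + _) ^+ _|]ger0_norm// => h; rewrite [leLHS]mulrC.
have isf := slip_inte sf; split => //.
have [B B0 HB] := cells_sum.
apply/eqP; rewrite -subr_eq0 -normr_le0; apply/ler_addgt0Pl => e e_gt0; rewrite addr0.
have K0 : 0 <= K.
 apply: le_trans ((HK [::] 0 (leq0n _)).1 0); apply: mulr_ge0 => //; exact: e0.
pose eps := Num.min 1 (e / (2 * (B * (C * K)) + 1)).
have q0 : 0 < 2 * (B * (C * K)) + 1 by rewrite ltr_wpDl.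
have eps0 : 0 < eps by rewrite lt_min ltr01 divr_gt0.
have eps1 : eps <= 1 by rewrite ge_min lexx.
have epsE : 2 * (B * (C * K)) * eps <= e.
 apply: (le_via ((2 * (B * (C * K)) + 1) * eps)); first by rewrite ler_wpM2r// lerDl.
 by rewrite mulrC -ler_pdivlMr// ge_min lexx orbT.
have [|I [m [p Hp]]] := HB eps; first by rewrite eps0.
have [sS dS] := schwartz_sum (index_enum I) m (fun c => sw (p c)).
have h1 := Hp _ _ sf.
have fS := tempered_sum tf (index_enum I) m (fun c => sw (p c)).
have h2 : `|f W - f (fun x => \sum_c m c * w (p c) x)| <= C * (B * (K * eps)).
 have [s1 <-] := temperedB tf sW sS; apply: HC => // al x sal.
 have [_ d] := smooth_comb (-1) sS.1 sW.1.
 have -> : (fun x0 => W x0 - \sum_c m c * w (p c) x0) = (fun x0 => -1 * (\sum_c m c * w (p c) x0) + W x0).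
 by apply/funext => z; rewrite mulN1r addrC.
 rewrite d dS mulN1r [- _ + _]addrC dW -[X in X * _]ger0_norm// -normrM mulrBr mulr_sumr.
 have := Hp _ _ (HK al x sal).
 rewrite RintegralZl//; last first.
 have := slip_inte (HK al x sal); move=> /(inteZ ((1 + enorm x) ^- k)).
 congr inte; apply/funext => y; rewrite mulrA mulVf ?mul1r//.
 by rewrite gt_eqF// exprn_gt0// enorm1_gt0.
 rewrite (eq_bigr (fun i => (1 + enorm x) ^+ k * (m i * dpart al (w (p i)) x)))// => i _.
 by rewrite mulrCA.
rewrite fS in h2; move: h1 h2; set a := \int[L]_y _; set b := \sum_c _ => h1 h2.
have -> : f W - a = (f W - b) - (a - b) by ring.
apply: le_trans (ler_normB _ _) _; apply: le_trans (lerD h2 h1) _; apply: le_trans epsE.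
by apply: le_of_eq; ring.
Qed.
End cells.

(** * Differentiation under the integral and convolution with dilated kernels *)

Lemma jap_ge0 (x : Rn) N : 0 <= (1 + enorm x) ^+ N.
by pos. Qed.

Lemma jap_gt0 (x : Rn) N : 0 < (1 + enorm x) ^+ N.
by apply: exprn_gt0; exact: enorm1_gt0. Qed.

Lemma taylor1 (g g1 g2 : R -> R) (K h : R) : (forall s : R, is_derive s 1 g (g1 s)) ->
 (forall s : R, is_derive s 1 g1 (g2 s)) -> (forall s, `|g2 s| <= K) ->
 `|g h - g 0 - h * g1 0| <= K * h ^+ 2.
move=> d1 d2 HK; pose r s := g s - s * g1 0.
have dr (s : R) : is_derive s 1 r (g1 s - g1 0).
 have dl : is_derive s 1 (fun z : R => z * g1 0) (g1 0).
 apply: (@is_derive_quad _ _ _ 0 1) => // z _.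
 by rewrite mul0r normr_le0; apply/eqP; ring.
 exact: (is_deriveB (d1 s) dl).
have -> : g h - g 0 - h * g1 0 = r h - r 0 by rewrite /r; ring.
apply: le_trans (mvt1 (K := K * `|h|) dr _) _ => [s sh|]; last first.
 by rewrite subr0 -mulrA -expr2 real_normK// num_real.
apply: le_trans (mvt1 d2 (fun z _ => HK z)) _; rewrite subr0 ler_wpM2l//.
 by apply: le_trans (HK 0).
move: sh; case: (leP 0 h) => h0 /andP[h1 h2]; rewrite ler_norml.
 by rewrite (ger0_norm h0); lra.
by rewrite (ltr0_norm h0); lra.
Qed.

(** The bound on two further derivatives gives a second-order Taylor estimate with constant
    [C eta y]; integrated over [y] it becomes the quadratic error bound of [is_derive_quad], so no
    limit is exchanged with the integral. *)
Lemma dui (w : Rn -> Rn -> R) (eta : Rn -> R) : (forall y, smooth (w y)) ->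
 (forall al x, mfun ((fun y => dpart al (w y) x))) ->
 inte eta -> (forall al, exists C : R, forall x y, `|dpart al (w y) x| <= C * eta y) ->
 smooth (fun x => \int[L]_y w y x) /\
 forall al, dpart al (fun x => \int[L]_y w y x) = fun x => \int[L]_y dpart al (w y) x.
move=> sw mw ie H.
have iw al x : inte (fun y => dpart al (w y) x).
 have [C HC] := H al; apply: (inte_le (mw al x)) (inteZ C ie) => y; exact: HC.
apply: (@dparts _ (fun al x => \int[L]_y dpart al (w y) x)) => // al i x.
apply/is_derive_line0; have [C HC] := H [:: i, i & al].
apply: (@is_derive_quad _ _ _ (C * \int[L]_y eta y) 1) => // h _.
rewrite add0r scale0r addr0 -RintegralZl//; last exact: iw.
rewrite -RintegralB//; [|exact: iw|exact: iw].
rewrite -RintegralB//; [|by apply: inteB; exact: iw|by apply: inteZ; exact: iw].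
have -> : C * \int[L]_y eta y * h ^+ 2 = \int[L]_y (C * h ^+ 2 * eta y).
 by rewrite RintegralZl// mulrAC.
apply: ler_norm_Rint; [|exact: inteZ|] => [|y].
 by apply: inteB; [apply: inteB; exact: iw|apply: inteZ; exact: iw].
have := @taylor1 (fun s => dpart al (w y) (x + s *: e_ i)) (fun s => dpart (i :: al) (w y) (x + s *: e_ i))
 (fun s => dpart [:: i, i & al] (w y) (x + s *: e_ i)) (C * eta y) h.
rewrite scale0r addr0 => T; rewrite mulrAC; apply: T => s; last exact: HC.
 by apply: isder_line; exact: smooth_isder.
by apply: isder_line; exact: smooth_isder.
Qed.

Lemma smooth_dpart (f : Rn -> R) al : smooth f ->
 smooth (dpart al f) /\ forall be, dpart be (dpart al f) = dpart (be ++ al) f.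
by move=> sf; apply: dparts => // i; exact: smooth_isder. Qed.

Lemma measurable_jap N : mfun ((fun x : Rn => (1 + enorm x) ^+ N)).
apply: measurable_funX; apply: measurable_funD => //.
by apply: econt_meas; exact: econt_enorm.
Qed.

Lemma schwartz_winte (f : Rn -> R) N : schwartz f -> inte (fun x => (1 + enorm x) ^+ N * f x).
move=> sf; have [C C0 HC] := schwartz_decay [::] (n.+1 + N) sf.
have [K K0 HK] := @inte_decay.
have [] // := HK (fun x => (1 + enorm x) ^+ N * f x) C _ _.
 by apply: measurable_funM; [exact: measurable_jap|exact: (schwartz_meas [::] sf)].
move=> x; rewrite normrM ger0_norm// mulrA -exprD; exact: HC.
Qed.

(** The transpose of [f -> f * Phi_t]: the kernel appears reflected, which is why the argument is
    [x + t u]. *)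
Definition conv (Phi : Rn -> R) (t : R) (psi : Rn -> R) : Rn -> R :=
 fun x => \int[L]_u (Phi u * psi (x + t *: u)).

Lemma conv_dpart Phi t psi : t != 0 -> schwartz Phi -> schwartz psi ->
 smooth (conv Phi t psi) /\ forall al, dpart al (conv Phi t psi) = conv Phi t (dpart al psi).
move=> t0 sP sp.
pose w (u : Rn) : Rn -> R := fun x => Phi u * psi (1 *: x + t *: u).
have wE u al : dpart al (w u) = fun x => Phi u * dpart al psi (x + t *: u).
 have [s d] := smooth_affine 1 (t *: u) sp.1.
 by rewrite dpartZ// d; apply/funext => x; rewrite expr1n mul1r scale1r.
have [||||s d] := @dui w (fun u => `|Phi u|).
- move=> u; have [s _] := smooth_affine 1 (t *: u) sp.1.
 have [s2 _] := smooth_comb (Phi u) s smooth0.1.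
 have -> // : w u = fun x => Phi u * psi (1 *: x + t *: u) + 0.
 by apply/funext => x; rewrite addr0.
- move=> al x; under eq_fun do rewrite wE.
 apply: measurable_funM; first exact: (schwartz_meas [::] sP).
 have h := econt_meas (econt_comp_affine t x (schwartz_econt al sp)).
 by apply: eq_measurable_fun h => u _; rewrite addrC.
- exact: inte_abs (schwartz_inte [::] sP).
- move=> al; have [C C0 HC] := schwartz_decay al 0 sp; exists C => x u; rewrite wE normrM mulrC.
 by rewrite ler_wpM2r; have := HC (x + t *: u); rewrite mul1r.
have E : conv Phi t psi = fun x => \int[L]_u w u x.
 by apply/funext => x; apply: eq_Rintegral => u _; rewrite /w scale1r.
rewrite E; split => // al; rewrite d; apply/funext => x.
by apply: eq_Rintegral => u _; rewrite wE.
Qed.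

Lemma one_enorm_le (x u : Rn) (t : R) : 0 <= t ->
 1 + enorm x <= (1 + enorm (x + t *: u)) * ((1 + t) * (1 + enorm u)).
move=> t0; apply: le_trans (one_enorm_mul x (x + t *: u)) _.
rewrite ler_wpM2l//.
have -> : x - (x + t *: u) = - (t *: u) by rewrite opprD addNKr.
rewrite enormN enormZ ger0_norm; have := enorm_ge0 u; nra.
Qed.

Lemma inte_conv (Phi : Rn -> R) (t : R) (psi : Rn -> R) al (x : Rn) : schwartz Phi -> schwartz psi ->
 inte (fun u => Phi u * dpart al psi (x + t *: u)).
move=> sP sp; have [C C0 HC] := schwartz_decay al 0 sp.
apply: (inte_le _ _ (inteZ C (inte_abs (schwartz_inte [::] sP)))) => [|u].
 apply: measurable_funM; first exact: (schwartz_meas [::] sP).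
 have h := econt_meas (econt_comp_affine t x (schwartz_econt al sp)).
 by apply: eq_measurable_fun h => u _; rewrite addrC.
rewrite normrM mulrC ler_wpM2r//.
by have := HC (x + t *: u); rewrite mul1r.
Qed.

Lemma schwartz_conv Phi t psi : 0 < t -> schwartz Phi -> schwartz psi -> schwartz (conv Phi t psi).
move=> t0 sP sp; have [s d] := conv_dpart (lt0r_neq0 t0) sP sp; split => // al N.
have [C C0 HC] := schwartz_decay al N sp.
have iw := schwartz_winte N sP.
exists (C * (1 + t) ^+ N * \int[L]_u `|(1 + enorm u) ^+ N * Phi u|) => x; rewrite d.
have x0 (z : Rn) : 0 <= (1 + enorm z) ^+ N by pos.
rewrite -[X in X * _]ger0_norm// -normrM -[X in `|X| <= _]RintegralZl//; last exact: (inte_conv t al x sP sp).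
rewrite -RintegralZl//; last exact: inte_abs.
apply: ler_norm_Rint; [by apply: inteZ; exact: inte_conv|by apply: inteZ; exact: inte_abs|].
move=> u; rewrite !normrM ![`|_ ^+ N|]ger0_norm//.
have t1 : 0 <= 1 + t by pos.
apply: (le_via (((1 + enorm (x + t *: u)) * ((1 + t) * (1 + enorm u))) ^+ N *
 (`|Phi u| * `|dpart al psi (x + t *: u)|))).
 rewrite ler_wpM2r//; apply: lerXn2r.
 - exact: ltW (enorm1_gt0 _).
 - by pos.
 - by apply: one_enorm_le; exact: ltW.
rewrite !exprMn; have := HC (x + t *: u).
move: ((1 + enorm (x + t *: u)) ^+ N) ((1 + t) ^+ N) (exprn_ge0 N t1) (x0 u) `|dpart _ _ _| `|Phi u| (normr_ge0 (Phi u)).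
move: ((1 + enorm u) ^+ N) => a b c c0 a0 e p p0 h.
have -> : b * (c * a) * (p * e) = b * e * (c * (a * p)) by ring.
by rewrite -[leRHS]mulrA ler_wpM2r.
Qed.

(** The mean value bound controls [psi(x + t u) - psi(x)] by [t |u|] times a derivative at a point
    near [x]; moving the decay weight from there to [x] costs powers of [1 + |u|], which [Phi]
    absorbs. *)
Lemma conv_approx Phi psi k : schwartz Phi -> schwartz psi -> \int[L]_u Phi u = 1 ->
 exists2 C : R, 0 < C & forall t al x, 0 < t <= 1 -> (size al <= k)%N ->
 (1 + enorm x) ^+ k * `|conv Phi t (dpart al psi) x - dpart al psi x| <= C * t.
move=> sP sp P1; have [C C0 HC] := schwartz_decayn k.+1 k sp.
have iw := inte_abs (schwartz_winte k.+1 sP).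
pose I := \int[L]_u `|(1 + enorm u) ^+ k.+1 * Phi u|.
have I0 : 0 <= I by apply: Rintegral_ge0.
exists (n%:R * C * I + 1); first by rewrite ltr_wpDl.
move=> t al x /andP[t0 t1] sal.
have x0 N (z : Rn) : 0 <= (1 + enorm z) ^+ N by pos.
have iP := schwartz_inte [::] sP.
have -> : dpart al psi x = \int[L]_u (dpart al psi x * Phi u) by rewrite RintegralZl// P1 mulr1.
rewrite -RintegralB//; [|exact: inte_conv|exact: inteZ].
rewrite -[X in X * _]ger0_norm// -normrM -RintegralZl//; last first.
 by apply: inteB; [exact: inte_conv|exact: inteZ].
apply: (le_via (n%:R * C * t * I)); last by rewrite mulrDl mulrAC lerDl.
rewrite -RintegralZl//; apply: ler_norm_Rint => [||u].
- by apply: inteZ; apply: inteB; [exact: inte_conv|exact: inteZ].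
- exact: inteZ.
have -> : Phi u * dpart al psi (x + t *: u) - dpart al psi x * Phi u =
 (dpart al psi (x + t *: u) - dpart al psi x) * Phi u by ring.
rewrite !normrM ![`|_ ^+ _|]ger0_norm// mulrA [leRHS]mulrA ler_wpM2r//.
have D := @mvt_bound (dpart al psi) (fun i => dpart (i :: al) psi) x (x + t *: u)
 (C * (1 + enorm u) ^+ k / (1 + enorm x) ^+ k) (fun i => smooth_isder al i sp.1).
have xk : 0 < (1 + enorm x) ^+ k by rewrite exprn_gt0// enorm1_gt0.
have -> : n%:R * C * t * (1 + enorm u) ^+ k.+1 =
 (1 + enorm x) ^+ k * (n%:R * (C * (1 + enorm u) ^+ k / (1 + enorm x) ^+ k) * (t * (1 + enorm u))).
 rewrite exprSr; move: ((1 + enorm x) ^+ k) ((1 + enorm u) ^+ k) xk => a b xk; field; exact: lt0r_neq0.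
rewrite ler_wpM2l//; apply: le_trans (D _) _ => [i z|].
 rewrite addrAC subrr add0r enormZ (gtr0_norm t0) => zx.
 have zu : enorm (z - x) <= enorm u by apply: le_trans zx _; rewrite ler_piMl.
 rewrite ler_pdivlMr// mulrC.
 have h := HC (i :: al) sal z.
 apply: (le_via (((1 + enorm z) * (1 + enorm u)) ^+ k * `|dpart (i :: al) psi z|)).
 rewrite ler_wpM2r//; apply: lerXn2r.
 - exact: ltW (enorm1_gt0 _).
 - by pos.
 - apply: le_trans (one_enorm_mul x z) _; rewrite ler_wpM2l//.
 by rewrite lerD2l enormB.
 by rewrite exprMn mulrAC ler_wpM2r.
have -> : x + t *: u - x = t *: u by rewrite addrAC subrr add0r.
rewrite enormZ (gtr0_norm t0) ler_wpM2l//.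
by rewrite ler_wpM2l// lerDr.
Qed.

(** * The functions obtained by convolving a distribution with a dilated kernel *)

Section pairing.

Lemma one_enorm_le2 (y z : Rn) : enorm (z - y) <= 1 -> 1 + enorm y <= 2 * (1 + enorm z).
move=> zy; have := enorm_dist3 y z 0; rewrite !subr0 [enorm (y - z)]enormB.
by have := enorm_ge0 z; lra.
Qed.

Lemma slip_isder g (dg : 'I_n -> Rn -> R) (K1 K2 : R) : (forall i, isder g i (dg i)) ->
 0 <= K1 -> 0 <= K2 ->
 (forall y, (1 + enorm y) ^+ n.+2 * `|g y| <= K1) ->
 (forall i y, (1 + enorm y) ^+ n.+2 * `|dg i y| <= K2) -> slip (K1 + n%:R * (2 ^+ n.+2 * K2)) g.
move=> D K10 K20 H1 H2; split => [y|y y' yy].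
 by apply: le_trans (H1 y) _; rewrite lerDl; pos.
have h : `|g y' - g y| <= n%:R * (2 ^+ n.+2 * K2 / (1 + enorm y) ^+ n.+2) * enorm (y' - y).
 apply: (mvt_bound D) => i z zy; rewrite ler_pdivlMr ?jap_gt0// mulrC.
 have zy1 := le_trans zy yy.
 apply: (le_via ((2 * (1 + enorm z)) ^+ n.+2 * `|dg i z|)).
 rewrite ler_wpM2r//; apply: lerXn2r; last exact: one_enorm_le2.
 exact: ltW (enorm1_gt0 _).
 by pos.
 by rewrite exprMn -mulrA ler_wpM2l.
apply: le_trans (ler_wpM2l (jap_ge0 y _) h) _.
have a0 := jap_gt0 y n.+2; move: ((1 + enorm y) ^+ n.+2) (enorm (y' - y)) (enorm_ge0 (y' - y)) a0 => a b b0 a0.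
have -> : a * (n%:R * (2 ^+ n.+2 * K2 / a) * b) = n%:R * (2 ^+ n.+2 * K2) * b.
 by field; exact: lt0r_neq0.
by apply: ler_wpM2r => //; rewrite lerDr.
Qed.

Lemma isderM (g h : Rn -> R) i dg dh : isder g i dg -> isder h i dh ->
 isder (fun x => g x * h x) i (fun x => dg x * h x + g x * dh x).
move=> Dg Dh x; apply: (is_derive_eq (is_deriveM (Dg x) (Dh x))).
by rewrite /GRing.scale/=; ring.
Qed.

Lemma isderZ (a : R) (g : Rn -> R) i dg : isder g i dg -> isder (fun x => a * g x) i (fun x => a * dg x).
by move=> Dg x; apply: (is_derive_eq (is_deriveZ a (Dg x))). Qed.

Lemma isder_affine (a : R) (v : Rn) (g : Rn -> R) i al : smooth g ->
 isder (fun x => dpart al g (a *: x + v)) i (fun x => a * dpart (i :: al) g (a *: x + v)).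
move=> sg; have [s _] := smooth_dpart al sg; have [s1 d1] := smooth_affine a v s.
have := smooth_isder [::] i s1; rewrite (d1 [:: i]); exact.
Qed.

Lemma kernel_bound (Phi : Rn -> R) k m : schwartz Phi -> exists2 C : R, 0 < C &
 forall t x z al, 0 < t -> (size al <= m)%N ->
 (1 + enorm x) ^+ k * `|dpart al Phi (t^-1 *: (z - x))| <= C * ((1 + t) * (1 + enorm z)) ^+ k.
move=> sP; have [C C0 HC] := schwartz_decayn m k sP; exists C => // t x z al t0 sal.
pose u := t^-1 *: (z - x).
have h : 1 + enorm x <= ((1 + t) * (1 + enorm z)) * (1 + enorm u).
 have -> : x = z + t *: (- u).
 by rewrite scalerN scalerA divff ?gt_eqF// scale1r opprB addrC subrK.
 have := one_enorm_le (z + t *: (- u)) u (ltW t0).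
 by rewrite scalerN subrK => /le_trans; apply; rewrite mulrA [X in X * _]mulrC.
apply: (le_via ((((1 + t) * (1 + enorm z)) * (1 + enorm u)) ^+ k * `|dpart al Phi u|)).
 rewrite ler_wpM2r//; apply: lerXn2r => //; first exact: ltW (enorm1_gt0 _).
 by pos.
have z0 := enorm1_gt0 z.
rewrite exprMn -mulrA [leRHS]mulrC ler_wpM2l//.
exact: HC.
Qed.

Variable f : @distr R n.
Hypothesis tf : tempered f.

Definition dilt (Phi : Rn -> R) (t : R) : Rn -> R := fun y => f (dil Phi t y).

Lemma dpart_dilE (Phi : Rn -> R) (t : R) (x y : Rn) al : smooth Phi ->
 dpart al (dil Phi t y) x = t ^- n * (- t^-1) ^+ size al * dpart al Phi (t^-1 *: y + (- (t^-1 *: x))).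
by move=> sP; rewrite dpart_dil// scalerBr. Qed.

Lemma dilc_bound (t : R) k j : 0 < t -> (j <= k)%N ->
 `|t ^- n * (- t^-1) ^+ j| <= t ^- n * (1 + t^-1) ^+ k.
move=> t0 jk; have ti : 0 < t^-1 by pos.
rewrite normrM normrX normrN !gtr0_norm//.
rewrite ler_wpM2l//.
apply: (le_via ((1 + t^-1) ^+ j)).
 by apply: lerXn2r; rewrite ?nnegrE// lerDr.
by apply: ler_weXn2l; rewrite ?lerDl.
Qed.

Lemma dilt_econt Phi t : schwartz Phi -> 0 < t -> econt (dilt Phi t).
move=> sP t0; have [C [k [C0 HC]]] := tempered_bound tf.
have [D D0 HD] := kernel_bound k k.+1 sP.
have ti : 0 < t^-1 by pos.
pose c := t ^- n * (1 + t^-1) ^+ k.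
have c0 : 0 <= c by pos.
move=> y e e0.
pose B := n%:R * (c * (t^-1 * (D * ((1 + t) * (2 * (1 + enorm y))) ^+ k))).
have B0 : 0 <= B.
 by pos.
exists (Num.min 1 (e / (C * B + 1))).
 rewrite lt_min ltr01 divr_gt0//; apply: ltr_wpDl => //; apply: mulr_ge0 => //; exact: ltW.
move=> y'; rewrite lt_min => /andP[y1]; rewrite ltr_pdivlMr; last by apply: ltr_wpDl => //; apply: mulr_ge0 => //; exact: ltW.
move=> y2.
have tn : t != 0 by exact: lt0r_neq0.
have [s1] := temperedB tf (schwartz_dil y' tn sP) (schwartz_dil y tn sP).
rewrite /dilt => <-; apply: le_lt_trans y2.
apply: (le_via (C * (B * enorm (y' - y)))); last first.
 by rewrite mulrA mulrC ler_wpM2l// lerDl.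
apply: HC => // al x sal.
have [_ d] := smooth_comb (-1) (schwartz_dil y tn sP).1 (schwartz_dil y' tn sP).1.
have -> : (fun x0 => dil Phi t y' x0 - dil Phi t y x0) = (fun x0 => -1 * dil Phi t y x0 + dil Phi t y' x0).
 by apply/funext => z; rewrite mulN1r addrC.
rewrite d mulN1r [- _ + _]addrC !dpart_dilE; [|exact: sP.1|exact: sP.1].
rewrite -mulrBr normrM mulrCA.
pose g z := (1 + enorm x) ^+ k * dpart al Phi (t^-1 *: z + (- (t^-1 *: x))).
have Dg i : isder g i (fun z => (1 + enorm x) ^+ k * (t^-1 * dpart (i :: al) Phi (t^-1 *: z + (- (t^-1 *: x))))).
 by apply: isderZ; apply: isder_affine; exact: sP.1.
have h : `|g y' - g y| <= n%:R * (t^-1 * (D * ((1 + t) * (2 * (1 + enorm y))) ^+ k)) * enorm (y' - y).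
 apply: (mvt_bound Dg) => i z zy.
 have zy1 := le_trans zy (ltW y1).
 rewrite normrM [`|_ ^+ k|]ger0_norm// normrM (gtr0_norm ti) mulrCA ler_wpM2l//.
 have := HD t x z (i :: al) t0 sal; rewrite scalerBr => /le_trans; apply.
 rewrite ler_wpM2l//; apply: lerXn2r.
 - by pos.
 - by pos.
 - rewrite ler_wpM2l//; apply: one_enorm_le2; by rewrite enormB.
apply: (le_via (c * `|g y' - g y|)).
 have gE : `|g y' - g y| = (1 + enorm x) ^+ k * `|dpart al Phi (t^-1 *: y' - t^-1 *: x) -
 dpart al Phi (t^-1 *: y - t^-1 *: x)| by rewrite -mulrBr normrM ger0_norm.
 rewrite gE; apply: ler_wpM2r => //.
 exact: dilc_bound.
apply: le_trans (ler_wpM2l c0 h) _; rewrite /B.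
by apply: le_of_eq; ring.
Qed.

Lemma dilt_growth Phi : schwartz Phi -> exists (C : R) (k : nat), 0 < C /\
 forall t y, 1 <= t -> `|dilt Phi t y| <= C * ((1 + t) * (1 + enorm y)) ^+ k.
move=> sP; have [C [k [C0 HC]]] := tempered_bound tf.
have [D D0 HD] := kernel_bound k k sP.
exists (C * (2 ^+ k * D)), k; split => //.
move=> t y t1; have t0 : 0 < t by apply: lt_le_trans.
have tn : t != 0 by exact: lt0r_neq0.
rewrite -mulrA; apply: HC; first exact: schwartz_dil.
move=> al x sal; rewrite dpart_dil; last exact: sP.1.
rewrite normrM mulrCA; apply: (le_via (2 ^+ k * ((1 + enorm x) ^+ k * `|dpart al Phi (t^-1 *: (y - x))|))).
 rewrite ler_wpM2r//; apply: le_trans (dilc_bound t0 sal) _.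
 apply: (le_via (1 * 2 ^+ k)); last by rewrite mul1r.
 have ti : t^-1 <= 1 by rewrite invf_le1.
 have tp : 0 <= t^-1 by pos.
 apply: ler_pM; rewrite//.
 by rewrite invf_le1// exprn_ege1.
 by apply: lerXn2r; rewrite ?nnegrE; lra.
by rewrite -mulrA ler_wpM2l//; exact: HD.
Qed.

Lemma convE1 (Phi psi : Rn -> R) (t : R) x : schwartz Phi -> schwartz psi -> 0 < t ->
 conv Phi t psi x = \int[L]_y (psi y * dil Phi t y x).
move=> sP sp t0; have tn : t != 0 by exact: lt0r_neq0.
pose g (y : Rn) := t ^- n * (psi y * Phi (t^-1 *: y + (- (t^-1 *: x)))).
have ig : inte g.
 apply: inteZ; have [C C0 HC] := schwartz_decay [::] 0 sP.
 apply: (inte_le _ _ (inteZ C (inte_abs (schwartz_inte [::] sp)))) => [|y].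
 apply: measurable_funM; first exact: (schwartz_meas [::] sp).
 exact: econt_meas (econt_comp_affine _ _ (schwartz_econt [::] sP)).
 rewrite normrM mulrC ler_wpM2r//.
 by have := HC (t^-1 *: y + (- (t^-1 *: x))); rewrite mul1r.
have [_] := Rint_affine x tn ig; rewrite (gtr0_norm t0).
have -> : \int[L]_y g y = \int[L]_y (psi y * dil Phi t y x).
 by apply: eq_Rintegral => y _; rewrite /dil scalerBr mulrCA.
have -> : \int[L]_x0 g (t *: (x0 : Rn) + x) = \int[L]_u (t ^- n * (Phi u * psi (x + t *: (u : Rn)))).
 apply: eq_Rintegral => u _; rewrite /g; congr (_ * _).
 by rewrite mulrC scalerDr scalerA mulVf// scale1r addrK [x + _]addrC.
rewrite RintegralZl//; last exact: (inte_conv t [::] x sP sp).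
by move/(mulfI _); apply; rewrite invr_eq0 expf_neq0.
Qed.

(** [conv Phi t psi] is a superposition of the test functions [psi y * dil Phi t y], and
    [tempered_Rint] takes [f] inside. From here on [f * Phi_t] can be handled as a function under
    the integral sign. *)
Lemma tempered_conv (Phi psi : Rn -> R) (t : R) : schwartz Phi -> schwartz psi -> 0 < t ->
 inte (fun y => dilt Phi t y * psi y) /\
 f (conv Phi t psi) = \int[L]_y (dilt Phi t y * psi y).
move=> sP sp t0; have tn : t != 0 by exact: lt0r_neq0.
have ti : 0 < t^-1 by pos.
pose w (y : Rn) : Rn -> R := fun x => psi y * dil Phi t y x.
have sw y : schwartz (w y) by apply: schwartzZ; exact: schwartz_dil.
have wE y al x : dpart al (w y) x =
 psi y * (t ^- n * (- t^-1) ^+ size al * dpart al Phi (t^-1 *: y + (- (t^-1 *: x)))).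
 by rewrite dpartZ ?dpart_dilE//; [exact: sP.1|exact: (schwartz_dil y tn sP).1].
have mw al x : mfun ((fun y => dpart al (w y) x)).
 under eq_fun do rewrite wE; apply: measurable_funM; first exact: (schwartz_meas [::] sp).
 apply: measurable_funM => //.
 exact: econt_meas (econt_comp_affine _ _ (schwartz_econt al sP)).
have fw y : f (w y) = dilt Phi t y * psi y.
 by rewrite (temperedZ tf _ (schwartz_dil y tn sP)) mulrC.
have cE : conv Phi t psi = fun x => \int[L]_y w y x.
 by apply/funext => x; exact: convE1.
have [||_ dW] := @dui w (fun y => `|psi y|) (fun y => (sw y).1) mw.
- exact: inte_abs (schwartz_inte [::] sp).
- move=> al; have [C C0 HC] := schwartz_decay al 0 sP.
 exists (t ^- n * (1 + t^-1) ^+ size al * C) => x y; rewrite wE normrM mulrC ler_wpM2r// normrM.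
 apply: ler_pM => //; first exact: dilc_bound.
 by have := HC (t^-1 *: y + (- (t^-1 *: x))); rewrite mul1r.
have := @tempered_Rint f tf w (conv Phi t psi) sw (schwartz_conv t0 sP sp).
have -> : (fun y => f (w y)) = (fun y => dilt Phi t y * psi y) by apply/funext => y; exact: fw.
apply; first by move=> x; rewrite cE dW.
move=> k; have [D D0 HD] := kernel_bound k k.+1 sP.
have [E E0 HE] := schwartz_decayn 1 (n.+2 + k) sp.
pose c := t ^- n * (1 + t^-1) ^+ k.
have t1 : 0 <= 1 + t by pos.
pose K1 := E * (D * (1 + t) ^+ k).
have key x z al be : (size al <= k.+1)%N -> (size be <= 1)%N ->
 (1 + enorm z) ^+ n.+2 * `|dpart be psi z * ((1 + enorm x) ^+ k * dpart al Phi (t^-1 *: z + (- (t^-1 *: x))))| <= K1.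
 move=> sal sbe; rewrite !normrM [`|_ ^+ k|]ger0_norm//.
 have h1 := HE be sbe z; have := HD t x z al t0 sal; rewrite scalerBr => h2.
 rewrite exprMn in h2; rewrite [leLHS]mulrA.
 apply: (le_via ((1 + enorm z) ^+ n.+2 * `|dpart be psi z| * (D * ((1 + t) ^+ k * (1 + enorm z) ^+ k)))).
 by apply: ler_wpM2l => //; apply: mulr_ge0 => //; exact: jap_ge0.
 have -> : (1 + enorm z) ^+ n.+2 * `|dpart be psi z| * (D * ((1 + t) ^+ k * (1 + enorm z) ^+ k)) =
 (1 + enorm z) ^+ (n.+2 + k) * `|dpart be psi z| * (D * (1 + t) ^+ k) by rewrite exprD; ring.
 by rewrite ler_wpM2r.
pose K2 := c * (K1 + t^-1 * K1).
exists (c * K1 + n%:R * (2 ^+ n.+2 * K2)) => al x sal.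
pose a := t ^- n * (- t^-1) ^+ size al.
pose P z := (1 + enorm x) ^+ k * dpart al Phi (t^-1 *: z + (- (t^-1 *: x))).
have ac : `|a| <= c by exact: dilc_bound.
have -> : (fun y => (1 + enorm x) ^+ k * dpart al (w y) x) = fun y => a * (psi y * P y).
 by apply/funext => y; rewrite wE /P /a; ring.
apply: (@slip_isder _ (fun i y => a * (dpart [:: i] psi y * P y + psi y *
 ((1 + enorm x) ^+ k * (t^-1 * dpart (i :: al) Phi (t^-1 *: y + (- (t^-1 *: x)))))))).
- move=> i; apply: isderZ; apply: isderM; first exact: (smooth_isder [::] i sp.1).
 by apply: isderZ; apply: isder_affine; exact: sP.1.
- by pos.
- by pos.
- move=> y; rewrite normrM mulrCA; apply: ler_pM => //.
 exact: (key x y al [::] (leqW sal) isT).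
- move=> i y; rewrite normrM mulrCA; apply: ler_pM => //.
 apply: le_trans (ler_wpM2l (jap_ge0 _ _) (ler_normD _ _)) _; rewrite mulrDr; apply: lerD.
 exact: (key x y al [:: i] (leqW sal) isT).
 have -> : psi y * ((1 + enorm x) ^+ k * (t^-1 * dpart (i :: al) Phi (t^-1 *: y + (- (t^-1 *: x))))) =
 t^-1 * (psi y * ((1 + enorm x) ^+ k * dpart (i :: al) Phi (t^-1 *: y + (- (t^-1 *: x))))) by ring.
 rewrite normrM (gtr0_norm ti) mulrCA ler_wpM2l//.
 exact: (key x y (i :: al) [::] sal isT).
Qed.
End pairing.

(** * The nontangential grand maximal function *)

Section gmax_facts.
Variable m : nat.
Implicit Types f g : @distr R n.

Lemma gmax_ub f psi t y x : Sm m psi -> 0 < t -> enorm (y - x) < t ->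
 (`|f (dil psi t y)|%:E <= gmax m f x)%E.
by move=> sp t0 yx; apply: ereal_sup_ubound; exists psi, t, y. Qed.

Lemma gmax_le f x (v : \bar R) : (forall psi t y, Sm m psi -> 0 < t -> enorm (y - x) < t ->
 (`|f (dil psi t y)|%:E <= v)%E) -> (gmax m f x <= v)%E.
by move=> H; apply: ub_ereal_sup => _ [psi [t [y [sp t0 yx ->]]]]; exact: H. Qed.

Lemma Sm0 : Sm m (fun _ : Rn => 0 : R).
by split; [exact: schwartz0|move=> al _ x; rewrite smooth0.2 normr0 mulr0]. Qed.

Lemma gmax_ge0 f x : (0 <= gmax m f x)%E.
apply: le_trans (@gmax_ub f (fun=> 0) 1 x x Sm0 ltr01 _) => //.
by rewrite subrr enorm0.
Qed.

Lemma Sm_scale (psi : Rn -> R) : schwartz psi -> exists2 C : R, 0 < C & Sm m (fun x => C^-1 * psi x).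
move=> sp; have [C C0 HC] := schwartz_decayn m.+1 ((m + 2) * (n + 1)) sp; exists C => //.
split; first exact: schwartzZ.
move=> al sal x; rewrite dpartZ; last exact: sp.1.
by rewrite normrM gtr0_norm// mulrCA mulrC ler_pdivrMr// mul1r; exact: HC.
Qed.

(** The rescaled function [K^n psi(K z)] at scale [K t] has the same dilate as [psi] at scale [t],
    and a cone of aperture [K] at scale [t] is the standard cone at scale [K t]. *)
Lemma gmax_aperture (psi : Rn -> R) (K : R) : schwartz psi -> 0 < K -> exists2 C : R, 0 < C &
 forall f, tempered f -> forall t x y, 0 < t -> enorm (y - x) < K * t ->
 (`|f (dil psi t y)|%:E <= C%:E * gmax m f x)%E.
move=> sp K0; pose psi' z := psi (K *: z + 0).
have sp' : schwartz psi' by apply: schwartz_affine => //; exact: lt0r_neq0.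
have [C C0 HC] := Sm_scale (schwartzZ (K ^+ n) sp').
exists C => // f tf t x y t0 yx.
have Kt : 0 < K * t by [].
have E : dil psi t y = fun u => C * dil (fun x => C^-1 * (K ^+ n * psi' x)) (K * t) y u.
 apply/funext => u.
 have kt : K *: ((K * t)^-1 *: (y - u)) = t^-1 *: (y - u).
 by rewrite scalerA invfM mulrA divff ?gt_eqF// mul1r.
 rewrite /dil /psi' addr0 kt exprMn invfM.
 have Kn : K ^+ n != 0 by rewrite gt_eqF.
 have tn : t ^+ n != 0 by rewrite gt_eqF.
 move: (psi _) (K ^+ n) (t ^+ n) Kn tn => p a b a0 b0; field.
 by rewrite b0 gt_eqF.
rewrite E temperedZ//; last by apply: schwartz_dil; [exact: lt0r_neq0|exact: HC.1].
rewrite normrM gtr0_norm// EFinM lee_wpmul2l ?lee_fin//.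
exact: gmax_ub.
Qed.

(** Cones are open: the vertex may move a little while the same pair [(t, y)] stays admissible. This
    gives open level sets and measurability. *)
Lemma gmax_eopen f (a : R) : eopen [set x | (a%:E < gmax m f x)%E].
move=> x /ereal_sup_gt[_ [psi [t [y [sp t0 yx ->]]]] av].
exists (t - enorm (y - x)); first by rewrite subr_gt0.
move=> z; rewrite /eball/= => zx; apply: lt_le_trans av _; apply: gmax_ub => //.
by have := enorm_dist3 y x z; rewrite [enorm (x - z)]enormB; lra.
Qed.

Lemma meas_gmax f : measurable_fun setT (gmax m f : RL R n -> \bar R).
by apply: lsc_measurable => a; exact: gmax_eopen. Qed.

Lemma gmax_comb (a b : R) f g x :
 (gmax m (dcomb a f b g) x <= `|a|%:E * gmax m f x + `|b|%:E * gmax m g x)%E.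
apply: gmax_le => psi t y sp t0 yx; rewrite /dcomb.
apply: (le_via (`|a|%:E * `|f (dil psi t y)|%:E + `|b|%:E * `|g (dil psi t y)|%:E)%E).
 by rewrite lee_fin -!normrM ler_normD.
by apply: leeD; apply: lee_wpmul2l; rewrite//; exact: gmax_ub.
Qed.

Lemma eq_gmax f g : (forall psi, schwartz psi -> f psi = g psi) -> gmax m f = gmax m g.
move=> fg; apply/funext => x; apply/eqP; rewrite eq_le; apply/andP; split; apply: gmax_le => psi t y sp t0 yx.
 by rewrite fg ?gmax_ub//; apply: schwartz_dil; [exact: lt0r_neq0|exact: sp.1].
by rewrite -fg ?gmax_ub//; apply: schwartz_dil; [exact: lt0r_neq0|exact: sp.1].
Qed.

Lemma tempered_comb (a b : R) f g : tempered f -> tempered g -> tempered (dcomb a f b g).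
move=> tf tg; split => [c p1 p2 s1 s2|]; first by rewrite /dcomb tf.1// tg.1//; ring.
have [_ [C [k HC]]] := tf; have [_ [D [k' HD]]] := tg.
exists (`|a| * `|C| + `|b| * `|D|), (maxn k k') => psi sp.
have [E E0 HE] := schwartz_decayn (maxn k k') (maxn k k') sp.
have mono (j : nat) : (j <= maxn k k')%N -> 0 <= seminorm j psi <= seminorm (maxn k k') psi.
 move=> jk.
 have ub i : (i <= maxn k k')%N -> has_ubound [set v | exists x (al : seq 'I_n), (size al <= i)%N /\
 v = (1 + enorm x) ^+ i * `|dpart al psi x|].
 move=> ik; exists E => _ [x [al [sal ->]]]; apply: le_trans (HE al (leq_trans sal ik) x).
 by rewrite ler_wpM2r//; apply: ler_weXn2l => //; exact: enorm1_ge1.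
 apply/andP; split.
 apply: (le_via ((1 + enorm (0 : Rn)) ^+ j * `|dpart [::] psi 0|)).
 by apply: mulr_ge0 => //; exact: jap_ge0.
 by apply: ub_le_sup; [exact: ub|exists 0, [::]].
 apply: ge_sup; first by exists ((1 + enorm (0 : Rn)) ^+ j * `|dpart [::] psi 0|), 0, [::].
 move=> _ [x [al [sal ->]]].
 apply: (le_via ((1 + enorm x) ^+ (maxn k k') * `|dpart al psi x|)).
 by rewrite ler_wpM2r//; apply: ler_weXn2l => //; exact: enorm1_ge1.
 by apply: ub_le_sup; [exact: ub|exists x, al; split => //; exact: leq_trans sal jk].
rewrite (le_trans (ler_normD _ _))// !normrM mulrDl -!mulrA.
have /andP[k0 k1] := mono k (leq_maxl _ _); have /andP[k2 k3] := mono k' (leq_maxr _ _).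
apply: lerD; apply: ler_wpM2l => //.
 apply: le_trans (HC _ sp) _; apply: (le_via (`|C| * seminorm k psi)).
 by rewrite ler_wpM2r// ler_norm.
 by rewrite ler_wpM2l.
apply: le_trans (HD _ sp) _; apply: (le_via (`|D| * seminorm k' psi)).
 by rewrite ler_wpM2r// ler_norm.
by rewrite ler_wpM2l.
Qed.
End gmax_facts.

(** * The refinable kernel in several variables *)

Section father_nd.
Variable M : nat.

Definition bPhi : Rn -> R := tens (fun=> sPhi M).
(** The factors of the [j]-th term in the telescoping expansion of a difference of two products:
    dilated factors before [j], the defect at [j], original factors after. *)
Definition bAe (j i : 'I_n) : sfun :=
 if (i < j)%N then sdil2 (sPhi M) else if i == j then sA M else sPhi M.
Definition bA (j : 'I_n) : Rn -> R := tens (bAe j).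

Lemma srad_ge0 : 0 <= srad M. by []. Qed.

Lemma schwartz_bPhi : schwartz bPhi.
by apply: (@tens_schwartz _ (srad M)) => i; [exact: swf_sPhi|exact: ssupp_sPhi]. Qed.

Lemma schwartz_bA j : schwartz (bA j).
apply: (@tens_schwartz _ (srad M)) => i; rewrite /bAe; case: ifP => _; try (case: ifP => _).
- by split => //; exact: swf_sPhi.
- exact: swf_sA.
- exact: swf_sPhi.
- move=> x; have r0 := srad_ge0; rewrite sev_sdil2 /dil2 => ax; rewrite ssupp_sPhi ?mulr0//.
 by apply: lt_le_trans ax _; rewrite normrM ger0_norm// ler_peMl// ler1n.
- exact: ssupp_sA.
- exact: ssupp_sPhi.
Qed.

Lemma Rint_bPhi : \int[L]_x bPhi x = 1.
rewrite (@Rint_tens (sPhi M) (srad M) 1) ?expr1n//; [exact: swf_sPhi|exact: ssupp_sPhi|].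
exact: integral_sPhi.
Qed.

Lemma prod_telescope (u v : 'I_n -> R) : \prod_i u i - \prod_i v i =
 \sum_(j < n) \prod_(i < n) (if (i < j)%N then u i else if i == j then u i - v i else v i).
pose w (k : nat) := \prod_(i < n) (if (i < k)%N then u i else v i).
have -> : \prod_i u i - \prod_i v i = w n - w 0%N.
 by congr (_ - _); apply: eq_bigr => i _; rewrite ?ltn_ord.
have -> : w n - w 0%N = \sum_(0 <= k < n) (w k.+1 - w k) by rewrite telescope_sumr.
rewrite big_mkord; apply: eq_bigr => j _; rewrite /w (bigD1 j)//= [X in _ - X](bigD1 j)//= [RHS](bigD1 j)//=.
rewrite leqnn ltnn eqxx mulrBl; congr (_ * _ - _ * _); apply: eq_bigr => i ij.
 by rewrite ltnS leq_eqVlt val_eqE (negPf ij).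
by rewrite (negPf ij).
Qed.

Definition csgn (t : 'I_M.+2) : R := (-1) ^+ t * 'C(M.+1, t)%:R.

Lemma bPhi_refine x : 2 ^+ n * bPhi (2 *: x) - bPhi x =
 \sum_(j < n) \sum_(t < M.+2) csgn t * bA j (x - (t%:R / 2) *: e_ j).
have -> : 2 ^+ n * bPhi (2 *: x) = \prod_(i < n) dil2 (sev (sPhi M)) (x ord0 i).
 rewrite -[n in 2 ^+ n]card_ord -prodr_const -big_split/=.
 by apply: eq_bigr => i _; rewrite mxE.
rewrite prod_telescope; apply: eq_bigr => j _.
have E i : dil2 (sev (sPhi M)) (x ord0 i) - sev (sPhi M) (x ord0 i) =
 \sum_(t < M.+2) csgn t * sev (sA M) (x ord0 i - t%:R / 2).
 rewrite sA_refine addrAC subrr add0r iter_shopE; apply: eq_bigr => t _.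
 by rewrite mul1r.
rewrite (bigD1 j)//= ltnn eqxx E mulr_suml; apply: eq_bigr => t _.
rewrite -mulrA; congr (_ * _); rewrite /bA /tens [in RHS](bigD1 j)//= /bAe ltnn !mxE !eqxx mulr1.
congr (_ * _); apply: eq_bigr => i ij; rewrite !mxE (negPf ij) mulr0 subr0.
by case: ifP => _; rewrite ?sev_sdil2.
Qed.

Variable f : @distr R n.
Hypothesis tf : tempered f.

(** The identity [bPhi_refine], dilated to scale [l] and tested with [f]. Every vanishing moment of
    the decomposition comes from the differences on its right side. *)
Lemma dilt_refine (l : R) y : 0 < l ->
 dilt f bPhi (l / 2) y - dilt f bPhi l y =
 \sum_(j < n) \sum_(t < M.+2) csgn t * dilt f (bA j) l (y - (t%:R * (l / 2)) *: e_ j).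
move=> l0; have l2 : 0 < l / 2 by [].
have ln := lt0r_neq0 l0; have ln2 := lt0r_neq0 l2.
rewrite /dilt -(temperedB tf (schwartz_dil y ln2 schwartz_bPhi) (schwartz_dil y ln schwartz_bPhi)).2.
rewrite pair_big/= -(tempered_sum tf); last by move=> [j t]; exact: schwartz_dil (schwartz_bA j).
congr f; apply/funext => x.
rewrite -(pair_big xpredT xpredT (fun j t => csgn t * dil (bA j) l (y - (t%:R * (l / 2)) *: e_ j) x))/=.
have := bPhi_refine (l^-1 *: (y - x)) => /(congr1 (fun z => l ^- n * z)).
rewrite mulrBr mulr_sumr => H.
transitivity (l ^- n * (2 ^+ n * bPhi (2 *: (l^-1 *: (y - x)))) - l ^- n * bPhi (l^-1 *: (y - x))).
 rewrite /dil scalerA expr_div_n invf_div [in bPhi ((l / 2)^-1 *: _)]invf_div; congr (_ - _).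
 by rewrite mulrA; congr (_ * _); rewrite mulrC.
rewrite H; apply: eq_bigr => j _; rewrite mulr_sumr; apply: eq_bigr => t _.
rewrite mulrCA; congr (_ * (_ * bA j _)).
rewrite [y - _ - x]addrAC [RHS]scalerBr scalerA; congr (_ - _ *: _).
by field.
Qed.

Lemma fine_limit psi (e : R) : schwartz psi -> 0 < e -> exists2 d : R, 0 < d & forall t, 0 < t <= d ->
 `|\int[L]_y (dilt f bPhi t y * psi y) - f psi| <= e.
move=> sp e0; have [C [k [C0 HC]]] := tempered_bound tf.
have [D D0 HD] := conv_approx k schwartz_bPhi sp Rint_bPhi.
exists (Num.min 1 (e / (C * D))); first by rewrite lt_min ltr01 divr_gt0.
move=> t; rewrite le_min => /andP[t0 /andP[t1 te]].
have [_ <-] := tempered_conv tf schwartz_bPhi sp t0.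
have sc := schwartz_conv t0 schwartz_bPhi sp.
have [s1 <-] := temperedB tf sc sp.
apply: (le_via (C * (D * t))); last by rewrite mulrA mulrC -ler_pdivlMr.
apply: HC => // al x sal.
have [_ d] := smooth_comb (-1) sp.1 sc.1.
have -> : (fun x0 => conv bPhi t psi x0 - psi x0) = (fun x0 => -1 * psi x0 + conv bPhi t psi x0).
 by apply/funext => z; rewrite mulN1r addrC.
rewrite d mulN1r [- _ + _]addrC (conv_dpart (lt0r_neq0 t0) schwartz_bPhi sp).2.
by apply: HD => //; rewrite t0.
Qed.

(** If the maximal function is small at [x1], then [f * Phi_t] is small on the ball of radius [t]
    around [x1]. Outside that ball the polynomial growth in [t] is converted into powers of
    [1 + |y|], with one factor [1/t] gained, and [psi] absorbs them. *)
Lemma coarse_limit m psi (e : R) : (forall a : R, 0 < a -> exists x, (gmax m f x <= a%:E)%E) ->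
 schwartz psi -> 0 < e -> exists2 T : R, 0 < T & forall t, T <= t ->
 `|\int[L]_y (dilt f bPhi t y * psi y)| <= e.
move=> small sp e0; have [C C0 HC] := gmax_aperture m schwartz_bPhi ltr01.
have [D [k [D0 HD]]] := dilt_growth tf schwartz_bPhi.
have ip := inte_abs (schwartz_inte [::] sp).
have iw := inte_abs (schwartz_winte (k + k).+1 sp).
pose I1 := \int[L]_y `|psi y|; pose I2 := \int[L]_y `|(1 + enorm y) ^+ (k + k).+1 * psi y|.
have I10 : 0 <= I1 by apply: Rintegral_ge0.
have I20 : 0 <= I2 by apply: Rintegral_ge0.
pose a := e / (2 * (C * (I1 + 1))).
have a0 : 0 < a by rewrite divr_gt0// !mulr_gt0// ltr_wpDl.
have [x1 x1a] := small a a0.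
pose B := D * (1 + enorm x1) ^+ k.+1.
have B0 : 0 < B by rewrite mulr_gt0// jap_gt0.
have T0 : 0 <= 2 * (B * (I2 + 1)) / e by [].
exists (1 + 2 * (B * (I2 + 1)) / e); first by rewrite ltr_pwDl.
move=> t tT.
have t1 : 1 <= t by apply: le_trans tT; rewrite lerDl.
have t0 : 0 < t by apply: lt_le_trans.
have key y : `|dilt f bPhi t y| <= C * a + B / t * (1 + enorm y) ^+ (k + k).+1.
 have Bt : 0 <= B / t by [].
 have [yx|yx] := ltP (enorm (y - x1)) (1 * t).
 apply: (le_via (C * a)); last by rewrite lerDl.
 rewrite -lee_fin; apply: le_trans (HC f tf t x1 y t0 yx) _.
 by rewrite EFinM lee_wpmul2l ?lee_fin.
 apply: (le_via (B / t * (1 + enorm y) ^+ (k + k).+1)); last by rewrite lerDr.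
 apply: le_trans (HD t y t1) _.
 have ty : 1 + t <= (1 + enorm x1) * (1 + enorm y).
 have := enorm_dist3 y 0 x1; rewrite !(subr0, sub0r) enormN.
 by have := enorm_ge0 x1; have := enorm_ge0 y; nra.
 have ty1 : t <= (1 + enorm x1) * (1 + enorm y) by apply: le_trans ty; rewrite lerDr.
 have h1 : ((1 + t) * (1 + enorm y)) ^+ k <= ((1 + enorm x1) * (1 + enorm y) * (1 + enorm y)) ^+ k.
 have y0 := enorm1_gt0 y; have x0 := enorm1_gt0 x1.
 apply: lerXn2r; rewrite ?nnegrE; try by [].
 by rewrite ler_wpM2r.
 apply: le_trans (ler_wpM2l (ltW D0) h1) _; rewrite [leRHS]mulrAC ler_pdivlMr//.
 have h2 : 0 <= D * ((1 + enorm x1) * (1 + enorm y) * (1 + enorm y)) ^+ k.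
 have := y; have := enorm1_gt0; by [].
 apply: le_trans (ler_wpM2l h2 ty1) _; rewrite /B !exprMn exprS exprS exprD.
 by apply: le_of_eq; ring.
have [id _] := tempered_conv tf schwartz_bPhi sp t0.
have h := @ler_norm_Rint _ (fun y => C * a * `|psi y| + B / t * `|(1 + enorm y) ^+ (k + k).+1 * psi y|) id
 (inteD (inteZ _ ip) (inteZ _ iw)).
apply: le_trans (h _) _ => [y|].
 have -> : C * a * `|psi y| + B / t * `|(1 + enorm y) ^+ (k + k).+1 * psi y| =
 (C * a + B / t * (1 + enorm y) ^+ (k + k).+1) * `|psi y|.
 by rewrite [`|_ ^+ _ * _|]normrM [`|_ ^+ _|]ger0_norm//; ring.
 by rewrite normrM ler_wpM2r.
rewrite RintegralD//; [|exact: inteZ|exact: inteZ].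
rewrite !RintegralZl// -/I1 -/I2.
have s1 : C * a * I1 <= e / 2.
 have -> : C * a = e / (2 * (I1 + 1)).
 rewrite /a; field; by rewrite (lt0r_neq0 C0) lt0r_neq0// ltr_wpDl.
 by rewrite mulrAC ler_pdivrMr ?mulr_gt0 ?ltr_wpDl// mulrA divfK// mulrDr lerDl.
have s2 : B / t * I2 <= e / 2.
 rewrite mulrAC ler_pdivrMr//.
 apply: (le_via (e / 2 * (1 + 2 * (B * (I2 + 1)) / e))); last by rewrite ler_wpM2l.
 have -> : e / 2 * (1 + 2 * (B * (I2 + 1)) / e) = e / 2 + (B * I2 + B) by field; exact: lt0r_neq0.
 have e2 : 0 < e / 2 by [].
 by move: (ltW e2) => e2'; rewrite addrCA lerDl.
by lra.
Qed.
End father_nd.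

(** * Tent functions and the Whitney partition of the level sets *)

Definition rho (q : R) : R := Num.max 0 (Num.min (2 * q - 1) (2 - q)).
Definition hat (s : R) : R := Num.max 0 (1 - `|s|).

Lemma rho_ge0 q : 0 <= rho q. by rewrite le_max lexx. Qed.
Lemma hat_ge0 s : 0 <= hat s. by rewrite le_max lexx. Qed.

Lemma rho_cases q : [\/ rho q = 0 /\ (q <= 2^-1 \/ 2 <= q), rho q = 2 * q - 1 /\ 2^-1 <= q <= 1 |
 rho q = 2 - q /\ 1 <= q <= 2].
rewrite /rho; case: (leP (2 * q - 1) (2 - q)) => h1; case: (leP 0 _) => h2.
- by constructor 2; split => //; apply/andP; split; lra.
- by constructor 1; split => //; left; lra.
- by constructor 3; split => //; apply/andP; split; lra.
- by constructor 1; split => //; right; lra.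
Qed.

Lemma rho_le1 q : rho q <= 1.
by case: (rho_cases q) => -[-> //]; lra. Qed.

Lemma rho_supp q : rho q != 0 -> 2^-1 < q < 2.
rewrite /rho; case: (leP (2 * q - 1) (2 - q)) => h1; case: (leP 0 _) => h2; rewrite ?eqxx// => h3.
- move: h2; rewrite le_eqVlt => /predU1P[h|h2]; first by rewrite -h eqxx in h3.
 by apply/andP; split; lra.
- move: h2; rewrite le_eqVlt => /predU1P[h|h2]; first by rewrite -h eqxx in h3.
 by apply/andP; split; lra.
Qed.

Lemma rho_lip p q : `|rho p - rho q| <= 2 * `|p - q|.
wlog pq : p q / q <= p.
 move=> H; have [/H//|/ltW/H] := leP q p; by rewrite distrC [`|q - p|]distrC.
rewrite [`|p - q|]ger0_norm ?subr_ge0// ler_norml.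
case: (rho_cases p) => -[-> hp]; case: (rho_cases q) => -[-> hq];
 try (move: hp => [] hp); try (move: hq => [] hq); try (move/andP: hp => [? ?]); try (move/andP: hq => [? ?]);
 apply/andP; split; lra.
Qed.

(** Hence the dyadic dilates of [rho] sum to 1 on the positive axis, as the integer translates of
    [hat] do on the line. With explicit tents no quotient by a sum of cutoffs occurs, and the
    Lipschitz bounds are direct. *)
Lemma rho_sum q : 1 <= q <= 2 -> rho q + rho (q / 2) = 1.
move=> /andP[q1 q2].
case: (rho_cases q) => -[-> hq]; case: (rho_cases (q / 2)) => -[-> hp];
 (move: hp => [] hp); (move: hq => [] hq); try (move/andP: hp => [? ?]); try (move/andP: hq => [? ?]); lra.
Qed.

Lemma hat_le1 s : hat s <= 1.
by rewrite ge_max ler01 lerBlDr lerDl normr_ge0. Qed.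

Lemma hat01 s : 0 <= hat s <= 1. by rewrite hat_ge0 hat_le1. Qed.

Lemma hat_supp s : hat s != 0 -> `|s| < 1.
by apply: contraNT; rewrite -leNgt => h; rewrite /hat max_l// subr_le0. Qed.

Lemma hat_lip p q : `|hat p - hat q| <= `|p - q|.
have h1 := ler_dist_dist p q; rewrite ler_norml in h1; move/andP: h1 => [h1 h2].
rewrite /hat ler_norml; case: (leP 0 (1 - `|p|)) => a; case: (leP 0 (1 - `|q|)) => b;
 have c := normr_ge0; apply/andP; split; lra.
Qed.

Lemma hat_sum t : 0 <= t < 1 -> hat t + hat (t - 1) = 1.
move=> /andP[t0 t1]; rewrite /hat (ger0_norm t0) ltr0_norm ?subr_lt0// !max_r; lra.
Qed.

Lemma prod01 (I : Type) (r : seq I) (a : I -> R) : (forall i, 0 <= a i <= 1) ->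
 0 <= \prod_(i <- r) a i <= 1.
move=> a01; elim: r => [|i r /andP[IH1 IH2]]; first by rewrite big_nil ler01 lexx.
have /andP[h1 h2] := a01 i; rewrite big_cons mulr_ge0//= mulr_ile1//.
Qed.

Lemma prod_lip (I : Type) (r : seq I) (a b : I -> R) : (forall i, 0 <= a i <= 1) ->
 (forall i, 0 <= b i <= 1) ->
 `|\prod_(i <- r) a i - \prod_(i <- r) b i| <= \sum_(i <- r) `|a i - b i|.
move=> a01 b01; elim: r => [|i r IH]; first by rewrite !big_nil subrr normr0.
rewrite !big_cons.
set A := \prod_(j <- r) a j; set B := \prod_(j <- r) b j.
have -> : a i * A - b i * B = (a i - b i) * A + b i * (A - B) by ring.
apply: le_trans (ler_normD _ _) _; rewrite !normrM; apply: lerD.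
 by have /andP[A0 A1] := prod01 r a01; rewrite (ger0_norm A0) ler_piMr.
have /andP[b0 b1] := b01 i; rewrite (ger0_norm b0).
by apply: le_trans IH; rewrite ler_piMl.
Qed.

Lemma csum_finsupp (J : countType) (u : J -> \bar R) (s0 : seq J) :
 (forall j, 0 <= u j)%E -> uniq s0 -> (forall j, j \notin s0 -> u j = 0%E) ->
 csum u = (\sum_(j <- s0) u j)%E.
move=> u0 us0 us; apply/eqP; rewrite eq_le le_csum_fin// andbT.
apply: csum_le_fin => // s us1.
rewrite (bigID (mem s0))/= [X in (_ + X <= _)%E]big1 ?adde0//.
rewrite -big_filter; apply: le_sum_sub => //; first exact: filter_uniq.
by move=> j; rewrite mem_filter => /andP[].
Qed.

Lemma int_two (a b : int) : a < b + 1 + 1 -> b < a + 1 -> a = b \/ a = b + 1.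
lia. Qed.

Section whitney.
Variable g : Rn -> \bar R.

Definition lev (k : int) : set Rn := [set x | ((2 ^ k)%:E < g x)%E].

Hypotheses (hO : forall k, eopen (lev k)) (hc : forall k, exists x, ~ lev k x)
 (hb : forall x r, exists k, eball x r `<=` lev k) (ha : forall x r, 0 < r -> exists k, ~ (eball x r `<=` lev k)).

Definition dk (k : int) (x : Rn) : R := inf [set enorm (x - y) | y in ~` lev k].

Let dk_nonempty k x : [set enorm (x - y) | y in ~` lev k] !=set0.
by have [y ny] := hc k; exists (enorm (x - y)), y. Qed.

Let dk_lb k x : has_lbound [set enorm (x - y) | y in ~` lev k].
by exists 0 => _ [y _ <-]; exact: enorm_ge0. Qed.

Lemma dk_le k x y : ~ lev k y -> dk k x <= enorm (x - y).
by move=> ny; apply: ge_inf; [exact: dk_lb|exists y]. Qed.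

Lemma dk_lt k x r : dk k x < r -> exists2 y, ~ lev k y & enorm (x - y) < r.
by move=> /(inf_lt (dk_nonempty k x))[_ [y ny <-] yr]; exists y.
Qed.

Lemma dk_ge k x r : eball x r `<=` lev k -> r <= dk k x.
move=> xr; rewrite leNgt; apply/negP => /dk_lt[y ny yx]; apply: ny; apply: xr.
by rewrite /eball/= enormB.
Qed.

Lemma dk_ball k x r : r <= dk k x -> eball x r `<=` lev k.
move=> rd y yx; apply: contrapT => ny; have := le_trans rd (dk_le x ny).
by move: yx; rewrite enormB leNgt => ->.
Qed.

Lemma dk_lip1 k x y : dk k x <= dk k y + enorm (x - y).
apply/ler_addgt0Pr => e e0.
have [z nz yz] : exists2 z, ~ lev k z & enorm (y - z) < dk k y + e by apply: dk_lt; rewrite ltrDl.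
by have := dk_le x nz; have := enorm_dist3 x y z; lra.
Qed.

Lemma dk_lip k x y : `|dk k x - dk k y| <= enorm (x - y).
rewrite ler_norml; have := dk_lip1 k x y; have := dk_lip1 k y x; rewrite [enorm (y - x)]enormB.
by move=> ? ?; apply/andP; split; lra.
Qed.

Lemma lev_mono k k' : k <= k' -> lev k' `<=` lev k.
move=> kk x; rewrite /lev/=; apply: le_lt_trans; rewrite lee_fin.
by apply: ler_weXz2l => //; rewrite ler1n.
Qed.

Lemma dk_mono k k' x : k <= k' -> dk k' x <= dk k x.
move=> kk; apply: dk_ge; apply: subset_trans (lev_mono kk); exact: dk_ball.
Qed.

Lemma dk_econt k : econt (dk k).
by apply: (@econt_lip _ 1) => x y; rewrite mul1r; exact: dk_lip. Qed.

(** The level attached to radius [r] at [x]: the ball of radius [r] lies in level set [k] but meets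
    the complement of the next one. A quantity controlled by the maximal function within that
    distance has size about [2^k]. *)
Definition kap (k : int) (r : R) (x : Rn) : bool := (r <= dk k x) && (dk (k + 1) x < r).

(** The distance [dk k x] decreases in [k]; by [hb] it is at least [r] for some [k], by [ha] it is
    below [r] for another, so it crosses [r] exactly once. *)
Lemma kap_uniq (r : R) x : 0 < r -> exists k0, forall k, kap k r x = (k == k0).
move=> r0.
have [k1 h1] : exists k, r <= dk k x by have [k /dk_ge kh] := hb x r; exists k.
have [k2 h2] : exists k, dk k x < r.
 have [k kh] := ha x r0; exists k; rewrite ltNge; apply/negP => /dk_ball; exact: kh.
have [N hN] : exists N : nat, dk (k1 + N%:Z) x < r.
 exists `|k2 - k1|%N; apply: le_lt_trans h2; apply: dk_mono.
 by have := (k2 - k1); lia.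
have := ex_minnP (ex_intro (fun N : nat => dk (k1 + N%:Z) x < r) N hN).
move=> [[|m] hm mmin]; first by move: hm; rewrite addr0 ltNge h1.
have hm1 : r <= dk (k1 + m%:Z) x.
 by rewrite leNgt; apply/negP => /mmin; rewrite ltnn.
exists (k1 + m%:Z) => k; rewrite /kap.
have hm2 : dk (k1 + m%:Z + 1) x < r by move: hm; congr (dk _ _ < _); lia.
have [->|/eqP kne] := eqVneq k; first by rewrite hm1.
have [kl|kg] : k + 1 <= k1 + m%:Z \/ k1 + m%:Z + 1 <= k by lia.
 by rewrite [X in _ && X]ltNge (le_trans hm1 (dk_mono _ kl)) andbF.
by rewrite leNgt (le_lt_trans (dk_mono _ kg) hm2).
Qed.

(** Triples of level, scale exponent and lattice point index all conceivable balls, and [chi]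
    vanishes identically for those that miss the Whitney region. So the index type does not depend
    on [f], and no selection of balls is made. *)
Definition WJ : countType := (int * int * {ffun 'I_n -> int})%type.
Definition Jk (J : WJ) : int := J.1.1.
Definition Jl (J : WJ) : int := J.1.2.
Definition Jz (J : WJ) : {ffun 'I_n -> int} := J.2.
Definition Jr (J : WJ) : R := 2 ^ (Jl J).
(** The mesh is [1/(16(n+1))] of the radius, so that the support of a lattice tent stays within
    [1/16] of the radius in the Euclidean norm. *)
Definition Wd : R := (16 * n.+1)%:R.
Definition Jdel (J : WJ) : R := Jr J / Wd.
Definition Jc (J : WJ) : Rn := \row_i ((Jz J i)%:~R * Jdel J).

Definition chi (J : WJ) (x : Rn) : R :=
 rho (dk (Jk J) x / Jr J) * \prod_(i < n) hat (x ord0 i / Jdel J - (Jz J i)%:~R).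

Lemma Jr_gt0 J : 0 < Jr J. by pos. Qed.
Lemma Wd_gt0 : 0 < Wd. by []. Qed.
Lemma Jdel_gt0 J : 0 < Jdel J. by pos. Qed.

Lemma chi_ge0 J x : 0 <= chi J x.
by rewrite mulr_ge0 ?rho_ge0//; apply: prodr_ge0 => i _; exact: hat_ge0. Qed.

Lemma chi_le1 J x : chi J x <= 1.
rewrite -[leRHS]mulr1; apply: ler_pM; rewrite ?rho_ge0 ?rho_le1//.
 by apply: prodr_ge0 => i _; exact: hat_ge0.
by have /andP[] := @prod01 _ (index_enum 'I_n) _ (fun i => hat01 (x ord0 i / Jdel J - (Jz J i)%:~R)).
Qed.

Lemma chi_supp J x : chi J x != 0 ->
 Jr J / 2 < dk (Jk J) x < 2 * Jr J /\ enorm (x - Jc J) < Jr J / 16.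
rewrite mulf_eq0 negb_or => /andP[/rho_supp h1 h2]; have r0 := Jr_gt0 J; split.
 move: h1; rewrite ltr_pdivlMr// ltr_pdivrMr// => /andP[? ?]; apply/andP; split; lra.
have hi i : `|x ord0 i - Jc J ord0 i| <= Jdel J.
 have d0 := Jdel_gt0 J; rewrite mxE.
 have hn : hat (x ord0 i / Jdel J - (Jz J i)%:~R) != 0.
 by apply: contraNN h2 => /eqP h; rewrite (bigD1 i)//= h mul0r.
 have := hat_supp hn; rewrite -[Jdel J in leRHS]mul1r => h.
 have -> : x ord0 i - (Jz J i)%:~R * Jdel J = (x ord0 i / Jdel J - (Jz J i)%:~R) * Jdel J.
 by rewrite mulrBl divfK// gt_eqF.
 by rewrite normrM (gtr0_norm d0) ler_wpM2r// ltW.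
apply: (@le_lt_trans _ _ (n%:R * Jdel J)).
 apply: le_trans (enorm_le_sum _) _; rewrite mulr_natl -[X in _ *+ X](card_ord n) -sumr_const.
 by apply: ler_sum => i _; have := hi i; rewrite !mxE.
have w0 := Wd_gt0; rewrite mulrA ltr_pdivrMr// mulrAC ltr_pdivlMr// [n%:R * _]mulrC -mulrA ltr_pM2l//.
by rewrite -natrM ltr_nat mulnC ltn_pmul2l.
Qed.

Definition Cchi : R := 2 + n%:R * Wd.

Lemma chi_lip J x y : `|chi J x - chi J y| <= Cchi / Jr J * enorm (x - y).
have r0 := Jr_gt0 J; have d0 := Jdel_gt0 J.
pose V (x : Rn) := \prod_(i < n) hat (x ord0 i / Jdel J - (Jz J i)%:~R).
have V01 z : 0 <= V z <= 1 by apply: prod01 => i; exact: hat01.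
have -> : chi J x - chi J y = (rho (dk (Jk J) x / Jr J) - rho (dk (Jk J) y / Jr J)) * V x +
 rho (dk (Jk J) y / Jr J) * (V x - V y) by rewrite /chi -/(V x) -/(V y); ring.
apply: le_trans (ler_normD _ _) _; rewrite !normrM mulrDl mulrDl; apply: lerD.
 have /andP[v0 v1] := V01 x; rewrite (ger0_norm v0).
 apply: (le_via (2 * `|dk (Jk J) x / Jr J - dk (Jk J) y / Jr J| * 1)).
 by apply: ler_pM => //; exact: rho_lip.
 rewrite mulr1 -mulrBl normrM normfV (gtr0_norm r0) -!mulrA ler_wpM2l// mulrC ler_wpM2l//.
 exact: dk_lip.
rewrite (ger0_norm (rho_ge0 _)); apply: (le_via (1 * `|V x - V y|)).
 by rewrite ler_wpM2r// rho_le1.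
rewrite mul1r; apply: le_trans (prod_lip _ _ _) _ => [i|i|]; rewrite ?hat_ge0 ?hat_le1//.
have -> : n%:R * Wd / Jr J * enorm (x - y) = \sum_(i < n) (Jdel J)^-1 * enorm (x - y).
 by rewrite sumr_const card_ord invf_div; ring.
apply: ler_sum => i _; apply: le_trans (hat_lip _ _) _.
have -> : x ord0 i / Jdel J - (Jz J i)%:~R - (y ord0 i / Jdel J - (Jz J i)%:~R) =
 (Jdel J)^-1 * (x - y) ord0 i by rewrite !mxE; ring.
by rewrite normrM gtr0_norm// ler_wpM2l// enorm_coord.
Qed.

Lemma chi_meas J : mfun (chi J).
by apply: econt_meas; apply: econt_lip => y; exact: chi_lip. Qed.

Lemma kap_meas k r : mset ([set x | kap k r x]).
have m1 j : mfun (dk j) by apply: econt_meas; exact: dk_econt.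
have -> : [set x | kap k r x] = (dk k @^-1` `[r, +oo[%classic) `&` (dk (k + 1) @^-1` `]-oo, r[%classic).
 by apply/seteqP; split => x /=; rewrite !in_itv/= andbT => /andP.
by apply: measurableI; rewrite -[X in measurable X]setTI; apply: m1 => //; exact: measurable_itv.
Qed.

(** The cut by [kap] is sharp, because the level must be determined by [x] and [r] for the sum over
    all indices to be 1. Its jumps lie where [dk k] or [dk (k + 1)] equals [r]. *)
Definition om (r : R) (J : WJ) (x : Rn) : R := if kap (Jk J) r x then chi J x else 0.

Lemma om_ge0 r J x : 0 <= om r J x.
by rewrite /om; case: ifP => // _; exact: chi_ge0. Qed.

Lemma om_meas r J : mfun (om r J).
have -> : om r J = fun x => \1_[set x | kap (Jk J) r x] x * chi J x.
 apply/funext => x; rewrite /om indicE; case: ifPn => h; first by rewrite mem_set ?mul1r.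
 by rewrite memNset ?mul0r//= => /=; apply/negP.
by apply: measurable_funM; [apply: measurable_indic; exact: kap_meas|exact: chi_meas].
Qed.

Lemma om_sum r x : 0 < r -> csum (fun J => (om r J x)%:E) = 1%:E.
move=> r0; have [k0 hk] := kap_uniq x r0.
have /andP[rd _] : kap k0 r x by rewrite hk.
have d0 : 0 < dk k0 x := lt_le_trans r0 rd.
have [l0 /andP[l01 l02]] := dyadic_exists d0.
(* Only the exponents [l0] and [l0 + 1] and the two integers next to each rescaled coordinate
   contribute; the sum then factors into tents that add up to 1. *)
pose Lb (b : bool) : int := l0 + (nat_of_bool b)%:Z.
pose del (b : bool) : R := 2 ^ (Lb b) / Wd.
pose fl (b : bool) (i : 'I_n) : int := Num.floor (x ord0 i / del b).
pose mk (p : bool * {ffun 'I_n -> bool}) : WJ :=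
 (k0, Lb p.1, [ffun i => fl p.1 i + (nat_of_bool (p.2 i))%:Z]).
have mk_inj : injective mk.
 move=> [b B] [b' B'] []; rewrite /Lb => /addrI/eqP; rewrite eqz_nat => /eqP bb.
 have {}bb : b = b' by move: bb; case: b; case: b'.
 subst b'; move=> /ffunP H; congr (_, _); apply/ffunP => i; have := H i; rewrite !ffunE.
 by move=> /addrI/eqP; rewrite eqz_nat => /eqP; case: (B i); case: (B' i).
rewrite (@csum_finsupp _ _ [seq mk p | p <- enum {: bool * {ffun 'I_n -> bool}}]); first last.
- move=> [[k l] z] Jn; congr EFin; rewrite /om hk; case: eqP => // kk; rewrite /Jk/= in kk; subst k.
 apply/eqP; apply: contraNT Jn; rewrite mulf_eq0 negb_or => /andP[/rho_supp h1 h2].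
 have p2 (j : int) : 0 < 2 ^ j :> R by pos.
 rewrite /Jk /Jr /Jl/= ltr_pdivlMr// ltr_pdivrMr// in h1.
 have [b bE] : exists b, l = Lb b.
 have l1 : l <= l0 + 1.
 rewrite leNgt; apply/negP => ll; have : (2 : R) ^ (l0 + 2) <= 2 ^ l.
 by apply: ler_weXz2l; rewrite ?ler1n//; lia.
 have -> : (2 : R) ^ (l0 + 2) = 2 * 2 ^ (l0 + 1) by rewrite !expfzDr//; ring.
 by move/andP: h1 => [? ?]; lra.
 have l2 : l0 <= l.
 rewrite leNgt; apply/negP => ll; have : (2 : R) ^ (l + 1) <= 2 ^ l0.
 by apply: ler_weXz2l; rewrite ?ler1n//; lia.
 have -> : (2 : R) ^ (l + 1) = 2 * 2 ^ l by rewrite expfzDr//; ring.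
 by move/andP: h1 => [? ?]; lra.
 have [->|->] : l = l0 \/ l = l0 + 1 by lia.
 by exists false; rewrite /Lb addr0.
 by exists true.
 subst l; apply/mapP.
 have hz i : exists c : bool, z i = fl b i + (nat_of_bool c)%:Z.
 have hn : hat (x ord0 i / del b - (z i)%:~R) != 0.
 by apply: contraNN h2 => /eqP h; rewrite (bigD1 i)//= h mul0r.
 have := hat_supp hn; rewrite ltr_norml => /andP[g1 g2].
 have := floor_itv (x ord0 i / del b); rewrite -/(fl b i) => /andP[g3 g4].
 have z1 : (z i < fl b i + 1 + 1) by rewrite -(ltr_int R); rewrite intrD in g4; lra.
 have z2 : fl b i < z i + 1 by rewrite -(ltr_int R); lra.
 have [->|->] := int_two z1 z2.
 by exists false; rewrite addr0.
 by exists true.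
 have /choice[B HB] := hz; exists (b, [ffun i => B i]); first by rewrite mem_enum.
 by rewrite /mk/=; congr (_, _); apply/ffunP => i; rewrite !ffunE.
- by rewrite map_inj_uniq ?enum_uniq.
- by move=> J; rewrite lee_fin om_ge0.
rewrite big_map big_enum/= sumEFin; congr EFin.
have E b B : om r (mk (b, B)) x = rho (dk k0 x / 2 ^ (Lb b)) *
 \prod_(i < n) hat (x ord0 i / del b - (fl b i)%:~R - (nat_of_bool (B i))%:R).
 rewrite /om hk eqxx /chi/=; congr (_ * _); apply: eq_bigr => i _.
 by rewrite ffunE intrD opprD addrA.
rewrite (eq_bigr (fun p => om r (mk (p.1, p.2)) x))//.
rewrite -(pair_bigA _ (fun b B => om r (mk (b, B)) x))/=.
rewrite (eq_bigr (fun b => rho (dk k0 x / 2 ^ (Lb b)))) => [|b _]; last first.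
 rewrite (eq_bigr (fun B : {ffun 'I_n -> bool} => rho (dk k0 x / 2 ^ (Lb b)) *
 \prod_(i < n) hat (x ord0 i / del b - (fl b i)%:~R - (nat_of_bool (B i))%:R))) => [|B _]//.
 rewrite -mulr_sumr -(bigA_distr_bigA (fun i c => hat (x ord0 i / del b - (fl b i)%:~R - (nat_of_bool c)%:R)))/=.
 rewrite big1 ?mulr1// => i _; rewrite big_bool/= subr0 addrC hat_sum//.
 have := floor_itv (x ord0 i / del b); rewrite -/(fl b i) intrD => /andP[g3 g4].
 by apply/andP; split; lra.
have p2 : 0 < 2 ^ l0 :> R by pos.
rewrite big_bool/= addrC /Lb/= addr0 expfzDr// invfM mulrA rho_sum//.
rewrite ler_pdivlMr// ler_pdivrMr// mul1r (ltW l01)/=.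
by move: l02; rewrite expfzDr// mulrC.
Qed.
End whitney.

(** * Elementary bounds for sums over dyadic scales *)

Lemma geo_le (c a : R) k : 0 < c -> 0 <= a ->
 \sum_(i < k) (if c / 2 ^+ i <= a then c / 2 ^+ i else 0) <= 2 * a.
move=> c0 a0; elim: k c c0 => [|k IH] c c0; first by rewrite big_ord0.
have E (i : nat) : c / 2 ^+ i.+1 = (c / 2) / 2 ^+ i by rewrite exprS invfM mulrA.
rewrite big_ord_recl divr1; case: (leP c a) => ca.
 have tot j : \sum_(i < j) c / 2 ^+ i <= 2 * c.
 have -> : \sum_(i < j) c / 2 ^+ i = 2 * c - 2 * c / 2 ^+ j.
 elim: j => [|j IHj]; first by rewrite big_ord0 divr1 subrr.
 rewrite big_ord_recr/= IHj exprS; field; by [].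
 by rewrite lerBlDr lerDl.
 apply: le_trans (_ : \sum_(i < k.+1) c / 2 ^+ i <= _); last by apply: le_trans (tot _) _; rewrite ler_wpM2l.
 rewrite big_ord_recl divr1 lerD2l; apply: ler_sum => i _; case: ifP => // _.
rewrite add0r; under eq_bigr do rewrite E.
by apply: IH; rewrite divr_gt0.
Qed.

Lemma geo_count (c a : R) k : 0 < c ->
 \sum_(i < k) (if c / 2 ^+ i / 2 <= a <= 2 * (c / 2 ^+ i) then 1 else 0 : R) <= 8.
move=> c0; have [a0|a0] := leP a 0.
 rewrite big1 // => i _; case: ifP => // /andP[h _]; exfalso; move: h; apply/negP; rewrite -ltNge.
 by apply: le_lt_trans a0 _; rewrite//.
apply: (le_via ((2 / a) * \sum_(i < k) (if c / 2 ^+ i <= 2 * a then c / 2 ^+ i else 0))).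
 rewrite mulr_sumr; apply: ler_sum => i _; case: ifP => [/andP[h1 h2]|_]; last first.
 by case: ifP => _; rewrite mulr_ge0.
 rewrite ifT; last by lra.
 by rewrite mulrAC ler_pdivlMr// mul1r.
apply: le_trans (ler_wpM2l _ (geo_le k c0 _)) _; rewrite//.
by apply: le_of_eq; field; exact: lt0r_neq0.
Qed.

(** [P] is increasing and [Q] decreasing in the index, so the indices with both form an interval and
    the sum telescopes to two boundary values. The induction carries the left boundary value [a]. *)
Lemma tele_bound (u : nat -> R) (P Q : nat -> bool) (B : R) k : 0 <= B ->
 (forall i, P i -> P i.+1) -> (forall i, Q i.+1 -> Q i) ->
 (forall i, P i && Q i -> `|u i| <= B /\ `|u i.+1| <= B) ->
 `|\sum_(i < k) (if P i && Q i then u i.+1 - u i else 0)| <= 2 * B.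
move=> B0 hP hQ hu.
have hP' i j : (i <= j)%N -> P i -> P j.
 by move=> ij pi; rewrite -(subnKC ij); elim: (j - i)%N => [|d IH]; rewrite ?addn0 ?addnS//; exact: hP.
have hQ' i j : (i <= j)%N -> Q j -> Q i.
 by move=> ij; rewrite -(subnKC ij); elim: (j - i)%N => [|d IH]; rewrite ?addn0 ?addnS// => /hQ.
suff [H _] : `|\sum_(i < k) (if P i && Q i then u i.+1 - u i else 0)| <= 2 * B /\
 (forall j, k = j.+1 -> P j && Q j -> exists2 a, `|a| <= B &
 \sum_(i < k) (if P i && Q i then u i.+1 - u i else 0) = u k - a) by [].
elim: k => [|k [IH1 IH2]]; first by rewrite big_ord0 normr0.
rewrite big_ord_recr/=; case: ifPn => pq; last first.
 by rewrite addr0; split => // j [<-] h; rewrite h in pq.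
have [u1 u2] := hu k pq.
have [a aB aE] : exists2 a, `|a| <= B & \sum_(i < k) (if P i && Q i then u i.+1 - u i else 0) + (u k.+1 - u k) = u k.+1 - a.
 have [k0|[j kj]] : k = 0%N \/ exists j, k = j.+1 by case: (k) => [|j]; [left|right; exists j].
 by exists (u k) => //; rewrite k0 big_ord0 add0r.
 have [pqj|npqj] := boolP (P j && Q j).
 by have [a aB ->] := IH2 j kj pqj; exists a => //; ring.
 exists (u k) => //; rewrite big1 ?add0r// => i _; case: ifP => // /andP[pi qi]; exfalso.
 move: npqj; apply/negP; rewrite negbK; move/andP: pq => [pk qk]; apply/andP; split.
 by apply: hP' pi; have := ltn_ord i; rewrite {2}kj.
 by apply: hQ' qk; rewrite kj.
split; last by move=> _ [<-] _; exists a.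
by rewrite aE (le_trans (ler_normB _ _))// mulrDl mul1r lerD.
Qed.

Lemma inte_bdd_supp (h : Rn -> R) (c : Rn) (r B : R) : 0 < r -> 0 <= B ->
 mfun h -> (forall x, `|h x| <= B) ->
 (forall x, ~ eball c r x -> h x = 0) -> inte h /\ \int[L]_x `|h x| <= B * (r ^+ n * vball).
move=> r0 B0 mh hB hs.
have iI : inte (\1_(eball c r)).
 apply: inte_indic_fin; first exact: meas_eball.
 by apply: (@le_lt_trans _ _ (leb (eball c r))) => //; rewrite leb_eball// ltry.
have hI x : `|h x| <= B * \1_(eball c r) x.
 rewrite indicE; case: (pselect (eball c r x)) => hx; first by rewrite mem_set// mulr1.
 by rewrite hs// normr0.
have ih : inte h by apply: inte_le mh hI _; exact: inteZ.
split => //; apply: le_trans (ler_Rint (inte_abs ih) (inteZ B iI) hI) _.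
by rewrite RintegralZl// /Rintegral integral_eball.
Qed.

Lemma Rint_shift (h : Rn -> R) (v : Rn) : inte h ->
 inte (fun x => h (x - v)) /\ \int[L]_x h ((x : Rn) - v) = \int[L]_x h x.
move=> ih; have [j1 j2] := Rint_affine (- v) (oner_neq0 R) ih; split.
 by move: j1; congr inte; apply/funext => x; rewrite scale1r.
rewrite normr1 expr1n invr1 mul1r in j2; rewrite -j2.
by apply: eq_Rintegral => x _; rewrite scale1r.
Qed.

Lemma meas_shift (h : Rn -> R) (v : Rn) : mfun h ->
 mfun ((fun x => h (x - v))).
move=> mh; have := @measurable_affine R n _ _ 1 (- v) h (oner_neq0 R) mh.
by apply: eq_measurable_fun => x _; rewrite scale1r.
Qed.

Lemma Rint_eq0 (h : Rn -> R) : (forall x, h x = 0) -> \int[L]_x h x = 0.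
move=> h0; rewrite (_ : (fun x : RL R n => h x) = cst 0); last by apply/funext => x; exact: h0.
by rewrite Rintegral_cst// mul0r.
Qed.

Definition locb (w : Rn -> R) := mfun w /\
 forall r, exists B : R, forall x, enorm x <= r -> `|w x| <= B.

(** * The localised pieces: size, support, moments and maximal function *)

Section atoms.
Variables (m M : nat).
Variable f : @distr R n.
Hypothesis tf : tempered f.
Local Notation g := (gmax m f).
Hypothesis hc : forall k, exists x, ~ lev g k x.
(** Differences of order [M.+1] and step [l/2] move a point by at most [(M+1) l/2 = Kc l/32], a
    small part of the cutoff radius [Kc l]. *)
Definition Kc : R := (16 * M.+1)%:R.
Variable CA : R.
Hypothesis CA0 : 0 < CA.
Hypothesis HA : forall j t x y, 0 < t -> enorm (y - x) < 2 * Kc * t ->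
 (`|dilt f (bA M j) t y|%:E <= CA%:E * g x)%E.
Hypothesis HP : forall t x y, 0 < t -> enorm (y - x) < 2 * Kc * t ->
 (`|dilt f (bPhi M) t y|%:E <= CA%:E * g x)%E.

Lemma Kc_gt0 : 0 < Kc. by []. Qed.
Let Kc0 := Kc_gt0.

Local Notation F l j := (dilt f (bA M j) l).
Local Notation d := (dk g).
Local Notation J := WJ.

(** Within the enlarged aperture there is a point outside the level set [k + 1], where the maximal
    function is at most [2^(k+1)]. *)
Lemma gmax_to_bound (k : int) (y : Rn) (l v : R) : 0 < l ->
 (forall x, enorm (y - x) < 2 * Kc * l -> (v%:E <= CA%:E * g x)%E) ->
 d (k + 1) y < 2 * Kc * l -> v <= 2 * CA * 2 ^ k.
move=> l0 H /(dk_lt hc)[x nx yx]; have := H x yx.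
have gx : (g x <= (2 ^ (k + 1))%:E)%E by rewrite leNgt; apply/negP.
move=> h; rewrite -lee_fin; apply: le_trans h _.
apply: le_trans (lee_wpmul2l _ gx) _; first by pos.
by rewrite lee_fin expfzDr//; apply: le_of_eq; ring.
Qed.

Lemma F_bound k l j y : 0 < l -> d (k + 1) y < 2 * Kc * l -> `|F l j y| <= 2 * CA * 2 ^ k.
by move=> l0; apply: gmax_to_bound => // yx; exact: HA. Qed.

Lemma P_bound k l y : 0 < l -> d (k + 1) y < 2 * Kc * l -> `|dilt f (bPhi M) l y| <= 2 * CA * 2 ^ k.
by move=> l0; apply: gmax_to_bound => // yx; exact: HP. Qed.

Definition shv (l : R) (j : 'I_n) (t : 'I_M.+2) : Rn := (t%:R * (l / 2)) *: e_ j.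

Lemma enorm_shv l j t : 0 < l -> enorm (shv l j t) <= Kc * l / 32.
move=> l0; have l2 : 0 < l / 2 by pos.
rewrite enorm_delta normrM (gtr0_norm l2) ger0_norm//.
have tM : t%:R <= M.+1%:R :> R by rewrite ler_nat -ltnS.
have -> : Kc * l / 32 = M.+1%:R * (l / 2) by rewrite /Kc; field.
by rewrite ler_wpM2r.
Qed.

Definition Ga (l : R) (j : 'I_n) (K : J) (y : Rn) : R := F l j y * om g (Kc * l) K y.

Lemma om_kap l K y : om g (Kc * l) K y != 0 ->
 [/\ kap g (Jk K) (Kc * l) y, chi g K y != 0 & Kc * l < 2 * Jr K].
rewrite /om; case: ifPn => [kp|_]; last by rewrite eqxx.
move=> cn; split => //; have [/andP[_ h] _] := chi_supp cn.
by move/andP: kp => [h1 _]; exact: le_lt_trans h.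
Qed.

Lemma om_le1 r K y : om g r K y <= 1.
by rewrite /om; case: ifP => // _; exact: chi_le1. Qed.

Lemma Ga_bound l j K y : 0 < l -> `|Ga l j K y| <= 2 * CA * 2 ^ (Jk K).
move=> l0; have [oz|onz] := eqVneq (om g (Kc * l) K y) 0.
 by rewrite /Ga oz mulr0 normr0.
have [/andP[_ h] _ _] := om_kap onz.
rewrite normrM -[leRHS]mulr1; apply: ler_pM => //.
 apply: F_bound => //; apply: lt_le_trans h _.
 by rewrite -mulrA ler_peMl// ler1n.
by rewrite ger0_norm ?om_ge0// om_le1.
Qed.

Lemma Ga_supp l j K y : Ga l j K y != 0 -> enorm (y - Jc K) < Jr K / 16 /\ Kc * l < 2 * Jr K.
rewrite mulf_eq0 negb_or => /andP[_ /om_kap[_ cn h]]; split => //.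
by have [] := chi_supp cn.
Qed.

Lemma Ga_meas l j K : 0 < l -> mfun (Ga l j K).
move=> l0; apply: measurable_funM; last exact: (om_meas hc).
by apply: econt_meas; apply: dilt_econt => //; exact: schwartz_bA.
Qed.

(** Moving the cutoff by a small shift has two effects. If the sharp cut does not change, [chi]
    varies by its Lipschitz constant times the shift, of order [l / Jr]. If it changes, [dk] at
    level [k] or [k + 1] is within a factor 2 of [Kc l], which happens for boundedly many dyadic
    [l]. *)
Lemma local_estimate l j (K : J) x x' : 0 < l -> enorm (x' - x) <= Kc * l / 32 ->
 `|F l j x'| * `|om g (Kc * l) K x' - om g (Kc * l) K x| <= 2 * CA * 2 ^ (Jk K) *
 ((if Kc * l / 2 <= d (Jk K) x <= 2 * (Kc * l) then 1 else 0 : R) +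
 (if Kc * l / 2 <= d (Jk K + 1) x <= 2 * (Kc * l) then 1 else 0 : R) +
 (if l <= Jr K then Cchi * Kc / Jr K * l else 0)).
move=> l0 xx; set k := Jk K; set r := Kc * l; rewrite -/r in xx.
have r0 : 0 < r by pos.
have k0 : 0 <= 2 * CA * 2 ^ k by pos.
have d1 := dk_lip hc k x' x; have d2 := dk_lip hc (k + 1) x' x.
move: d1 d2; rewrite !ler_norml => /andP[d1 d1'] /andP[d2 d2'].
have Cc0 : 0 < Cchi by rewrite ltr_pwDl.
have Jr0 := @Jr_gt0 K.
have b0 (b : bool) : 0 <= (if b then 1 else 0 : R) by case: b.
have e0 : 0 <= (if l <= Jr K then Cchi * Kc / Jr K * l else 0).
 by case: ifP => // _; rewrite !mulr_ge0.
have Fk : kap g k r x || kap g k r x' -> `|F l j x'| <= 2 * CA * 2 ^ k.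
 move=> h; apply: F_bound => //; rewrite -mulrA -/r.
 by case/orP: h => /andP[_ h]; lra.
have [kk|kk] := eqVneq (kap g k r x') (kap g k r x).
 have [kx|/negPf kx] := boolP (kap g k r x); last first.
 by rewrite /om kk kx subrr normr0 mulr0 mulr_ge0// !addr_ge0.
 rewrite ler_pM//; first by apply: Fk; rewrite kx.
 rewrite /om -/k kk kx; apply: ler_wpDl; first by pos.
 case: ifPn => lJ.
 apply: le_trans (chi_lip hc K x' x) _.
 have -> : Cchi * Kc / Jr K * l = Cchi / Jr K * (Kc * l) by ring.
 rewrite ler_wpM2l//; apply: le_trans xx _; rewrite -/r; lra.
 (* Scales larger than the radius are void: [kap] forces [dk >= Kc l], while [chi] is supported
    where [dk < 2 Jr]. *)
 rewrite -ltNge in lJ.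
 have K16 : 16 <= Kc by rewrite ler_nat leq_pmulr.
 have rJ : 2 * Jr K <= r by rewrite /r; nra.
 have z y : r <= d k y -> chi g K y = 0.
 move=> ry; apply/eqP; apply: contraT => /chi_supp[/andP[_]]; rewrite -/k => h _.
 by exfalso; lra.
 move: (kx) kk => /andP[h1 _]; rewrite kx => /andP[h2 _].
 by rewrite !z// subrr normr0.
have o1 : `|om g r K x' - om g r K x| <= 1.
 rewrite ler_norml; have := om_ge0 g r K x; have := om_ge0 g r K x'.
 by have := om_le1 r K x; have := om_le1 r K x' => ? ? ? ?; apply/andP; split; lra.
apply: ler_pM => //.
 by apply: Fk; move: kk; case: (kap g k r x); case: (kap g k r x').
apply: le_trans o1 _.
have [h|h] := boolP (r / 2 <= d k x <= 2 * r); first by rewrite -addrA lerDl addr_ge0.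
have [h'|h'] := boolP (r / 2 <= d (k + 1) x <= 2 * r); first by rewrite add0r lerDl.
exfalso; move/negP: kk; apply; apply/eqP; rewrite /kap; congr andb; apply/idP/idP => p.
- by rewrite leNgt; apply/negP => q; move/negP: h; apply; apply/andP; split; lra.
- by rewrite leNgt; apply/negP => q; move/negP: h; apply; apply/andP; split; lra.
- by rewrite ltNge; apply/negP => q; move/negP: h'; apply; apply/andP; split; lra.
- by rewrite ltNge; apply/negP => q; move/negP: h'; apply; apply/andP; split; lra.
Qed.

(** The scales run from [2^I] at [i = 0] down to [2^(-I)] at [i = I + I]. *)
Definition ell (I i : nat) : R := 2 ^+ I / 2 ^+ i.
Lemma ell_gt0 I i : 0 < ell I i. by pos. Qed.
Lemma ellS I i : ell I i.+1 = ell I i / 2. by rewrite /ell exprS invfM mulrA mulrAC. Qed.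

(** The cutoff sits inside the difference: [Ga] is localised first and differenced over the shifts
    afterwards. Localising the differences instead would destroy the moments. *)
Definition bJ (I : nat) (K : J) (x : Rn) : R :=
 \sum_(i < I + I) \sum_(j < n) \sum_(t < M.+2)
 @csgn M t * Ga (ell I i) j K (x - shv (ell I i) j t).

Definition Ccs : R := \sum_(j < n) \sum_(t < M.+2) `|@csgn M t|.
(** The first term is the telescoping main part. In the bracket, 8 and 8 count the scales at which
    the sharp cut can change, and the last term sums the Lipschitz errors over scales [l <= Jr]. *)
Definition Cb : R := 2 * (2 * CA) + Ccs * (2 * CA) * (8 + 8 + 2 * (Cchi * Kc)).

Lemma Ccs_ge0 : 0 <= Ccs. by apply: sumr_ge0 => j _; exact: sumr_ge0. Qed.

Lemma Cb_gt0 : 0 < Cb.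
rewrite ltr_pwDl//; have := Ccs_ge0; have := CA0.
have : 0 <= Cchi * Kc by pos.
by move=> h1; pos.
Qed.

(** Freezing the cutoff at [x] turns the sum over shifts back into increments of [f * Phi] over
    consecutive scales, which telescope; [local_estimate] sums the error of freezing. Hence the
    bound is uniform in the number of scales. *)
Lemma bJ_bound I K x : `|bJ I K x| <= Cb * 2 ^ (Jk K).
have k0 : 0 < 2 ^ (Jk K) :> R by pos.
have l0 i := ell_gt0 I i.
pose u i := dilt f (bPhi M) (ell I i) x.
pose mainp := \sum_(i < I + I) om g (Kc * ell I i) K x * (u i.+1 - u i).
pose errp := \sum_(i < I + I) \sum_(j < n) \sum_(t < M.+2) @csgn M t *
 (F (ell I i) j (x - shv (ell I i) j t) *
 (om g (Kc * ell I i) K (x - shv (ell I i) j t) - om g (Kc * ell I i) K x)).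
have -> : bJ I K x = mainp + errp.
 rewrite -big_split/=; apply: eq_bigr => i _.
 rewrite /u ellS dilt_refine// mulr_sumr -big_split/=; apply: eq_bigr => j _.
 rewrite mulr_sumr -big_split/=; apply: eq_bigr => t _; rewrite /Ga; ring.
apply: le_trans (ler_normD _ _) _; rewrite mulrDl; apply: lerD.
 have -> : mainp = chi g K x * \sum_(i < I + I) (if (Kc * ell I i <= d (Jk K) x) &&
 (d (Jk K + 1) x < Kc * ell I i) then u i.+1 - u i else 0).
 rewrite mulr_sumr; apply: eq_bigr => i _; rewrite /om -/(kap _ _ _ _); case: ifP => // _.
 by rewrite mul0r mulr0.
 rewrite normrM -[leRHS]mul1r; apply: ler_pM => //.
 by rewrite ger0_norm ?chi_ge0// chi_le1.
 rewrite -mulrA; apply: (@tele_bound u (fun i => Kc * ell I i <= d (Jk K) x) (fun i => d (Jk K + 1) x < Kc * ell I i)).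
 - by pos.
 - move=> i; apply: le_trans; rewrite ellS mulrA ler_pdivrMr// ler_peMr ?ler1n//.
 - move=> i; move/lt_le_trans; apply; rewrite ellS mulrA ler_pdivrMr// ler_peMr ?ler1n//.
 - move=> i /andP[_ h]; split; apply: P_bound => //.
 apply: lt_le_trans h _; rewrite -mulrA ler_peMl ?ler1n//.
 by rewrite ellS; have -> : 2 * Kc * (ell I i / 2) = Kc * ell I i by field.
pose E i := (if Kc * ell I i / 2 <= d (Jk K) x <= 2 * (Kc * ell I i) then 1 else 0 : R) +
 (if Kc * ell I i / 2 <= d (Jk K + 1) x <= 2 * (Kc * ell I i) then 1 else 0 : R) +
 (if ell I i <= Jr K then Cchi * Kc / Jr K * ell I i else 0) : R.
apply: (le_via (\sum_(i < I + I) Ccs * (2 * CA * 2 ^ (Jk K) * E i))).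
 apply: le_trans (ler_norm_sum _ _ _) _; apply: ler_sum => i _.
 apply: le_trans (ler_norm_sum _ _ _) _; rewrite mulr_suml; apply: ler_sum => j _.
 apply: le_trans (ler_norm_sum _ _ _) _; rewrite mulr_suml; apply: ler_sum => t _.
 rewrite normrM ler_wpM2l// normrM; apply: local_estimate => //.
 by rewrite addrAC subrr add0r enormN; exact: enorm_shv.
rewrite -mulr_sumr -mulr_sumr -!mulrA ler_wpM2l ?Ccs_ge0//.
rewrite ler_wpM2l// ler_wpM2l//.
rewrite [leRHS]mulrC ler_wpM2l//.
rewrite !big_split/=; have cK : 0 < Kc * 2 ^+ I by pos.
have cE i : Kc * ell I i = Kc * 2 ^+ I / 2 ^+ i by rewrite mulrA.
have Jr0 := @Jr_gt0 K.
apply: lerD; first apply: lerD.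
- by under eq_bigr do rewrite cE; exact: geo_count.
- by under eq_bigr do rewrite cE; exact: geo_count.
rewrite (eq_bigr (fun i : 'I_(I + I) => Cchi * Kc / Jr K * (if ell I i <= Jr K then ell I i else 0))); last first.
 by move=> i _; case: ifP => _; rewrite ?mulr0.
have Cc0 : 0 < Cchi by rewrite ltr_pwDl.
rewrite -mulr_sumr; apply: le_trans (ler_wpM2l _ (geo_le _ _ _)) _.
- by pos.
- by [].
- exact: ltW.
by apply: le_of_eq; field; exact: lt0r_neq0.
Qed.

(** [chi] reaches at most [Jr/16] from the centre, and a shift adds at most [Kc l/32 < Jr/16]. *)
Lemma bJ_supp I K x : bJ I K x != 0 -> enorm (x - Jc K) < Jr K / 8 /\ exists y, chi g K y != 0.
move=> b0.
have [i [j [t h]]] : exists (i : 'I_(I + I)) j t, Ga (ell I i) j K (x - shv (ell I i) j t) != 0.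
 apply: contrapT => H; move/eqP: b0; apply; rewrite /bJ big1// => i _; rewrite big1// => j _.
 rewrite big1// => t _; apply/eqP; rewrite mulf_eq0; apply/orP; right.
 by apply: contraT => h; exfalso; apply: H; exists i, j, t.
have [h1 h2] := Ga_supp h; split; last first.
 by move: h; rewrite mulf_eq0 negb_or => /andP[_ /om_kap[_ cn _]]; exists (x - shv (ell I i) j t).
have := enorm_shv j t (ell_gt0 I i); set v := shv _ _ _ in h1 *; move=> h3.
have := enorm_dist3 x (x - v) (Jc K); rewrite opprB [x + (v - x)]addrC subrK => h4.
have := @Jr_gt0 K; move: h1; lra.
Qed.

Lemma bJ_meas I K : mfun (bJ I K).
apply: measurable_sum => i; apply: measurable_sum => j; apply: measurable_sum => t.
by apply: measurable_funM => //; apply: meas_shift; apply: Ga_meas; exact: ell_gt0.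
Qed.

Lemma inte_Ga l j K w v : 0 < l -> locb w -> inte (fun y => Ga l j K y * w (y + v)).
move=> l0 [mw bw]; have Jr0 := @Jr_gt0 K.
have [B HB] := bw (enorm (Jc K) + Jr K + enorm v).
have mwv : mfun ((fun y => w (y + v))).
 by have := meas_shift (- v) mw; apply: eq_measurable_fun => y _; rewrite opprK.
have k0 : 0 <= 2 * CA * 2 ^ (Jk K) by pos.
have [] // := @inte_bdd_supp (fun y => Ga l j K y * w (y + v)) (Jc K) (Jr K) (2 * CA * 2 ^ (Jk K) * `|B|).
- by apply: measurable_funM => //; exact: Ga_meas.
- move=> y; have [->|g0] := eqVneq (Ga l j K y) 0; first by rewrite mul0r normr0.
 rewrite normrM; apply: ler_pM => //; first exact: Ga_bound.
 apply: le_trans (HB _ _) (ler_norm _); have [h _] := Ga_supp g0.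
 have := enormD y v; have := enorm_dist3 y (Jc K) 0; rewrite !subr0; lra.
- move=> y ny; have [->|g0] := eqVneq (Ga l j K y) 0; first by rewrite mul0r.
 by exfalso; apply: ny; have [h _] := Ga_supp g0; rewrite /eball/=; lra.
Qed.

Lemma bJ_pair I K w : locb w -> inte (fun x => bJ I K x * w x) /\
 \int[L]_x (bJ I K x * w x) = \sum_(i < I + I) \sum_(j < n)
 \int[L]_y (Ga (ell I i) j K y * \sum_(t < M.+2) @csgn M t * w (y + shv (ell I i) j t)).
move=> lw.
have sh i j t : inte (fun x => @csgn M t * (Ga (ell I i) j K (x - shv (ell I i) j t) * w x)) /\
 \int[L]_x (@csgn M t * (Ga (ell I i) j K ((x : Rn) - shv (ell I i) j t) * w x)) =
 \int[L]_y (@csgn M t * (Ga (ell I i) j K y * w (y + shv (ell I i) j t))).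
 have iG := inte_Ga j K (shv (ell I i) j t) (ell_gt0 I i) lw.
 have [s1 s2] := Rint_shift (shv (ell I i) j t) iG.
 have E : (fun x => Ga (ell I i) j K (x - shv (ell I i) j t) * w (x - shv (ell I i) j t + shv (ell I i) j t)) =
 (fun x => Ga (ell I i) j K (x - shv (ell I i) j t) * w x) by apply/funext => x; rewrite subrK.
 rewrite E in s1; split; first exact: inteZ.
 rewrite RintegralZl// RintegralZl//; congr (_ * _); rewrite -s2.
 by apply: eq_Rintegral => x _; rewrite subrK.
have iT i j := inte_sum (index_enum 'I_M.+2) (fun t => (sh i j t).1).
have iJ i := inte_sum (index_enum 'I_n) (fun j => (iT i j).1).
have [iI IE] := inte_sum (index_enum 'I_(I + I)) (fun i : 'I_(I + I) => (iJ i).1).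
have E : (fun x => bJ I K x * w x) = fun x => \sum_(i < I + I) \sum_(j < n) \sum_(t < M.+2)
 @csgn M t * (Ga (ell I i) j K (x - shv (ell I i) j t) * w x).
 apply/funext => x; rewrite mulr_suml; apply: eq_bigr => i _; rewrite mulr_suml; apply: eq_bigr => j _.
 by rewrite mulr_suml; apply: eq_bigr => t _; rewrite mulrA.
rewrite E; split => //; rewrite IE; apply: eq_bigr => i _; rewrite (iJ i).2; apply: eq_bigr => j _.
rewrite (iT i j).2.
have iS : forall t, inte (fun y => @csgn M t * (Ga (ell I i) j K y * w (y + shv (ell I i) j t))).
 by move=> t; apply: inteZ; exact: inte_Ga.
rewrite (eq_bigr (fun t => \int[L]_y (@csgn M t * (Ga (ell I i) j K y * w (y + shv (ell I i) j t))))); last first.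
 by move=> t _; exact: (sh i j t).2.
rewrite -(inte_sum (index_enum 'I_M.+2) iS).2; apply: eq_Rintegral => y _.
by rewrite mulr_sumr; apply: eq_bigr => t _; rewrite mulrCA.
Qed.

Lemma locb_schwartz (w : Rn -> R) : schwartz w -> locb w.
move=> sw; split; first exact: (schwartz_meas [::] sw).
move=> r; have [C C0 HC] := schwartz_decay [::] 0 sw; exists C => x _.
by have := HC x; rewrite mul1r.
Qed.

Lemma locb_monomial (gam : 'I_n -> nat) : locb (fun x : Rn => \prod_(i < n) x ord0 i ^+ gam i).
split.
 apply/measurable_EFinP; apply: borelfun_measurable.
 apply: (borelfun_tensor (g := fun i z => z ^+ gam i)) => i; exact: measurable_funX.
move=> r; exists (\prod_(i < n) `|r| ^+ gam i) => x xr; rewrite normr_prod.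
apply: ler_prod => i _; rewrite normr_ge0 normrX; apply: lerXn2r; rewrite//.
by rewrite (le_trans (enorm_coord x i))// (le_trans xr)// ler_norm.
Qed.

(** Moving the shifts onto the monomial produces a difference of order [M.+1] in the variable [x_j],
    in which the monomial has degree at most [M]. *)
Lemma bJ_moments I K (gam : 'I_n -> nat) : (\sum_(i < n) gam i <= M)%N ->
 \int[L]_x (bJ I K x * xpow gam x) = 0.
move=> gM; have [_ ->] := bJ_pair I K (locb_monomial gam).
rewrite big1// => i _; rewrite big1// => j _.
apply: Rint_eq0 => y; rewrite [X in _ * X](_ : _ = 0) ?mulr0//.
pose l := ell I i; rewrite -/l.
pose P := \prod_(a < n | a != j) (y : Rn) ord0 a ^+ gam a.
rewrite (eq_bigr (fun t : 'I_M.+2 => P * (csgn t * horner 'X^(gam j) ((y : Rn) ord0 j - t%:R * (- (l / 2)))))); last first.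
 move=> t _; rewrite (bigD1 j)//= hornerXn [RHS]mulrCA; congr (_ * _); rewrite [RHS]mulrC; congr (_ * _).
 by rewrite !mxE !eqxx mulr1 mulrN opprK.
 by apply: eq_bigr => a aj; rewrite !mxE (negPf aj) mulr0 addr0.
rewrite -mulr_sumr -[X in _ * X](iter_shopE (-1) (- (l / 2)) M.+1).
rewrite [X in _ * X](_ : _ = 0) ?mulr0//.
have := @iter_dif_poly (- (l / 2)) M.+1 'X^(gam j); rewrite /dif => ->//.
rewrite size_polyXn; apply: leq_trans gM; by rewrite (bigD1 j)//= leq_addr.
Qed.

Hypothesis mM : (m <= M)%N.
Variable KI : R.
Hypothesis KI0 : 0 < KI.
Hypothesis HKI : forall (h : Rn -> R) (C : R),
 mfun h -> (forall x, (1 + enorm x) ^+ n.+1 * `|h x| <= C) ->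
 inte h /\ \int[L]_x `|h x| <= KI * C.

Lemma Sm_decay (psi : Rn -> R) al (x : Rn) k : Sm m psi -> (size al <= m.+1)%N -> (k <= (m + 2) * (n + 1))%N ->
 (1 + enorm x) ^+ k * `|dpart al psi x| <= 1.
move=> [_ sp] sal kM; apply: le_trans (sp al sal x); rewrite ler_wpM2r//.
by apply: ler_weXn2l => //; exact: enorm1_ge1.
Qed.

Lemma Rint_dil (psi : Rn -> R) (tau : R) (y : Rn) : Sm m psi -> 0 < tau -> \int[L]_u `|dil psi tau y u| <= KI.
move=> sp t0; have tn : - tau^-1 != 0 by rewrite oppr_eq0 gt_eqF.
have nM : (n.+1 <= (m + 2) * (n + 1))%N.
 by apply: leq_trans (_ : n.+1 <= 1 * (n + 1))%N _; [rewrite mul1n addn1|rewrite leq_mul2r addn2 orbT].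
have [ip pI] := HKI (schwartz_meas [::] sp.1) (fun x => @Sm_decay psi [::] x _ sp isT nM).
have [_ E] := Rint_affine (tau^-1 *: y) tn (inte_abs ip).
rewrite mulr1 in pI; apply: le_trans pI; apply: le_of_eq.
transitivity (tau ^- n * \int[L]_u `|psi (- tau^-1 *: (u : Rn) + tau^-1 *: y)|).
 rewrite -RintegralZl//; last exact: (Rint_affine (tau^-1 *: y) tn (inte_abs ip)).1.
 by apply: eq_Rintegral => u _; rewrite dilE normrM ger0_norm.
rewrite [X in _ * X]E normrN gtr0_norm// exprVn invrK mulrA mulVf ?mul1r//.
by rewrite gt_eqF.
Qed.

(** The factor [tau^-(n+m+1)] from dilation and differentiation is balanced by the decay
    [(1+|z|)^-(n+m+1)] of the test function, since [tau (1 + |z|)] is at least [q]. The bound is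
    thus uniform in [tau]. *)
Lemma dil_far (psi : Rn -> R) (tau : R) (x y v : Rn) (j : 'I_n) : Sm m psi -> 0 < tau -> enorm (y - x) < tau ->
 forall q, 0 < q -> q <= enorm (x - v) ->
 `|dpart (nseq m.+1 j) (dil psi tau y) v| <= q ^- (n + m.+1).
move=> sp t0 yx q q0 qv; rewrite dpart_dil; last exact: sp.1.1.
rewrite size_nseq; set z := tau^-1 *: (y - v).
have tz : q <= tau * (1 + enorm z).
 rewrite mulrDr mulr1 enormZ gtr0_norm// mulrA divff ?gt_eqF// mul1r.
 by have := enorm_dist3 x y v; rewrite [enorm (x - y)]enormB; lra.
have h : (1 + enorm z) ^+ (n + m.+1) * `|dpart (nseq m.+1 j) psi z| <= 1.
 apply: Sm_decay => //; first by rewrite size_nseq.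
 by rewrite mulnDr muln1 addn2 -addnA leq_add2l; apply: leq_trans (leqnSn _) _; rewrite leq_addl.
have ti : 0 < tau^-1 by pos.
rewrite !normrM normrX normrN [`|tau ^- n|]gtr0_norm// (gtr0_norm ti).
have -> : tau ^- n * tau^-1 ^+ m.+1 = tau ^- (n + m.+1) by rewrite exprVn -invfM -exprD.
have z0 := enorm1_gt0 z.
rewrite -[leRHS]mul1r ler_pdivlMr//.
apply: (le_via (tau ^- (n + m.+1) * `|dpart (nseq m.+1 j) psi z| * (tau * (1 + enorm z)) ^+ (n + m.+1))).
 rewrite ler_wpM2l//.
 by apply: lerXn2r; rewrite ?nnegrE.
rewrite exprMn; apply: le_trans h; apply: le_of_eq.
have tk : tau ^+ (n + m.+1) != 0 by rewrite gt_eqF.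
by move: (tau ^+ _) tk => a a0; field.
Qed.

(** Of the differences, [m.+1] are turned into derivatives and give [l^(m+1)]; the other [M - m]
    cost a factor 2 each. *)
Lemma dif_bound (psi : Rn -> R) (tau : R) (x y u : Rn) (l : R) (j : 'I_n) (q : R) : Sm m psi -> 0 < tau -> enorm (y - x) < tau ->
 0 < l -> 0 < q -> (forall v, enorm (v - u) <= Kc * l / 32 -> q <= enorm (x - v)) ->
 `|\sum_(t < M.+2) csgn t * dil psi tau y (u + shv l j t)| <=
 2 ^+ M.+1 * (q ^- (n + m.+1) * l ^+ m.+1).
move=> sp t0 yx l0 q0 hq; set w := dil psi tau y.
have sw : smooth w by apply: (schwartz_dil y (lt0r_neq0 t0) sp.1).1.
pose G k (s : R) := (-1) ^+ k * dpart (nseq k j) w (u + (- s) *: e_ j).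
have dG k (s : R) : is_derive s 1 (G k) (G k.+1 s).
 have dn : is_derive s 1 (fun z : R => - z) (-1).
 apply: (@is_derive_quad _ _ _ 0 1) => // z _.
 by rewrite mul0r normr_le0; apply/eqP; ring.
 have lin := @isder_line _ j _ u (- s) (smooth_isder (nseq k j) j sw).
 have h := @is_derive1_comp _ (fun z => dpart (nseq k j) w (u + z *: e_ j)) (fun z : R => - z) s _ _ lin dn.
 apply: (is_derive_eq (is_deriveZ ((-1) ^+ k) h)).
 by rewrite /G exprS /GRing.scale/=; ring.
pose h := l / 2; have h0 : 0 <= h by pos.
have -> : \sum_(t < M.+2) csgn t * w (u + shv l j t) = iter M.+1 (dif h) (G 0%N) 0.
 rewrite iter_shopE; apply: eq_bigr => t _; rewrite /G mul1r sub0r opprK.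
 by [].
rewrite -(subnK (_ : m.+1 <= M.+1)%N)// iterD.
have hm : h ^+ m.+1 <= l ^+ m.+1 by apply: lerXn2r; rewrite ?nnegrE /h; lra.
apply: (le_via (2 ^+ (M.+1 - m.+1) * (q ^- (n + m.+1) * h ^+ m.+1))); last first.
 apply: ler_pM; rewrite//.
 by apply: ler_weXn2l; rewrite ?ler1n// subnK// leq_subr.
 by rewrite ler_wpM2l.
apply: iter_dif_bound2 => // s /andP[s1 s2].
apply: iter_dif_bound => // s' /andP[s1' s2'].
rewrite normrM normrX normrN1 expr1n mul1r; apply: dil_far yx _ _ _ => //.
apply: hq; rewrite addrAC subrr add0r enorm_delta normrN.
have -> : Kc * l / 32 = M.+1%:R * h by rewrite /h; field.
have s'0 : s' <= 0 by apply: le_trans s2.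
rewrite ler0_norm//; move: s1 s1'.
have -> : M.+1%:R = (M.+1 - m.+1)%:R + m.+1%:R :> R by rewrite -natrD subnK.
by rewrite mulrDl; lra.
Qed.

(** The factor [2^(n+m+1)] is lost in [htail_lb], and [8^(n+m+1)] in passing from radius [Jr] to
    [Jr/8]; the two summands belong to points near the ball and far from it. *)
Definition Chh : R := 2 ^+ (n + m.+1) * (8 ^+ (n + m.+1) *
 (Cb * KI + n%:R * (4 * CA) * 2 ^+ M.+1 * vball * 2 ^+ (n + m.+1))).

Lemma Chh_gt0 : 0 < Chh.
have := vball_gt0; have := Cb_gt0 => c0 v0.
rewrite !mulr_gt0// ltr_pwDl; have := CA0 => ca; by [].
Qed.

(** Near the ball, the sup bound of the piece is paired with the integral of the test function. Far
    away, the differences are moved to the test function, whose derivatives of order [m+1] decay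
    like the distance to the power [-(n+m+1)]; the factors [l^(m+1)] are summed over the scales
    [l <= Jr]. *)
Lemma bJ_htail I K (psi : Rn -> R) (tau : R) (x y : Rn) : Sm m psi -> 0 < tau -> enorm (y - x) < tau ->
 (`|\int[L]_u (bJ I K u * dil psi tau y u)|%:E <=
 htail (n + m.+1) (Jc K) (Jr K / 8) (Chh * 2 ^ (Jk K)) x)%E.
move=> sp t0 yx; set k := Jk K; set w := dil psi tau y.
have Jr0 := @Jr_gt0 K; have v0 := vball_gt0; have c0 := Cb_gt0.
have k0 : 0 < 2 ^ k :> R by pos.
have sw : schwartz w by apply: schwartz_dil; [exact: lt0r_neq0|exact: sp.1].
have [ib bE] := bJ_pair I K (locb_schwartz sw).
pose A1 := Cb * KI; pose A2 := n%:R * (4 * CA) * 2 ^+ M.+1 * vball * 2 ^+ (n + m.+1).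
have A10 : 0 <= A1 by pos.
have A20 : 0 <= A2 by pos.
have A8 : 1 <= 8 ^+ (n + m.+1) :> R by apply: exprn_ege1; rewrite ler1n.
have CE : Chh * 2 ^ k = 2 ^+ (n + m.+1) * (8 ^+ (n + m.+1) * (A1 + A2) * 2 ^ k).
 by rewrite /Chh -/A2 !mulrA.
have b1 : `|\int[L]_u (bJ I K u * w u)| <= A1 * 2 ^ k.
 have iw := inte_abs (schwartz_inte [::] sw).
 apply: (le_via (Cb * 2 ^ k * \int[L]_u `|w u|)).
 rewrite -RintegralZl//; apply: ler_norm_Rint => //; first exact: inteZ.
 by move=> u; rewrite normrM ler_wpM2r// bJ_bound.
 rewrite /A1 mulrAC ler_wpM2r ?(ltW k0)// ler_wpM2l ?(ltW c0)//; exact: Rint_dil.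
rewrite CE; apply: htail_lb => //.
- apply: le_trans b1 _; rewrite ler_wpM2r ?(ltW k0)//; nra.
have E8 : 8 ^+ (n + m.+1) * (A1 + A2) * 2 ^ k * (Jr K / 8) ^+ (n + m.+1) = (A1 + A2) * 2 ^ k * Jr K ^+ (n + m.+1).
 rewrite expr_div_n; have : 8 ^+ (n + m.+1) != 0 :> R by [].
 by move: (8 ^+ _) => a a0; field.
rewrite E8; have [xJ|xJ] := leP (enorm (x - Jc K)) (Jr K).
 apply: ler_pM => //.
 by apply: le_trans b1 _; rewrite ler_wpM2r ?(ltW k0)// lerDl.
 by apply: lerXn2r => //; rewrite nnegrE ?enorm_ge0// ltW.
set X := enorm (x - Jc K) in xJ *; have X0 : 0 < X by apply: lt_trans xJ.
pose q := X / 2; have q0 : 0 < q by pos.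
have b2 i j : `|\int[L]_u (Ga (ell I i) j K u * \sum_(t < M.+2) csgn t * w (u + shv (ell I i) j t))| <=
 (2 * CA * 2 ^ k * (2 ^+ M.+1 * q ^- (n + m.+1))) * (Jr K ^+ n * vball) * Jr K ^+ m *
 (if ell I i <= Jr K then ell I i else 0).
 set l := ell I i; have l0 : 0 < l by pos.
 have ca := CA0; have K16 : 16 <= Kc by rewrite ler_nat leq_pmulr.
 have [lJ|lJ] := leP l (Jr K); last first.
 rewrite mulr0 Rint_eq0 ?normr0// => u; have [->|g0] := eqVneq (Ga l j K u) 0; first by rewrite mul0r.
 by have [_ h] := Ga_supp g0; exfalso; nra.
 pose B := 2 * CA * 2 ^ k * (2 ^+ M.+1 * (q ^- (n + m.+1) * l ^+ m.+1)).
 have B0 : 0 <= B by pos.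
 pose h u := Ga l j K u * \sum_(t < M.+2) csgn t * w (u + shv l j t).
 have [||u nu|ih hB] := @inte_bdd_supp h (Jc K) (Jr K) B Jr0 B0.
 - apply: measurable_funM; first exact: Ga_meas.
 apply: measurable_sum => t; apply: measurable_funM => //.
 have := @meas_shift w (- shv l j t) (schwartz_meas [::] sw).
 by apply: eq_measurable_fun => u _; rewrite opprK.
 - move=> u; rewrite /h; have [->|g0] := eqVneq (Ga l j K u) 0; first by rewrite mul0r normr0.
 have [h1 h2] := Ga_supp g0.
 rewrite normrM; apply: ler_pM => //; first exact: Ga_bound.
 apply: dif_bound yx _ _ _ => // v vu; rewrite /q.
 have := enorm_dist3 x v (Jc K); have := enorm_dist3 v u (Jc K); rewrite -/X; lra.
 - rewrite /h; have [->|g0] := eqVneq (Ga l j K u) 0; first by rewrite mul0r.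
 by exfalso; apply: nu; have [h1 _] := Ga_supp g0; rewrite /eball/=; lra.
 apply: le_trans (le_normr_Rintegral measurableT ih) _; apply: le_trans hB _.
 (* One power of [l] is kept for the geometric sum over the scales. *)
 have lm : l ^+ m.+1 <= Jr K ^+ m * l.
 by rewrite exprSr ler_wpM2r ?(ltW l0)//; apply: lerXn2r; rewrite ?nnegrE ?(ltW l0) ?(ltW Jr0).
 have -> : B * (Jr K ^+ n * vball) = (2 * CA * 2 ^ k * (2 ^+ M.+1 * q ^- (n + m.+1))) * (Jr K ^+ n * vball) * l ^+ m.+1.
 by rewrite /B; ring.
 rewrite -[leRHS]mulrA ler_wpM2l//; pos.
have b3 : `|\int[L]_u (bJ I K u * w u)| <=
 n%:R * ((2 * CA * 2 ^ k * (2 ^+ M.+1 * q ^- (n + m.+1))) * (Jr K ^+ n * vball) * Jr K ^+ m * (2 * Jr K)).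
 rewrite bE exchange_big/=; apply: le_trans (ler_norm_sum _ _ _) _.
 rewrite mulr_natl -[X in _ *+ X](card_ord n) -sumr_const; apply: ler_sum => j _.
 apply: le_trans (ler_norm_sum _ _ _) _.
 apply: (le_via (\sum_(i < I + I)
 (2 * CA * 2 ^ k * (2 ^+ M.+1 * q ^- (n + m.+1))) * (Jr K ^+ n * vball) * Jr K ^+ m *
 (if ell I i <= Jr K then ell I i else 0))); first by apply: ler_sum => i _; exact: b2.
 rewrite -mulr_sumr ler_wpM2l//.
 by apply: geo_le; rewrite ?exprn_gt0// ltW.
apply: (le_via (A2 * 2 ^ k * Jr K ^+ (n + m.+1))); last first.
 by rewrite !ler_wpM2r ?exprn_ge0 ?(ltW Jr0) ?(ltW k0)// lerDr.
apply: le_trans (ler_wpM2r _ b3) _; first by pos.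
apply: le_of_eq.
rewrite -/X /A2 /q expr_div_n [Jr K ^+ (n + m.+1)]exprD [Jr K ^+ m.+1]exprS.
have x1 : X ^+ (n + m.+1) != 0 by rewrite expf_neq0// gt_eqF.
have x3 : 2 ^+ (n + m.+1) != 0 :> R by [].
move: (X ^+ (n + m.+1)) (2 ^+ (n + m.+1) : R) (2 ^+ M.+1 : R) (2 ^ k : R) (Jr K ^+ n) (Jr K ^+ m) x1 x3.
by move=> a b c e g1 g2 a0 b0; field; rewrite b0.
Qed.
End atoms.

(** * Almost everywhere convergence and completeness of L2 *)

Lemma aeL_imp (P Q : RL R n -> Prop) : {ae L, forall x, P x} -> (forall x, P x -> Q x) ->
 {ae L, forall x, Q x}.
move=> [A [mA A0 PA]] PQ; exists A; split => //; apply: subset_trans PA => x /= nQ Px.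
exact/nQ/PQ.
Qed.

Lemma aeL_and (P Q : RL R n -> Prop) : {ae L, forall x, P x} -> {ae L, forall x, Q x} ->
 {ae L, forall x, P x /\ Q x}.
move=> [A [mA A0 PA]] [B [mB B0 QB]]; exists (A `|` B); split; [exact: measurableU|by apply: null_set_setU|].
move=> x /not_andP[nP|nQ]; [left; exact: PA|right; exact: QB].
Qed.

Lemma dct0 (h : nat -> Rn -> R) (H : Rn -> R) :
 (forall P, mfun (h P)) -> inte H ->
 (forall P x, `|h P x| <= H x) -> (forall x, h ^~ x @ \oo --> (0 : R)) ->
 forall e : R, 0 < e -> exists P0, forall P, (P0 <= P)%N -> \int[L]_x `|h P x| <= e.
move=> mh iH hH h0 e e0.
have mE P : measurable_fun setT (EFin \o (h P : RL R n -> R)) by exact/measurable_EFinP.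
have [] := @dominated_convergence _ _ _ L setT measurableT (fun P x => (h P x)%:E) (cst 0%E) (fun x => (H x)%:E) mE.
- exact: measurable_cst.
- by apply: aeW => x _; apply/fine_cvgP; split; [exact: nearW|exact: h0].
- exact: iH.
- by apply: aeW => x P _; rewrite lee_fin.
move=> _ + _ => /fine_cvgP[_] /cvgrPdist_le /(_ e e0)[P0 _ HP].
exists P0 => P /HP; rewrite /= sub0r normrN; apply: le_trans; rewrite (le_trans _ (ler_norm _))//.
apply: le_of_eq; congr fine; apply: eq_integral => x _.
by rewrite oppr0 addr0.
Qed.

Lemma fatou_ae (F : nat -> RL R n -> \bar R) (h : RL R n -> \bar R) (B : \bar R) :
 (forall v, measurable_fun setT (F v)) -> (forall v x, (0 <= F v x)%E) ->
 measurable_fun setT h -> (forall x, (0 <= h x)%E) ->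
 {ae L, forall x, F ^~ x @ \oo --> h x} ->
 (forall v, (\int[L]_x F v x <= B)%E) -> (\int[L]_x h x <= B)%E.
move=> mF F0 mh h0 Fh FB.
have -> : (\int[L]_x h x = \int[L]_x limn_einf (F ^~ x))%E.
 apply: ge0_ae_eq_integral => //.
 - have -> : (fun x : RL R n => limn_einf (F ^~ x)) = (fun x => - limn_esup (fun v => - F v x))%E.
 by [].
 apply: measurableT_comp => //; apply: measurable_fun_limn_esup => v.
 exact: measurableT_comp.
 - move=> x _; rewrite limn_einf_lim; apply: lime_ge; first exact: is_cvg_einfs.
 by apply: nearW => v; apply: le_ereal_inf_tmp => _ [k _ <-]; exact: F0.
 - apply: (aeL_imp Fh) => x Fx _; apply/esym; rewrite is_cvg_limn_einfE; first exact: cvg_lim.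
 by apply/cvg_ex; exists (h x).
apply: le_trans (fatou L measurableT mF (fun v x _ => F0 v x)) _.
apply: le_trans (limn_einf_sup _) _.
rewrite limn_esup_lim; apply: lime_le; first exact: is_cvg_esups.
apply: nearW => v; apply: ub_ereal_sup => _ [k _ <-]; exact: FB.
Qed.

(** The weighted sum of indicators is integrable, hence finite almost everywhere; there its tail
    falls below the positive number [w x], which excludes membership in late sets. *)
Lemma borel_cantelli_weight (w : Rn -> R) (E : nat -> set Rn) (B : R) :
 mfun w -> (forall x, 0 < w x) ->
 (forall v, mset (E v)) ->
 (forall v, (\int[L]_x (\1_(E v) x * w x)%:E <= (B * 2^-1 ^+ v)%:E)%E) ->
 {ae L, forall x, exists v0, forall v, (v0 <= v)%N -> ~ E v x}.
move=> mw w0 mE EB.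
have me v : measurable_fun setT ((fun x => (\1_(E v) x * w x)%:E) : RL R n -> \bar R).
 by apply/measurable_EFinP; apply: measurable_funM => //; exact: measurable_indic.
have e0 v x : (0 <= (\1_(E v) x * w x)%:E :> \bar R)%E by pos.
pose H (x : RL R n) := csum (fun v : nat => (\1_(E v) x * w x)%:E).
have B0 : 0 <= B.
 have := EB 0%N; rewrite mulr1 -lee_fin; apply: le_trans; exact: integral_ge0.
have iH : L.-integrable setT H.
 apply/integrableP; split; first exact: meas_csum.
 rewrite (eq_integral H); last by move=> x _; rewrite gee0_abs//; apply: csum_ge0 => v.
 rewrite integral_csum//; apply: (@le_lt_trans _ _ (B * 2)%:E); last exact: ltry.
 apply: csum_le_fin => [v|s us]; first by apply: integral_ge0.
 apply: (le_via (\sum_(v <- s) (B * 2^-1 ^+ v)%:E)%E); first exact: lee_sum.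
 rewrite sumEFin lee_fin -mulr_sumr ler_wpM2l//.
 have := @geom_uniq_nat (2^-1) s; rewrite invr_gt0 invf_lt1// ltr0n ltr1n => /(_ isT us).
 by rewrite (_ : (1 - 2^-1)^-1 = 2 :> R); last by field.
apply: (aeL_imp (integrable_ae measurableT iH)) => x /(_ Logic.I) Hx.
have cx : (csum (fun v : nat => (\1_(E v) x * w x)%:E) < +oo)%E.
 by rewrite -ge0_fin_numE//; apply: csum_ge0 => v.
have [N HN] := ctail_small (fun v => e0 v x) cx (w0 x).
exists N => v Nv Ev; move: HN; apply/negP; rewrite -leNgt.
pose q (j : nat) : \bar R := if (pickle j < N)%N then 0%E else (\1_(E j) x * w x)%:E.
have q0 j : (0 <= q j)%E by rewrite /q; case: ifP.
apply: le_trans (le_csum1 v q0).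
by rewrite /q ltnNge Nv/= indicE mem_set// mul1r.
Qed.

Lemma geo_cauchy (u : nat -> R) v0 : (forall v, (v0 <= v)%N -> `|u v.+1 - u v| <= 2^-1 ^+ v) ->
 cvgn u.
move=> H; pose a v := u (v + v0)%N - 2 * 2^-1 ^+ (v + v0).
have na : {homo a : x y / (x <= y)%N >-> x <= y}.
 apply/nondecreasing_seqP => v; rewrite /a addSn exprS.
 by have := H (v + v0)%N (leq_addl _ _); rewrite ler_norml => /andP[h1 h2]; lra.
have ub : has_ubound (range a).
 exists (u v0 + 2 * 2^-1 ^+ v0) => _ [v _ <-].
 have h : u (v + v0)%N <= u v0 + 2 * 2^-1 ^+ v0 - 2 * 2^-1 ^+ (v + v0).
 elim: v => [|v IH]; first by rewrite addrK.
 rewrite addSn exprS.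
 by have := H (v + v0)%N (leq_addl _ _); rewrite ler_norml => /andP[h1 h2]; lra.
 have p : 0 <= 2^-1 ^+ (v + v0) :> R by [].
 by rewrite /a; lra.
have ca := nondecreasing_is_cvgn na ub.
have cg : (fun v => 2 * 2^-1 ^+ (v + v0) : R) @ \oo --> (2 * 0 : R).
 apply: cvgM; first exact: cvg_cst.
 by rewrite (cvg_shiftn v0 (fun v => 2^-1 ^+ v : R)); apply: cvg_expr; rewrite ger0_norm// invf_lt1// ltr1n.
have cu : cvgn (fun v => u (v + v0)%N).
 apply/cvg_ex; exists (limn a + 2 * 0).
 have -> : (fun v => u (v + v0)%N) = (fun v => a v + 2 * 2^-1 ^+ (v + v0)).
 by apply/funext => v; rewrite subrK.
 exact: cvgD.
by move: cu => /cvg_ex[l]; rewrite (cvg_shiftn v0 u) => hl; apply/cvg_ex; exists l.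
Qed.

Definition L2i (h : Rn -> R) := mfun h /\ inte (fun x => h x ^+ 2).
Definition n2 (h : Rn -> R) : R := \int[L]_x (h x ^+ 2).

Lemma n2_ge0 h : 0 <= n2 h. by apply: Rintegral_ge0 => x _; exact: sqr_ge0. Qed.

Lemma L2iM u v : L2i u -> L2i v -> inte (fun x => u x * v x).
move=> [mu iu] [mv iv]; apply: (inte_le _ _ (inteD iu iv)); first exact: measurable_funM.
move=> x; rewrite normrM -[u x ^+ 2]real_normK ?num_real// -[v x ^+ 2]real_normK ?num_real//.
have := sqr_ge0; have := mulr_ge0; nra.
Qed.

Lemma L2i_comb a b u v : L2i u -> L2i v -> L2i (fun x => a * u x + b * v x).
move=> Lu Lv; split.
 by apply: measurable_funD; apply: measurable_funM => //; [exact: Lu.1|exact: Lv.1].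
have := inteD (inteD (inteZ (a ^+ 2) Lu.2) (inteZ (2 * a * b) (L2iM Lu Lv))) (inteZ (b ^+ 2) Lv.2).
by congr inte; apply/funext => x; ring.
Qed.

Lemma L2iB u v : L2i u -> L2i v -> L2i (fun x => u x - v x).
move=> Lu Lv; have := L2i_comb 1 (-1) Lu Lv; congr L2i; apply/funext => x; ring.
Qed.

Lemma L2iD u v : L2i u -> L2i v -> L2i (fun x => u x + v x).
move=> Lu Lv; have := L2i_comb 1 1 Lu Lv; congr L2i; apply/funext => x; ring.
Qed.

Lemma L2iZ a u : L2i u -> L2i (fun x => a * u x).
move=> Lu; have := L2i_comb a 0 Lu Lu; congr L2i; apply/funext => x; ring.
Qed.

Lemma L2i0 : L2i (fun=> 0).
split => //.
by have := @inte0; congr inte; apply/funext => x; rewrite expr0n.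
Qed.

Lemma L2i_sum (I : Type) (r : seq I) (F : I -> Rn -> R) : (forall i, L2i (F i)) ->
 L2i (fun x => \sum_(i <- r) F i x).
move=> LF; elim: r => [|i r IH].
 by have := L2i0; congr L2i; apply/funext => x; rewrite big_nil.
by have := L2iD (LF i) IH; congr L2i; apply/funext => x; rewrite big_cons.
Qed.

Lemma n2Z a u : L2i u -> n2 (fun x => a * u x) = a ^+ 2 * n2 u.
by move=> Lu; rewrite -RintegralZl//; [apply: eq_Rintegral => x _; rewrite exprMn|exact: Lu.2].
Qed.

Lemma n2D u v : L2i u -> L2i v -> n2 (fun x => u x + v x) <= 2 * n2 u + 2 * n2 v.
move=> Lu Lv; rewrite /n2 -RintegralZl//; last exact: Lu.2.
rewrite -RintegralZl//; last exact: Lv.2.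
rewrite -RintegralD//; [|exact: inteZ Lu.2|exact: inteZ Lv.2].
apply: ler_Rint; [exact: (L2iD Lu Lv).2|by apply: inteD; apply: inteZ; [exact: Lu.2|exact: Lv.2]|].
by move=> x; have := sqr_ge0 (u x - v x); nra.
Qed.

Lemma n2_para u v : L2i u -> L2i v ->
 n2 (fun x => u x - v x) = 2 * n2 u + 2 * n2 v - 4 * n2 (fun x => 2^-1 * u x + 2^-1 * v x).
move=> Lu Lv; have Lm := L2i_comb 2^-1 2^-1 Lu Lv.
rewrite /n2 -RintegralZl//; last exact: Lu.2.
rewrite -RintegralZl//; last exact: Lv.2.
rewrite -RintegralD//; [|exact: inteZ Lu.2|exact: inteZ Lv.2].
rewrite -RintegralZl//; last exact: Lm.2.
rewrite -RintegralB//; [|by apply: inteD; apply: inteZ; [exact: Lu.2|exact: Lv.2]|exact: inteZ Lm.2].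
by apply: eq_Rintegral => x _; field.
Qed.

Lemma L2_pair_bound u w (e : R) : L2i u -> L2i w -> 0 < e ->
 `|\int[L]_x (u x * w x)| <= e^-1 * n2 u + e * n2 w.
move=> Lu Lw e0; have ei : 0 < e^-1 by pos.
have -> : e^-1 * n2 u + e * n2 w = \int[L]_x (e^-1 * u x ^+ 2 + e * w x ^+ 2).
 rewrite RintegralD//; [|exact: inteZ Lu.2|exact: inteZ Lw.2].
 by congr (_ _); rewrite RintegralZl//; [exact: Lu.2|exact: Lw.2].
apply: ler_norm_Rint; [exact: L2iM|by apply: inteD; apply: inteZ; [exact: Lu.2|exact: Lw.2]|].
move=> x; rewrite normrM -[u x ^+ 2]real_normK ?num_real// -[w x ^+ 2]real_normK ?num_real//.
have a0 := normr_ge0 (u x); have b0 := normr_ge0 (w x); move: `|u x| `|w x| a0 b0 => a b a0 b0.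
have h : 0 <= e^-1 * (a - e * b) ^+ 2 by pos.
have E : e^-1 * (a - e * b) ^+ 2 = e^-1 * a ^+ 2 - 2 * (a * b) + e * b ^+ 2 by field; exact: lt0r_neq0.
by rewrite E in h; have := mulr_ge0 a0 b0; lra.
Qed.

Lemma schwartz_L2i psi : schwartz psi -> L2i psi.
move=> sp; have [C C0 HC] := schwartz_decay [::] 0 sp.
split; first exact: (schwartz_meas [::] sp).
apply: (inte_le _ _ (inteZ C (inte_abs (schwartz_inte [::] sp)))).
 by apply: measurable_funX; exact: (schwartz_meas [::] sp).
by move=> x; rewrite normrX ler_wpM2r; have := HC x; rewrite mul1r.
Qed.

(** By Chebyshev at height [2^-v] the rate [16^-v] leaves [4^-v], which is summable, so the whole
    sequence converges almost everywhere; Fatou then gives the L2 bounds for the limit. *)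
Lemma L2_complete (u : nat -> Rn -> R) : (forall v, L2i (u v)) ->
 (forall v k, (v <= k)%N -> n2 (fun x => u k x - u v x) <= 16^-1 ^+ v) ->
 exists g, [/\ L2i g, (forall v, n2 (fun x => u v x - g x) <= 16^-1 ^+ v) &
 {ae L, forall x, u ^~ x @ \oo --> g x}].
move=> Lu H.
pose E v : set Rn := [set x | 2^-1 ^+ v < `|u v.+1 x - u v x|].
have mu v : mfun (u v) := (Lu v).1.
have md k v : mfun (fun x => u k x - u v x) by exact: measurable_funB.
have mE v : mset (E v).
 have mn : mfun (fun x => `|u v.+1 x - u v x|) by exact: measurableT_comp.
 have := mn measurableT _ (measurable_itv `]2^-1 ^+ v, +oo[); rewrite setTI.
 by congr measurable; apply/seteqP; split => x /=; rewrite in_itv/= andbT.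
have ae1 : {ae L, forall x, exists v0, forall v, (v0 <= v)%N -> ~ E v x}.
 apply: (@borel_cantelli_weight (cst 1) E 1) => // v.
 have L2d := L2iB (Lu v.+1) (Lu v).
 apply: (le_via ((4 ^+ v * n2 (fun x => u v.+1 x - u v x))%:E)); last first.
 rewrite mul1r; apply: le_trans (ler_wpM2l _ (H v v.+1 (leqnSn _))) _ => //.
 by rewrite -exprMn (_ : 4 * 16^-1 = 4^-1 :> R); [apply: lerXn2r; rewrite ?nnegrE; lra|field].
 have -> : 4 ^+ v = (2 ^+ v) ^+ 2 :> R by rewrite -exprM mulnC exprM; congr (_ ^+ _); ring.
 rewrite -n2Z//.
 rewrite fineK; last by apply: integrable_fin_num => //; exact: (L2iZ _ L2d).2.
 apply: le_integral_ge0 => x; rewrite lee_fin mulr1// indicE.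
 case: (pselect (E v x)) => Ex; last by rewrite memNset// sqr_ge0.
 rewrite mem_set//= exprMn -[(_ - _) ^+ 2]real_normK ?num_real// -exprMn.
 have h : 1 <= 2 ^+ v * `|u v.+1 x - u v x|.
 by rewrite mulrC -ler_pdivrMr// mul1r -exprVn ltW.
 by rewrite -[leLHS](expr1n _ 2); apply: lerXn2r; rewrite ?nnegrE//; apply: h.
pose g (x : Rn) := fine (limn_esup (fun v => (u v x)%:E)).
have gl x (l : R) : u ^~ x @ \oo --> l -> g x = l.
 move=> ul; rewrite /g; have cE : (fun v => (u v x)%:E) @ \oo --> l%:E.
 by apply/fine_cvgP; split; [exact: nearW|exact: ul].
 rewrite is_cvg_limn_esupE; first by rewrite (cvg_lim _ cE).
 by apply/cvg_ex; exists l%:E.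
have mg : mfun g.
 apply: (@measurableT_comp _ _ _ _ _ _ (@fine R)) => //.
 by apply: measurable_fun_limn_esup => v; exact/measurable_EFinP.
have ae2 : {ae L, forall x, u ^~ x @ \oo --> g x}.
 apply: (aeL_imp ae1) => x [v0 hv].
 have /cvg_ex[l ul] : cvgn (u ^~ x).
 by apply: (@geo_cauchy (u ^~ x) v0) => v /hv h; rewrite leNgt; apply/negP.
 by rewrite (gl _ _ ul).
have key v : (\int[L]_x ((u v x - g x) ^+ 2)%:E <= (16^-1 ^+ v)%:E)%E.
 apply: (@fatou_ae (fun k x => ((u (k + v)%N x - u v x) ^+ 2)%:E)).
 - by move=> k; apply/measurable_EFinP; apply: measurable_funX.
 - by move=> k x; rewrite lee_fin.
 - by apply/measurable_EFinP; apply: measurable_funX; exact: measurable_funB.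
 - by move=> x; rewrite lee_fin.
 - apply: (aeL_imp ae2) => x ux; apply/fine_cvgP; split; first exact: nearW.
 have -> : (u v x - g x) ^+ 2 = (g x - u v x) * (g x - u v x) by ring.
 have us : (fun k => u (k + v)%N x) @ \oo --> g x by rewrite (cvg_shiftn v (u ^~ x)).
 have h : (fun k => u (k + v)%N x - u v x) @ \oo --> g x - u v x by apply: cvgB us _; exact: cvg_cst.
 have -> : fine \o (fun k : nat => ((u (k + v)%N x - u v x) ^+ 2)%:E) =
 (fun k => (u (k + v)%N x - u v x) * (u (k + v)%N x - u v x)) by [].
 exact: (cvgM h h).
 - move=> k; have := H v (k + v)%N (leq_addl _ _); rewrite -lee_fin fineK//.
 by apply: integrable_fin_num => //; exact: (L2iB (Lu _) (Lu v)).2.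
have Ld v : L2i (fun x => u v x - g x).
 split; first exact: measurable_funB.
 apply/integrableP; split; first by apply/measurable_EFinP; apply: measurable_funX; exact: measurable_funB.
 apply: (@le_lt_trans _ _ (16^-1 ^+ v)%:E); last exact: ltry.
 apply: le_trans (key v); apply: le_of_eq; apply: eq_integral => x _ /=.
 by rewrite ger0_norm.
exists g; split => // [|v].
 have := L2iB (Lu 0%N) (Ld 0%N); congr L2i; apply/funext => x; ring.
rewrite -lee_fin fineK//; by apply: integrable_fin_num => //; exact: (Ld v).2.
Qed.

(** * Midpoint combinations of a bounded sequence *)

Inductive mtree := MLeaf of nat | MNode of mtree & mtree.

Fixpoint teR (t : mtree) (s : nat -> R) : R :=
 match t with MLeaf i => s i | MNode t1 t2 => 2^-1 * teR t1 s + 2^-1 * teR t2 s end.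

Fixpoint tge (v : nat) (t : mtree) : Prop :=
 match t with MLeaf i => (v <= i)%N | MNode t1 t2 => tge v t1 /\ tge v t2 end.

Definition tev (t : mtree) (u : nat -> Rn -> R) : Rn -> R := fun x => teR t (u ^~ x).

Lemma tge_le v k t : (v <= k)%N -> tge k t -> tge v t.
by move=> vk; elim: t => [i|t1 I1 t2 I2 [h1 h2]]; [exact: leq_trans|split; auto]. Qed.

Lemma teR_close t v s (l e : R) : (forall i, (v <= i)%N -> `|s i - l| <= e) -> tge v t ->
 `|teR t s - l| <= e.
move=> H; elim: t => /= [i|t1 I1 t2 I2 [/I1 h1 /I2 h2]]; first exact: H.
have -> : 2^-1 * teR t1 s + 2^-1 * teR t2 s - l = 2^-1 * (teR t1 s - l) + 2^-1 * (teR t2 s - l) by field.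
by apply: le_trans (ler_normD _ _) _; rewrite !normrM !(@ger0_norm _ 2^-1); lra.
Qed.

Lemma teR_bound t s (e : R) : (forall i, `|s i| <= e) -> `|teR t s| <= e.
move=> H; have := @teR_close t 0 s 0 e; rewrite subr0; apply => [i _|]; first by rewrite subr0.
by elim: t => //=.
Qed.

Lemma teR_comb t a b s1 s2 : teR t (fun i => a * s1 i + b * s2 i) = a * teR t s1 + b * teR t s2.
by elim: t => //= t1 -> t2 ->; ring. Qed.

Lemma teR_sum (I : Type) (r : seq I) t (s : I -> nat -> R) :
 teR t (fun i => \sum_(j <- r) s j i) = \sum_(j <- r) teR t (s j).
elim: r => [|j r IH].
 rewrite big_nil; have -> : (fun i => \sum_(j <- [::]) s j i) = (fun i => 0 * 0 + 0 * 0).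
 by apply/funext => i; rewrite big_nil; ring.
 by rewrite (teR_comb t 0 0 (fun=> 0) (fun=> 0)); ring.
have := teR_comb t 1 1 (s j) (fun i => \sum_(j <- r) s j i); rewrite big_cons -IH !mul1r => <-.
by congr teR; apply/funext => i; rewrite big_cons !mul1r.
Qed.

Lemma tev_L2i t u : (forall i, L2i (u i)) -> L2i (tev t u).
by move=> Lu; elim: t => //= I1 t2 I2; exact: L2i_comb. Qed.

Lemma tev_meas t (u : nat -> Rn -> R) : (forall i, mfun (u i)) ->
 mfun (tev t u).
move=> mu; elim: t => //= t1 I1 t2 I2.
by apply: measurable_funD; apply: measurable_funM.
Qed.

Lemma tev_pair t u w : (forall i, inte (fun x => u i x * w x)) ->
 inte (fun x => tev t u x * w x) /\
 \int[L]_x (tev t u x * w x) = teR t (fun i => \int[L]_x (u i x * w x)).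
move=> iu; elim: t => [i|t1 [I1 E1] t2 [I2 E2]]; first by split => //; exact: iu.
have E : (fun x => tev (MNode t1 t2) u x * w x) =
 (fun x => 2^-1 * (tev t1 u x * w x) + 2^-1 * (tev t2 u x * w x)).
 by apply/funext => x; rewrite /tev/=; ring.
rewrite E; split; first by apply: inteD; exact: inteZ.
by rewrite RintegralD//; [rewrite !RintegralZl// E1 E2|exact: inteZ|exact: inteZ].
Qed.

(** Among combinations of terms with index at least [v], the infima of the squared norm increase
    with [v] to a finite limit. The midpoint of two near-minimisers is a competitor, so by the
    parallelogram law near-minimisers form a Cauchy sequence. Binary trees suffice as combinations
    because midpoints are all that is used; weak compactness does not enter. *)
Lemma mazur (u : nat -> Rn -> R) (B : R) : (forall i, L2i (u i)) -> (forall i, n2 (u i) <= B) ->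
 exists (t : nat -> mtree) (g : Rn -> R), [/\ forall v, tge v (t v), L2i g,
 (forall v, n2 (fun x => tev (t v) u x - g x) <= 16^-1 ^+ v) &
 {ae L, forall x, (fun v => tev (t v) u x) @ \oo --> g x}].
move=> Lu uB.
pose S v : set R := [set n2 (tev t u) | t in [set t | tge v t]].
have S0 v : S v !=set0 by exists (n2 (u v)); exists (MLeaf v) => /=.
have Slb v : has_lbound (S v) by exists 0 => _ [t _ <-]; exact: n2_ge0.
pose a v := inf (S v).
have aB v : a v <= B by apply: le_trans (uB v); apply: ge_inf => //; exists (MLeaf v) => /=.
have amono v k : (v <= k)%N -> a v <= a k.
 move=> vk; apply: lb_le_inf => // _ [t tk <-]; apply: ge_inf => //; exists t => //.
 exact: tge_le tk.
pose A := sup (range a).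
have hsA : has_sup (range a).
 by split; [exists (a 0%N), 0%N|exists B => _ [v _ <-]].
have aA v : a v <= A by apply: ub_le_sup; [exact: hsA.2|exists v].
(* In the parallelogram law an error [ep] in each of the three norms adds up to [8 * ep], the rate
   that [L2_complete] requires. *)
pose ep v : R := 16^-1 ^+ v / 8.
have ep0 v : 0 < ep v by pos.
have choose v : exists k, (v <= k)%N /\ A - ep v < a k.
 have [_ [k _ <-] h] := sup_adherent (ep0 v) hsA.
 by exists (maxn v k); rewrite leq_maxl; split => //; apply: lt_le_trans h _; apply: amono; rewrite leq_maxr.
have /choice[ki Hk] := choose.
have trees v : exists t, tge (ki v) t /\ n2 (tev t u) < A + ep v.
 have [_ [t tk <-] h] := inf_adherent (ep0 v) (conj (S0 (ki v)) (Slb (ki v))).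
 by exists t; split => //; apply: lt_le_trans h _; rewrite lerD2r -/(a (ki v)).
have /choice[t Ht] := trees.
have cauchy v k : (v <= k)%N -> n2 (fun x => tev (t k) u x - tev (t v) u x) <= 16^-1 ^+ v.
 move=> vk; rewrite n2_para; [|exact: tev_L2i|exact: tev_L2i].
 have epm : ep k <= ep v.
 rewrite ler_pM2r//; apply: ler_wiXn2l => //; by rewrite invf_le1// ler1n.
 have mid : A - ep v <= n2 (fun x => 2^-1 * tev (t k) u x + 2^-1 * tev (t v) u x).
 have lo : A - ep v <= a (minn (ki k) (ki v)).
 rewrite /minn; case: ifP => _; apply/ltW; last exact: (Hk v).2.
 by apply: le_lt_trans (Hk k).2; lra.
 apply: le_trans lo _; apply: ge_inf => //; exists (MNode (t k) (t v)) => //=.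
 by split; [apply: tge_le (Ht k).1; exact: geq_minl|apply: tge_le (Ht v).1; exact: geq_minr].
 have hk := ltW (Ht k).2; have hv := ltW (Ht v).2.
 have e8 : 16^-1 ^+ v = 8 * ep v by rewrite /ep; field.
 by rewrite e8; lra.
have [g [Lg gn gae]] := @L2_complete (fun v => tev (t v) u) (fun v => tev_L2i _ Lu) cauchy.
exists t, g; split => // v; apply: tge_le (Ht v).1; exact: (Hk v).1.
Qed.

(** * Square-integrable functions orthogonal to all Schwartz functions *)

Definition orthant (a : 'I_n -> R) : set Rn := [set x | forall i, a i < x ord0 i].

Lemma measurable_orthant a : measurable (tup2row @^-1` orthant a : set (n.-tuple R)).
have -> : tup2row @^-1` orthant a = \big[setI/setT]_(i < n) [set t : n.-tuple R | a i < tnth t i].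
 apply/seteqP; split => t /=.
 by move=> h; rewrite -bigcap_seq => i; have := h i; rewrite mxE.
 by rewrite -bigcap_seq => h i; rewrite mxE; apply: h; rewrite /= mem_index_enum.
apply: big_ind => //; first exact: measurableI.
move=> i _; have := measurable_tnth i measurableT (measurable_itv (`]a i, +oo[ : interval R)).
rewrite setTI; congr measurable; apply/seteqP; split => t /=; by rewrite in_itv/= andbT.
Qed.

(** Open upper orthants are closed under intersection, as Dynkin induction requires, and they
    generate the sigma-algebra because a coordinate half-space is a countable union of orthants. *)
Lemma measurable_tupleE : @measurable _ (n.-tuple R) =
 <<s [set A | exists a, A = tup2row @^-1` orthant a] >>.
apply/seteqP; split => B; last first.
 apply: smallest_sub; first exact: sigma_algebra_measurable.
 by move=> _ [a ->]; exact: measurable_orthant.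
set G := [set A | _].
apply: smallest_sub => //.
rewrite -bigcup_seq => C [i _ [A mA <-]].
suff : measurable_fun setT ((@tnth n R)^~ i : g_sigma_algebraType G -> R).
 by move/(_ measurableT A mA).
apply: (measurability _ (RGenOInfty.measurableE R)) => _ [_ [a ->] <-].
have -> : setT `&` (@tnth n R)^~ i @^-1` `]a, +oo[%classic =
 \bigcup_(k : nat) (tup2row @^-1` orthant (fun j => if j == i then a else - k%:R)).
 apply/seteqP; split => t /=.
 move=> [_]; rewrite in_itv/= andbT => ta.
 pose y := enorm (tup2row t).
 exists (Num.truncn y).+1 => // j; rewrite mxE; case: eqP => [->//|_].
 have := truncnS_gt y; have := enorm_coord (tup2row t) j.
 rewrite mxE ler_norml -/y => /andP[h1 _]; lra.
 by move=> [k _ h]; split => //; have := h i; rewrite eqxx mxE in_itv/= andbT.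
apply: bigcup_measurable => k _; apply: sub_sigma_algebra.
by exists (fun j => if j == i then a else - k%:R).
Qed.

Lemma inte_indic u (A : set (RL R n)) : inte u -> measurable A -> inte (fun x => u x * \1_A x).
move=> iu mA; apply: (inte_le _ _ (inte_abs iu)).
 by apply: measurable_funM; [exact: inte_meas|exact: measurable_indic].
by move=> x; rewrite normrM ler_piMr// indicE; case: (x \in A); rewrite ?normr1 ?normr0.
Qed.

Lemma Rint_null (u : Rn -> R) : {ae L, forall x, u x = 0} ->
 mfun u -> \int[L]_x u x = 0.
move=> u0 mu; rewrite /Rintegral -[RHS](_ : fine (\int[L]_x 0%E) = 0); last by rewrite integral0.
congr fine; apply: ae_eq_integral => //; [exact/measurable_EFinP|].
by apply: (aeL_imp u0) => x ->.
Qed.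

(** The sets over which [u] has integral zero form a Dynkin class containing the orthants, hence all
    Borel sets and, up to null sets, all Lebesgue sets. The set where [u > 0] then shows that [|u|]
    has integral zero. *)
Lemma orthant_ae0 u : inte u -> \int[L]_x u x = 0 ->
 (forall a, \int[L]_x (u x * \1_(orthant a) x) = 0) -> {ae L, forall x, u x = 0}.
move=> iu u0 ua; have mu := inte_meas iu.
have mB (E : set (n.-tuple R)) : measurable E -> mset (row2tup @^-1` E).
 by move=> mE; have := meas_row2tup measurableT mE; rewrite setTI.
have K (E : set (n.-tuple R)) : measurable E -> \int[L]_x (u x * \1_(row2tup @^-1` E) x) = 0.
 rewrite measurable_tupleE; move: E.
 apply: (@dynkin_induction _ _ _ (fun E => \int[L]_x (u x * \1_(row2tup @^-1` E) x) = 0) measurable_tupleE).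
 - move=> _ _ [a ->] [b ->]; exists (fun i => Num.max (a i) (b i)).
 apply/seteqP; split => t /=; first by move=> [ha hb] i; rewrite gt_max ha hb.
 by move=> h; split => i; have := h i; rewrite gt_max => /andP[].
 - rewrite -[RHS]u0; apply: eq_Rintegral => x _.
 by rewrite indicE mem_set ?mulr1.
 - move=> _ [a ->]; rewrite -[RHS](ua a); apply: eq_Rintegral => x _; congr (_ * \1__ x).
 by apply/seteqP; split => y /=; rewrite row2tupK.
 - move=> S mS S0.
 have -> : \int[L]_x (u x * \1_(row2tup @^-1` (~` S)) x) =
 \int[L]_x (u x - u x * \1_(row2tup @^-1` S) x).
 apply: eq_Rintegral => x _; rewrite !indicE in_setC.
 by case: (_ \in _); rewrite ?mulr0 ?mulr1 ?subr0 ?subrr.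
 rewrite RintegralB ?S0 ?subr0//; apply: inte_indic => //; exact: mB.
 - move=> F mF tF F0.
 pose A k : set (RL R n) := row2tup @^-1` F k.
 have mA k : measurable (A k) by exact: mB.
 have iA k : inte (fun x => u x * \1_(A k) x) by exact: inte_indic.
 pose h P x := u x * \1_(row2tup @^-1` (\bigcup_k F k)) x - \sum_(k <- iota 0 P) u x * \1_(A k) x.
 have mU : mset (row2tup @^-1` (\bigcup_k F k)) by apply: mB; exact: bigcup_measurable.
 have iU := inte_indic iu mU.
 have sumE x P : ~ (\bigcup_(k < P) F k) (row2tup x) -> \sum_(k <- iota 0 P) u x * \1_(A k) x = 0.
 move=> h0; rewrite big_seq big1// => k; rewrite mem_iota add0n => /andP[_ kP].
 rewrite indicE memNset ?mulr0// => Ak; apply: h0; by exists k.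
 have sumE2 x P k : (k < P)%N -> F k (row2tup x) -> \sum_(k <- iota 0 P) u x * \1_(A k) x = u x.
 move=> kP Fk; rewrite (bigD1_seq k) ?iota_uniq ?mem_iota ?add0n//= big1 ?addr0.
 by rewrite indicE mem_set ?mulr1.
 move=> j jk; rewrite indicE memNset ?mulr0// => Aj.
 move/eqP: jk; apply; have /trivIsetP/(_ j k I I) := tF.
 by case: eqP => // _ /(_ isT)/seteqP[/(_ (row2tup x))]/= + _; move=> /(_ (conj Aj Fk)).
 have hE P x : h P x = 0 \/ (h P x = u x /\ ~ (\bigcup_(k < P) F k) (row2tup x)).
 rewrite /h; have [[k /= kP Fk]|nF] := pselect ((\bigcup_(k < P) F k) (row2tup x)).
 by left; rewrite (sumE2 _ _ k)// indicE mem_set ?mulr1 ?subrr//; exists k.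
 rewrite sumE// subr0; rewrite indicE; case: (_ \in _); rewrite ?mulr1 ?mulr0; first by right.
 by left.
 apply/eqP; rewrite -normr_le0; apply/ler_addgt0Pl => e e0; rewrite addr0.
 have := @dct0 h (fun x => `|u x|) _ (inte_abs iu) _ _ e e0; case.
 - move=> P; apply: measurable_funB; first exact: inte_meas.
 by apply: measurable_sum => k; exact: inte_meas.
 - by move=> P x; have [->|[-> _]] := hE P x; rewrite ?normr0.
 - move=> x; have [[k _ Fk]|nF] := pselect ((\bigcup_k F k) (row2tup x)).
 apply: cvg_near_cst; near=> P.
 rewrite /h (sumE2 _ _ k)//; first by rewrite indicE mem_set ?mulr1 ?subrr//; exists k.
 by near: P; exists k.+1.
 apply: cvg_near_cst; apply: nearW => P; rewrite /h sumE; last by move=> [k _ Fk]; apply: nF; exists k.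
 by rewrite subr0 indicE memNset ?mulr0.
 move=> P /(_ P (leqnn P)); apply: le_trans.
 have [iS S0] := inte_sum (iota 0 P) iA.
 have : \int[L]_x h P x = \int[L]_x (u x * \1_(row2tup @^-1` (\bigcup_k F k)) x).
 by rewrite RintegralB// S0 big1 ?subr0// => k _; exact: F0.
 move=> <-; apply: ler_norm_Rint => //; first exact: inteB.
 by apply: inte_abs; exact: inteB.
have KA (A : set (RL R n)) : measurable A -> \int[L]_x (u x * \1_A x) = 0.
 move=> mA; have [B [N [bB [bN [N0 ABN]]]]] := mA.
 have mB' : mset B by exact: borel_lebRn.
 have <- : \int[L]_x (u x * \1_B x) = \int[L]_x (u x * \1_A x).
 apply/eqP; rewrite -subr_eq0 -RintegralB//; [|exact: inte_indic..].
 apply/eqP; apply: Rint_null; last by apply: measurable_funB; apply: inte_meas; exact: inte_indic.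
 exists N; split => //; first exact: borel_lebRn.
 move=> x /= nx; apply: contrapT => Nx; apply: nx; rewrite !indicE.
 have -> : (x \in A) = (x \in B); last by rewrite subrr.
 apply/idP/idP; rewrite !inE => h; apply: contrapT => h'; apply: Nx; apply: ABN; by [left|right].
 rewrite borelRnE in bB; rewrite -[RHS](K _ bB); apply: eq_Rintegral => x _; congr (_ * \1__ x).
 by apply/seteqP; split => y /=; rewrite row2tupK.
have m1 : mset ([set x | 0 < u x]).
 by have := mu measurableT _ (measurable_itv `]0, +oo[); rewrite setTI; congr measurable;
 apply/seteqP; split => x /=; rewrite in_itv/= andbT.
have iabs := inte_abs iu.
have abs0 : \int[L]_x `|u x| = 0.
 have -> : \int[L]_x `|u x| = \int[L]_x (2 * (u x * \1_[set x | 0 < u x] x) - u x).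
 apply: eq_Rintegral => x _; rewrite indicE; have [ux|ux] := ltP 0 (u x).
 by rewrite mem_set//= gtr0_norm; lra.
 by rewrite memNset ?mulr0 ?ler0_norm//; [lra|apply/negP; rewrite -leNgt].
 rewrite RintegralB ?u0 ?subr0//; last by apply: inteZ; exact: inte_indic.
 by rewrite RintegralZl ?KA ?mulr0//; exact: inte_indic.
have : (\int[L]_x `|(EFin \o (u : RL R n -> R)) x| = 0)%E.
 move: abs0; rewrite /Rintegral => abs0.
 have -> : (\int[L]_x `|(EFin \o (u : RL R n -> R)) x| = \int[L]_x (`|u x|)%:E)%E by [].
 have fin := integrable_fin_num measurableT iabs.
 by rewrite -[LHS](fineK fin) [fine _]abs0.
have mE : measurable_fun setT (EFin \o (u : RL R n -> R)) by exact/measurable_EFinP.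
move=> /(ae_eq_integral_abs L measurableT mE) H.
by apply: (aeL_imp H) => x /(_ I) [].
Unshelve. all: by end_near.
Qed.

Lemma sstep01 (x : R) : 0 <= sev (sstep) x <= 1.
have [x0|x0] := leP x 0; first by rewrite sstep0// lexx ler01.
have p := ebump1_gt0 x0; have p' := ebump1_ge0 (-1 * x + 1).
have q : 0 < ebump 1 x + ebump 1 (-1 * x + 1) by rewrite ltr_pwDl.
by rewrite [sev _]/= divr_ge0// ler_pdivrMr// mul1r lerDl.
Qed.

Definition sbox (k : nat) (a b : R) : sfun :=
 SMul (SAff k%:R (- (k%:R * a)) sstep) (SAff (- k%:R) (k%:R * b) sstep).

Lemma sev_sbox k a b (x : R) :
 sev (sbox k a b) x = sev (sstep) (k%:R * (x - a)) * sev (sstep) (k%:R * (b - x)).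
have -> : sev (sbox k a b) x = sev (sstep) (k%:R * x - k%:R * a) *
 sev (sstep) (- k%:R * x + k%:R * b) by [].
by congr (sev _ _ * sev _ _); ring.
Qed.

Lemma sbox01 k a b (x : R) : 0 <= sev (sbox k a b) x <= 1.
rewrite sev_sbox; have /andP[h1 h2] := sstep01 (k%:R * (x - a)).
have /andP[h3 h4] := sstep01 (k%:R * (b - x)).
by rewrite mulr_ge0//= mulr_ile1.
Qed.

Lemma sbox_out k a b (x : R) : ~~ (a < x < b) -> sev (sbox k a b) x = 0.
rewrite negb_and -!leNgt sev_sbox => /orP[xa|xb].
 by rewrite sstep0 ?mul0r// mulr_ge0_le0// subr_le0.
by rewrite mulrC sstep0 ?mul0r// mulr_ge0_le0// subr_le0.
Qed.

Lemma sbox_in (a b x : R) : a < x < b -> exists k0, forall k, (k0 <= k)%N -> sev (sbox k a b) x = 1.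
move=> /andP[ax xb].
exists (Num.truncn (Num.max (x - a)^-1 (b - x)^-1)).+1 => k kk.
have := truncnS_gt (Num.max (x - a)^-1 (b - x)^-1).
rewrite gt_max => /andP[h1 h2].
have kk' : (Num.truncn (Num.max (x - a)^-1 (b - x)^-1)).+1%:R <= k%:R :> R by rewrite ler_nat.
have H (d : R) : 0 < d -> d^-1 < k%:R -> 1 <= k%:R * d.
 by move=> d0 h; rewrite -ler_pdivrMr// div1r ltW.
rewrite sev_sbox !sstep1 ?mulr1//.
 by apply: H; rewrite ?subr_gt0// (lt_le_trans h2).
by apply: H; rewrite ?subr_gt0// (lt_le_trans h1).
Qed.

Lemma box_schwartz k (a b : 'I_n -> R) : schwartz (tens (fun i => sbox k (a i) (b i)) : Rn -> R).
pose A := \sum_(i < n) (`|a i| + `|b i|).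
apply: (@tens_schwartz _ A) => i; first by split; exact: swf_sstep.
move=> x Ax; apply: sbox_out; apply/negP => /andP[h1 h2].
have : `|a i| + `|b i| <= A.
 by rewrite /A (bigD1 i)//= lerDl; apply: sumr_ge0 => j _; exact: addr_ge0.
have := ler_norm (b i); have := ler_norm (- a i); rewrite normrN.
move: Ax (normr_ge0 (a i)) (normr_ge0 (b i)); case: (ltP 0 x) => [x0|x0].
 by rewrite (gtr0_norm x0) => *; lra.
by rewrite (ler0_norm x0) => *; lra.
Qed.

Lemma prod_cvg (r : seq 'I_n) (v : nat -> 'I_n -> R) (w : 'I_n -> R) :
 (forall i, v ^~ i @ \oo --> w i) -> (fun k => \prod_(i <- r) v k i) @ \oo --> \prod_(i <- r) w i.
move=> h; elim: r => [|i r IH].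
 by rewrite big_nil; apply: cvg_near_cst; apply: nearW => k; rewrite big_nil.
rewrite big_cons; under eq_fun do rewrite big_cons.
exact: (cvgM (h i) IH).
Qed.

Lemma box_cvg (a b : 'I_n -> R) (x : Rn) :
 (fun k => tens (fun i => sbox k (a i) (b i)) x) @ \oo -->
 (\1_[set x : Rn | forall i, a i < x ord0 i < b i] x : R).
have -> : (\1_[set x : Rn | forall i, a i < x ord0 i < b i] x : R) =
 \prod_(i < n) (if a i < x ord0 i < b i then 1 else 0).
 rewrite indicE; have [h|/existsNP[i hi]] := pselect (forall i, a i < x ord0 i < b i).
 by rewrite mem_set//= big1// => i _; rewrite h.
 rewrite memNset/= => [|h]//.
 by rewrite (bigD1 i)//= ifN ?mul0r//; apply/negP.
apply: prod_cvg => i; case: ifPn => h; apply: cvg_near_cst.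
 by have [k0 K] := sbox_in h; exists k0 => //.
by apply: nearW => k; rewrite sbox_out.
Qed.

Lemma L2i_box (h : Rn -> R) (A : R) (B : set (RL R n)) : L2i h -> measurable B ->
 (forall x, B x -> cube 0 A x) -> inte (fun x => h x * \1_B x).
move=> ih mB BA; apply: L2iM => //; split => //.
pose C := Num.max A 0.
have i1 : inte (\1_(cube 0 C) : Rn -> R).
 have mc : mset (cube 0 C) by apply: borel_lebRn; exact: borel_cube.
 apply/integrableP; split; first exact/measurable_EFinP/measurable_indic.
 rewrite (eq_integral (fun x : RL R n => (\1_(cube 0 C) x)%:E)); last first.
 by move=> x /=; rewrite ger0_norm.
 by rewrite integral_indic// setIT [_ (cube _ _)]leb_cube ?ltry// le_max lexx orbT.
apply: (inte_le _ _ i1); first by apply: measurable_funX; exact: measurable_indic.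
move=> x; rewrite !indicE; case: (boolP (x \in B)) => [|_]; last by rewrite expr0n normr0; case: (_ \in _).
rewrite inE => /BA h'; rewrite mem_set ?expr1n ?normr1// => i.
have := h' i; rewrite !mxE /C => /andP[h1 h2].
have AC : A <= Num.max A 0 by rewrite le_max lexx.
by apply/andP; split; lra.
Qed.

(** Smooth boxes converge to the indicators of open boxes, so [h] has integral zero over every box.
    On a bounded cube [h] is integrable and an orthant meets the cube in a box, so [orthant_ae0]
    applies; cubes exhaust the space. *)
Lemma L2_orthogonal (h : Rn -> R) : L2i h -> (forall psi, schwartz psi -> \int[L]_x (h x * psi x) = 0) ->
 {ae L, forall x, h x = 0}.
move=> ih h0.
have mbox (a b : 'I_n -> R) : measurable ([set x : Rn | forall i, a i < x ord0 i < b i] : set (RL R n)).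
 have -> : [set x : Rn | forall i, a i < x ord0 i < b i] =
 \big[setI/setT]_(i < n) [set x : Rn | a i < x ord0 i < b i].
 apply/seteqP; split => t /=; first by move=> hh; rewrite -bigcap_seq => i _; exact: hh.
 by rewrite -bigcap_seq => hh i; apply: hh; rewrite /= mem_index_enum.
 apply: (@big_ind _ (fun A : set (RL R n) => measurable A)) => [|A B|i _] //; first exact: measurableI.
 have := measurable_coord i measurableT (measurable_itv (`]a i, b i[ : interval R)).
 by rewrite setTI; congr measurable; apply/seteqP; split => /=; rewrite in_itv.
have box0 (a b : 'I_n -> R) : \int[L]_x (h x * \1_[set x : Rn | forall i, a i < x ord0 i < b i] x) = 0.
 set B := [set x : Rn | _].
 pose A := \sum_(i < n) (`|a i| + `|b i|).
 have iB : inte (fun x => h x * \1_B x).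
 apply: (@L2i_box _ A) => //; first exact: mbox.
 move=> x Bx i; rewrite mxE !add0r.
 have : `|a i| + `|b i| <= A.
 by rewrite /A (bigD1 i)//= lerDl; apply: sumr_ge0 => j _; exact: addr_ge0.
 have := ler_norm (b i); have := ler_norm (- a i); rewrite normrN.
 have := Bx i; have := normr_ge0 (a i); have := normr_ge0 (b i); move=> *; apply/andP; split; lra.
 pose v k : Rn -> R := tens (fun i => sbox k (a i) (b i)).
 have iv k : inte (fun x => h x * v k x) by apply: L2iM => //; apply: schwartz_L2i; exact: box_schwartz.
 apply/eqP; rewrite -normr_le0; apply/ler_addgt0Pl => e e0; rewrite addr0.
 have := @dct0 (fun k x => h x * \1_B x - h x * v k x) (fun x => `|h x * \1_B x|) _ (inte_abs iB) _ _ e e0; case.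
 - by move=> k; apply: measurable_funB; apply: inte_meas.
 - move=> k x; rewrite -mulrBr !normrM ler_wpM2l// indicE; have [Bx|nBx] := pselect (B x).
 rewrite mem_set// normr1; have /andP[v1 v2] : 0 <= v k x <= 1 by apply: prod01 => i; exact: sbox01.
 by rewrite ger0_norm ?subr_ge0// lerBlDr lerDl.
 rewrite memNset//= sub0r normrN; have [i hi] : exists i, ~ (a i < x ord0 i < b i) by apply/existsNP.
 have -> : v k x = 0 by apply/eqP/prodf_eq0; exists i => //; rewrite (sbox_out _ (introN idP hi)).
 by [].
 - move=> x; rewrite -(subrr (h x * \1_B x)).
 apply: cvgB; first exact: cvg_cst.
 by apply: cvgM; [exact: cvg_cst|exact: box_cvg].
 move=> k /(_ k (leqnn k)); apply: le_trans.
 have -> : \int[L]_x (h x * \1_B x) = \int[L]_x (h x * \1_B x - h x * v k x).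
 rewrite (@RintegralB _ _ _ L setT (fun x => h x * \1_B x) (fun x => h x * v k x) measurableT iB (iv k)).
 by rewrite (h0 (v k)) ?subr0//; exact: box_schwartz.
 apply: ler_norm_Rint => //; first exact: inteB.
 by apply: inte_abs; exact: inteB.
have Hk (k : nat) : {ae L, forall x, h x * \1_[set x : Rn | forall i, - k%:R < x ord0 i < k%:R] x = 0}.
 apply: orthant_ae0.
 - apply: (@L2i_box _ k%:R) => // x hx i; rewrite mxE !add0r.
 by have /andP[h1 h2] := hx i; rewrite !ltW.
 - exact: (box0 (fun=> - k%:R) (fun=> k%:R)).
 - move=> a; rewrite -[RHS](box0 (fun i => Num.max (- k%:R) (a i)) (fun=> k%:R)).
 apply: eq_Rintegral => x _; rewrite -mulrA -natrM mulnb -in_setI; congr (_ * (x \in _)%:R).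
 apply/seteqP; split => y /=.
 by move=> [h1 h2] i; have := h2 i; have /andP[h3 h4] := h1 i; rewrite gt_max h3 => ->.
 by move=> hh; split => i; have := hh i; rewrite gt_max => /andP[/andP[h1 h2] h3]; rewrite ?h1.
have [A [mA A0 AP]] := ae_foralln Hk.
exists A; split => // x /= hx; apply: AP => /= hh; apply: hx.
have := hh (Num.truncn (enorm x)).+1; rewrite indicE mem_set ?mulr1// => i.
have := truncnS_gt (enorm x); have := enorm_coord x i.
by rewrite ler_norml => /andP[h1 h2] h3; apply/andP; split; lra.
Qed.

Lemma inL2P (h : Rn -> R) : inL2 h <-> L2i h.
split => [[/measRP mh hoo]|[mh ih]].
 split => //; apply/integrableP; split; first by apply/measurable_EFinP; exact: measurable_funX.
 move: hoo; rewrite nnintE//; last by apply/measurable_EFinP; apply: measurable_funX; exact: measurableT_comp.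
 by apply: le_lt_trans; rewrite (eq_integral (fun x : RL R n => (`|h x| ^+ 2)%:E))// => x _ /=; rewrite normrX.
split; first exact/measRP.
rewrite nnintE//; last by apply/measurable_EFinP; apply: measurable_funX; exact: measurableT_comp.
have /integrableP[_] := ih; apply: le_lt_trans.
by apply: le_integral_ge0 => // x /=; rewrite normrX.
Qed.

Lemma L2normE (h : Rn -> R) : L2i h -> L2norm h = Num.sqrt (n2 h).
move=> [mh ih]; rewrite /L2norm nnintE//; last first.
 by apply/measurable_EFinP; apply: measurable_funX; exact: measurableT_comp.
congr (Num.sqrt (fine _)); apply: eq_integral => x _.
by rewrite real_normK ?num_real.
Qed.

Lemma n2_ae0 (h : Rn -> R) : L2i h -> n2 h = 0 -> {ae L, forall x, h x = 0}.
move=> ih h0; apply: L2_orthogonal => // psi sp.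
have ip := schwartz_L2i sp.
apply/eqP; rewrite -normr_le0; apply/ler_addgt0Pl => e e0; rewrite addr0.
have e' : 0 < e / (n2 psi + 1) by rewrite divr_gt0// ltr_wpDl// n2_ge0.
apply: le_trans (L2_pair_bound ih ip e') _.
rewrite h0 mulr0 add0r mulrAC ler_pdivrMr ?ler_pM2l ?lerDl//.
by rewrite ltr_wpDl// n2_ge0.
Qed.

(** * Convolution of L2 functions with compactly supported kernels *)

Lemma lebm_sigma_finite : sigma_finite setT L.
exists (fun k => eball (0 : Rn) k.+1%:R).
 apply/seteqP; split => // x _; exists (Num.truncn (enorm x)) => //.
 by rewrite /eball/= subr0 truncnS_gt.
by move=> k; split; [exact: meas_eball|rewrite [L _]leb_eball ?ltry].
Qed.

Lemma measurable_pair_ball (r : R) :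
 measurable ([set z | enorm ((z.1 : Rn) - (z.2 : Rn)) < r] : set (RL R n * RL R n)).
have m : measurable_fun setT (fun z : RL R n * RL R n => enorm ((z.1 : Rn) - (z.2 : Rn))).
 rewrite /enorm; apply: (measurableT_comp (continuous_measurable_fun (@sqrt_continuous R))).
 apply: measurable_sum => i; apply: measurable_funX.
 rewrite (_ : (fun _ => _) = fun z : RL R n * RL R n => (z.1 : Rn) ord0 i - (z.2 : Rn) ord0 i); last first.
 by apply/funext => z; rewrite !mxE.
 by apply: measurable_funB; apply: (measurableT_comp (measurable_coord i)).
have := m measurableT _ (measurable_itv `]-oo, r[); rewrite setTI; congr measurable.
Qed.

Lemma integral_local_square (f : Rn -> R) (r : R) : 0 < r -> L2i f ->
 (\int[L]_y \int[L]_x (f x ^+ 2 * \1_(eball y r) x)%:E = (r ^+ n * vball * n2 f)%:E)%E.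
move=> r0 [mf if2]; pose m := sfmeasure lebm_sigma_finite.
have -> : (\int[L]_y \int[L]_x (f x ^+ 2 * \1_(eball y r) x)%:E =
 \int[m]_y \int[m]_x (f x ^+ 2 * \1_(eball y r) x)%:E)%E by [].
pose F (z : RL R n * RL R n) := (f z.2 ^+ 2 * \1_[set z | enorm ((z.1 : Rn) - (z.2 : Rn)) < r] z)%:E.
have mF : measurable_fun setT F.
 apply/measurable_EFinP; apply: measurable_funM.
 by apply: measurable_funX; apply: (measurableT_comp mf).
 apply: measurable_indic; exact: measurable_pair_ball.
have F0 z : (0 <= F z)%E by pos.
have E1 (x y : Rn) : (f x ^+ 2 * \1_(eball y r) x)%:E = F (y, x).
 rewrite /F; congr (_ * _)%:E; congr (_%:R); congr nat_of_bool.
 by apply/idP/idP; rewrite !inE /eball/= enormB.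
transitivity (\int[m]_x \int[m]_y F (x, y))%E.
 by apply: eq_integral => y _; apply: eq_integral => x _; exact: E1.
rewrite (fubini_tonelli (m1 := m) (m2 := m) F mF F0).
transitivity (\int[m]_x ((f x ^+ 2)%:E * (r ^+ n * vball)%:E))%E.
 apply: eq_integral => x _.
 transitivity (\int[L]_y ((f x ^+ 2)%:E * (\1_(eball (x : Rn) r) y)%:E))%E.
 apply: eq_integral => y _; rewrite -E1; congr (_ * _)%:E; rewrite !indicE; congr (_%:R).
 by congr nat_of_bool; apply/idP/idP; rewrite !inE /eball/= enormB.
 rewrite ge0_integralZl//; first by congr (_ _)%E; exact: integral_eball.
 by apply/measurable_EFinP; apply: measurable_indic; exact: meas_eball.
 by pos.
rewrite ge0_integralZr//; last 3 first.
- by apply/measurable_EFinP; exact: measurable_funX.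
- by move=> x _; rewrite lee_fin.
- by rewrite lee_fin mulr_ge0 ?ltW// vball_gt0.
have -> : (\int[m]_x (f x ^+ 2)%:E = (n2 f)%:E)%E.
 by rewrite fineK//; exact: integrable_fin_num.
by rewrite -EFinM mulrC.
Qed.

Lemma L2_cauchy u w : L2i u -> L2i w -> (\int[L]_x (u x * w x)) ^+ 2 <= 4 * (n2 u * n2 w).
move=> iu iw; set F := \int[L]_x _; have u0 := n2_ge0 u; have w0 := n2_ge0 w.
have H e : 0 < e -> `|F| <= e^-1 * n2 u + e * n2 w by exact: L2_pair_bound.
have F2 : F ^+ 2 = `|F| ^+ 2 by rewrite real_normK ?num_real.
rewrite F2; have [w1|w1] := eqVneq (n2 w) 0.
 suff -> : `|F| = 0 by rewrite expr0n mulr_ge0.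
 apply/eqP; rewrite -normr_le0 normr_id; apply/ler_addgt0Pl => e e0; rewrite addr0.
 have e1 : 0 < (n2 u + 1) / e by rewrite divr_gt0// ltr_wpDl.
 apply: le_trans (H _ e1) _; rewrite w1 mulr0 addr0 invf_div mulrAC ler_pdivrMr ?ltr_wpDl//.
 by rewrite ler_pM2l// lerDl.
have wp : 0 < n2 w by rewrite lt_neqAle eq_sym w1.
have [F0|F0] := eqVneq `|F| 0; first by rewrite F0 expr0n mulr_ge0.
have Fp : 0 < `|F| by rewrite lt_neqAle eq_sym F0 normr_ge0.
have := H (`|F| / (2 * n2 w)); rewrite divr_gt0// => /(_ isT).
rewrite invf_div -[X in _ <= _ + X]mulrA (_ : (2 * n2 w)^-1 * n2 w = 2^-1); last by field.
move: (`|F|) Fp => y yp h; have := ler_wpM2l (ltW yp) h.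
rewrite mulrDr (_ : y * (2 * n2 w / y * n2 u) = 2 * (n2 u * n2 w)); first by pos; lra.
by field; exact: lt0r_neq0.
Qed.

(** Cauchy-Schwarz on the ball of radius [A t] bounds the square at [y] by the local integral of
    [f^2]. Tonelli then gives each point the measure of such a ball, proportional to [t^n], which
    cancels the [t^-n] of the kernel; so the constant is independent of [t]. *)
Lemma dilt_L2 (Phi : Rn -> R) (A : R) : 0 < A -> schwartz Phi -> (forall x, A <= enorm x -> Phi x = 0) ->
 exists2 C : R, 0 < C & forall f t, L2i f -> tempered (fdist f) -> 0 < t ->
 L2i (dilt (fdist f) Phi t) /\ n2 (dilt (fdist f) Phi t) <= C * n2 f.
move=> A0 sP PA; have [B B0 HB] := @schwartz_decay Phi [::] 0 sP.
have {}HB x : `|Phi x| <= B by have := HB x; rewrite mul1r.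
pose V := vball; have V0 : 0 < V := vball_gt0.
exists (4 * (B ^+ 2 * (A ^+ n * V)) * (A ^+ n * V)) => //.
move=> f t iL tf t0; have t1 : 0 < A * t by pos.
have [mf if2] := iL.
have sd y : schwartz (dil Phi t y) by apply: schwartz_dil => //; exact: lt0r_neq0.
have mD : mfun (dilt (fdist f) Phi t).
 by apply: econt_meas; exact: dilt_econt.
have u2 y : L2i (fun x => f x * \1_(eball y (A * t)) x).
 split; first by apply: measurable_funM => //; apply: measurable_indic; exact: meas_eball.
 apply: (inte_le _ _ if2).
 by apply: measurable_funX; apply: measurable_funM => //; apply: measurable_indic; exact: meas_eball.
 move=> x; rewrite exprMn normrM (ger0_norm (sqr_ge0 _)) ler_piMr// indicE.
 by case: (_ \in _); rewrite ?expr1n ?expr0n ?normr1 ?normr0.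
have n2d y : n2 (dil Phi t y) <= t ^- n * (B ^+ 2 * (A ^+ n * V)).
 have b x : `|dil Phi t y x ^+ 2| <= (t ^- n * B) ^+ 2.
 rewrite normrX lerXn2r ?nnegrE//.
 by rewrite normrM ger0_norm ?ler_wpM2l.
 have [||||i1 i2] := @inte_bdd_supp (fun x => dil Phi t y x ^+ 2) y (A * t) ((t ^- n * B) ^+ 2) t1.
 - by pos.
 - by apply: measurable_funX; exact: (schwartz_meas [::] (sd y)).
 - exact: b.
 - move=> x nb; rewrite /dil PA ?mulr0 ?expr0n// enormZ enormB gtr0_norm//.
 by rewrite mulrC ler_pdivlMr// leNgt; apply/negP.
 apply: le_trans (_ : \int[L]_x `|dil Phi t y x ^+ 2| <= _).
 by apply: ler_Rint => //; [exact: inte_abs|move=> x; exact: ler_norm].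
 apply: le_trans i2 _; apply: le_of_eq.
 rewrite !exprMn -/V; have := expf_neq0 n (lt0r_neq0 t0).
 by move: (t ^+ n) (A ^+ n) => T1 T2 T0; field.
have pw y : dilt (fdist f) Phi t y ^+ 2 <= 4 * (t ^- n * (B ^+ 2 * (A ^+ n * V))) *
 n2 (fun x => f x * \1_(eball y (A * t)) x).
 rewrite /dilt fdistE//; last exact: (schwartz_meas [::] (sd y)).
 have -> : \int[L]_x (f x * dil Phi t y x) = \int[L]_x (f x * \1_(eball y (A * t)) x * dil Phi t y x).
 apply: eq_Rintegral => x _; rewrite indicE.
 have [h|h] := pselect (eball y (A * t) x); first by rewrite mem_set// mulr1.
 rewrite /dil PA ?mulr0// enormZ enormB gtr0_norm//.
 by rewrite mulrC ler_pdivlMr// leNgt; apply/negP.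
 apply: le_trans (L2_cauchy (u2 y) (schwartz_L2i (sd y))) _.
 rewrite -[leRHS]mulrA ler_pM2l// mulrC ler_wpM2r ?n2_ge0//; exact: n2d.
have key : (\int[L]_y (dilt (fdist f) Phi t y ^+ 2)%:E <=
 (4 * (B ^+ 2 * (A ^+ n * V)) * (A ^+ n * V) * n2 f)%:E)%E.
 set K := 4 * (t ^- n * (B ^+ 2 * (A ^+ n * V))) in pw.
 have K0 : 0 <= K by pos.
 have mI : measurable_fun setT (fun y : RL R n => \int[L]_x (f x ^+ 2 * \1_(eball (y : Rn) (A * t)) x)%:E)%E.
 pose m := sfmeasure lebm_sigma_finite.
 pose F (z : RL R n * RL R n) := (f z.2 ^+ 2 * \1_[set z | enorm ((z.1 : Rn) - (z.2 : Rn)) < A * t] z)%:E.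
 have mF : measurable_fun setT F.
 apply/measurable_EFinP; apply: measurable_funM.
 by apply: measurable_funX; apply: (measurableT_comp mf).
 apply: measurable_indic; exact: measurable_pair_ball.
 have F0 z : (0 <= F z)%E by pos.
 have := measurable_fun_fubini_tonelli_F (m2 := m) F mF F0.
 apply: eq_measurable_fun => y _; apply: eq_integral => x _.
 rewrite /F; congr (_ * _)%:E; congr (_%:R); congr nat_of_bool.
 by apply/idP/idP; rewrite !inE /eball/= enormB.
 apply: (le_via (\int[L]_y (K%:E * \int[L]_x (f x ^+ 2 * \1_(eball (y : Rn) (A * t)) x)%:E))%E).
 apply: le_integral_ge0 => y; first by pos.
 have <- : ((n2 (fun x => f x * \1_(eball y (A * t)) x))%:E =
 \int[L]_x (f x ^+ 2 * \1_(eball (y : Rn) (A * t)) x)%:E)%E.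
 rewrite fineK; last by apply: integrable_fin_num => //; case: (u2 y).
 apply: eq_integral => x _; rewrite exprMn; congr (_ * _)%:E.
 by rewrite indicE; case: (_ \in _); rewrite ?expr1n ?expr0n.
 by pos.
 rewrite ge0_integralZl//; last by move=> y _; apply: integral_ge0 => x _; rewrite lee_fin.
 rewrite integral_local_square// lee_fin; apply: le_of_eq.
 rewrite /K exprMn -/V; have := expf_neq0 n (lt0r_neq0 t0).
 by move: (t ^+ n) (A ^+ n) => T1 T2 T0; field.
have i2 : inte (fun y => dilt (fdist f) Phi t y ^+ 2).
 apply/integrableP; split; first by apply/measurable_EFinP; exact: measurable_funX.
 apply: le_lt_trans (ltry _); apply: le_trans key.
 by apply: le_integral_ge0 => // y /=; rewrite ger0_norm.
split => //.
rewrite -lee_fin fineK//; exact: integrable_fin_num.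
Qed.

(** * Bounded overlap of the Whitney balls *)

Section overlap.

Definition wact (g : Rn -> \bar R) (J : WJ) : Prop := exists y, chi g J y != 0.
Definition Jb (J : WJ) : set Rn := eball (Jc J) (Jr J / 8).

(** [chi] is nonzero at some [y] within [Jr/16] of the centre with [Jr/2 < dk < 2 Jr]; the ball adds
    [Jr/8], so [dk] changes by at most [3/16] of [Jr]. *)
Lemma wact_dk g J x : (forall k, exists x, ~ lev g k x) -> wact g J -> Jb J x ->
 Jr J * (5 / 16) < dk g (Jk J) x < Jr J * (35 / 16).
move=> hc [y /chi_supp[/andP[h1 h2] h3]]; rewrite /Jb /eball/= => h4.
have := dk_lip hc (Jk J) x y; rewrite ler_norml => /andP[h5 h6].
have := enorm_dist3 x (Jc J) y; rewrite [enorm (Jc J - y)]enormB => h7.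
by apply/andP; split; lra.
Qed.

Lemma wact_lev g J : (forall k, exists x, ~ lev g k x) -> wact g J -> Jb J `<=` lev g (Jk J).
move=> hc aJ x xJ; have /andP[h1 h2] := wact_dk hc aJ xJ.
apply: (@dk_ball _ _ x _ (lexx _)); rewrite /eball/= subrr enorm0.
by apply: lt_trans h1; rewrite mulr_gt0.
Qed.

Lemma scale_window (l l0 : int) (d : R) : 2 ^ l0 < d <= 2 ^ (l0 + 1) ->
 2 ^ l * (5 / 16) < d < 2 ^ l * (35 / 16) -> l0 - 1 <= l <= l0 + 2.
move=> /andP[d1 d2] /andP[d3 d4]; apply/andP; split; rewrite leNgt; apply/negP => h.
 have : 2 ^ l <= 2 ^ (l0 - 2) :> R by apply: ler_weXz2l; rewrite ?ler1n; lia.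
 have -> : 2 ^ (l0 - 2) = 2 ^ l0 / 4 :> R by rewrite expfzDr//; congr (_ _^-1); rewrite -natrX.
 have : 0 < 2 ^ l0 :> R by pos.
 lra.
have : 2 ^ (l0 + 1 + 2) <= 2 ^ l :> R by apply: ler_weXz2l; rewrite ?ler1n; lia.
have -> : 2 ^ (l0 + 1 + 2) = 2 ^ (l0 + 1) * 4 :> R by rewrite expfzDr// -[2 ^ 2]/((2 : R) ^+ 2) expr2 -natrM.
have : 0 < 2 ^ (l0 + 1) :> R by pos.
lra.
Qed.

(** Four scales, and for each coordinate a window of [4n + 7] lattice positions. *)
Definition Movl : nat := #|{: 'I_4 * {ffun 'I_n -> 'I_(4 * n + 6).+1}}|.

Lemma absz_inord_inj N (a b : int) : 0 <= a <= N%:Z -> 0 <= b <= N%:Z ->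
 inord (absz a) = inord (absz b) :> 'I_N.+1 -> a = b.
move=> ha hb /(congr1 val) /=; rewrite !inordK; lia.
Qed.

(** For active balls of one level through [x], the radius is comparable with [dk k x], which leaves
    four exponents. The ball radius is [2(n+1)] mesh widths, so the lattice point is within that
    distance of the rescaled coordinates of [x]. Recording these offsets is injective. *)
Lemma whitney_card g x k (s : seq WJ) : (forall k, exists x, ~ lev g k x) -> uniq s ->
 (forall J, J \in s -> [/\ Jk J = k, wact g J & Jb J x]) -> (size s <= Movl)%N.
move=> hc us sP; case: s us sP => [//|J0 s0]; set s := J0 :: s0 => us sP.
have [k0 a0 b0] := sP J0 (mem_head _ _).
have dpos : 0 < dk g k x.
 by have /andP[h _] := wact_dk hc a0 b0; rewrite -k0; apply: lt_trans h; rewrite mulr_gt0.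
have [l0 l0P] := dyadic_exists dpos.
pose fl (l : int) i := Num.floor (x ord0 i / (2 ^ l / Wd)).
pose F (J : WJ) : 'I_4 * {ffun 'I_n -> 'I_(4 * n + 6).+1} :=
 (inord (absz (Jl J - l0 + 1)),
 [ffun i => inord (absz (Jz J i - fl (Jl J) i + (2 * n + 2)%:Z))]).
have lP J : J \in s -> 0 <= Jl J - l0 + 1 <= 3%:Z.
 move=> /sP[kJ aJ bJ]; have := wact_dk hc aJ bJ; rewrite kJ => h.
 by have := scale_window l0P h; clear; lia.
have zP J i : J \in s -> 0 <= Jz J i - fl (Jl J) i + (2 * n + 2)%:Z <= (4 * n + 6)%:Z.
 move=> /sP[_ _ bJ]; rewrite /fl; set y := x ord0 i / Jdel J.
 have d0 : 0 < Jdel J :> R by pos.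
 have h : `|y - (Jz J i)%:~R| < 2 * n.+1%:R :> R.
 have -> : y - (Jz J i)%:~R = (x - Jc J) ord0 i / Jdel J.
 by rewrite !mxE mulrBl mulfK ?lt0r_neq0.
 rewrite normrM normfV (gtr0_norm d0) ltr_pdivrMr//; apply: le_lt_trans (enorm_coord _ _) _.
 apply: lt_le_trans bJ _; rewrite /Jdel /Wd natrM.
 have n0 : n.+1%:R != 0 :> R by [].
 by move: (n.+1%:R) n0 => N N0; apply: le_of_eq; field.
 have := floor_itv y; rewrite ltr_norml in h; case/andP: h => h1 h2 /andP[h3 h4].
 have n2E : (2 * n + 2)%:Z%:~R = 2 * n.+1%:R :> R by rewrite -natrM; congr (_%:R); clear; lia.
 have e1 : (Num.floor y)%:~R < (Jz J i + (2 * n + 2)%:Z)%:~R :> R.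
 by rewrite intrD; lra.
 have e2 : (Jz J i)%:~R < (Num.floor y + 1 + (2 * n + 2)%:Z)%:~R :> R.
 by rewrite intrD; lra.
 by move: e1 e2; rewrite !ltr_int; move: (Num.floor y) => z; clear; lia.
have Finj : {in s &, injective F}.
 move=> J J' sJ sJ' [] /(absz_inord_inj (lP J sJ) (lP J' sJ')) e1 e2.
 have el : Jl J = Jl J' by move: e1; clear; lia.
 have ez : Jz J = Jz J'.
 apply/ffunP => i; move/ffunP: e2 => /(_ i); rewrite !ffunE => /(absz_inord_inj (zP J i sJ) (zP J' i sJ')).
 by rewrite el => /addIr/addIr.
 have [ek _ _] := sP J sJ; have [ek' _ _] := sP J' sJ'.
 by move: J J' {sJ sJ' e1 e2} ek ek' el ez => [[? ?] ?] [[? ?] ?]; rewrite /Jk /Jl /Jz/= => -> -> -> ->.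
rewrite -(size_map F) /Movl; have /card_uniqP <- : uniq (map F s) by rewrite map_inj_in_uniq.
exact: max_card.
Qed.

Variables (phi : Rn -> R -> R) (p0 p1 C : R).
Hypothesis Q : qtype phi p0 p1 C.

(** At each point the active balls of level [k] are at most [Movl] in number and all lie in the
    level set [k]; so the sum over balls is at most [Movl] times the sum over levels, which
    integrates to [Mod]. *)
Lemma whitney_overlap (g : Rn -> \bar R) lam : (forall k, exists x, ~ lev g k x) ->
 measurable_fun setT (g : RL R n -> \bar R) -> 0 < lam ->
 (csum (fun J => if `[< wact g J >] then phiset phi (Jb J) (2 ^ (Jk J) / lam) else 0) <=
 Movl%:R%:E * Mod phi lam g)%E.
move=> hc mg lam0.
have t0 (k : int) : 0 <= 2 ^ k / lam by pos.
have mJ J : mset (Jb J) by exact: meas_eball.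
have ml (k : int) := meas_gt (2 ^ k)%:E mg.
pose u J (x : RL R n) : \bar R :=
 if `[< wact g J >] then (\1_(Jb J) x * phi x (2 ^ (Jk J) / lam))%:E else 0%E.
pose v (k : int) (x : RL R n) : \bar R := (\1_[set x | (2 ^ k)%:E < g x]%E x * phi x (2 ^ k / lam))%:E.
have w0 (x : Rn) (k : int) (b : R) : 0 <= b -> (0 <= (b * phi x (2 ^ k / lam))%:E)%E.
 by move=> b0; rewrite lee_fin.
have u0 J x : (0 <= u J x)%E by rewrite /u; case: ifP => // _; exact: w0.
have v0 k x : (0 <= v k x)%E by exact: w0.
have mu J : measurable_fun setT (u J).
 case: (boolP `[< wact g J >]) => aJ; last by rewrite /u (negPf aJ).
 by rewrite /u aJ; exact: (meas_weight Q).
have mv k : measurable_fun setT (v k) by exact: (meas_weight Q).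
rewrite (ModE Q)//.
have -> : (csum (fun J => if `[< wact g J >] then phiset phi (Jb J) (2 ^ (Jk J) / lam) else 0) =
 csum (fun J => \int[L]_x u J x))%E.
 congr csum; apply/funext => J; rewrite /u; case: ifP => _; last by rewrite integral0.
 by rewrite (phisetE Q).
have -> : csum (fun k : int => phiset phi [set x | (2 ^ k)%:E < g x]%E (2 ^ k / lam)) =
 csum (fun k => \int[L]_x v k x)%E.
 by congr csum; apply/funext => k; rewrite (phisetE Q).
rewrite -integral_csum// -integral_csum// -ge0_integralZl//; last 2 first.
- exact: meas_csum.
- by move=> x _; exact: csum_ge0.
apply: le_integral_ge0 => x; first exact: csum_ge0.
apply: (csum_fiber (g := @Jk)) => //.
- move=> J; rewrite /u; case: ifPn => [/asboolP aJ|_] //.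
 rewrite lee_fin ler_wpM2r// ler_nat.
 by have [xJ|xJ] := boolP (x \in Jb J); rewrite // mem_set//; apply: (wact_lev hc aJ); exact: set_mem.
- move=> k s us sP; apply: (@whitney_card g x k) => // J /sP[kJ]; rewrite /u.
 case: ifPn => [/asboolP aJ|_]; last by rewrite eqxx.
 rewrite indicE; case: (boolP (x \in Jb J)) => [/set_mem xJ _|_]//.
 by rewrite mul0r eqxx.
Qed.
End overlap.

(** * Truncation of the sum of pieces *)

Section remainder.

Lemma sum_cvg (I : Type) (r : seq I) (v : nat -> I -> R) (w : I -> R) :
 (forall i, v ^~ i @ \oo --> w i) -> (fun k => \sum_(i <- r) v k i) @ \oo --> \sum_(i <- r) w i.
move=> h; elim: r => [|i r IH].
 by rewrite big_nil; apply: cvg_near_cst; apply: nearW => k; rewrite big_nil.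
rewrite big_cons; under eq_fun do rewrite big_cons.
exact: (cvgD (h i) IH).
Qed.

Lemma cvg_mul0 (a : R) (u : nat -> R) : u @ \oo --> (0 : R) -> (fun P => a * u P) @ \oo --> (0 : R).
by move=> h; rewrite -[X in _ --> X](mulr0 a); apply: cvgM => //; exact: cvg_cst. Qed.

Lemma csum_cvg (J : countType) (u : J -> R) (l : R) : (forall j, 0 <= u j) ->
 csum (fun j => (u j)%:E) = l%:E -> (fun P => \sum_(j <- @cfirst J P) u j) @ \oo --> l.
move=> u0 ul.
have : (fun P => \sum_(0 <= i < P) oapp (fun j => (u j)%:E) 0%E (@pickle_inv J i))%E @ \oo -->
 csum (fun j => (u j)%:E).
 by apply: is_cvg_nneseries => i _; case: pickle_inv => j; rewrite lee_fin.
rewrite ul; under eq_fun do rewrite csum_partial sumEFin.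
by move=> /fine_cvgP[].
Qed.

Variables (m M : nat) (f : @distr R n).
Hypothesis tf : tempered f.
Local Notation g := (gmax m f).
Local Notation F l j := (dilt f (bA M j) l).

(** By telescoping, the sum of all increments before localisation; it approximates [f] as [I]
    grows. *)
Definition PI (I : nat) (x : Rn) : R := dilt f (bPhi M) (ell I (I + I)) x - dilt f (bPhi M) (ell I 0) x.
(** The majorant for dominated convergence: the cutoffs add up to at most 1, whatever the truncation
    [P]. *)
Definition HI (I : nat) (x : Rn) : R := \sum_(i < I + I) \sum_(j < n) \sum_(t < M.+2)
 `|@csgn M t| * `|F (ell I i) j (x - shv (ell I i) j t)|.

Lemma PI_sum I x : PI I x = \sum_(i < I + I) \sum_(j < n) \sum_(t < M.+2)
 @csgn M t * F (ell I i) j (x - shv (ell I i) j t).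
rewrite /PI -(telescope_sumr (fun i => dilt f (bPhi M) (ell I i) x))// big_mkord.
apply: eq_bigr => i _; rewrite ellS dilt_refine//; exact: ell_gt0.
Qed.

Hypotheses (hc : forall k, exists x, ~ lev g k x) (hb : forall x r, exists k, eball x r `<=` lev g k)
 (ha : forall x r, 0 < r -> exists k, ~ (eball x r `<=` lev g k)).

Definition Ssum (P I : nat) (x : Rn) : R := \sum_(J <- @cfirst WJ P) bJ m M f I J x.

Lemma remE P I x : PI I x - Ssum P I x = \sum_(i < I + I) \sum_(j < n) \sum_(t < M.+2)
 @csgn M t * (F (ell I i) j (x - shv (ell I i) j t) *
 (1 - \sum_(J <- @cfirst WJ P) om g (Kc M * ell I i) J (x - shv (ell I i) j t))).
rewrite PI_sum [X in _ - X]exchange_big/= -sumrB; apply: eq_bigr => i _.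
rewrite [X in _ - X]exchange_big/= -sumrB; apply: eq_bigr => j _.
rewrite [X in _ - X]exchange_big/= -sumrB; apply: eq_bigr => t _.
by rewrite -mulr_sumr -mulrBr -mulr_sumr -[X in X - _]mulr1 -mulrBr.
Qed.

Let om01 P r x : 0 < r -> 0 <= \sum_(J <- @cfirst WJ P) om g r J x <= 1.
move=> r0; apply/andP; split; first by apply: sumr_ge0 => J _; exact: om_ge0.
rewrite -lee_fin -sumEFin -(om_sum hc hb ha x r0); apply: le_csum_fin; last exact: cfirst_uniq.
by move=> J; rewrite lee_fin om_ge0.
Qed.

Lemma rem_bound P I x : `|PI I x - Ssum P I x| <= HI I x.
rewrite remE; do 3 (apply: le_trans (ler_norm_sum _ _ _) _; apply: ler_sum => ? _).
rewrite normrM ler_wpM2l// normrM ler_piMr//.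
set s := \sum_(J <- _) _; have /andP[h1 h2] : 0 <= s <= 1 by exact: om01.
by rewrite ger0_norm; lra.
Qed.

Lemma rem_cvg I x : (fun P => PI I x - Ssum P I x) @ \oo --> (0 : R).
suff : (fun P => PI I x - Ssum P I x) @ \oo --> \sum_(i < I + I) \sum_(j < n) \sum_(t < M.+2) (0 : R).
 by rewrite big1// => _; rewrite big1// => _; rewrite big1.
under eq_fun do rewrite remE.
apply: sum_cvg => i; apply: sum_cvg => j; apply: sum_cvg => t.
apply: cvg_mul0; apply: cvg_mul0; rewrite -[X in _ --> X](subrr 1).
apply: cvgB; first exact: cvg_cst.
by apply: csum_cvg; [move=> J; exact: om_ge0|exact: (om_sum hc hb ha)].
Qed.

Lemma Ssum_meas P I : mfun (Ssum P I).
by apply: measurable_sum => J; exact: bJ_meas. Qed.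

Lemma PI_meas I : mfun (PI I).
by apply: measurable_funB; apply: econt_meas; apply: dilt_econt => //; rewrite//; exact: schwartz_bPhi.
Qed.

Lemma rem_pair I (w : Rn -> R) : schwartz w -> forall e : R, 0 < e -> exists P0, forall P, (P0 <= P)%N ->
 \int[L]_x `|(PI I x - Ssum P I x) * w x| <= e.
move=> sw; apply: (@dct0 _ (fun x => HI I x * `|w x|)).
- move=> P; apply: measurable_funM; last exact: (schwartz_meas [::] sw).
 by apply: measurable_funB; [exact: PI_meas|exact: Ssum_meas].
- rewrite (_ : (fun x => _) = fun x => \sum_(i < I + I) \sum_(j < n) \sum_(t < M.+2)
 `|@csgn M t| * (`|F (ell I i) j (x - shv (ell I i) j t)| * `|w x|)); last first.
 apply/funext => x; rewrite mulr_suml; apply: eq_bigr => i _; rewrite mulr_suml.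
 by apply: eq_bigr => j _; rewrite mulr_suml; apply: eq_bigr => t _; rewrite mulrA.
 apply: (proj1 (inte_sum _ _)) => i.
 apply: (proj1 (inte_sum _ _)) => j.
 apply: (proj1 (inte_sum _ _)) => t.
 apply: inteZ; set v := shv _ _ _.
 have sv : schwartz (fun x => w (x + v)).
 have := @schwartz_affine 1 v w (oner_neq0 _) sw.
 by congr schwartz; apply/funext => x; rewrite scale1r.
 have [i1 _] := @tempered_conv _ tf (bA M j) (fun x => w (x + v)) (ell I i) (schwartz_bA _ _) sv (ell_gt0 _ _).
 have [i2 _] := Rint_shift v (inte_abs i1).
 by move: i2; congr inte; apply/funext => x; rewrite subrK normrM.
- by move=> P x; rewrite normrM ler_wpM2r// rem_bound.
- move=> x; rewrite -(mul0r (w x)); apply: cvgM; [exact: rem_cvg|exact: cvg_cst].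
Qed.

Lemma rem_n2 I : (forall i j, L2i (F (ell I i) j)) -> forall e : R, 0 < e -> exists P0, forall P, (P0 <= P)%N ->
 n2 (fun x => PI I x - Ssum P I x) <= e.
move=> iF e e0.
have iH : L2i (HI I).
 apply: L2i_sum => i; apply: L2i_sum => j; apply: L2i_sum => t; apply: L2iZ.
 have [m1 i1] := iF i j; split; first by apply: measurableT_comp => //; exact: meas_shift.
 have [i2 _] := Rint_shift (shv (ell I i) j t) i1.
 by move: i2; congr inte; apply/funext => x; rewrite real_normK ?num_real.
have := @dct0 (fun P x => (PI I x - Ssum P I x) ^+ 2) (fun x => HI I x ^+ 2) _ iH.2 _ _ e e0; case.
- by move=> P; apply: measurable_funX; apply: measurable_funB; [exact: PI_meas|exact: Ssum_meas].
- move=> P x; rewrite normrX; apply: lerXn2r; rewrite ?nnegrE ?rem_bound//.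
 by apply: le_trans (rem_bound P I x).
- by move=> x; rewrite -(mulr0 0); apply: (cvgM (rem_cvg I x) (rem_cvg I x)).
move=> P0 HP; exists P0 => P /HP; rewrite /n2; apply: le_trans; apply: le_of_eq.
by apply: eq_Rintegral => x _; rewrite ger0_norm.
Qed.
End remainder.

(** * Limits in the scale, and level sets of the maximal function *)

Section levels.

Lemma PI_limit (m M : nat) (f : @distr R n) (w : Rn -> R) (e : R) : tempered f ->
 (forall a : R, 0 < a -> exists x, (gmax m f x <= a%:E)%E) -> schwartz w -> 0 < e ->
 exists I0, forall I, (I0 <= I)%N ->
 inte (fun x => PI M f I x * w x) /\ `|\int[L]_x (PI M f I x * w x) - f w| <= e.
move=> tf sm sw e0; have e2 : 0 < e / 2 by pos.
have [d d0 dP] := fine_limit M tf sw e2; have [T T0 TP] := coarse_limit M tf sm sw e2.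
have [I0 [I1 I2]] : exists I0 : nat, T <= I0%:R /\ d^-1 <= I0%:R.
 exists (Num.truncn (Num.max T d^-1)).+1; have := truncnS_gt (Num.max T d^-1).
 by rewrite gt_max => /andP[h1 h2]; rewrite !ltW.
have big I : (I0 <= I)%N -> I0%:R <= 2 ^+ I :> R.
 by move=> h; rewrite -natrX ler_nat (leq_trans h)// ltnW// ltn_expl.
exists I0 => I hI.
have l0 : ell I 0 = 2 ^+ I :> R by rewrite /ell divr1.
have l1 : ell I (I + I) = 2 ^- I :> R by rewrite /ell exprD invfM mulrA divff ?mul1r.
have [i1 _] := tempered_conv tf (schwartz_bPhi M) sw (ell_gt0 I (I + I)).
have [i2 _] := tempered_conv tf (schwartz_bPhi M) sw (ell_gt0 I 0).
have iE : (fun x => PI M f I x * w x) = fun x => dilt f (bPhi M) (ell I (I + I)) x * w x -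
 dilt f (bPhi M) (ell I 0) x * w x by apply/funext => x; rewrite mulrBl.
rewrite iE; split; first exact: inteB.
rewrite (RintegralB measurableT i1 i2).
have p2 : 0 < 2 ^- I :> R by [].
have := dP (ell I (I + I)); rewrite l1 p2 /= => h1.
have {}h1 := h1.
have := TP (ell I 0); rewrite l0 => h2.
have {}h1 : `|\int[L]_y (dilt f (bPhi M) (2 ^- I) y * w y) - f w| <= e / 2.
 by apply: h1; rewrite -[leRHS]invrK lef_pV2 ?posrE// (le_trans I2) ?big.
have {}h2 : `|\int[L]_y (dilt f (bPhi M) (2 ^+ I) y * w y)| <= e / 2.
 by apply: h2; rewrite (le_trans I1)// big.
move: h1 h2; move: (\int[L]_y _) (\int[L]_y _) (f w) => a b c h1 h2.
by rewrite addrAC (le_trans (ler_normB _ _)); lra.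
Qed.

(** The constant depends on the kernels alone, which makes the later bounds uniform in [f]. *)
Lemma aperture_constant (m M : nat) : exists2 CA : R, 0 < CA & forall f : @distr R n, tempered f ->
 (forall j t x y, 0 < t -> enorm (y - x) < 2 * Kc M * t ->
 (`|dilt f (bA M j) t y|%:E <= CA%:E * gmax m f x)%E) /\
 (forall t x y, 0 < t -> enorm (y - x) < 2 * Kc M * t ->
 (`|dilt f (bPhi M) t y|%:E <= CA%:E * gmax m f x)%E).
have K0 : 0 < 2 * Kc M by pos.
have [C0 C00 HC0] := gmax_aperture m (@schwartz_bPhi M) K0.
have /choice[Cj HCj] : forall j : 'I_n, exists Cj : R, 0 < Cj /\
 forall f, tempered f -> forall t x y, 0 < t -> enorm (y - x) < 2 * Kc M * t ->
 (`|f (dil (bA M j) t y)|%:E <= Cj%:E * gmax m f x)%E.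
 by move=> j; have [Cj h2] := gmax_aperture m (@schwartz_bA M j) K0; exists Cj.
have s0 : 0 <= \sum_(j < n) Cj j by apply: sumr_ge0 => j _; exact: ltW (HCj j).1.
exists (C0 + \sum_(j < n) Cj j); first by rewrite ltr_pwDl.
move=> f tf; split => [j t x y t0 h|t x y t0 h].
 apply: le_trans ((HCj j).2 f tf t x y t0 h) _; apply: lee_wpmul2r; first exact: gmax_ge0.
 rewrite lee_fin (bigD1 j)//= addrCA lerDl addr_ge0//.
 by apply: sumr_ge0 => i _; exact: ltW (HCj i).1.
apply: le_trans (HC0 f tf t x y t0 h) _; apply: lee_wpmul2r; first exact: gmax_ge0.
by rewrite lee_fin lerDl.
Qed.

Lemma seminorm_ub (k : nat) (psi : Rn -> R) al x : schwartz psi -> (size al <= k)%N ->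
 (1 + enorm x) ^+ k * `|dpart al psi x| <= seminorm k psi.
move=> sp sal; have [C C0 HC] := schwartz_decayn k k sp.
apply: ub_le_sup; last by exists x, al.
by exists C => _ [y [be [sb ->]]]; exact: HC.
Qed.

Lemma L2_tempered (h : Rn -> R) : L2i h -> tempered (fdist h).
move=> ih; have [mh _] := ih.
have fE psi : schwartz psi -> fdist h psi = \int[L]_x (h x * psi x).
 by move=> sp; rewrite fdistE//; exact: (schwartz_meas [::] sp).
have iE psi : schwartz psi -> inte (fun x => h x * psi x).
 by move=> sp; apply: L2iM => //; exact: schwartz_L2i.
split.
 move=> a psi1 psi2 s1 s2; rewrite !fE//; last exact: schwartz_comb.
 rewrite -RintegralZl//; last exact: iE.
 rewrite -RintegralD//; [|by apply: inteZ; exact: iE|exact: iE].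
 by apply: eq_Rintegral => x _; ring.
have [K K0 HK] := @inte_decay.
exists (Num.sqrt (4 * (n2 h * K))), n.+1 => psi sp; rewrite fE//.
have S0 : 0 <= seminorm n.+1 psi.
 by apply: le_trans (@seminorm_ub n.+1 psi [::] 0 sp _) => //; rewrite mulr_ge0.
have ip := schwartz_L2i sp.
have n2p : n2 psi <= K * seminorm n.+1 psi ^+ 2.
 have [|x|i1 i2] := HK (fun x => psi x ^+ 2) (seminorm n.+1 psi ^+ 2).
 - by apply: measurable_funX; exact: (schwartz_meas [::] sp).
 - rewrite normrX; apply: le_trans (_ : ((1 + enorm x) ^+ n.+1 * `|psi x|) ^+ 2 <= _).
 rewrite exprMn ler_wpM2r// -exprM; apply: ler_weXn2l; first exact: enorm1_ge1.
 by rewrite mulnC mul2n -addnn leq_addr.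
 by apply: lerXn2r; rewrite ?nnegrE//; exact: (@seminorm_ub n.+1 psi [::] x sp).
 apply: le_trans i2; apply: le_of_eq; apply: eq_Rintegral => x _.
 by rewrite ger0_norm.
have K1 : 0 <= 4 * (n2 h * K) by rewrite !mulr_ge0 ?n2_ge0.
rewrite -(@ler_pXn2r _ 2) ?nnegrE ?mulr_ge0// exprMn sqr_sqrtr// real_normK ?num_real//.
apply: le_trans (L2_cauchy ih ip) _; rewrite -!mulrA ler_pM2l// ler_wpM2l ?n2_ge0//.
Qed.

Variables (phi : Rn -> R -> R) (p0 p1 C q D : R).
Hypotheses (Q : qtype phi p0 p1 C) (HD : doubles phi q D) (D0 : 0 < D).

Let C0 := qt_C0 Q.

Lemma Mod_up lam a (g : RL R n -> \bar R) : 0 < lam -> 1 <= a -> measurable_fun setT g ->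
 (Mod phi (lam / a) g <= (C * a)%:E * Mod phi lam g)%E.
move=> lam0 a1 mg; have a0 : 0 < a by exact: lt_le_trans.
have ml (k : int) := meas_gt (2 ^ k)%:E mg.
rewrite !(ModE Q)//.
rewrite -csumZl//; last first.
 by move=> k; apply: (phiset_ge0 Q); rewrite divr_ge0.
have t0 (k : int) : 0 <= 2 ^ k / lam by pos.
apply: le_csum => k; first by apply: (phiset_ge0 Q); rewrite divr_ge0.
rewrite invf_div mulrCA; apply: le_trans (phiset_up Q (t0 k) a1 (ml k)) _.
apply: lee_wpmul2r; first exact: (phiset_ge0 Q).
rewrite lee_fin ler_pM2l// -[leRHS]powRr1//.
by apply: ler_powR => //; case/andP: (qt_p1 Q) => _ /ltW.
Qed.

Lemma Mod_low lam a (g : RL R n -> \bar R) : 0 < lam -> 0 < a -> a <= 1 -> measurable_fun setT g ->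
 (Mod phi (lam / a) g <= (C * a `^ p0)%:E * Mod phi lam g)%E.
move=> lam0 a0 a1 mg.
have ml (k : int) := meas_gt (2 ^ k)%:E mg.
rewrite !(ModE Q)//.
rewrite -csumZl//; last first.
 by move=> k; apply: (phiset_ge0 Q); rewrite divr_ge0.
have t0 (k : int) : 0 <= 2 ^ k / lam by pos.
apply: le_csum => k; first by apply: (phiset_ge0 Q); rewrite divr_ge0.
by rewrite invf_div mulrCA; exact: (phiset_low Q (t0 k) a0 a1 (ml k)).
Qed.

Lemma Mod_zero lam : 0 < lam -> Mod phi lam (fun=> 0%E) = 0%E.
move=> lam0; apply/eqP; rewrite eq_le (Mod_ge0 Q)// andbT.
have := Mod_indic Q lam0 (lexx 0) (@measurable0 _ (RL R n)).
rewrite mul0r (_ : phiset _ _ _ = 0%E) ?mule0; last first.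
 by rewrite (phisetE Q)// integral0_eq// => x _; rewrite indic0 mul0r.
by rewrite (_ : (fun => (0 * _)%:E) = fun=> 0%E)//; apply/funext => x; rewrite mul0r.
Qed.

(** Otherwise the level set of some [2^k] is the whole space, whose weight is infinite by
    [phiset_total], against the finiteness of [Mod]. *)
Lemma gmax_small (i0 : 'I_n) lam (g : Rn -> \bar R) : 0 < lam ->
 measurable_fun setT (g : RL R n -> \bar R) -> (Mod phi lam g < +oo)%E ->
 forall a : R, 0 < a -> exists x, (g x <= a%:E)%E.
move=> lam0 mg fin a a0; apply: contrapT => nx.
have [k /andP[k1 _]] := dyadic_exists a0.
have ga x : ((2 ^ k)%:E < g x)%E.
 rewrite ltNge; apply/negP => h; apply: nx; exists x; apply: le_trans h _.
 by pos.
have t0 (j : int) : 0 < 2 ^ j / lam by pos.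
have [B BE] : exists B : R, Mod phi lam g = B%:E.
 by exists (fine (Mod phi lam g)); rewrite fineK// ge0_fin_numE// (Mod_ge0 Q).
have [r r0] := phiset_total Q D0 HD i0 0 (t0 k) B.
apply/negP; rewrite -leNgt -BE (ModE Q)//.
apply: le_trans (le_csum1 k _) => [|j]; last exact/(phiset_ge0 Q)/ltW.
apply: (le_phiset Q) => //.
by move=> x _; exact: ga.
Qed.

(** Complements are nonempty by [gmax_small]. If [f] does not vanish on [w], then [w] is a
    unit-scale test function seen from every point of a ball in a cone of suitable aperture, which
    bounds the maximal function below there. A ball inside all level sets would contribute its
    weight infinitely often to [Mod]. *)
Lemma gmax_levels (i0 : 'I_n) m (f : @distr R n) lam : 0 < lam -> tempered f ->
 (Mod phi lam (gmax m f) < +oo)%E -> (exists2 w, schwartz w & f w != 0) ->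
 [/\ forall k, exists x, ~ lev (gmax m f) k x,
 forall x r, exists k, eball x r `<=` lev (gmax m f) k &
 forall x r, 0 < r -> exists k, ~ (eball x r `<=` lev (gmax m f) k)].
move=> lam0 tf fin [w sw w0]; have mg := meas_gmax m f.
have t0 (j : int) : 0 < 2 ^ j / lam by pos.
split.
- move=> k; have p : 0 < 2 ^ k :> R by pos.
 by have [x hx] := gmax_small i0 lam0 mg fin p; exists x; rewrite /lev/=; apply/negP; rewrite -leNgt.
- move=> x r; pose K := enorm x + `|r| + 1.
 have K0 : 0 < K by rewrite ltr_wpDl.
 have sw' : schwartz (fun z => w (-1 *: z + 0)) by apply: schwartz_affine; rewrite//.
 have [A A0 HA] := gmax_aperture m sw' K0.
 have dE : dil (fun z => w (-1 *: z + 0)) 1 0 = w.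
 by apply/funext => z; rewrite /dil expr1n invr1 mul1r scale1r sub0r scaleN1r opprK addr0.
 have fp : 0 < `|f w| / A by rewrite divr_gt0 ?normr_gt0.
 have [k /andP[k1 _]] := dyadic_exists fp.
 exists k => y; rewrite /eball/= => yr.
 have := HA f tf 1 y 0 ltr01; rewrite dE sub0r enormN mulr1 => h.
 have {}h : (`|f w|%:E <= A%:E * gmax m f y)%E.
 apply: h; have := enorm_dist3 y x 0; rewrite !subr0; have := ler_norm r; rewrite /K; lra.
 rewrite /lev/=; apply: lt_le_trans (_ : ((`|f w| / A)%:E <= _)%E) => //.
 have -> : (`|f w| / A)%:E = ((A^-1)%:E * `|f w|%:E)%E by rewrite mulrC.
 apply: le_trans (_ : ((A^-1)%:E * (A%:E * gmax m f y) <= _)%E).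
 by apply: lee_wpmul2l => //; rewrite lee_fin.
 by rewrite muleA -EFinM mulVf ?lt0r_neq0// mul1e.
- move=> x r r0; apply: contrapT => nk.
 have sub k : eball x r `<=` lev (gmax m f) k.
 by apply: contrapT => h; apply: nk; exists k.
 have [B BE] : exists B : R, Mod phi lam (gmax m f) = B%:E.
 by exists (fine (Mod phi lam (gmax m f))); rewrite fineK// ge0_fin_numE// (Mod_ge0 Q).
 have l1 : 0 < lam^-1 by pos.
 have [foo _] := HD r0 r0 l1 (@subset_refl _ (eball x r)).
 have fp := phiset_ball_gt0 Q x r0 l1.
 have [b bE] : exists b : R, phiset phi (eball x r) lam^-1 = b%:E.
 by exists (fine (phiset phi (eball x r) lam^-1)); rewrite fineK// ge0_fin_numE// ltW.
 rewrite bE lte_fin in fp.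
 pose N := (Num.truncn (B / b)).+1.
 have : B / b < N%:R by exact: truncnS_gt.
 rewrite ltr_pdivrMr// => hN.
 have : (\sum_(k <- map Posz (iota 0 N)) phiset phi [set x | (2 ^ k)%:E < gmax m f x]%E (2 ^ k / lam) <= B%:E)%E.
 rewrite -BE (ModE Q)//; apply: le_csum_fin; first by move=> k; exact/(phiset_ge0 Q)/ltW.
 by rewrite map_inj_uniq ?iota_uniq// => a c [].
 apply/negP; rewrite -ltNge; apply: lt_le_trans (_ : ((N%:R * b)%:E <= _)%E) => //.
 rewrite big_map.
 have -> : (N%:R * b)%:E = (\sum_(k <- iota 0 N) b%:E)%E.
 by rewrite sumEFin big_const_seq count_predT size_iota iter_addr_0 mulr_natl.
 apply: lee_sum => k _; rewrite -bE; apply: (le_phiset Q); [exact: ltW| |exact: sub].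
 by rewrite ler_peMl// exprn_ege1// ler1n.
Qed.
End levels.

(** * Approximation of a distribution by finitely many pieces *)

Section density.
Local Notation WJ := WJ.

Lemma pow16_small (e : R) : 0 < e -> exists v0, forall v, (v0 <= v)%N -> 16^-1 ^+ v <= e.
move=> e0; have := @cvg_geometric R 1 (16^-1) _.
have -> : `|16^-1 : R| < 1 by rewrite ger0_norm ?invr_ge0// invf_lt1// ltr1n.
move=> /(_ isT) /cvgrPdist_lt /(_ _ e0)[v0 _ Hv]; exists v0 => v /Hv.
by rewrite /= sub0r normrN mul1r ger0_norm ?exprn_ge0 ?invr_ge0// => /ltW.
Qed.

(** Averaging keeps a pairing within [a] of [l], because the trees use late indices, and strong
    convergence passes the bound to [h]. *)
Lemma mazur_pair (u : nat -> Rn -> R) (t : nat -> mtree) (h w : Rn -> R) I0 (l a : R) :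
 (forall I, L2i (u I)) -> L2i h -> (forall v, tge v (t v)) ->
 (forall v, n2 (fun x => tev (t v) u x - h x) <= 16^-1 ^+ v) -> L2i w ->
 (forall I, (I0 <= I)%N -> `|\int[L]_x (u I x * w x) - l| <= a) -> `|\int[L]_x (h x * w x) - l| <= a.
move=> iu ih tg hn iw HI0; apply/ler_addgt0Pl => e e0.
pose c : R := n2 w + 1; have c0 : 0 < c by rewrite ltr_wpDl ?n2_ge0.
have [v [vI vs]] : exists v, (I0 <= v)%N /\ 4 * (16^-1 ^+ v * n2 w) <= e ^+ 2.
 have : 0 < e ^+ 2 / (4 * c) by pos.
 move=> /pow16_small[v0 Hv]; exists (maxn I0 v0); split; first exact: leq_maxl.
 have := Hv _ (leq_maxr I0 v0); rewrite ler_pdivlMr//; apply: le_trans.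
 by rewrite mulrCA ler_wpM2l// ler_pM2l// lerDl.
have iS I : inte (fun x => u I x * w x) by exact: L2iM.
have [i1 E1] := tev_pair (t v) iS.
have d1 : `|teR (t v) (fun I => \int[L]_x (u I x * w x)) - l| <= a.
 by apply: (@teR_close _ v) => // I vI'; apply: HI0; exact: leq_trans vI'.
have d2 : `|\int[L]_x (tev (t v) u x * w x) - \int[L]_x (h x * w x)| <= e.
 have iB : L2i (fun x => tev (t v) u x - h x) by apply: L2iB => //; exact: tev_L2i.
 have -> : \int[L]_x (tev (t v) u x * w x) - \int[L]_x (h x * w x) =
 \int[L]_x ((tev (t v) u x - h x) * w x).
 by rewrite -(RintegralB measurableT i1 (L2iM ih iw)); apply: eq_Rintegral => x _; rewrite [RHS]mulrBl.
 rewrite -(@ler_pXn2r _ 2) ?nnegrE// real_normK ?num_real//.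
 by apply: le_trans (L2_cauchy iB iw) _; apply: le_trans vs; rewrite ler_pM2l// ler_wpM2r ?n2_ge0//; exact: hn.
move: d1 d2; rewrite E1; move: (teR _ _) (\int[L]_x (h x * w x)) => b d d1 d2.
have -> : d - l = (b - l) - (b - d) by ring.
by rewrite (le_trans (ler_normB _ _)); lra.
Qed.

Section approximation.
Variables (m M : nat) (f : @distr R n) (CA : R).
Hypothesis tf : tempered f.
Local Notation g := (gmax m f).
Hypotheses (hc : forall k, exists x, ~ lev g k x) (hb : forall x r, exists k, eball x r `<=` lev g k)
 (ha : forall x r, 0 < r -> exists k, ~ (eball x r `<=` lev g k))
 (sm : forall a : R, 0 < a -> exists x, (g x <= a%:E)%E) (CA0 : 0 < CA).
Hypothesis HA : forall j t x y, 0 < t -> enorm (y - x) < 2 * Kc M * t ->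
 (`|dilt f (bA M j) t y|%:E <= CA%:E * g x)%E.
Hypothesis HP : forall t x y, 0 < t -> enorm (y - x) < 2 * Kc M * t ->
 (`|dilt f (bPhi M) t y|%:E <= CA%:E * g x)%E.

(** The bound must not depend on the number of scales, since [mazur] is applied in [I] for fixed
    [P]: finitely many pieces, each bounded uniformly in [I] on a fixed ball, provide it. *)
Lemma Ssum_L2 P : exists B : R, forall I, L2i (Ssum m M f P I) /\ n2 (Ssum m M f P I) <= B.
pose A : R := 1 + \sum_(J <- @cfirst WJ P) (enorm (Jc J) + Jr J / 8).
pose B : R := \sum_(J <- @cfirst WJ P) Cb M CA * 2 ^ (Jk J).
have t0 (J : WJ) : 0 <= enorm (Jc J : Rn) + Jr J / 8 :> R.
 by pos.
have A0 : 0 < A by rewrite ltr_pwDl//; apply: sumr_ge0 => J _; exact: t0.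
have b0 (J : WJ) : 0 <= Cb M CA * 2 ^ (Jk J) by rewrite mulr_ge0 ?exprz_ge0// ltW// Cb_gt0.
have B0 : 0 <= B by apply: sumr_ge0 => J _; exact: b0.
exists (B ^+ 2 * (A ^+ n * vball)) => I.
have bd x : `|Ssum m M f P I x| <= B.
 apply: le_trans (ler_norm_sum _ _ _) _; apply: ler_sum => J _.
 exact: (bJ_bound tf hc CA0 HA HP).
have [||||i1 i2] := @inte_bdd_supp (fun x => Ssum m M f P I x ^+ 2) 0 A (B ^+ 2) A0.
- exact: sqr_ge0.
- by apply: measurable_funX; exact: Ssum_meas.
- by move=> x; rewrite normrX lerXn2r.
- move=> x nx; rewrite /Ssum big_seq big1 ?expr0n// => J JP; apply/eqP/negPn/negP => /bJ_supp[h _].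
 apply: nx; rewrite /eball/= subr0; apply: le_lt_trans (_ : enorm (Jc J) + Jr J / 8 < _).
 by have := enorm_dist3 x (Jc J) 0; rewrite !subr0; lra.
 rewrite /A (bigD1_seq J) ?cfirst_uniq//=.
 by rewrite addrCA ltr_pwDr// ltr_pwDl//; apply: sumr_ge0 => K _; exact: t0.
split; first by split => //; exact: Ssum_meas.
apply: le_trans i2; apply: le_of_eq; apply: eq_Rintegral => x _.
by rewrite ger0_norm.
Qed.

Hypothesis mM : (m <= M)%N.
Variable KI : R.
Hypothesis KI0 : 0 < KI.
Hypothesis HKI : forall (h : Rn -> R) (C : R),
 mfun h -> (forall x, (1 + enorm x) ^+ n.+1 * `|h x| <= C) ->
 inte h /\ \int[L]_x `|h x| <= KI * C.

Definition hJ (J : WJ) (x : Rn) : \bar R := if `[< wact g J >] then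
 htail (n + m.+1) (Jc J) (Jr J / 8) (Chh m M CA KI * 2 ^ (Jk J)) x else 0%E.

Lemma hJ_ge0 J x : (0 <= hJ J x)%E.
rewrite /hJ; case: ifP => // _; apply: htail_ge0.
by rewrite mulr_ge0 ?exprz_ge0// ltW// Chh_gt0.
Qed.

Lemma bJ_hJ I J psi tau (x y : Rn) : Sm m psi -> 0 < tau -> enorm (y - x) < tau ->
 (`|\int[L]_u (bJ m M f I J u * dil psi tau y u)|%:E <= hJ J x)%E.
move=> sp t0 yx; rewrite /hJ; case: ifPn => [_|/asboolP na].
 exact: (bJ_htail tf hc CA0 HA HP mM KI0 HKI).
rewrite Rint_eq0 ?normr0// => u.
have [->|/bJ_supp[_ h]] := eqVneq (bJ m M f I J u) 0; first by rewrite mul0r.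
by [].
Qed.

(* Only the part of the sum outside the first P indices survives the passage to the limit. *)
Lemma pair_tail P I psi tau (x y : Rn) : Sm m psi -> 0 < tau -> enorm (y - x) < tau ->
 inte (fun u => PI M f I u * dil psi tau y u) ->
 (`|\int[L]_u (PI M f I u * dil psi tau y u) - \int[L]_u (Ssum m M f P I u * dil psi tau y u)|%:E
 <= ctail P (fun J => hJ J x))%E.
move=> sp t0 yx; set w := dil psi tau y => iP.
have sw : schwartz w by apply: schwartz_dil; [exact: lt0r_neq0|case: sp].
have lw := locb_schwartz sw.
have ib J : inte (fun u => bJ m M f I J u * w u) by have [] := bJ_pair tf hc CA0 HA I J lw.
have SE P' : (fun u => Ssum m M f P' I u * w u) = fun u => \sum_(J <- @cfirst WJ P') bJ m M f I J u * w u.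
 by apply/funext => u; rewrite mulr_suml.
have iS P' : inte (fun u => Ssum m M f P' I u * w u) by rewrite SE; exact: (proj1 (inte_sum _ ib)).
have SI P' : \int[L]_u (Ssum m M f P' I u * w u) = \sum_(J <- @cfirst WJ P') \int[L]_u (bJ m M f I J u * w u).
 by rewrite SE; exact: (proj2 (inte_sum _ ib)).
apply/lee_addgt0Pr => e e0.
have [P0 HP0] := rem_pair M tf hc hb ha I sw e0.
pose P' := maxn P0 P.
have /HP0 h1 : (P0 <= P')%N by exact: leq_maxl.
have PP' : (P <= P')%N by exact: leq_maxr.
have d1 : `|\int[L]_u (PI M f I u * w u) - \int[L]_u (Ssum m M f P' I u * w u)| <= e.
 have -> : \int[L]_u (PI M f I u * w u) - \int[L]_u (Ssum m M f P' I u * w u) =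
 \int[L]_u ((PI M f I u - Ssum m M f P' I u) * w u).
 by rewrite -(RintegralB measurableT iP (iS P')); apply: eq_Rintegral => u _; rewrite [RHS]mulrBl.
 apply: le_trans h1.
 have iB : inte (fun u => (PI M f I u - Ssum m M f P' I u) * w u).
 by have := inteB iP (iS P'); congr inte; apply/funext => u; rewrite [RHS]mulrBl.
 by apply: ler_norm_Rint => //; exact: inte_abs.
have cE : @cfirst WJ P' = @cfirst WJ P ++ pmap (@pickle_inv WJ) (iota P (P' - P)).
 by rewrite -pmap_cat -iotaD subnKC.
have d2 : (`|\int[L]_u (Ssum m M f P' I u * w u) - \int[L]_u (Ssum m M f P I u * w u)|%:E <= ctail P (fun J => hJ J x))%E.
 rewrite !SI cE big_cat/= addrAC subrr add0r.
 apply: le_trans (_ : ((\sum_(J <- pmap (@pickle_inv WJ) (iota P (P' - P))) `|\int[L]_u (bJ m M f I J u * w u)|)%:E <= _)%E).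
 by rewrite lee_fin; exact: ler_norm_sum.
 rewrite -sumEFin big_seq.
 set s := pmap _ _.
 apply: le_trans (_ : (\sum_(J <- s | J \in s) (if (pickle J < P)%N then 0 else hJ J x) <= _)%E).
 apply: lee_sum => J; rewrite mem_pmap => /mapP[i]; rewrite mem_iota => /andP[Pi _] iJ.
 have := @pickle_invK WJ i; rewrite -iJ /= => ->.
 by rewrite ltnNge Pi; exact: bJ_hJ.
 rewrite -big_seq; apply: (@le_csum_fin _ (fun J => if (pickle J < P)%N then 0%E else hJ J x)).
 by move=> J; case: ifP => // _; exact: hJ_ge0.
 by have := @cfirst_uniq WJ P'; rewrite cE cat_uniq => /and3P[].
apply: le_trans (_ : ((`|\int[L]_u (PI M f I u * w u) - \int[L]_u (Ssum m M f P' I u * w u)|%:E +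
 `|\int[L]_u (Ssum m M f P' I u * w u) - \int[L]_u (Ssum m M f P I u * w u)|%:E) <= _)%E).
 rewrite lee_fin; set a := \int[L]_u _; set b := \int[L]_u _; set c := \int[L]_u _.
 by have -> : a - b = (a - c) + (c - b); [rewrite addrA subrK|exact: ler_normD].
by rewrite addeC; apply: leeD; rewrite//.
Qed.

Lemma density_gmax P : exists2 h : Rn -> R, L2i h &
 forall x, (gmax m (dcomb 1 f (-1) (fdist h)) x <= ctail P (fun J => hJ J x))%E.
have [B HB] := Ssum_L2 P.
have [t [h [tg ih hn _]]] := mazur (fun I => (HB I).1) (fun I => (HB I).2).
exists h => // x; apply: gmax_le => psi tau y sp t0 yx; set w := dil psi tau y.
have sw : schwartz w by apply: schwartz_dil; [exact: lt0r_neq0|case: sp].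
have iw := schwartz_L2i sw.
rewrite /dcomb mul1r mulN1r fdistE; [|by case: ih|exact: (schwartz_meas [::] sw)].
have : (0 <= ctail P (fun J => hJ J x))%E.
 by apply: csum_ge0 => J; case: ifP => // _; exact: hJ_ge0.
case TE : (ctail P (fun J => hJ J x)) => [T| |]// _; last by rewrite leey.
apply/lee_addgt0Pr => e e0; rewrite lee_fin.
have [I0 HI0] := PI_limit M tf sm sw e0.
rewrite distrC; apply: (mazur_pair (fun I => (HB I).1) ih tg hn iw (I0 := I0)) => I vI.
have [iP hP] := HI0 I vI.
have := @pair_tail P I psi tau x y sp t0 yx iP; rewrite TE lee_fin -/w; move: hP.
move: (\int[L]_u (PI M f I u * w u)) (\int[L]_u (Ssum m M f P I u * w u)) (f w) => a b d h1 h2.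
have -> : b - d = (a - d) - (a - b) by ring.
by rewrite (le_trans (ler_normB _ _)); lra.
Qed.
End approximation.
End density.

(** * Density of L2 functions, and atomic approximation in L2 *)

Section density_theorem.
Local Notation WJ := WJ.

Lemma gmax_zero m (f : @distr R n) : (forall psi, schwartz psi -> f psi = 0) -> gmax m f = fun=> 0%E.
move=> f0; apply/funext => x; apply/eqP; rewrite eq_le gmax_ge0 andbT.
apply: gmax_le => psi t y [sp _] t0 _; rewrite f0 ?normr0//.
by apply: schwartz_dil => //; exact: lt0r_neq0.
Qed.

Lemma fdist0 (psi : Rn -> R) : schwartz psi -> fdist (fun _ : Rn => 0 : R) psi = 0.
move=> sp; rewrite fdistE; [|exact: measurable_cst|exact: (schwartz_meas [::] sp)].
by apply: Rint_eq0 => x; rewrite mul0r.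
Qed.

Variables (phi : Rn -> R -> R) (p0 p1 C q D : R) (m : nat).
Hypotheses (Q : qtype phi p0 p1 C) (HD : doubles phi q D) (D0 : 0 < D) (expo : n%:R * q < p0 * (n + m.+1)%:R).

Let C0 := qt_C0 Q.

Lemma phiset_scale E t a : 0 <= t -> 0 <= a -> mset E ->
 (phiset phi E (a * t) <= (C * (1 + a))%:E * phiset phi E t)%E.
move=> t0 a0 mE; have a1 : 1 <= 1 + a by rewrite lerDl.
apply: le_trans (_ : (phiset phi E ((1 + a) * t) <= _)%E).
 by apply: (le_phiset Q); rewrite// ler_wpM2r// lerDr.
apply: le_trans (phiset_up Q t0 a1 mE) _; apply: lee_wpmul2r; first exact: (phiset_ge0 Q).
rewrite lee_fin ler_pM2l// -[leRHS]powRr1//.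
by apply: ler_powR => //; case/andP: (qt_p1 Q) => _ /ltW.
Qed.

(** Whitney overlap makes the weights of the balls summable, [Mod_htail] bounds the maximal
    functions of the pieces by these weights, and [P] is taken large enough for the tail. A
    functional that vanishes on all test functions is approximated by 0. *)
Lemma density_Mod (i0 : 'I_n) (f : @distr R n) lam (eps : R) : tempered f -> 0 < lam ->
 (Mod phi lam (gmax m f) < +oo)%E -> 0 < eps ->
 exists2 h : Rn -> R, L2i h & (Mod phi lam (gmax m (dcomb 1 f (-1) (fdist h))) <= eps%:E)%E.
move=> tf lam0 fin eps0.
have [nz|/forall2NP z] := pselect (exists2 w, schwartz w & f w != 0); last first.
 exists (fun=> 0); first exact: L2i0.
 rewrite gmax_zero ?(Mod_zero Q) ?lee_fin ?ltW// => psi sp; rewrite /dcomb fdist0// mulr0 addr0 mul1r.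
 by case: (z psi) => [//|/negP/negPn/eqP].
have [hc hb ha] := gmax_levels Q HD D0 i0 lam0 tf fin nz.
have mg := meas_gmax m f.
have sm := gmax_small Q HD D0 i0 lam0 mg fin.
have [CA CA0 HCA] := @aperture_constant m m; have [HA HP] := HCA f tf.
have [KI KI0 HKI] := @inte_decay.
have [K K0 HK] := Mod_htail Q D0 HD expo.
have Ch0 : 0 < Chh m m CA KI by exact: Chh_gt0.
pose Kt := K * (C * (1 + Chh m m CA KI)).
have Kt0 : 0 < Kt by pos.
pose u J := if `[< wact (gmax m f) J >] then phiset phi (Jb J) (2 ^ (Jk J) / lam) else 0%E.
have t0 (k : int) : 0 <= 2 ^ k / lam by pos.
have u0 J : (0 <= u J)%E by rewrite /u; case: ifP => // _; exact: (phiset_ge0 Q).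
have ufin : (csum u < +oo)%E.
 apply: le_lt_trans (whitney_overlap Q hc mg lam0) _; rewrite lte_mul_pinfty//.
have e0 : 0 < eps / (Kpsi p0 C * Kt) by rewrite divr_gt0// mulr_gt0// (Kpsi_gt0 Q).
have [P HPt] := ctail_small u0 ufin e0.
have [h ih hh] := density_gmax tf hc hb ha sm CA0 HA HP (leqnn m) KI0 HKI P.
exists h => //.
pose v J (x : RL R n) : \bar R := if (pickle J < P)%N then 0%E else hJ m m f CA KI J x.
have v0 J x : (0 <= v J x)%E by rewrite /v; case: ifP => // _; exact: hJ_ge0.
have mv J : measurable_fun setT (v J).
 case: (ltnP (pickle J) P) => hJP; first by rewrite /v hJP.
 have -> : v J = hJ m m f CA KI J by apply/funext => x; rewrite /v ltnNge hJP.
 case: (boolP `[< wact (gmax m f) J >]) => aJ; last by rewrite /hJ (negPf aJ).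
 by rewrite /hJ aJ; apply: measurable_htail; rewrite mulr_ge0 ?exprz_ge0// ltW.
have Mv J : (Mod phi lam (v J) <= Kt%:E * (if (pickle J < P)%N then 0 else u J))%E.
 case: (ltnP (pickle J) P) => hJP; first by rewrite /v hJP (Mod_zero Q)// mule0.
 have -> : v J = hJ m m f CA KI J by apply/funext => x; rewrite /v ltnNge hJP.
 rewrite /u; case: (boolP `[< wact (gmax m f) J >]) => aJ; last by rewrite /hJ (negPf aJ) (Mod_zero Q)// mule0.
 rewrite /hJ aJ; apply: le_trans (HK _ _ _ _ _ _ _) _ => //.
 rewrite /Kt EFinM -muleA; apply: lee_wpmul2l; first by pos.
 rewrite -mulrA; apply: phiset_scale => //; exact: meas_eball.
apply: le_trans (_ : (Mod phi lam (fun x => csum (fun J => v J x)) <= _)%E).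
 by apply: (le_Mod Q) => //; [exact: meas_gmax|exact: meas_csum].
apply: le_trans (Mod_csum Q lam0 v0 mv) _.
apply: le_trans (_ : ((Kpsi p0 C)%:E * (Kt%:E * ctail P u) <= _)%E).
 apply: lee_wpmul2l; first by rewrite lee_fin ltW// (Kpsi_gt0 Q).
 rewrite /ctail -csumZl ?(ltW Kt0)//; last by move=> J; case: ifP.
 by apply: le_csum => J //; exact: (Mod_ge0 Q).
rewrite muleA -EFinM.
apply: le_trans (_ : ((Kpsi p0 C * Kt)%:E * (eps / (Kpsi p0 C * Kt))%:E <= _)%E).
 by apply: lee_wpmul2l; [rewrite lee_fin ltW// mulr_gt0// (Kpsi_gt0 Q)|exact: ltW].
by rewrite -EFinM mulrCA divff ?mulr1// mulf_neq0 ?lt0r_neq0// (Kpsi_gt0 Q).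
Qed.

(* The atoms are midpoint-tree combinations of the b_J at several truncation scales; this is
 what turns the merely weak convergence of the truncations into convergence in L2. *)
Lemma L2_atomic_approx (i0 : 'I_n) (M : nat) : exists2 B : R, 0 < B &
 forall (f : Rn -> R) lam (e : R), L2i f -> 0 < lam ->
 (Mod phi lam (gmax m (fdist f)) < +oo)%E -> (exists2 w, schwartz w & fdist f w != 0) -> 0 < e ->
 (forall k, exists x, ~ lev (gmax m (fdist f)) k x) /\
 exists P (b : WJ -> Rn -> R), [/\ forall J, mfun (b J),
 forall J x, `|b J x| <= B * 2 ^ (Jk J),
 forall J x, b J x != 0 -> Jb J x /\ wact (gmax m (fdist f)) J,
 forall J (gam : 'I_n -> nat), (\sum_(i < n) gam i <= M)%N ->
 \int[L]_x (b J x * xpow gam x) = 0 &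
 n2 (fun x => f x - \sum_(J <- @cfirst WJ P) b J x) <= e].
have [CA CA0 HCA] := @aperture_constant m M.
exists (Cb M CA); first exact: Cb_gt0.
move=> f lam e iL lam0 fin nz e0; have tf := L2_tempered iL.
have [hc hb ha] := gmax_levels Q HD D0 i0 lam0 tf fin nz; split => //.
have mg := meas_gmax m (fdist f).
have sm := gmax_small Q HD D0 i0 lam0 mg fin.
have [HA HP] := HCA _ tf; set F := fdist f in hc hb ha HA HP mg sm tf *.
have A0 : 0 < n%:R * srad M + 1 :> R by rewrite ltr_wpDl.
have [K K0 HK] : exists2 K : R, 0 < K & forall t, 0 < t ->
 L2i (dilt F (bPhi M) t) /\ n2 (dilt F (bPhi M) t) <= K * n2 f.
 have [|K K0 HK] := @dilt_L2 (bPhi M) _ A0 (schwartz_bPhi M).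
 move=> x hx; apply: (@tens_supp _ (srad M)); first by move=> i; exact: ssupp_sPhi.
 by apply: lt_le_trans hx; rewrite ltrDl.
 by exists K => // t0; exact: HK.
have LA j t : 0 < t -> L2i (dilt F (bA M j) t).
 have [|K' _ HK'] := @dilt_L2 (bA M j) _ A0 (schwartz_bA M j).
 move=> x hx; apply: (@tens_supp _ (srad M)); last by apply: lt_le_trans hx; rewrite ltrDl.
 move=> i y; rewrite /bAe; case: ifP => _; [|by case: ifP => _; [exact: ssupp_sA|exact: ssupp_sPhi]].
 rewrite sev_sdil2 /dil2 => ay; rewrite ssupp_sPhi ?mulr0//.
 by apply: lt_le_trans ay _; rewrite normrM ger0_norm// ler_peMl// ler1n.
 by move=> t0; have [] := HK' f t.
have LP I : L2i (PI M F I) by apply: L2iB; case: (HK _ (ell_gt0 I (I + I))); case: (HK _ (ell_gt0 I 0)).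
have NP I : n2 (PI M F I) <= 4 * K * n2 f.
 have [l1 k1] := HK _ (ell_gt0 I (I + I)); have [l2 k2] := HK _ (ell_gt0 I 0).
 have -> : PI M F I = fun x => dilt F (bPhi M) (ell I (I + I)) x + -1 * dilt F (bPhi M) (ell I 0) x.
 by apply/funext => x; rewrite mulN1r.
 apply: le_trans (n2D l1 (L2iZ _ l2)) _; rewrite n2Z// sqrrN expr1n mul1r.
 move: k1 k2; move: (n2 (dilt F _ (ell I (I + I)))) => a1 a2 a3; lra.
have [t [h [tg ih hn _]]] := mazur LP NP.
(* The Mazur limit is [f] itself: the sums of increments tend to [f] weakly, which identifies their
   strong limit by testing with Schwartz functions. *)
have hf : {ae L, forall x, h x - f x = 0}.
 apply: L2_orthogonal; first exact: L2iB.
 move=> w sw; have iw := schwartz_L2i sw.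
 have -> : \int[L]_x ((h x - f x) * w x) = \int[L]_x (h x * w x) - F w.
 rewrite /F fdistE; [|by case: iL|exact: (schwartz_meas [::] sw)].
 rewrite -(RintegralB measurableT (L2iM ih iw) (L2iM iL iw)).
 by apply: eq_Rintegral => x _; rewrite mulrBl.
 apply/eqP; rewrite -normr_le0; apply/ler_addgt0Pl => d d0; rewrite addr0.
 have [I0 HI0] := PI_limit M tf sm sw d0.
 by apply: (mazur_pair LP ih tg hn iw (I0 := I0)) => I /HI0[].
(* The error has two parts, each doubled by [n2D]; both are kept below [e/4]. *)
have e4 : 0 < e / 4 by pos.
have [v /(_ v (leqnn v)) Hv] := pow16_small e4.
have LS P I : L2i (fun x => PI M F I x - Ssum m M F P I x).
 by apply: L2iB => //; have [B HB] := Ssum_L2 tf hc CA0 HA HP P; case: (HB I).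
(* A tree has finitely many leaves, so one [P] serves the scales at all of them. *)
have tree (s : mtree) : exists P0, forall P, (P0 <= P)%N ->
 n2 (tev s (fun I x => PI M F I x - Ssum m M F P I x)) <= e / 4.
 elim: s => [I|s1 [P1 H1] s2 [P2 H2]].
 by have [P0 HP0] := rem_n2 tf hc hb ha (I := I) (fun i j => LA j _ (ell_gt0 _ _)) e4; exists P0.
 exists (maxn P1 P2) => P; rewrite geq_max => /andP[/H1 h1 /H2 h2].
 have l1 := tev_L2i s1 (LS P); have l2 := tev_L2i s2 (LS P).
 apply: le_trans (n2D (L2iZ 2^-1 l1) (L2iZ 2^-1 l2)) _; rewrite !n2Z//.
 rewrite (_ : 2^-1 ^+ 2 = 4^-1 :> R); last by rewrite exprVn -natrX.
 by move: h1; move: (n2 _) => a1 a2; lra.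
have [P HPP] := tree (t v).
exists P, (fun J => tev (t v) (fun I => bJ m M F I J)); split.
- by move=> J; apply: tev_meas => I; exact: bJ_meas.
- by move=> J x; apply: teR_bound => I; exact: (bJ_bound tf hc CA0 HA HP).
- move=> J x nz0.
 have [I hI] : exists I, bJ m M F I J x != 0.
 apply: contrapT => hn0; move/eqP: nz0; apply.
 have : `|tev (t v) (fun I => bJ m M F I J) x| <= 0.
 apply: teR_bound => I; rewrite normr_le0; apply/negPn/negP => h0; apply: hn0; by exists I.
 by rewrite normr_le0 => /eqP.
 by have [h1 h2] := bJ_supp hI.
- move=> J gam sg.
 have ib I : inte (fun x => bJ m M F I J x * xpow gam x).
 by have [] := bJ_pair tf hc CA0 HA I J (locb_monomial gam).
 have [_ ->] := tev_pair (t v) ib.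
 have : `|teR (t v) (fun I => \int[L]_x (bJ m M F I J x * xpow gam x))| <= 0.
 by apply: teR_bound => I; rewrite (bJ_moments tf hc CA0 HA I J sg) normr0.
 by rewrite normr_le0 => /eqP.
have sE x : \sum_(J <- @cfirst WJ P) tev (t v) (fun I => bJ m M F I J) x =
 tev (t v) (PI M F) x - tev (t v) (fun I x => PI M F I x - Ssum m M F P I x) x.
 rewrite /tev -teR_sum.
 rewrite (_ : (fun I => PI M F I x - _) = fun I => 1 * PI M F I x + -1 * Ssum m M F P I x); last first.
 by apply/funext => I; rewrite mul1r mulN1r.
 by rewrite teR_comb; ring.
have lT := tev_L2i (t v) LP; have lR := tev_L2i (t v) (LS P).
have -> : n2 (fun x => f x - \sum_(J <- @cfirst WJ P) tev (t v) (fun I => bJ m M F I J) x) =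
 n2 (fun x => -1 * (tev (t v) (PI M F) x - h x) + tev (t v) (fun I x => PI M F I x - Ssum m M F P I x) x).
 rewrite /n2; congr fine; apply: ae_eq_integral => //.
 - apply/measurable_EFinP; apply: measurable_funX; apply: measurable_funB; first by case: iL.
 by apply: measurable_sum => J; apply: tev_meas => I; exact: bJ_meas.
 - by apply/measurable_EFinP; apply: measurable_funX; case: (L2iD (L2iZ (-1) (L2iB lT ih)) lR).
 - apply: (aeL_imp hf) => x hx _; rewrite sE; have -> : f x = h x by move/eqP: hx; rewrite subr_eq0 => /eqP.
 by congr (_ ^+ 2)%:E; ring.
apply: le_trans (n2D (L2iZ (-1) (L2iB lT ih)) lR) _; rewrite n2Z; last exact: L2iB.
rewrite sqrrN expr1n mul1r; have := hn v; have := HPP P (leqnn _).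
move: (n2 _) => a1 a2; lra.
Qed.
End density_theorem.

Lemma powR_exprn (x p : R) j : 0 <= x -> (x ^+ j) `^ p = (x `^ p) ^+ j.
by move=> x0; rewrite -powR_mulrn// -powRrM mulrC powRrM powR_mulrn. Qed.

(** * Superposition of weak estimates *)

Section superposition.
Variables (phi : Rn -> R -> R) (p0 p1 C : R).
Hypothesis Q : qtype phi p0 p1 C.
Let C0 := qt_C0 Q.

Let rho : R := 2 `^ (p1 - 1).
Let rho01 : 0 < rho < 1.
have /andP[_ h] := qt_p1 Q; rewrite /rho powR_gt0//=.
have -> : p1 - 1 = - (1 - p1) by rewrite opprB.
rewrite powRN invf_lt1//.
have h1 : 1 `^ (1 - p1) = 1 :> R by rewrite powR1.
by rewrite -[ltLHS]h1 gt0_ltr_powR ?nnegrE ?ltr1n ?subr_gt0.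
Qed.

Definition Ksup : R := C * 2 * (1 - rho)^-1.

Lemma Ksup_gt0 : 0 < Ksup.
by have /andP[h1 h2] := rho01; rewrite !mulr_gt0// invr_gt0 subr_gt0. Qed.

Let mlev (G : Rn -> R) (s : R) : mfun G ->
 mset ([set x | s < G x]).
move=> mG; have := mG measurableT _ (measurable_itv `]s, +oo[); rewrite setTI; congr measurable.
by apply/seteqP; split => x /=; rewrite in_itv/= andbT.
Qed.

(** On the shell where [G] is about [tau/2^j], raising the argument of [phi] to [tau/lam] costs
    about [2^(j p1)], while the value of [G] gains [2^-j]. The series converges because [p1 < 1];
    the strict inequality is decisive here. *)
Lemma truncated_mean (G : Rn -> R) (A : \bar R) lam tau : 0 < lam -> 0 < tau ->
 mfun G -> (forall x, 0 <= G x) ->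
 (forall s : R, 0 < s -> (phiset phi [set x | s < G x]%R (s / lam)%R <= A)%E) ->
 (\int[L]_x ((if G x <= tau then G x else 0) * phi x (tau / lam))%:E <= (tau * Ksup)%:E * A)%E.
move=> lam0 tau0 mG G0 HG; have /andP[r0 r1] := rho01.
have A0 : (0 <= A)%E by apply: le_trans (HG 1 ltr01); apply: (phiset_ge0 Q); rewrite//.
have tl : 0 <= tau / lam by [].
have f0 x : 0 <= phi x (tau / lam) by [].
pose a (j : nat) : R := tau / 2 ^+ j.
have a0 j : 0 < a j by [].
pose u (j : nat) (x : RL R n) : \bar R := ((a j)%:E * (\1_[set x | a j.+1 < G x] x * phi x (tau / lam))%:E)%E.
have w0 j x : (0 <= (\1_[set x | a j < G x] x * phi x (tau / lam))%:E)%E by rewrite lee_fin.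
have u0 j x : (0 <= u j x)%E by rewrite lee_fin.
have mw j : measurable_fun setT (fun x : RL R n => (\1_[set x | a j < G x] x * phi x (tau / lam))%:E).
 by apply: (meas_weight Q) => //; exact: mlev.
have mu j : measurable_fun setT (u j) by exact: emeasurable_funM.
apply: le_trans (_ : (\int[L]_x csum (fun j => u j x) <= _)%E).
 apply: le_integral_ge0 => x; first by rewrite lee_fin mulr_ge0//; case: ifP.
 have [Gt|Gt] := leP (G x); last by rewrite mul0r; apply: csum_ge0.
 have [->|Gx] := eqVneq (G x) 0; first by rewrite mul0r; apply: csum_ge0.
 have Gp : 0 < G x by rewrite lt_neqAle eq_sym Gx G0.
 have ex : exists j, a j < G x.
 exists (Num.truncn (tau / G x)).+1; rewrite ltr_pdivrMr// mulrC -ltr_pdivrMr//.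
 apply: lt_trans (truncnS_gt _) _; by rewrite -natrX ltr_nat ltn_expl.
 have [j hj jmin] := ex_minnP ex; case: j hj jmin => [|j] hj jmin.
 by move: hj; rewrite /a divr1 ltNge Gt.
 apply: le_trans (le_csum1 j (u0 ^~ x)); rewrite /u indicE mem_set//= mul1r lee_fin ler_wpM2r//.
 by rewrite leNgt; apply/negP => /jmin; rewrite ltnn.
rewrite integral_csum//.
have term j : (\int[L]_x u j x <= (rho ^+ j)%:E * ((tau * (C * 2))%:E * A))%E.
 rewrite ge0_integralZl ?lee_fin//.
 rewrite -(phisetE Q)//; last exact: mlev.
 have e2 : (1 : R) <= 2 ^+ j.+1 by rewrite exprn_ege1// ler1n.
 have -> : tau / lam = 2 ^+ j.+1 * (a j.+1 / lam).
 by rewrite mulrCA -!mulrA mulKf.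
 apply: le_trans (_ : ((a j)%:E * ((C * (2 ^+ j.+1) `^ p1)%:E * A) <= _)%E).
 apply: lee_wpmul2l; first by rewrite lee_fin.
 apply: le_trans (phiset_up Q _ e2 (mlev _ mG)) _ => //.
 by apply: lee_wpmul2l; [rewrite lee_fin mulr_ge0 ?powR_ge0// ltW|exact: HG].
 rewrite !muleA; apply: lee_wpmul2r => //; rewrite lee_fin /a.
 rewrite powR_exprn// exprS.
 have -> : rho ^+ j = (2 `^ p1) ^+ j / 2 ^+ j.
 by rewrite /rho powRD ?pnatr_eq0 ?implybT// powR_inv1// exprMn exprVn.
 have h2 : 2 `^ p1 <= 2 :> R.
 by have /andP[_ /ltW h] := qt_p1 Q; rewrite -[leRHS](@powRr1 _ 2)// ler_powR// ler1n.
 have p2 : 0 < (2 ^+ j)^-1 :> R by [].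
 have p3 : 0 <= (2 `^ p1) ^+ j :> R by [].
 move: (2 ^+ j)^-1 p2 => x x0; move: (2 `^ p1) p3 h2 => z; move: (z ^+ j) => y y0 z2.
 rewrite (_ : tau * x * (C * (z * y)) = tau * x * C * y * z); last by ring.
 rewrite (_ : y * x * (tau * (C * 2)) = tau * x * C * y * 2); last by ring.
 by rewrite ler_wpM2l.
set K := ((tau * (C * 2))%:E * A)%E in term *.
have K0 : (0 <= K)%E by rewrite mule_ge0// lee_fin.
have -> : ((tau * Ksup)%:E * A = ((1 - rho)^-1)%:E * K)%E by rewrite muleA; congr (_%:E * _)%E; rewrite /Ksup; ring.
apply: csum_le_fin => [j|s us]; first by apply: integral_ge0 => x _.
apply: le_trans (lee_sum _ (fun j _ => term j)) _.
rewrite -ge0_sume_distrl; last by move=> j _; rewrite lee_fin.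
apply: lee_wpmul2r => //; by rewrite sumEFin lee_fin geom_uniq_nat.
Qed.

Lemma min1_sum (J : Type) (r : seq J) (g : J -> R) : (forall j, 0 <= g j) ->
 Num.min 1 (\sum_(j <- r) g j) <= \sum_(j <- r) Num.min 1 (g j).
move=> g0; elim: r => [|j r IH]; first by rewrite !big_nil ge_min lexx orbT.
rewrite !big_cons; apply: le_trans (lerD (lexx _) IH).
have S0 : 0 <= \sum_(i <- r) g i by exact: sumr_ge0.
move: (g j) (g0 j) (\sum_(i <- r) g i) S0 => x x0 y y0.
by rewrite !minEle; do 3 (case: ifP => ?); lra.
Qed.

(** Where the sum exceeds [tau], 1 is at most the sum of [min(1, G_j/tau)], hence of the indicators
    of [G_j > tau] and of the truncated values. The former are bounded by hypothesis and the latter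
    by [truncated_mean], with no loss in the number of terms. *)
Lemma superposition (J : Type) (r : seq J) (G : J -> Rn -> R) (A : J -> \bar R) lam : 0 < lam ->
 (forall j, mfun (G j)) -> (forall j x, 0 <= G j x) ->
 (forall j (s : R), 0 < s -> (phiset phi [set x | s < G j x]%R (s / lam)%R <= A j)%E) ->
 forall tau : R, 0 < tau ->
 (phiset phi [set x | tau < \sum_(j <- r) G j x]%R (tau / lam)%R <=
 (1 + Ksup)%:E * \sum_(j <- r) A j)%E.
move=> lam0 mG G0 HG tau tau0.
have tl : 0 <= tau / lam by [].
have f0 x : 0 <= phi x (tau / lam) by [].
have A0 j : (0 <= A j)%E by apply: le_trans (HG j 1 ltr01); apply: (phiset_ge0 Q); rewrite//.
have mS : mfun ((fun x => \sum_(j <- r) G j x)) by exact: measurable_sum.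
rewrite (phisetE Q)//; last exact: mlev.
pose u j (x : RL R n) : \bar R := (\1_[set x | tau < G j x] x * phi x (tau / lam))%:E.
pose v j (x : RL R n) : \bar R := ((tau^-1)%:E * ((if G j x <= tau then G j x else 0) * phi x (tau / lam))%:E)%E.
have i0 j x : 0 <= (if G j x <= tau then G j x else 0) by case: ifP.
have u0 j x : (0 <= u j x)%E by rewrite lee_fin.
have v0 j x : (0 <= v j x)%E by rewrite mule_ge0// lee_fin// mulr_ge0.
have mi j : mfun ((fun x => (if G j x <= tau then G j x else 0))).
 rewrite (_ : (fun x => _) = fun x : RL R n => G j x * (1 - \1_[set x | tau < G j x] x)); last first.
 apply/funext => x; rewrite indicE; have [h|h] := leP.
 by rewrite memNset/= ?subr0 ?mulr1//; apply/negP; rewrite -leNgt.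
 by rewrite mem_set//= subrr mulr0.
 by apply: measurable_funM => //; apply: measurable_funB => //; apply: measurable_indic; exact: mlev.
have mp : mfun (fun x => phi x (tau / lam)) by apply/measRP; exact: (qt_meas Q).
have mw j : measurable_fun setT (fun x : RL R n => ((if G j x <= tau then G j x else 0) * phi x (tau / lam))%:E).
 by apply/measurable_EFinP; exact: measurable_funM.
have mu j : measurable_fun setT (u j) by apply: (meas_weight Q) => //; exact: mlev.
have mv j : measurable_fun setT (v j) by exact: emeasurable_funM.
apply: le_trans (_ : (\int[L]_x (\sum_(j <- r) (u j x + v j x)) <= _)%E).
 apply: le_integral_ge0 => x; first by rewrite lee_fin.
 rewrite indicE; have [hx|hx] := pselect (tau < \sum_(j <- r) G j x); last first.
 by rewrite memNset//= mul0r sume_ge0// => j _; exact: adde_ge0.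
 rewrite mem_set//= mul1r.
 have -> : (\sum_(j <- r) (u j x + v j x) =
 ((\sum_(j <- r) (\1_[set x | tau < G j x] x + tau^-1 * (if G j x <= tau then G j x else 0))) * phi x (tau / lam))%:E)%E.
 by rewrite mulr_suml -sumEFin; apply: eq_bigr => j _; rewrite mulrDl -mulrA.
 rewrite lee_fin ler_peMl//.
 have H : 1 <= \sum_(j <- r) Num.min 1 (G j x / tau).
 have g0 j : 0 <= G j x / tau by rewrite divr_ge0.
 apply: le_trans (min1_sum r g0); rewrite le_min lexx/= -mulr_suml ler_pdivlMr// mul1r ltW//.
 apply: le_trans H _; apply: ler_sum => j _; rewrite indicE; have [h|h] := leP (G j x).
 by rewrite memNset/= ?add0r 1?mulrC ?ge_min ?lexx ?orbT//; apply/negP; rewrite -leNgt.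
 by rewrite mem_set//= mulr0 addr0 ge_min lexx.
rewrite ge0_integral_sum//; last 2 first.
- by move=> j; exact: emeasurable_funD.
- by move=> j x _; exact: adde_ge0.
rewrite ge0_sume_distrr//; apply: lee_sum => j _.
rewrite ge0_integralD// EFinD ge0_muleDl ?lee_fin ?(ltW Ksup_gt0)// mul1e; apply: leeD.
 by rewrite -(phisetE Q)//; [exact: HG|exact: mlev].
rewrite ge0_integralZl//; [|by move=> x _; rewrite lee_fin mulr_ge0|by rewrite lee_fin invr_ge0 ltW].
apply: le_trans (lee_wpmul2l _ (truncated_mean lam0 tau0 (mG j) (G0 j) (HG j))) _.
 by rewrite lee_fin.
by rewrite muleA -EFinM mulKf// gt_eqF.
Qed.
End superposition.

(** * Bounded functions with vanishing moments as multiples of atoms *)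

Section multiples_of_atoms.
Variables (phi : Rn -> R -> R) (p0 p1 C q D : R).
Hypotheses (Q : qtype phi p0 p1 C) (HD : doubles phi q D).

Let C0 := qt_C0 Q.

Lemma qphi_ge1 : in_Ainf phi -> 1 <= qphi phi.
by move=> [r rP]; apply: lb_le_inf; [exists r|move=> x []]. Qed.

Lemma modular_ball c r lam : 0 < lam ->
 modular phi (absE \1_(eball c r)) lam = phiset phi (eball c r) lam^-1.
move=> lam0; rewrite /modular; congr nnint; apply/funext => x.
rewrite /absE indicE; case: (_ \in _) => /=; first by rewrite normr1 !mul1r.
by rewrite normr0 !mul0r (qt_0 Q).
Qed.

Lemma ball_fin c r t : 0 < r -> 0 < t -> exists2 v : R, 0 < v & phiset phi (eball c r) t = v%:E.
move=> r0 t0; have [foo _] := HD r0 r0 t0 (@subset_refl _ (eball c r)).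
have fp := phiset_ball_gt0 Q c r0 t0.
have E : phiset phi (eball c r) t = (fine (phiset phi (eball c r) t))%:E.
 by rewrite fineK// ge0_fin_numE// ltW.
by exists (fine (phiset phi (eball c r) t)) => //; move: fp; rewrite E.
Qed.

Lemma Lphi_norm_ball_gt0 c r : 0 < r -> 0 < Lphi_norm phi (absE \1_(eball c r)).
move=> r0; have [v v0 vE] := ball_fin c r0 ltr01; have p00 := qt_p0 Q.
have mB := @meas_eball c r.
have pw (x : R) : 0 < x -> (x `^ p0^-1) `^ p0 = x.
 by move=> x0; rewrite -powRrM mulVf ?gt_eqF// powRr1.
have vC : 0 < v / C by [].
apply: (@lt_le_trans _ _ (Num.min 1 ((v / C) `^ p0^-1))); first by rewrite lt_min ltr01 powR_gt0.
apply: lb_le_inf.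
 (* The infimum of an empty set would be 0, so a [lam] with modular at most 1 must be exhibited as
    well. *)
 pose y := (C * v + 1)^-1; have y1 : 0 < C * v + 1 by [].
 have y0 : 0 < y by [].
 have a0 : 0 < y `^ p0^-1 by [].
 have a1 : y `^ p0^-1 <= 1.
 have -> : 1 = 1 `^ p0^-1 :> R by rewrite powR1.
 apply: ge0_ler_powR; rewrite ?nnegrE//.
 by rewrite invf_le1// lerDr.
 exists (y `^ p0^-1)^-1; split => //.
 rewrite modular_ball// invrK -[_ `^ _]mulr1.
 apply: le_trans (phiset_low Q ler01 a0 a1 mB) _.
 by rewrite vE pw// lee_fin mulrAC ler_pdivrMr// mul1r lerDl.
move=> lam [lam0]; rewrite modular_ball// => h.
have [l1|l1] := leP 1 lam; first by rewrite ge_min l1.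
have : ((v / C)%:E <= (lam `^ p0)%:E)%E.
 rewrite lee_fin ler_pdivrMr// mulrC -lee_fin -vE -(mulfV (lt0r_neq0 lam0)).
 apply: le_trans (phiset_low Q _ lam0 (ltW l1) mB) _ => //.
 by rewrite -[leRHS]mule1; apply: lee_wpmul2l => //; rewrite lee_fin.
rewrite lee_fin => h2; rewrite ge_min; apply/orP; right.
have -> : lam = (lam `^ p0) `^ p0^-1 by rewrite -powRrM mulfV ?gt_eqF// powRr1.
by apply: ge0_ler_powR; rewrite ?nnegrE.
Qed.

Lemma Lqphi_bound (r : \bar R) c rad (b : Rn -> R) (B : R) : (1%:E < r)%E -> 0 < rad ->
 mfun b -> (forall x, `|b x| <= B) ->
 (0 <= Lqphi phi r (eball c rad) b <= B%:E)%E.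
move=> r1 rad0 mb bB; have B0 : 0 <= B by exact: le_trans (bB 0).
case: r r1 => [r| |]//=; last first.
 move=> _; apply/andP; split.
 apply: le_ereal_inf_tmp => M [N [bN [N0 NP]]]; rewrite leNgt; apply/negP => M0.
 have sub : eball c rad `<=` N.
 move=> x Bx; apply: contrapT => /NP/(_ Bx) h.
 by have := le_lt_trans h M0; rewrite lte_fin ltNge normr_ge0.
 have := le_leb (@meas_eball c rad) (borel_lebRn bN) sub.
 by rewrite N0 leb_eball// lee_fin leNgt mulr_gt0 ?vball_gt0.
 apply: ereal_inf_lbound; apply/aeP; apply: aeW => x _.
 by rewrite lee_fin.
rewrite lte_fin => r1; have rp : 0 < r by exact: lt_trans.
have mBl := @meas_eball c rad.
apply/andP; split.
 apply: le_trans; last by apply: ereal_sup_ubound; exists 1 => //=.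
 exact: poweR_ge0.
apply: ub_ereal_sup => _ [t /= t0 <-].
have [v v0 vE] := ball_fin c rad0 t0; rewrite vE /=.
have f0 x : 0 <= phi x t by apply: (qt_ge0 Q); exact: ltW.
have X0 : (0 <= nnint (fun x => (\1_(eball c rad) x * `|b x| `^ r * phi x t)%:E))%E.
 by apply: nnint_ge0 => x; rewrite lee_fin.
have X1 : (nnint (fun x => (\1_(eball c rad) x * `|b x| `^ r * phi x t)%:E) <= (B `^ r * v)%:E)%E.
 rewrite EFinM -vE (phisetE Q)// -ge0_integralZl; last 4 first.
 - by [].
 - by apply: (meas_weight Q) => //; exact: ltW.
 - by move=> x _; rewrite lee_fin.
 - by rewrite lee_fin.
 rewrite -nnintE; last 2 first.
 - by move=> x; rewrite lee_fin.
 - by apply: emeasurable_funM => //; apply: (meas_weight Q) => //; exact: ltW.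
 apply: le_nnint => x; first by rewrite lee_fin.
 rewrite lee_fin -!mulrA [leRHS]mulrCA ler_wpM2l// ler_wpM2r//.
 by apply: ge0_ler_powR; rewrite//.
have -> : B%:E = ((B `^ r)%:E `^ r^-1)%E.
 by rewrite poweR_EFin -powRrM mulfV ?gt_eqF// powRr1.
apply: gt0_ler_poweR; rewrite ?in_itv/= ?leey ?lee_fin ?powR_ge0 ?mule_ge0 ?lee_fin//.
apply: le_trans (lee_wpmul2r _ X1) _; first by rewrite lee_fin.
by rewrite -EFinM mulfK// gt_eqF.
Qed.

(** Dividing by [B] times the norm of the indicator of the ball bounds the function by the
    reciprocal of that norm, and a sup bound controls [Lqphi] for every exponent above 1. *)
Lemma multiple_of_atom (r : \bar R) (s : nat) c rad (b : Rn -> R) (B : R) : (1%:E < r)%E -> 0 < rad -> 0 < B ->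
 mfun b -> (forall x, `|b x| <= B) ->
 (forall x, b x != 0 -> eball c rad x) ->
 (forall gam : 'I_n -> nat, (\sum_(i < n) gam i <= s)%N ->
 \int[L]_x (b x * xpow gam x) = 0) ->
 exists (cc : R) a, b = (fun y => cc * a y) /\ atom phi r s c rad a.
move=> r1 rad0 B0 mb bB bs bm; have l0 := Lphi_norm_ball_gt0 c rad0.
set l := Lphi_norm _ _ in l0; pose cc := B * l; have c0 : 0 < cc by [].
have ma : mfun (fun y => cc^-1 * b y) by exact: measurable_funM.
exists cc, (fun y => cc^-1 * b y); split; first by apply/funext => y; rewrite mulVKf ?gt_eqF.
split => //; first exact/measRP.
- by move=> x; have [->|/bs] := eqVneq (b x) 0; rewrite ?mulr0.
- have := @Lqphi_bound r c rad (fun y => cc^-1 * b y) l^-1 r1 rad0 ma; case/(_ _)/andP => // x.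
 rewrite normrM normfV (gtr0_norm c0) invfM mulrAC -[leRHS]mul1r ler_pM2r//.
 by rewrite mulrC ler_pdivrMr// mul1r.
move=> gam sg.
have locm := @locb_monomial gam.
have mm : mfun ((fun x => cc^-1 * b x * xpow gam x)).
 by apply: measurable_funM => //; case: locm.
rewrite rintE//.
have [Bm HBm] := locm.2 (enorm c + rad).
have ib : inte (fun x => cc^-1 * b x * xpow gam x).
 have [|||] := @inte_bdd_supp (fun x => cc^-1 * b x * xpow gam x) c rad
 (cc^-1 * B * `|Bm|) rad0 _ mm; rewrite//.
 - move=> x; have [->|bx] := eqVneq (b x) 0; first by rewrite mulr0 mul0r normr0.
 rewrite normrM; apply: ler_pM => //.
 by rewrite normrM normfV (gtr0_norm c0) ler_wpM2l.
 apply: le_trans (HBm x _) (ler_norm _).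
 have := bs x; rewrite /eball/=; have := enorm_dist3 x c 0; rewrite !subr0; lra.
 - by move=> x; have [->|/bs] := eqVneq (b x) 0; rewrite ?mulr0 ?mul0r.
have fin := integrable_fin_num measurableT ib.
rewrite -(fineK fin); congr EFin.
have -> : fine (\int[L]_x (cc^-1 * b x * xpow gam x)%:E) =
 \int[L]_x (cc^-1 * (b x * xpow gam x)).
 by apply: eq_Rintegral => x _; rewrite mulrA.
have ib' : inte (fun x => b x * xpow gam x).
 have := inteZ cc ib; congr inte; apply/funext => x; rewrite -mulrA mulVKf// gt_eqF//.
by rewrite RintegralZl// bm// mulr0.
Qed.
End multiples_of_atoms.

(** * The weak estimate for the operator on L2 functions *)

Section main_estimate.
Local Notation WJ := WJ.
Implicit Types (f g : Rn -> R).

Section L2_operator.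
Variables (k : opkind) (T : (Rn -> R) -> Rn -> R).
Hypotheses (Tk : kind_L2 k T) (Tb : bounded_L2 T).

Lemma T_L2 : exists2 CT : R, 0 < CT & forall f, L2i f -> L2i (T f) /\ n2 (T f) <= CT * n2 f.
have [C HC] := Tb; exists (C ^+ 2 + 1); first by rewrite ltr_wpDl.
move=> f fL; have [/inL2P iT h] := HC f ((inL2P f).2 fL); split => //.
move: h; rewrite !L2normE// => h.
have f0 := n2_ge0 f; have T0 := n2_ge0 (T f).
have : Num.sqrt (n2 (T f)) ^+ 2 <= (C * Num.sqrt (n2 f)) ^+ 2.
 by apply: lerXn2r; rewrite ?nnegrE// (le_trans (sqrtr_ge0 _) h).
by rewrite exprMn !sqr_sqrtr; lra.
Qed.

Lemma T_null f : L2i f -> n2 f = 0 -> {ae L, forall x, T f x = 0}.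
move=> fL f0; have [CT _ HT] := T_L2; have [iT] := HT f fL; rewrite f0 mulr0 => h.
by apply: n2_ae0 => //; apply/eqP; rewrite eq_le h n2_ge0.
Qed.

Lemma T_sub (u v : Rn -> R) : L2i u -> L2i v ->
 {ae L, forall x, `|T (fun y => u y + v y) x| <= `|T u x| + `|T v x|}.
move=> /inL2P iu /inL2P iv; case: k Tk => Hk.
 have /aeP := Hk u v 1 1 iu iv.
 rewrite (_ : (fun y => _) = fun y => u y + v y); last by apply/funext => y; rewrite !mul1r.
 by move=> H; apply: (aeL_imp H) => x ->; rewrite !mul1r; exact: ler_normD.
apply: aeW => x.
have iD : inL2 (fun y => u y + v y) by apply/inL2P; apply: L2iD; exact/inL2P.
have [h1 _ h2] := Hk u v 1 iu iv x; have [h3 _ _] := Hk v u 1 iv iu x.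
have [h4 _ _] := Hk _ u 1 iD iu x.
by rewrite !ger0_norm.
Qed.

Lemma T_sum (J : Type) (r : seq J) (b : J -> Rn -> R) : (forall j, L2i (b j)) ->
 {ae L, forall x, `|T (fun y => \sum_(j <- r) b j y) x| <= \sum_(j <- r) `|T (b j) x|}.
move=> ib; elim: r => [|j r IH].
 have z : (fun y : Rn => \sum_(j <- [::]) b j y) = fun=> 0 by apply/funext => y; rewrite big_nil.
 rewrite z; have := T_null L2i0; rewrite /n2 Rint_eq0; last by pos; rewrite expr0n.
 by move=> /(_ erefl) H; apply: (aeL_imp H) => x ->; rewrite big_nil normr0.
have := aeL_and IH (T_sub (ib j) (L2i_sum r ib)) => H; apply: (aeL_imp H) => x [h1 h2].
rewrite big_cons; have -> : (fun y => \sum_(i <- j :: r) b i y) = fun y => b j y + \sum_(i <- r) b i y.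
 by apply/funext => y; rewrite big_cons.
by apply: le_trans h2 _; rewrite lerD2l.
Qed.
End L2_operator.

Variables (phi : Rn -> R -> R) (p0 p1 C q D : R).
Hypotheses (Q : qtype phi p0 p1 C) (HD : doubles phi q D) (D0 : 0 < D).
Let C0 := qt_C0 Q.

Lemma meas_level (G : Rn -> R) (s : R) : mfun G ->
 mset ([set x | s < `|G x|]).
move=> mG; have := (measurableT_comp (@normr_measurable R setT) mG) measurableT _ (measurable_itv `]s, +oo[).
by rewrite setTI; congr measurable; apply/seteqP; split => x /=; rewrite in_itv/= andbT.
Qed.

Lemma phiset_ae (E F : set (RL R n)) t : 0 <= t -> measurable E -> measurable F ->
 {ae L, forall x, E x -> F x} -> (phiset phi E t <= phiset phi F t)%E.
move=> t0 mE mF EF; rewrite !(phisetE Q)//.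
apply: ae_ge0_le_integral => //.
- by move=> x _; rewrite lee_fin.
- exact: (meas_weight Q).
- by move=> x _; rewrite lee_fin.
- exact: (meas_weight Q).
apply: (aeL_imp EF) => x h _; rewrite lee_fin ler_wpM2r// ler_nat.
by have [xE|] := boolP (x \in E); rewrite // mem_set//; apply: h; exact: set_mem.
Qed.

Lemma phiset0 t : 0 <= t -> phiset phi set0 t = 0%E.
by move=> t0; rewrite (phisetE Q)// integral0_eq// => x _; rewrite indic0 mul0r. Qed.

(** On the set where [w] stays at most [tau/2] from index [N] on, [|h| > tau] forces
    [|u N| > tau/2]. These sets increase to almost everything, and Fatou passes the bound to the
    limit. *)
Lemma weak_fatou (h : Rn -> R) (u w : nat -> Rn -> R) (t tau : R) (Bd : \bar R) :
 0 < tau -> 0 <= t -> mfun h ->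
 (forall v, mfun (u v)) -> (forall v, mfun (w v)) ->
 (forall v, {ae L, forall x, `|h x| <= `|u v x| + `|w v x|}) ->
 {ae L, forall x, w ^~ x @ \oo --> (0 : R)} ->
 (forall v, (phiset phi [set x | (tau / 2 < `|u v x|)%R] t <= Bd)%E) ->
 (phiset phi [set x | (tau < `|h x|)%R] t <= Bd)%E.
move=> tau0 t0 mh mu mw huw w0 HB.
pose W v : set (RL R n) := ~` [set x | tau / 2 < `|w v x|].
have mW v : measurable (W v) by apply: measurableC; exact: meas_level.
pose E N : set (RL R n) := \bigcap_(v in [set v | (N <= v)%N]) W v.
have mE N : measurable (E N) by apply: bigcap_measurable => //; exists N => /=.
pose H : set (RL R n) := [set x | tau < `|h x|].
have mH : measurable H by exact: meas_level.
rewrite (phisetE Q)//.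
have f0 x : 0 <= phi x t by [].
apply: (@fatou_ae (fun N x => (\1_(H `&` E N) x * phi x t)%:E)).
- by move=> N; apply: (meas_weight Q) => //; exact: measurableI.
- by move=> N x; rewrite lee_fin.
- exact: (meas_weight Q).
- by move=> x; rewrite lee_fin.
- apply: (aeL_imp w0) => x wx; apply: cvg_near_cst.
 have t2 : 0 < tau / 2 by pos.
 move/cvgrPdist_lt : wx => /(_ _ t2)[N0 _ HN].
 exists N0 => // N N0N; congr (_ * _)%:E; rewrite !indicE in_setI.
 have -> : x \in E N; last by rewrite andbT.
 rewrite inE => v Nv; rewrite /W/=; apply/negP; rewrite -leNgt.
 by have := HN v (leq_trans N0N Nv); rewrite sub0r normrN => /ltW.
move=> N; rewrite -(phisetE Q)//; last exact: measurableI.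
apply: le_trans (HB N); apply: phiset_ae => //; [exact: measurableI|exact: meas_level|].
apply: (aeL_imp (huw N)) => x hx [Hx /(_ N (leqnn N))]; rewrite /W/= => /negP; rewrite -leNgt => h2.
by move: Hx; rewrite /H/= => h1; lra.
Qed.

Variables (k : opkind) (T : (Rn -> R) -> Rn -> R).
Hypotheses (Tk : kind_L2 k T) (Tb : bounded_L2 T).
Variables (m s : nat) (r : \bar R) (Ca : R).
Hypotheses (expo : n%:R * q < p0 * (n + m.+1)%:R) (r1 : (1%:E < r)%E) (Ca0 : 0 < Ca).
Hypothesis HT : forall (lam cc : R) (c : Rn) (rad : R) (a : Rn -> R), 0 < lam -> atom phi r s c rad a ->
 forall tau : R, 0 < tau ->
 (phiset phi [set x | (tau < `|T (fun y => cc * a y) x|)%R] (tau / lam)%R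
 <= Ca%:E * phiset phi (eball c rad) (fine (Lqphi phi r (eball c rad) (fun y => cc * a y)) / lam)%R)%E.

Lemma T_atom lam c rad b (B : R) tau : 0 < lam -> 0 < tau -> 0 < rad -> 0 < B ->
 mfun b -> (forall x, `|b x| <= B) ->
 (forall x, b x != 0 -> eball c rad x) ->
 (forall gam : 'I_n -> nat, (\sum_(i < n) gam i <= s)%N ->
 \int[L]_x (b x * xpow gam x) = 0) ->
 (phiset phi [set x | (tau < `|T b x|)%R] (tau / lam)%R <= Ca%:E * phiset phi (eball c rad) (B / lam)%R)%E.
move=> lam0 tau0 rad0 B0 mb bB bs bm.
have [cc [a [bE aa]]] := multiple_of_atom Q HD r1 rad0 B0 mb bB bs bm.
have := HT cc lam0 aa tau0; rewrite -bE => h; apply: le_trans h _.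
have /andP[h1 h2] := Lqphi_bound Q HD c r1 rad0 mb bB.
apply: lee_wpmul2l; first by pos.
apply: (le_phiset Q) => //; first by rewrite divr_ge0 ?fine_ge0.
rewrite ler_pM2r; by move: h2; case: (Lqphi _) => [x| |]//=; rewrite lee_fin.
Qed.

(** [f] is split into a finite sum of pieces and an L2-small remainder, whose image tends to 0
    almost everywhere along a fast sequence. The images of the pieces obey the hypothesis on [T] and
    combine by [superposition]; the weights of the balls add up by Whitney overlap. *)
Lemma main_estimate (i0 : 'I_n) : exists2 K : R, 0 < K & forall f lam tau, L2i f -> 0 < lam -> 0 < tau ->
 (phiset phi [set x | (tau < `|T f x|)%R] (tau / lam)%R <= K%:E * Mod phi lam (gmax m (fdist f)))%E.
have [CT CT0 HCT] := T_L2 Tb.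
have [B B0 HB] := L2_atomic_approx m Q HD D0 i0 s.
pose K1 := Ca * (C * (1 + 2 * B)).
have Ks := Ksup_gt0 Q.
pose K := (1 + Ksup p1 C) * (K1 * Movl.+1%:R).
have K0 : 0 < K by pos.
exists K => // f lam tau fL lam0 tau0.
have mg := meas_gmax m (fdist f).
have [foo|fin] := eqVneq (Mod phi lam (gmax m (fdist f))) +oo%E.
 by rewrite foo gt0_muley ?lte_fin// leey.
have {}fin : (Mod phi lam (gmax m (fdist f)) < +oo)%E by rewrite lt_neqAle fin leey.
have tl : 0 <= tau / lam by pos.
have [iT _] := HCT f fL; have [mT _] := iT.
have [nz|/forall2NP z] := pselect (exists2 w, schwartz w & fdist f w != 0); last first.
 have f0 : {ae L, forall x, f x = 0}.
 apply: L2_orthogonal => // w sw; rewrite -fdistE; [|by case: fL|exact: (schwartz_meas [::] sw)].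
 by case: (z w) => [//|/negP/negPn/eqP].
 have n0 : n2 f = 0.
 apply: Rint_null; last by apply: measurable_funX; case: fL.
 by apply: (aeL_imp f0) => x ->; rewrite expr0n.
 apply: le_trans (_ : (phiset phi set0 (tau / lam)%R <= _)%E).
 apply: phiset_ae => //; first exact: meas_level.
 by apply: (aeL_imp (T_null Tb fL n0)) => x /= ->; rewrite normr0 ltNge ltW.
 by rewrite phiset0// mule_ge0// ?lee_fin ?(ltW K0)// (Mod_ge0 Q).
(* With this choice the images of the remainders have squared norm at most [16^-v/4], so that their
   differences meet the rate of [L2_complete]. *)
pose e v : R := 16^-1 ^+ v / (4 * CT).
have e0 v : 0 < e v by pos.
have [hc _] := HB f lam 1 fL lam0 fin nz ltr01.
have /choice[P /choice[b HPb]] := fun v => (HB f lam (e v) fL lam0 fin nz (e0 v)).2.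
have lb v J : L2i (b v J).
 have [mb bB bs _ _] := HPb v; split; first exact: mb.
 have rJ : 0 < Jr J / 8 :> R by pos.
 have B2 : 0 <= B * 2 ^ (Jk J) by pos.
 have [||||//] := @inte_bdd_supp (fun x => b v J x ^+ 2) (Jc J) (Jr J / 8) ((B * 2 ^ (Jk J)) ^+ 2) rJ.
 - exact: sqr_ge0.
 - exact: measurable_funX.
 - by move=> x; rewrite normrX; apply: lerXn2r; rewrite ?nnegrE.
 - by move=> x nx; have [->|/bs[]//] := eqVneq (b v J x) 0; rewrite expr0n.
pose S v x := \sum_(J <- @cfirst WJ (P v)) b v J x.
have lS v : L2i (S v) by apply: L2i_sum => J; exact: lb.
have lR v : L2i (fun x => f x - S v x) by exact: L2iB.
pose w v := T (fun x => f x - S v x).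
have lw v : L2i (w v) by case: (HCT _ (lR v)).
have nw v : n2 (w v) <= 16^-1 ^+ v / 4.
 have [_ h] := HCT _ (lR v); apply: le_trans h _.
 have [_ _ _ _ h] := HPb v; apply: le_trans (ler_wpM2l (ltW CT0) h) _.
 have CTn : CT != 0 by rewrite gt_eqF.
 by rewrite /e; move: (16^-1 ^+ v) => y; apply: le_of_eq; field.
have w0 : {ae L, forall x, w ^~ x @ \oo --> (0 : R)}.
 have [v i vi|g [ig gn gw]] := L2_complete lw.
 have -> : (fun x => w i x - w v x) = fun x => w i x + -1 * w v x by apply/funext => x; rewrite mulN1r.
 apply: le_trans (n2D (lw i) (L2iZ _ (lw v))) _; rewrite n2Z// sqrrN expr1n mul1r.
 have h3 : 16^-1 ^+ i <= 16^-1 ^+ v :> R by rewrite ler_wiXn2l// invf_le1// ler1n.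
 by have := nw i; have := nw v; lra.
 have g0 : n2 g = 0.
 apply/eqP; rewrite eq_le n2_ge0 andbT; apply/ler_addgt0Pl => d d0; rewrite addr0.
 have /pow16_small[v /(_ v (leqnn v)) hv] : 0 < d / 4 by pos.
 have -> : g = fun x => w v x + -1 * (w v x - g x) by apply/funext => x; ring.
 have lB := L2iB (lw v) ig.
 apply: le_trans (n2D (lw v) (L2iZ _ lB)) _; rewrite n2Z// sqrrN expr1n mul1r.
 by have := nw v; have := gn v; lra.
 have H := aeL_and gw (n2_ae0 ig g0).
 by apply: (aeL_imp H) => x [h1 h2]; rewrite h2 in h1.
apply: (@weak_fatou (T f) (fun v => T (S v)) w) => //.
- by move=> v; have [[]] := HCT _ (lS v).
- by move=> v; have [] := lw v.
- move=> v; have := T_sub Tk (lS v) (lR v); rewrite (_ : (fun y => S v y + _) = f)//.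
 by apply/funext => y; rewrite addrC subrK.
move=> v; have [mb bB bs bm _] := HPb v.
have lam2 : 0 < lam / 2 by pos.
have tau2 : 0 < tau / 2 by pos.
(* Halving [tau] and [lam] together keeps the argument of [phi], so the estimate for the pieces is
   used with [lam/2]. *)
have tE : tau / lam = tau / 2 / (lam / 2) by field; rewrite gt_eqF.
pose U J := if `[< wact (gmax m (fdist f)) J >] then phiset phi (Jb J) (2 ^ (Jk J) / lam) else 0%E.
have t0 (j : int) : 0 <= 2 ^ j / lam by pos.
have U0 J : (0 <= U J)%E by rewrite /U; case: ifP => // _; exact: (phiset_ge0 Q).
have HU J (s' : R) : 0 < s' -> (phiset phi [set x | s' < `|T (b v J) x|]%R (s' / (lam / 2))%R <= K1%:E * U J)%E.
 move=> s0; rewrite /U; case: (boolP `[< wact (gmax m (fdist f)) J >]) => [/asboolP aJ|/asboolP nJ]; last first.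
 have b0 : b v J = fun=> 0.
 by apply/funext => x; apply/eqP/negPn/negP => /bs[].
 rewrite mule0 b0; apply: le_trans (_ : (phiset phi set0 (s' / (lam / 2))%R <= _)%E); last first.
 by rewrite phiset0// divr_ge0// ltW.
 apply: phiset_ae => //.
 by apply: meas_level; case: (HCT _ (@L2i0)) => [[]].
 have := T_null Tb (@L2i0); rewrite /n2 Rint_eq0; last by pos; rewrite expr0n.
 by move=> /(_ erefl) H; apply: (aeL_imp H) => x /= ->; rewrite normr0 ltNge ltW.
 apply: le_trans (@T_atom _ (Jc J) (Jr J / 8) _ (B * 2 ^ (Jk J)) _ lam2 s0 _ _ (mb J) (bB J) _ (bm J)) _.
 - by pos.
 - by pos.
 - by move=> x /bs[].
 rewrite /K1 EFinM -muleA; apply: lee_wpmul2l; first by pos.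
 have -> : B * 2 ^ (Jk J) / (lam / 2) = 2 * B * (2 ^ (Jk J) / lam).
 by move: (2 ^ (Jk J)) => y; field; rewrite gt_eqF.
 apply: (phiset_scale Q) => //; exact: meas_eball.
have lT J : L2i (T (b v J)) by case: (HCT _ (lb v J)).
apply: le_trans (_ : (phiset phi [set x | (tau / 2 < \sum_(J <- @cfirst WJ (P v)) `|T (b v J) x|)%R] (tau / lam)%R <= _)%E).
 apply: phiset_ae => //.
 - by apply: meas_level; have [[]] := HCT _ (lS v).
 - have := @meas_level (fun x => \sum_(J <- @cfirst WJ (P v)) `|T (b v J) x|) (tau / 2).
 rewrite (_ : [set x | _] = [set x | tau / 2 < \sum_(J <- @cfirst WJ (P v)) `|T (b v J) x|]); last first.
 by apply/seteqP; split => x /=; rewrite ger0_norm//; exact: sumr_ge0.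
 by apply; apply: measurable_sum => J; apply: measurableT_comp => //; case: (lT J).
 by apply: (aeL_imp (T_sum Tk Tb (@cfirst WJ (P v)) (lb v))) => x h1 h2; exact: lt_le_trans h1.
rewrite tE; apply: le_trans (@superposition _ _ _ _ Q _ (@cfirst WJ (P v)) (fun J x => `|T (b v J) x|) (fun J => (K1%:E * U J)%E) _ lam2 _ _ HU _ tau2) _.
- by move=> J; apply: measurableT_comp => //; case: (lT J).
- by [].
have -> : (K%:E = (1 + Ksup p1 C)%:E * (K1%:E * Movl.+1%:R%:E))%E by [].
rewrite -!muleA; apply: lee_wpmul2l; first by pos.
rewrite -ge0_sume_distrr//; apply: lee_wpmul2l; first by pos.
apply: le_trans (le_csum_fin U0 (@cfirst_uniq WJ (P v))) _.
apply: le_trans (whitney_overlap Q hc mg lam0) _.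
by apply: lee_wpmul2r; rewrite ?(Mod_ge0 Q)// lee_fin ler_nat.
Qed.
End main_estimate.

Section real_sequences.
Implicit Types (u v : nat -> R) (l : R).

Lemma cvg_lincomb (a b : R) u v l l' : u @ \oo --> l -> v @ \oo --> l' ->
 (fun i => a * u i + b * v i) @ \oo --> a * l + b * l'.
by move=> hu hv; exact: (cvgD (cvgM (cvg_cst a) hu) (cvgM (cvg_cst b) hv)).
Qed.

Lemma cvg_add u v l l' : u @ \oo --> l -> v @ \oo --> l' ->
 (fun i => u i + v i) @ \oo --> l + l'.
by move=> hu hv; exact: (cvgD hu hv). Qed.

Lemma ler_cvgn u v l l' : u @ \oo --> l -> v @ \oo --> l' -> (forall i, u i <= v i) -> l <= l'.
by move=> hu hv uv; apply: (ler_cvg_to hu hv); exact: nearW. Qed.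
End real_sequences.

(** * The extension: existence, boundedness and uniqueness *)

Section extension.
Variables (phi : Rn -> R -> R) (p0 p1 C : R).
Hypothesis Q : qtype phi p0 p1 C.
Let C0 := qt_C0 Q.
Local Notation m := (mphi phi).
Local Notation M lam g := (Mod phi lam g).
Local Notation h2 v := ((2^-1 : R) ^+ v).

Lemma EFinMA (a b c : R) : ((a * b * c)%:E = a%:E * (b * c)%:E)%E.
by rewrite -EFinM mulrA. Qed.

Lemma Mod_le_lam lam lam' (g : RL R n -> \bar R) : 0 < lam -> lam <= lam' -> measurable_fun setT g ->
 (M lam' g <= M lam g)%E.
move=> l0 ll mg; have l0' : 0 < lam' by exact: lt_le_trans ll.
rewrite !(ModE Q)//; apply: le_csum => k.
 by apply: (phiset_ge0 Q); rewrite divr_ge0.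
apply: (le_phiset Q) => //.
by rewrite ler_wpM2l// lef_pV2.
Qed.

Lemma Mod_add lam (g g' : RL R n -> \bar R) : 0 < lam -> (forall x, 0 <= g x)%E -> (forall x, 0 <= g' x)%E ->
 measurable_fun setT g -> measurable_fun setT g' ->
 (M lam (fun x => g x + g' x) <= (Kpsi p0 C)%:E * (M lam g + M lam g'))%E.
move=> l0 g0 g0' mg mg'.
pose h (b : bool) := if b then g else g'.
have sE (u : bool -> \bar R) : (forall b, (0 <= u b)%E) -> csum u = (u true + u false)%E.
 move=> u0; rewrite (@csum_finsupp _ u [:: true; false])//; last by case.
 by rewrite !big_cons big_nil adde0.
have := Mod_csum Q l0 (fun b => if b as b0 return (forall x, (0 <= h b0 x)%E) then g0 else g0')
 (fun b => if b as b0 return measurable_fun setT (h b0) then mg else mg').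
rewrite sE; last by move=> b; exact: (Mod_ge0 Q).
rewrite (_ : (fun x => csum _) = fun x => (g x + g' x)%E)//; apply/funext => x.
by rewrite sE//; case.
Qed.

Lemma Mod_mul lam a (g : RL R n -> \bar R) : 0 < lam -> 0 <= a -> (forall x, 0 <= g x)%E ->
 measurable_fun setT g ->
 (M lam (fun x => a%:E * g x) <= (Cpsi p0 C * (2 * C) * (C * (1 + a)))%:E * M lam g)%E.
move=> l0 a0 g0 mg; have a1 : 1 <= 1 + a by rewrite lerDl.
have a1p : 0 < 1 + a by exact: lt_le_trans.
have mZ c : measurable_fun setT (fun x => c%:E * g x)%E by exact: emeasurable_funM.
apply: le_trans (_ : (M lam (fun x => (1 + a)%:E * g x) <= _)%E).
 apply: (le_Mod Q) => // x; apply: lee_wpmul2r => //; by rewrite lee_fin lerDr.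
apply: le_trans (Mod_le_modular Q l0 _ (mZ _)) _; first by move=> x; rewrite mule_ge0// ltW.
have -> : modular phi (fun x => (1 + a)%:E * g x)%E lam = modular phi g (lam / (1 + a)).
 rewrite /modular; congr nnint; apply/funext => x; congr phiE.
 by rewrite [((1 + a)%:E * _)%E]muleC -muleA invf_div.
rewrite EFinMA -muleA; apply: lee_wpmul2l; first by rewrite lee_fin ltW// (Cpsi_gt0 Q).
have l1 : 0 < lam / (1 + a) by pos.
apply: le_trans (modular_le_Mod Q l1 g0 mg) _.
rewrite (EFinM (2 * C)) -muleA; apply: lee_wpmul2l; first by pos.
exact: (Mod_up Q l0 a1 mg).
Qed.

(** Finiteness for one [lam] spreads to larger values by monotonicity and to smaller ones by the
    upper type. *)
Lemma inH_Mod (f : @distr R n) : inH phi f -> tempered f /\ forall lam, 0 < lam -> (M lam (gmax m f) < +oo)%E.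
move=> [tf [mE [l0 [l0p h]]]]; split => // lam lam0; have mg := meas_gmax m f.
have fin : (M l0 (gmax m f) < +oo)%E.
 apply: le_lt_trans (Mod_le_modular Q l0p (gmax_ge0 m f) mg) _.
 apply: le_lt_trans (lee_wpmul2l _ h) _; first by rewrite lee_fin ltW// (Cpsi_gt0 Q).
 by rewrite ltry.
have [ll|ll] := leP l0 lam; first exact: le_lt_trans (Mod_le_lam l0p ll mg) fin.
have a1 : 1 <= l0 / lam by rewrite ler_pdivlMr// mul1r ltW.
have -> : lam = l0 / (l0 / lam) by rewrite invf_div mulrCA divff ?gt_eqF// mulr1.
apply: le_lt_trans (Mod_up Q l0p a1 mg) _; rewrite lte_mul_pinfty ?lee_fin//.
Qed.

Lemma Mod_inH (f : @distr R n) lam : tempered f -> 0 < lam -> (M lam (gmax m f) < +oo)%E -> inH phi f.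
move=> tf lam0 fin; have mg := meas_gmax m f; split => //; split; first exact/measEP.
have [B BE] : exists B : R, M lam (gmax m f) = B%:E.
 by exists (fine (M lam (gmax m f))); rewrite fineK// ge0_fin_numE// (Mod_ge0 Q).
have B0 : 0 <= B by rewrite -lee_fin -BE (Mod_ge0 Q).
have p00 := qt_p0 Q.
pose y := (2 * C * (C * B) + 1)^-1.
have y1 : 1 <= 2 * C * (C * B) + 1 by rewrite lerDr.
have y0 : 0 < y by rewrite invr_gt0 (lt_le_trans ltr01).
have a0 : 0 < y `^ p0^-1 by pos.
have a1 : y `^ p0^-1 <= 1.
 have -> : 1 = 1 `^ p0^-1 :> R by rewrite powR1.
 apply: ge0_ler_powR; rewrite ?nnegrE//.
 by rewrite invf_le1// (lt_le_trans ltr01).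
exists (lam / y `^ p0^-1); have l1 : 0 < lam / y `^ p0^-1 by pos.
split => //; apply: le_trans (modular_le_Mod Q l1 (gmax_ge0 m f) mg) _.
apply: le_trans (lee_wpmul2l _ (Mod_low Q lam0 a0 a1 mg)) _; first by pos.
rewrite BE lee_fin -powRrM mulVf ?gt_eqF// powRr1//.
rewrite (_ : 2 * C * (C * y * B) = 2 * C * (C * B) * y); last by ring.
by rewrite ler_pdivrMr ?mul1r ?lerDl// (lt_le_trans ltr01).
Qed.

Lemma fdist_comb (a b : R) (u v psi : Rn -> R) : L2i u -> L2i v -> schwartz psi ->
 fdist (fun y => a * u y + b * v y) psi = a * fdist u psi + b * fdist v psi.
move=> iu iv sp; have mp := schwartz_meas [::] sp; have ip := schwartz_L2i sp.
have [mc _] := L2i_comb a b iu iv.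
rewrite !fdistE//; [|by case: iv|by case: iu].
have i1 := L2iM iu ip; have i2 := L2iM iv ip.
rewrite -(RintegralZl a measurableT i1) -(RintegralZl b measurableT i2).
rewrite -(RintegralD measurableT (inteZ a i1) (inteZ b i2)).
by apply: eq_Rintegral => x _; ring.
Qed.

Variables (k : opkind) (T : (Rn -> R) -> Rn -> R).
Hypotheses (Tk : kind_L2 k T) (Tb : bounded_L2 T).
Variable K : R.
Hypothesis K0 : 0 < K.
Hypothesis HME : forall f lam tau, L2i f -> 0 < lam -> 0 < tau ->
 (phiset phi [set x | (tau < `|T f x|)%R] (tau / lam)%R <= K%:E * M lam (gmax m (fdist f)))%E.
Hypothesis HDn : forall (f : @distr R n) lam (eps : R), tempered f -> 0 < lam ->
 (M lam (gmax m f) < +oo)%E -> 0 < eps ->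
 exists2 h : Rn -> R, L2i h & (M lam (gmax m (dcomb 1 f (-1) (fdist h))) <= eps%:E)%E.

Let h2_gt0 v : 0 < h2 v. by []. Qed.

(** In the sublinear case subadditivity gives both one-sided bounds, and homogeneity with factor -1
    bounds [T (v - u)] by [T (u - v)]. *)
Lemma T_diff (u v : Rn -> R) : L2i u -> L2i v ->
 {ae L, forall x, `|T u x - T v x| <= `|T (fun y => u y - v y) x|}.
move=> iu iv; have iB := L2iB iu iv; have iB' := L2iB iv iu.
move: iu iv iB iB' => /inL2P iu /inL2P iv /inL2P iB /inL2P iB'; case: k Tk => Hk.
 have /aeP := Hk u v 1 (-1) iu iv.
 rewrite (_ : (fun y => _ + _) = fun y => u y - v y); last by apply/funext => y; rewrite mul1r mulN1r.
 by move=> H; apply: (aeL_imp H) => x ->; rewrite mul1r mulN1r.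
apply: aeW => x.
have [a1 a2 a3] := Hk _ v (-1) iB iv x; have [b1 _ b3] := Hk _ u 1 iB' iu x.
have [c1 _ _] := Hk u u 1 iu iu x; have [d1 _ _] := Hk v u 1 iv iu x.
have e1 : (fun y => u y - v y + v y) = u by apply/funext => y; rewrite subrK.
have e2 : (fun y => v y - u y + u y) = v by apply/funext => y; rewrite subrK.
have e3 : (fun y => -1 * (u y - v y)) = fun y => v y - u y by apply/funext => y; rewrite mulN1r opprB.
rewrite e1 in a3; rewrite e2 in b3; rewrite e3 normrN normr1 mul1r in a2.
by rewrite (ger0_norm a1) ler_norml; apply/andP; split; lra.
Qed.

Lemma T_meas (u : Rn -> R) : L2i u -> mfun (T u).
by move=> iu; have [CT _ H] := T_L2 Tb; have [[]] := H u iu. Qed.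

Lemma eventually_small (B : R) (F : nat -> Rn -> R) : (forall v, mfun (F v)) ->
 (forall v, (phiset phi [set x | (h2 v < `|F v x|)%R] 1 <= (B * h2 v)%:E)%E) ->
 {ae L, forall x, exists v0, forall v, (v0 <= v)%N -> `|F v x| <= h2 v}.
move=> mF HF; have m1 : mfun (fun x => phi x 1) by apply/measRP; exact: (qt_meas Q).
have mE v : mset ([set x | h2 v < `|F v x|]) by exact: meas_level.
have f1 x : 0 < phi x 1 by [].
have hE v : (\int[L]_x (\1_[set x | (h2 v < `|F v x|)%R] x * phi x 1)%:E <= (B * 2^-1 ^+ v)%:E)%E.
 by rewrite -(phisetE Q).
have H := borel_cantelli_weight m1 f1 mE hE.
apply: (aeL_imp H) => x [v0 Hv]; exists v0 => v /Hv /negP; by rewrite -leNgt.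
Qed.

(** With [tau = lam = 2^-v] the argument of [phi] is 1, so all level sets are measured by the single
    weight [phi(x, 1)] and Borel-Cantelli applies. *)
Lemma T_eventually_small (B : R) (u : nat -> Rn -> R) : (forall v, L2i (u v)) ->
 (forall v, (M (h2 v) (gmax m (fdist (u v))) <= (B * h2 v)%:E)%E) ->
 {ae L, forall x, exists v0, forall v, (v0 <= v)%N -> `|T (u v) x| <= h2 v}.
move=> iu Hu; apply: (@eventually_small (K * B)) => [v|v]; first exact: T_meas.
have := HME (iu v) (h2_gt0 v) (h2_gt0 v); rewrite divff// => h; apply: le_trans h _.
by rewrite -mulrA EFinM; apply: lee_wpmul2l => //; rewrite ltW.
Qed.

(** Both the parameter [lam] and the bound shrink like [2^-v]. This speed gives almost everywhere
    convergence of the whole sequence [T (g v)], and it is kept by linear combinations of two such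
    sequences. *)
Definition appr (f : @distr R n) (g : nat -> Rn -> R) := (forall v, L2i (g v)) /\
 exists B : R, forall v, (M (h2 v) (gmax m (dcomb 1 f (-1) (fdist (g v)))) <= (B * h2 v)%:E)%E.

Lemma gmax_tri (f : @distr R n) (u v : Rn -> R) x : L2i u -> L2i v ->
 (gmax m (fdist (fun y => u y - v y)%R) x <=
 gmax m (dcomb 1 f (-1) (fdist u)) x + gmax m (dcomb 1 f (-1) (fdist v)) x)%E.
move=> iu iv.
have -> : gmax m (fdist (fun y => u y - v y)) =
 gmax m (dcomb (-1) (dcomb 1 f (-1) (fdist u)) 1 (dcomb 1 f (-1) (fdist v))).
 apply: eq_gmax => psi sp; have := fdist_comb 1 (-1) iu iv sp.
 rewrite (_ : (fun y => _ + _) = fun y => u y - v y); last by apply/funext => y; rewrite mul1r mulN1r.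
 by move=> ->; rewrite /dcomb; ring.
have := gmax_comb m (-1) 1 (dcomb 1 f (-1) (fdist u)) (dcomb 1 f (-1) (fdist v)) x.
by rewrite normrN !normr1 !mul1e.
Qed.

Lemma appr_diff f g g' : appr f g -> appr f g' -> exists B : R, forall v,
 (M (h2 v) (gmax m (fdist (fun y => g v y - g' v y)%R)) <= (B * h2 v)%:E)%E.
move=> [ig [B HB]] [ig' [B' HB']]; exists (Kpsi p0 C * (B + B')) => v.
have mg' h := meas_gmax m (dcomb 1 f (-1) (fdist h)).
apply: le_trans (le_Mod Q (h2_gt0 v) (meas_gmax _ _) _ (fun x => gmax_tri f x (ig v) (ig' v))) _.
 exact: emeasurable_funD.
apply: le_trans (Mod_add (h2_gt0 v) (gmax_ge0 _ _) (gmax_ge0 _ _) (mg' _) (mg' _)) _.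
rewrite EFinMA; apply: lee_wpmul2l; first by rewrite lee_fin ltW.
by rewrite mulrDl EFinD; exact: leeD.
Qed.

Lemma h2_cvg : (fun v => h2 v) @ \oo --> (0 : R).
have := @cvg_geometric R 1 (2^-1) _.
have -> : `|2^-1 : R| < 1 by rewrite ger0_norm// invf_lt1// ltr1n.
move=> /(_ isT); rewrite (_ : geometric 1 2^-1 = fun v => h2 v)//.
by apply/funext => v; rewrite /= mul1r.
Qed.

Lemma small_cvg (u : nat -> R) : (exists v0, forall v, (v0 <= v)%N -> `|u v| <= h2 v) -> u @ \oo --> (0 : R).
move=> [v0 Hv]; apply/cvgrPdist_le => e e0.
move/cvgrPdist_le : h2_cvg => /(_ e e0)[v1 _ H1].
exists (maxn v0 v1) => // v /=; rewrite geq_max => /andP[a b].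
rewrite sub0r normrN; apply: le_trans (Hv v a) _.
by have := H1 v b; rewrite sub0r normrN ger0_norm.
Qed.

Lemma appr_unique f g g' (h : Rn -> R) : appr f g -> appr f g' ->
 {ae L, forall x, (fun v => T (g v) x) @ \oo --> h x} -> {ae L, forall x, (fun v => T (g' v) x) @ \oo --> h x}.
move=> ag ag' gh; have [B HB] := appr_diff ag' ag.
have iB v := L2iB (ag'.1 v) (ag.1 v).
have H := ae_foralln (fun v => T_diff (ag'.1 v) (ag.1 v)).
have H2 := aeL_and gh (aeL_and H (T_eventually_small iB HB)).
apply: (aeL_imp H2) => x [h1 [h2' [v0 Hv]]].
have : (fun v => T (g' v) x - T (g v) x) @ \oo --> (0 : R).
 by apply: small_cvg; exists v0 => v /Hv; apply: le_trans.
move=> h3; have E : (fun v => T (g' v) x) = fun v => (T (g' v) x - T (g v) x) + T (g v) x.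
 by apply/funext => v; rewrite subrK.
by rewrite E -[h x]add0r; exact: (cvgD h3 h1).
Qed.

Lemma appr_exists f : inH phi f -> exists g, appr f g.
move=> /inH_Mod[tf fin].
have /choice[g Hg] : forall v, exists h, L2i h /\ (M (h2 v) (gmax m (dcomb 1 f (-1) (fdist h))) <= (h2 v)%:E)%E.
 by move=> v; have [h Hh] := HDn tf (h2_gt0 v) (fin _ (h2_gt0 v)) (h2_gt0 v); exists h.
exists g; split; first by move=> v; case: (Hg v).
by exists 1 => v; rewrite mul1r; case: (Hg v).
Qed.

Lemma appr_cvg f g : appr f g -> exists h, mfun h /\
 {ae L, forall x, (fun v => T (g v) x) @ \oo --> h x}.
move=> ag; have [ig [B HB]] := ag.
have [B' HB'] : exists B' : R, forall v,
 (M (h2 v) (gmax m (fdist (fun y => g v.+1 y - g v y)%R)) <= (B' * h2 v)%:E)%E.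
 exists (Kpsi p0 C * (`|B| + B)) => v.
 have mg' h := meas_gmax m (dcomb 1 f (-1) (fdist h)).
 apply: le_trans (le_Mod Q (h2_gt0 v) (meas_gmax _ _) _ (fun x => gmax_tri f x (ig v.+1) (ig v))) _.
 exact: emeasurable_funD.
 apply: le_trans (Mod_add (h2_gt0 v) (gmax_ge0 _ _) (gmax_ge0 _ _) (mg' _) (mg' _)) _.
 rewrite EFinMA; apply: lee_wpmul2l; first by rewrite lee_fin ltW.
 rewrite mulrDl EFinD; apply: leeD => //.
 have h : h2 v.+1 <= h2 v by rewrite exprS ler_piMl// invf_le1// ler1n.
 apply: le_trans (Mod_le_lam (h2_gt0 v.+1) h (mg' _)) _; apply: le_trans (HB v.+1) _.
 rewrite lee_fin; apply: le_trans (ler_wpM2r (ltW (h2_gt0 _)) (ler_norm B)) _.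
 by rewrite ler_wpM2l.
have iB v := L2iB (ig v.+1) (ig v).
have H := ae_foralln (fun v => T_diff (ig v.+1) (ig v)).
have [N [mN N0 NP]] := aeL_and H (T_eventually_small iB HB').
(* The factor vanishing on [N] makes the sequence converge everywhere, so that its limit is
   measurable. *)
pose h x : R := limn (fun v => T (g v) x * \1_(~` N) x).
have cv x : (fun v => T (g v) x * \1_(~` N) x) @ \oo --> h x.
 have [Nx|nNx] := pselect (N x).
 have -> : (fun v => T (g v) x * \1_(~` N) x) = fun=> 0.
 by apply/funext => v; rewrite indicE memNset ?mulr0//=; apply.
 by rewrite /h (_ : (fun => _) = 0); [exact: is_cvg_cst|apply/funext => v; rewrite indicE memNset ?mulr0//=; apply].
 have [h1 [v0 Hv]] : (forall v, `|T (g v.+1) x - T (g v) x| <= `|T (fun y => g v.+1 y - g v y) x|) /\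
 (exists v0, forall v, (v0 <= v)%N -> `|T (fun y => g v.+1 y - g v y) x| <= h2 v).
 by apply: contrapT => hh; apply: nNx; exact: NP.
 have c : cvgn (fun v => T (g v) x) by apply: (@geo_cauchy _ v0) => v /Hv; apply: le_trans.
 rewrite /h (_ : (fun v => _) = fun v => T (g v) x)//.
 by apply/funext => v; rewrite indicE mem_set ?mulr1.
exists h; split.
 apply: (@measurable_fun_cvg _ _ _ setT (fun v (x : RL R n) => T (g v) x * \1_(~` N) x)) => //.
 move=> v; apply: measurable_funM; first exact: T_meas.
 by apply: measurable_indic; exact: measurableC.
exists N; split => // x /= nx; apply: contrapT => Nx; apply: nx.
by have := cv x; under eq_fun do rewrite indicE mem_set//= mulr1.
Qed.

(** A choice among the almost everywhere limits of [T (g v)]; by [appr_unique] it is independent of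
    the approximating sequence up to null sets. The value 0 is the default where no such limit
    exists. *)
Definition Ttilde (f : @distr R n) : Rn -> R :=
 if pselect (exists h : Rn -> R, mfun h /\
 exists2 g, appr f g & {ae L, forall x, (fun v => T (g v) x) @ \oo --> h x})
 is left e then projT1 (cid e) else fun=> 0.

Lemma TtildeP f g : appr f g -> mfun (Ttilde f) /\
 {ae L, forall x, (fun v => T (g v) x) @ \oo --> Ttilde f x}.
move=> ag; rewrite /Ttilde; case: pselect => [e|]; last first.
 by case; have [h [mh hc]] := appr_cvg ag; exists h; split => //; exists g.
case: cid => h [mh [g' ag' hg']]; split => //; exact: appr_unique ag hg'.
Qed.

Lemma appr_comb (a b : R) f f' g g' : appr f g -> appr f' g' ->
 appr (dcomb a f b f') (fun v y => a * g v y + b * g' v y).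
move=> [ig [B HB]] [ig' [B' HB']]; split; first by move=> v; exact: L2i_comb.
pose c (a : R) := Cpsi p0 C * (2 * C) * (C * (1 + `|a|)).
have c0 x : 0 <= c x.
 apply: mulr_ge0; first by apply: mulr_ge0; [exact/ltW/(Cpsi_gt0 Q)|rewrite mulr_ge0// ltW].
 by pos.
exists (Kpsi p0 C * (c a * B + c b * B')) => v.
pose d := dcomb 1 f (-1) (fdist (g v)); pose d' := dcomb 1 f' (-1) (fdist (g' v)).
have -> : gmax m (dcomb 1 (dcomb a f b f') (-1) (fdist (fun y => a * g v y + b * g' v y)%R)) =
 gmax m (dcomb a d b d').
 apply: eq_gmax => psi sp; rewrite {1}/dcomb fdist_comb//; rewrite /d /d' /dcomb; ring.
have md := meas_gmax m d; have md' := meas_gmax m d'.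
have mZ (x : R) (h : RL R n -> \bar R) : measurable_fun setT h -> measurable_fun setT (fun y => `|x|%:E * h y)%E.
 by move=> mh; exact: emeasurable_funM.
apply: le_trans (le_Mod Q (h2_gt0 v) (meas_gmax _ _) _ (gmax_comb m a b d d')) _.
 by apply: emeasurable_funD; exact: mZ.
have g0 (x : R) (h : @distr R n) y : (0 <= `|x|%:E * gmax m h y)%E by rewrite mule_ge0 ?gmax_ge0.
apply: le_trans (Mod_add (h2_gt0 v) (g0 a d) (g0 b d') (mZ _ _ md) (mZ _ _ md')) _.
rewrite EFinMA; apply: lee_wpmul2l; first by rewrite lee_fin ltW.
rewrite mulrDl EFinD; apply: leeD.
 apply: le_trans (Mod_mul (h2_gt0 v) (normr_ge0 a) (gmax_ge0 m d) md) _.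
 by rewrite [leRHS]EFinMA; apply: lee_wpmul2l; rewrite ?lee_fin ?c0.
apply: le_trans (Mod_mul (h2_gt0 v) (normr_ge0 b) (gmax_ge0 m d') md') _.
by rewrite [leRHS]EFinMA; apply: lee_wpmul2l; rewrite ?lee_fin ?c0.
Qed.

Lemma Ttilde_kind : kind_H k phi Ttilde.
case: k Tk => Hk.
 move=> f f' a b /appr_exists[g ag] /appr_exists[g' ag']; apply/aeP.
 have [_ c1] := TtildeP ag; have [_ c2] := TtildeP ag'; have [_ c3] := TtildeP (appr_comb a b ag ag').
 have H v : {ae L, forall x, T (fun y => a * g v y + b * g' v y) x = a * T (g v) x + b * T (g' v) x}.
 by apply/aeP; apply: Hk; apply/inL2P; [exact: ag.1|exact: ag'.1].
 have H2 := aeL_and (ae_foralln H) (aeL_and c1 (aeL_and c2 c3)).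
 apply: (aeL_imp H2) => x [e [h1 [h2 h3]]].
 have h4 := @cvg_lincomb a b _ _ _ _ h1 h2; rewrite (_ : (fun i => _) = fun v => T (fun y => a * g v y + b * g' v y) x) in h4.
 exact: (cvg_unique _ h3 h4).
 by apply/funext => v; rewrite e.
move=> f f' a /appr_exists[g ag] /appr_exists[g' ag']; apply/aeP.
have [_ c1] := TtildeP ag; have [_ c2] := TtildeP ag'; have [_ c3] := TtildeP (appr_comb 1 1 ag ag').
have [_ c4] := TtildeP (appr_comb a 0 ag ag).
have E1 v : (fun y => 1 * g v y + 1 * g' v y) = fun y => g v y + g' v y by apply/funext => y; rewrite !mul1r.
have E2 v : (fun y => a * g v y + 0 * g v y) = fun y => a * g v y by apply/funext => y; rewrite mul0r addr0.
have H2 := aeL_and c1 (aeL_and c2 (aeL_and c3 c4)).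
apply: (aeL_imp H2) => x [h1 [h2 [h3 h4]]].
have i1 v : inL2 (g v) by apply/inL2P; exact: ag.1.
have i2 v : inL2 (g' v) by apply/inL2P; exact: ag'.1.
split.
- by apply: (ler_cvgn (cvg_cst 0) h1) => v; have [] := Hk _ _ a (i1 v) (i2 v) x.
- have := @cvg_lincomb `|a| 0 _ _ _ _ h1 h1; rewrite mul0r addr0 => h5.
 apply: (ler_cvgn h4 h5) => v; rewrite E2 mul0r addr0.
 by have [] := Hk _ _ a (i1 v) (i2 v) x.
- apply: (ler_cvgn h3 (cvg_add h1 h2)) => v; rewrite E1.
 by have [] := Hk _ _ a (i1 v) (i2 v) x.
Qed.

Lemma appr_const (f : Rn -> R) : L2i f -> appr (fdist f) (fun=> f).
move=> fL; split => //; exists 0 => v; rewrite gmax_zero ?(Mod_zero Q)// => psi sp.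
by rewrite /dcomb mul1r mulN1r subrr.
Qed.

Lemma Ttilde_extends (f : Rn -> R) : L2i f -> {ae L, forall x, Ttilde (fdist f) x = T f x}.
move=> fL; have [_ H] := TtildeP (appr_const fL).
by apply: (aeL_imp H) => x h; apply: (cvg_unique _ h) => //; exact: cvg_cst.
Qed.

(** [weak_fatou] transfers the estimate from [T (g v)] to the limit. Since [g v] is [f] minus an
    error, its maximal function is at most that of [f] plus a term whose [Mod] tends to 0; passing
    to [lam/2] absorbs the halving of [tau]. *)
Lemma Ttilde_weak f lam tau : inH phi f -> 0 < lam -> 0 < tau ->
 (phiset phi [set x | (tau < `|Ttilde f x|)%R] (tau / lam)%R <=
 (K * Kpsi p0 C * (C * 2))%:E * M lam (gmax m f))%E.
move=> Hf lam0 tau0; have [g ag] := appr_exists Hf; have [mT Tc] := TtildeP ag.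
have [ig [B HB]] := ag; have mg := meas_gmax m f.
have KK : 0 < K * Kpsi p0 C by [].
have lam2 : 0 < lam / 2 by pos.
apply/lee_addgt0Pr => e e0.
have [N HN] : exists N, forall v, (N <= v)%N -> h2 v <= lam / 2 /\ K * Kpsi p0 C * (B * h2 v) <= e.
 have KB : 0 < K * Kpsi p0 C * (`|B| + 1) by pos.
 have b0 : 0 < e / (K * Kpsi p0 C * (`|B| + 1)) by pos.
 move/cvgrPdist_le : h2_cvg => H.
 have [N1 _ H1] := H _ lam2; have [N2 _ H2] := H _ b0.
 exists (maxn N1 N2) => v; rewrite geq_max => /andP[/H1 a1 /H2 a2].
 move: a1 a2; rewrite sub0r normrN ger0_norm// => a1; split => //.
 apply: le_trans (_ : K * Kpsi p0 C * ((`|B| + 1) * h2 v) <= _).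
 rewrite ler_pM2l// ler_wpM2r//; apply: le_trans (ler_norm B) _; by rewrite lerDl.
 by move: a2; rewrite ler_pdivlMr// => a2; apply: le_trans a2; rewrite mulrA mulrC.
have tE : tau / lam = tau / 2 / (lam / 2) by field; rewrite gt_eqF.
apply: (@weak_fatou _ _ _ _ Q (Ttilde f) (fun v => T (g (v + N)%N)) (fun v x => Ttilde f x - T (g (v + N)%N) x)) => //.
- by move=> v; exact: T_meas.
- by move=> v; apply: measurable_funB => //; exact: T_meas.
- move=> v; apply: aeW => x.
 have -> : Ttilde f x = T (g (v + N)%N) x + (Ttilde f x - T (g (v + N)%N) x) by rewrite addrC subrK.
 by rewrite addrAC subrr add0r; exact: ler_normD.
- apply: (aeL_imp Tc) => x hx.
 have hx' : (fun v => T (g (v + N)%N) x) @ \oo --> Ttilde f x by rewrite (cvg_shiftn N (fun v => T (g v) x)).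
 by rewrite -[X in _ --> X](subrr (Ttilde f x)); apply: cvgB hx'; exact: cvg_cst.
move=> v; rewrite tE; have tau2 : 0 < tau / 2 by pos.
have [v1 v2] := HN (v + N)%N (leq_addl _ _).
pose d := dcomb 1 f (-1) (fdist (g (v + N)%N)).
have md := meas_gmax m d.
apply: le_trans (HME (ig _) lam2 tau2) _.
have tri x : (gmax m (fdist (g (v + N)%N)) x <= gmax m f x + gmax m d x)%E.
 have -> : gmax m (fdist (g (v + N)%N)) = gmax m (dcomb 1 f (-1) d).
 by apply: eq_gmax => psi _; rewrite /d /dcomb; ring.
 by have := gmax_comb m 1 (-1) f d x; rewrite normrN !normr1 !mul1e.
apply: le_trans (lee_wpmul2l (ltW (_ : 0 < K%:E)%E) (le_Mod Q lam2 (meas_gmax _ _) (emeasurable_funD mg md) tri)) _.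
 by [].
apply: le_trans (lee_wpmul2l (ltW (_ : 0 < K%:E)%E) (Mod_add lam2 (gmax_ge0 _ _) (gmax_ge0 _ _) mg md)) _.
 by [].
rewrite muleA -EFinM ge0_muleDr ?(Mod_ge0 Q)//; apply: leeD.
 rewrite (EFinM (K * Kpsi p0 C)) -muleA; apply: lee_wpmul2l; first by pos.
 by apply: (Mod_up Q) => //; rewrite ler1n.
apply: le_trans (_ : ((K * Kpsi p0 C)%:E * (B * h2 (v + N))%:E <= _)%E) => //.
apply: lee_wpmul2l; first by pos.
by apply: le_trans (HB _); exact: Mod_le_lam.
Qed.

Lemma Ttilde_bounded : exists A : R, forall f, inH phi f ->
 inWL phi (Ttilde f) /\ WLnorm phi (Ttilde f) <= A * Hnorm phi f.
have [KW KW0 HW] : exists2 KW : R, 0 < KW & forall f lam tau, inH phi f -> 0 < lam -> 0 < tau ->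
 (phiset phi [set x | (tau < `|Ttilde f x|)%R] (tau / lam)%R <= KW%:E * M lam (gmax m f))%E.
 exists (K * Kpsi p0 C * (C * 2)); last exact: Ttilde_weak.
 by apply: mulr_gt0; [apply: mulr_gt0 => //; exact: (Kpsi_gt0 Q)|exact: mulr_gt0].
have [Cp Cp0 HCp] : exists2 Cp : R, 0 < Cp & forall f lam, 0 < lam ->
 (M lam (gmax m f) <= Cp%:E * modular phi (gmax m f) lam)%E.
 exists (Cpsi p0 C); first exact: (Cpsi_gt0 Q).
 by move=> f lam lam0; exact: (Mod_le_modular Q lam0 (gmax_ge0 m f) (meas_gmax _ _)).
(* Multiplying [lam] by [A = Y^(1/p0)] gains the factor [C/Y] by the lower type; [Y] exceeds
   [KW * C * Cp], which brings the final bound below 1. *)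
have p00 := qt_p0 Q; pose Y := KW * C * Cp + 1.
have Y1 : 1 <= Y by rewrite lerDr.
have Y0 : 0 < Y by pos.
pose A := Y `^ p0^-1; have A0 : 0 < A by pos.
have A1 : 1 <= A.
 have -> : 1 = 1 `^ p0^-1 :> R by rewrite powR1.
 by apply: ge0_ler_powR; rewrite ?nnegrE.
have AV : A^-1 <= 1 by rewrite invf_le1.
exists A => f Hf; have mg := meas_gmax m f.
have key lam : 0 < lam -> (modular phi (gmax m f) lam <= 1)%E -> 0 < A * lam /\ forall tau : R, 0 < tau ->
 (phiset phi [set x | (tau < `|Ttilde f x|)%R] (tau / (A * lam))%R <= 1)%E.
 move=> lam0 h; have l1 : 0 < A * lam by pos.
 split => // tau tau0; apply: le_trans (HW _ _ _ Hf l1 tau0) _.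
 have -> : A * lam = lam / A^-1 by rewrite invrK mulrC.
 have AV0 : 0 < A^-1 by pos.
 apply: le_trans (lee_wpmul2l _ (Mod_low Q lam0 AV0 AV mg)) _; first by pos.
 have h3 : (M lam (gmax m f) <= Cp%:E)%E.
 apply: le_trans (HCp _ _ lam0) _.
 by rewrite -[leRHS]mule1; apply: lee_wpmul2l => //; rewrite ltW.
 rewrite muleA -EFinM; apply: le_trans (lee_wpmul2l _ h3) _.
 by pos.
 rewrite lee_fin powR_invl// -powRrM mulVf ?gt_eqF// powRr1//.
 rewrite (_ : KW * (C / Y) * Cp = KW * C * Cp / Y); last by ring.
 by rewrite ler_pdivrMr// mul1r lerDl.
have [_ [_ [l0 [l0p hl0]]]] := Hf.
split.
 split; first by apply/measRP; have [g ag] := appr_exists Hf; case: (TtildeP ag).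
 by exists (A * l0); exact: key.
rewrite mulrC -ler_pdivrMr//; apply: lb_le_inf; first by exists l0.
move=> lam [lam0 hlam]; rewrite ler_pdivrMr// mulrC.
have [k1 k2] := key lam lam0 hlam.
by apply: ge_inf; [exists 0 => x [/ltW]|split].
Qed.

(** For another extension the norm inequality is the available information, so the approximating
    sequence is adapted to its constant [A]: the Hardy norms of the errors shrink so fast that their
    images have weight at most [2^-v] above height [2^-v]. *)
Lemma extension_small (Tt' : @distr R n -> Rn -> R) (A : R) f : inH phi f ->
 (forall f, inH phi f -> inWL phi (Tt' f) /\ WLnorm phi (Tt' f) <= A * Hnorm phi f) ->
 exists2 g, appr f g & {ae L, forall x, (fun v => Tt' (dcomb 1 f (-1) (fdist (g v))) x) @ \oo --> (0 : R)}.
move=> Hf HA; have [tf fin] := inH_Mod Hf; have p00 := qt_p0 Q.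
pose A' := `|A| + 1; have A'0 : 0 < A' by rewrite ltr_wpDl.
(* This solves [C y^p0 = 2^-v]; the ratio [a] of [lam] to [2^-v] below is at most [y], so the lower
   type yields the factor [2^-v]. *)
pose y v := (h2 v / C) `^ p0^-1.
have yp v : 0 < y v by pos.
have h2le1 v : h2 v <= 1 by rewrite exprn_ile1// invf_le1// ler1n.
pose del v := Num.min (h2 v) (h2 v * y v / A').
have del0 v : 0 < del v by rewrite lt_min h2_gt0 divr_gt0.
(* The bound [1/(2C)] makes the modular of the error at most 1, so that its Hardy norm is at most
   [del v]. *)
pose eps v := Num.min (h2 v) (2 * C)^-1.
have eps0 v : 0 < eps v by rewrite lt_min h2_gt0 invr_gt0 mulr_gt0.
have /choice[g Hg] : forall v, exists h, L2i h /\
 (M (del v) (gmax m (dcomb 1 f (-1) (fdist h))) <= (eps v)%:E)%E.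
 by move=> v; have [h Hh] := HDn tf (del0 v) (fin _ (del0 v)) (eps0 v); exists h.
have ig v : L2i (g v) by case: (Hg v).
have ag : appr f g.
 split => //; exists 1 => v; rewrite mul1r.
 apply: le_trans (Mod_le_lam (del0 v) _ (meas_gmax _ _)) _; first by rewrite ge_min lexx.
 by apply: le_trans (proj2 (Hg v)) _; rewrite lee_fin ge_min lexx.
exists g => //.
pose d v := dcomb 1 f (-1) (fdist (g v)).
have Hd v : inH phi (d v).
 apply: (@Mod_inH _ (del v)) => //; last by apply: le_lt_trans (proj2 (Hg v)) (ltry _).
 by apply: tempered_comb => //; exact: L2_tempered.
have mTd v : mfun (Tt' (d v)) by apply/measRP; have [[]] := HA _ (Hd v).
have H : {ae L, forall x, exists v0, forall v, (v0 <= v)%N -> `|Tt' (d v) x| <= h2 v}.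
 apply: (@eventually_small 1) => // v; rewrite mul1r.
 have hn : Hnorm phi (d v) <= del v.
 apply: ge_inf; first by exists 0 => x [/ltW].
 split => //.
 apply: le_trans (modular_le_Mod Q (del0 v) (gmax_ge0 m _) (meas_gmax _ _)) _.
 apply: le_trans (lee_wpmul2l _ (proj2 (Hg v))) _; first by pos.
 rewrite lee_fin mulrC -ler_pdivlMr// div1r ge_min lexx orbT//.
 have [[_ [l0 [l0p hl0]]] wn] := HA _ (Hd v).
 have wl : WLnorm phi (Tt' (d v)) < A' * del v.
 apply: le_lt_trans wn _; apply: le_lt_trans (_ : `|A| * del v < _).
 apply: le_trans (_ : `|A| * Hnorm phi (d v) <= _); last by rewrite ler_wpM2l.
 apply: ler_wpM2r; last exact: ler_norm.
 apply: lb_le_inf; last by move=> x [/ltW].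
 by have [_ [_ [x hx]]] := Hd v; exists x.
 by rewrite ltr_pM2r// ltrDl.
 have [lam [lam0 hlam] ll] : exists2 lam, (0 < lam /\ forall tau : R, 0 < tau ->
 (phiset phi [set x | (tau < `|Tt' (d v) x|)%R] (tau / lam)%R <= 1)%E) & lam < A' * del v.
 by apply: inf_lt wl; exists l0.
 have := hlam _ (h2_gt0 v).
 set E := [set x | _]; have mE : mset E by exact: meas_level.
 move=> h; pose a := lam / h2 v; have a0 : 0 < a by pos.
 have ay : a <= y v.
 rewrite ler_pdivrMr//; apply: ltW; apply: lt_le_trans ll _.
 apply: le_trans (_ : A' * (h2 v * y v / A') <= _); first by rewrite ler_pM2l// ge_min lexx orbT.
 by rewrite mulrCA mulfV ?gt_eqF// mulr1 mulrC.
 have y1 : y v <= 1.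
 have -> : 1 = 1 `^ p0^-1 :> R by rewrite powR1.
 apply: ge0_ler_powR; rewrite ?nnegrE//.
 by rewrite ler_pdivrMr// mul1r (le_trans (h2le1 v))// (qt_C Q).
 rewrite [X in phiset _ _ X](_ : 1 = a * (h2 v / lam)); last by rewrite mulrA mulfVK ?mulfV ?gt_eqF.
 have t0 : 0 <= h2 v / lam by pos.
 apply: le_trans (phiset_low Q t0 a0 (le_trans ay y1) mE) _.
 apply: le_trans (lee_wpmul2l _ h) _; first by pos.
 rewrite mule1; apply: le_trans (_ : C * (y v) `^ p0 <= _).
 by rewrite ler_pM2l//; apply: ge0_ler_powR; rewrite ?nnegrE.
 by rewrite -powRrM mulVf ?gt_eqF// powRr1// mulrCA mulfV ?gt_eqF// mulr1.
by apply: (aeL_imp H) => x; exact: small_cvg.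
Qed.

(** [Tt' f] differs from [T (g v)] by at most the image of the error [f - g v], which tends to 0,
    while [T (g v)] tends to [Ttilde f]. The errors and the [g v] must first be shown to lie in
    [H^phi], where the assumptions on [Tt'] hold. *)
Lemma extension_unique (Tt' : @distr R n -> Rn -> R) : extension_of k phi T Tt' ->
 forall f, inH phi f -> {ae L, forall x, Tt' f x = Ttilde f x}.
move=> [kT' [A HA] eT'] f Hf.
have [g ag H0] := extension_small Hf HA; have [ig [B HB]] := ag.
have [_ c1] := TtildeP ag; have [tf _] := Hf.
pose d v := dcomb 1 f (-1) (fdist (g v)).
have fHd v : (M (h2 v) (gmax m (d v)) < +oo)%E by apply: le_lt_trans (ltry _).
have tg v := L2_tempered (ig v).
have Hd v : inH phi (d v) by apply: (@Mod_inH _ (h2 v)) => //; exact: tempered_comb.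
have Hg v : inH phi (fdist (g v)).
 apply: (@Mod_inH _ (h2 v)) => //; have mg := meas_gmax m f; have md := meas_gmax m (d v).
 have tri x : (gmax m (fdist (g v)) x <= gmax m f x + gmax m (d v) x)%E.
 have -> : gmax m (fdist (g v)) = gmax m (dcomb 1 f (-1) (d v)).
 by apply: eq_gmax => psi _; rewrite /d /dcomb; ring.
 by have := gmax_comb m 1 (-1) f (d v) x; rewrite normrN !normr1 !mul1e.
 apply: le_lt_trans (le_Mod Q (h2_gt0 v) (meas_gmax _ _) (emeasurable_funD mg md) tri) _.
 apply: le_lt_trans (Mod_add (h2_gt0 v) (gmax_ge0 _ _) (gmax_ge0 _ _) mg md) _.
 rewrite lte_mul_pinfty ?lee_fin ?(ltW (Kpsi_gt0 Q))//.
 by apply: lte_add_pinfty => //; exact: (proj2 (inH_Mod Hf)).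
have diff v : {ae L, forall x, `|Tt' f x - T (g v) x| <= `|Tt' (d v) x|}.
 have /aeP e1 := eT' _ ((inL2P _).2 (ig v)) (Hg v).
 case: k kT' => Hk.
 have /aeP e2 := Hk f (fdist (g v)) 1 (-1) Hf (Hg v).
 by apply: (aeL_imp (aeL_and e1 e2)) => x [<-]; rewrite -/(d v) => ->; rewrite mul1r mulN1r.
 (* In the sublinear case the two one-sided bounds come from writing [f] as the error plus [g v],
    and [g v] as minus the error plus [f]. *)
 have E1 : dcomb 1 (d v) 1 (fdist (g v)) = f by apply/funext => psi; rewrite /d /dcomb; ring.
 pose d' := dcomb (-1) (d v) 0 (d v).
 have Hd' : inH phi d'.
 apply: (@Mod_inH _ (h2 v)) => //; first by apply: tempered_comb; case: (Hd v).
 rewrite (_ : gmax m d' = gmax m (d v))//; apply/funext => x; apply/eqP; rewrite eq_le; apply/andP; split.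
 have := gmax_comb m (-1) 0 (d v) (d v) x; by rewrite normrN normr1 normr0 mul0e mul1e adde0.
 have -> : gmax m (d v) = gmax m (dcomb (-1) d' 0 d') by apply: eq_gmax => psi _; rewrite /d' /dcomb; ring.
 by have := gmax_comb m (-1) 0 d' d' x; rewrite normrN normr1 normr0 mul0e mul1e adde0.
 have E2 : dcomb 1 d' 1 f = fdist (g v) by apply/funext => psi; rewrite /d' /d /dcomb; ring.
 have /aeP e2 := Hk (d v) (fdist (g v)) (-1) (Hd v) (Hg v); have /aeP e3 := Hk d' f 1 Hd' Hf.
 apply: (aeL_imp (aeL_and e1 (aeL_and e2 e3))) => x [<- [[a1 a2 a3] [b1 b2 b3]]].
 rewrite E1 in a3; rewrite E2 in b3; rewrite -/d' normrN normr1 mul1r in a2.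
 by rewrite (ger0_norm a1) ler_norml; apply/andP; split; lra.
have H := aeL_and c1 (aeL_and H0 (ae_foralln diff)).
apply: (aeL_imp H) => x [h1 [h2 h3]].
have h4 : (fun v => Tt' f x - T (g v) x) @ \oo --> Tt' f x - Ttilde f x.
 by apply: cvgB h1; exact: cvg_cst.
have : `|Tt' f x - Ttilde f x| <= 0.
 have h5 : (fun v => `|Tt' f x - T (g v) x|) @ \oo --> `|Tt' f x - Ttilde f x| by exact: cvg_norm.
 have h6 : (fun v => `|Tt' (d v) x|) @ \oo --> `|0 : R| by exact: cvg_norm.
 by rewrite normr0 in h6; exact: (ler_cvgn h5 h6).
by rewrite normr_le0 subr_eq0 => /eqP.
Qed.

Lemma extension_theorem : exists Tt : @distr R n -> Rn -> R, extension_of k phi T Tt /\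
 forall Tt', extension_of k phi T Tt' -> forall f, inH phi f -> ae (fun x => Tt' f x = Tt f x).
exists Ttilde; split; last by move=> Tt' HT' f Hf; apply/aeP; exact: extension_unique.
split; [exact: Ttilde_kind|exact: Ttilde_bounded|].
by move=> f /inL2P fL _; apply/aeP; exact: Ttilde_extends.
Qed.
End extension.
End space.

(** * Dimension zero, where the space is a point *)

Section dimension_zero.
Context {R : realType}.
Local Notation Rn := 'rV[R]_0.

Lemma point0 (x : Rn) : x = 0. by apply/rowP => -[]. Qed.

Lemma nnint_dim0 (f : Rn -> \bar R) : nnint f = f 0.
by rewrite /=; congr f; exact: point0. Qed.

Lemma fdist_dim0 (h psi : Rn -> R) : fdist h psi = h 0 * psi 0.
rewrite /fdist /rint !nnint_dim0 /=; move: (h 0 * psi 0) => x.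
by rewrite !maxEle; do 2 (case: ifP => ?); lra.
Qed.

Lemma Sm_one m : Sm m (fun _ : Rn => 1 : R).
have e0 (x : Rn) : enorm x = 0 by rewrite (point0 x) enorm0.
split; [split; first by move=> al []|].
 by case=> [N|[]//]; exists 1 => x; rewrite e0 normr1.
by case=> [_ x|[]//]; rewrite e0 normr1.
Qed.

Lemma L2i_cst (c : R) : L2i (fun _ : Rn => c).
apply/inL2P; split; first by apply/measRP; exact: measurable_cst.
by rewrite ltry.
Qed.

Variables (phi : Rn -> R -> R) (p0 p1 C : R) (m : nat).
Hypothesis Q : qtype phi p0 p1 C.
Let C0 := qt_C0 Q.

(** On a point every functional is a multiple of evaluation, hence given by a constant function, so
    the approximation is exact. *)
Lemma density_dim0 (f : @distr R 0) lam (eps : R) : tempered f -> 0 < lam -> 0 < eps ->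
 exists2 h : Rn -> R, L2i h & (Mod phi lam (gmax m (dcomb 1 f (-1) (fdist h))) <= eps%:E)%E.
move=> tf lam0 eps0; exists (fun=> f (fun=> 1)); first exact: L2i_cst.
rewrite gmax_zero ?(Mod_zero Q) ?lee_fin// => psi _.
have -> : psi = fun x => psi 0 * 1 by apply/funext => x; rewrite mulr1 (point0 x).
rewrite /dcomb fdist_dim0 mul1r mulN1r (temperedZ tf) ?mulr1 1?mulrC ?subrr//.
by case: (Sm_one 0).
Qed.

(** The L2 bound is a pointwise bound here, and the constant test function 1 shows that the maximal
    function dominates [|f|]. *)
Lemma main_estimate_dim0 (T : (Rn -> R) -> Rn -> R) : bounded_L2 T ->
 exists2 K : R, 0 < K & forall f lam tau, L2i f -> 0 < lam -> 0 < tau ->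
 (phiset phi [set x | (tau < `|T f x|)%R] (tau / lam)%R <= K%:E * Mod phi lam (gmax m (fdist f)))%E.
move=> [B HB]; exists (C * (1 + `|B|) * (2 * C)); first by pos.
move=> f lam tau fL lam0 tau0.
have [_] := HB f ((inL2P f).2 fL); rewrite /L2norm !nnint_dim0 !sqrtr_sqr !normr_id => hT.
have K0 : 0 < C * (1 + `|B|) * (2 * C) by pos.
rewrite /phiset nnint_dim0 indicE.
have [h|h] := ltP tau `|T f 0|; last first.
 rewrite memNset ?mul0r; last by apply/negP; rewrite -leNgt.
 by rewrite mule_ge0 ?(Mod_ge0 Q)// ltW.
rewrite mem_set//= mul1r.
set a := `|f 0|; have a0 : 0 <= a by pos.
have B0 : 0 <= 1 + `|B| by [].
have aV : 0 <= a / lam by pos.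
have h1 : phi 0 (tau / lam) <= C * (1 + `|B|) * phi 0 (a / lam).
 apply: le_trans (_ : phi 0 ((1 + `|B|) * (a / lam)) <= _).
 apply: (qt_mono Q) => //.
 rewrite mulrA ler_pM2r//; apply: ltW; apply: lt_le_trans h _; apply: le_trans hT _.
 by rewrite ler_wpM2r// (le_trans (ler_norm B))// lerDr.
 have b1 : 1 <= 1 + `|B| by rewrite lerDl.
 apply: le_trans (qt_up Q 0 aV b1) _; rewrite ler_wpM2r ?(qt_ge0 Q)// ler_pM2l//.
 by rewrite -[leRHS]powRr1//; apply: ler_powR => //; case/andP: (qt_p1 Q) => _ /ltW.
have h2 : ((phi 0 (a / lam))%:E <= (2 * C)%:E * Mod phi lam (gmax m (fdist f)))%E.
 apply: le_trans (modular_le_Mod Q lam0 (gmax_ge0 _ _) (meas_gmax _ _)).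
 have ga : (a%:E <= gmax m (fdist f) 0)%E.
 have := @gmax_ub R 0 m (fdist f) (fun=> 1) 1 0 0 (Sm_one m) ltr01.
 by rewrite subrr enorm0 fdist_dim0 /dil invr1 !mulr1 => /(_ ltr01).
 rewrite /modular nnint_dim0; move: (gmax m (fdist f) 0) ga => [y| |]//.
 by rewrite lee_fin => ay; rewrite lee_fin; apply: (qt_mono Q) => //; rewrite ler_pM2r.
 by move=> _; rewrite gt0_mulye ?lte_fin// leey.
rewrite EFinM -muleA; apply: le_trans (_ : ((C * (1 + `|B|))%:E * (phi 0 (a / lam))%:E <= _)%E).
 by [].
by apply: lee_wpmul2l => //; rewrite lee_fin.
Qed.
End dimension_zero.

Theorem theorem3p14 (R : realType) (n : nat) (phi : 'rV[R]_n -> R -> R)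
    (q : \bar R) (s : nat) (k : opkind) (T : ('rV[R]_n -> R) -> 'rV[R]_n -> R) :
  growth phi -> 0 < Iphi phi < 1 -> admissible phi q s ->
  kind_L2 k T -> bounded_L2 T ->
  (exists C : R, 0 < C /\
     forall (lam : R) (cc : R) (c : 'rV[R]_n) (r : R) (a : 'rV[R]_n -> R),
       0 < lam -> atom phi q s c r a ->
       forall tau : R, 0 < tau ->
         (phiset phi [set x | (tau < `|T (fun y => cc * a y) x|)%R] (tau / lam)%R
          <= C%:E * phiset phi (eball c r)
                      (fine (Lqphi phi q (eball c r) (fun y => cc * a y)) / lam)%R)%E) ->
  exists Tt : distr -> 'rV[R]_n -> R,
    extension_of k phi T Tt /\
    forall Tt' : distr -> 'rV[R]_n -> R, extension_of k phi T Tt' ->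
      forall f : distr, inH phi f -> ae (fun x => Tt' f x = Tt f x).
Proof.
move=> gphi /andP[_ I1] [qq _] Tk Tb [Ca [Ca0 HT]].
have [p0 [q0 [q1 [p00 lp Aq q01 expo']]]] := exponents gphi.
have [p1 [C Q]] := qtype_exists gphi I1 p00 lp.
have [q2 [D [q21 D0 HD]]] := doubling Q Aq q01.
have expo : n%:R * q2 < p0 * (n%:R + (mphi phi).+1%:R) by apply: le_lt_trans expo'; rewrite ler_wpM2l.
(* A point has finite weight, so a level set of the maximal function may be the whole space and the
   Whitney construction is void; this case is settled directly. *)
have [n0|n0] := posnP n.
  subst n; have [K K0 HME] := @main_estimate_dim0 _ _ _ _ _ (mphi phi) Q _ Tb.
  apply: (extension_theorem Q Tk Tb K0 HME) => f lam eps tf lam0 _ eps0.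
  exact: (density_dim0 _ Q).
have i0 := Ordinal n0.
have r1 : (1%:E < q)%E.
  by apply: le_lt_trans qq; rewrite lee_fin qphi_ge1; case: gphi.
have [K K0 HME] := main_estimate Q HD D0 Tk Tb (mphi phi) r1 Ca0 HT i0.
apply: (extension_theorem Q Tk Tb K0 HME) => f lam eps tf lam0 fin eps0.
by apply: (density_Mod Q HD D0 _ i0) => //; rewrite natrD.
Qed.
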